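(* Let $\omega_1,\omega_2$ be quadratic irrational real numbers and let $\alpha_1,\alpha_2$ be algebraic numbers with $0<|\alpha_1|,|\alpha_2|<1$. The numbers $\mathfrak f_{\omega_1}(\alpha_1)$ and $\mathfrak f_{\omega_2}(\alpha_2)$ are algebraically dependent over $\overline{\mathbb Q}$ if and only if $\alpha_1=\alpha_2$ and $\omega_1\equiv\pm\omega_2\pmod{\mathbb Z}$.
   Context: For a real number $\omega$, the Hecke–Mahler series is $\mathfrak f_\omega(z)=\sum_{n=0}^{\infty}\lfloor n\omega\rfloor z^n$. $\overline{\mathbb Q}$ denotes the field of algebraic numbers. *)

(* Defs.v *)
From HB Require Import structures.
From mathcomp Require Import all_boot all_order all_algebra.
From mathcomp Require Import polyXY.
From mathcomp.real_closed Require Import complex.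
From mathcomp Require Import all_classical all_reals all_analysis.

Set Implicit Arguments.
Unset Strict Implicit.
Unset Printing Implicit Defensive.

Import Order.TTheory GRing.Theory Num.Theory.
Import numFieldNormedType.Exports.

Local Open Scope classical_set_scope.
Local Open Scope ring_scope.
Local Open Scope complex_scope.

(* The sum is the limit of the partial sums for the topology given by the
   modulus on the complex numbers; R[i]^o carries the normed space structure
   of R[i] over itself.  [lim] has a junk value on divergent sequences, so this
   is the Hecke-Mahler series for `|z| < 1, where the series converges. *)
Definition hecke_mahler (R : realType) (w : R) (z : R[i]) : R[i] :=
  limn (series (fun n : nat =>
    (Num.floor (n%:R * w))%:~R * z ^+ n : R[i]^o)).

Definition quadratic_irrational (R : realType) (w : R) : Prop :=
  irrational w /\
  exists2 p : {poly rat}, size p = 3%N & root (map_poly ratr p) w.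

Definition Qbar (R : realType) : set R[i] :=
  [set z | algebraicOver (ratr : rat -> R[i]) z].

Arguments Qbar R : clear implicits.

Definition algebraically_dependent (C : fieldType) (K : set C) (x y : C) :
    Prop :=
  exists P : {poly {poly C}},
    [/\ P != 0, forall i j : nat, K P`_i`_j & P.[x, y] = 0].

(* Main.v *)
(** Along the orbit of a hyperbolic automorphism of the lattice fixing the line of slope w, the
    convergents p_k / q_k of w give f_w(a) = s_k + F (a ^ P_k, a ^ Q_k), where s_k is the rational
    value of the series of slope p_k / q_k, F is the generating series of a lattice cone with one
    irrational edge, and the exponents P_k, Q_k grow like lam ^ k.  Mahler's method then applies to
    the pair of series: an auxiliary polynomial in the s_k and in the monomials, vanishing to high
    order, is too small compared with Liouville's lower bound unless f_w1(a1) and f_w2(a2) are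
    algebraically independent, provided that no polynomial in these data vanishes for all large k.

    Three cases give this last point.
    - lam1 and lam2 multiplicatively independent: for infinitely many k one monomial dominates,
      since ties between monomials occur only at finitely many ratios of lam2 ^ l and lam1 ^ k.
    - same lam (after taking powers), a1 and a2 multiplicatively independent: the tied dominant
      monomials are polynomials in two consecutive terms of a bounded sequence y with
      y_(k+2) y_k = y_(k+1) ^ t, and their relation would force y to be torsion.
    - same lam, a1 ^ e1 = a2 ^ e2: the s_k satisfy s_(k+1) - s_k in the field of rational functions
      of the monomials, so by Kubota's argument an algebraic relation yields a linear one; comparing
      the coefficients across the irrational edges of the cones gives a1 = a2 and
      w1 = w2 or w1 = - w2 modulo the integers. *)

Require Import Defs.
From mathcomp Require Import all_boot all_order all_algebra all_fingroup all_field.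
From mathcomp Require Import polyXY.
From mathcomp.real_closed Require Import complex.
From mathcomp Require Import all_classical all_reals all_analysis.
From mathcomp Require Import zify ring lra.
From mathcomp Require Import -(notations) mpoly.
Set Implicit Arguments.
Unset Strict Implicit.
Unset Printing Implicit Defensive.
Import Order.TTheory GRing.Theory Num.Theory.
Import ComplexField.Normc.

Local Open Scope ring_scope.

(** * The modulus of complex numbers *)

Section Modulus.
Variable R : realType.
Implicit Types x y z : R[i]%C.

(** The s_k are not functions of the monomials, so vanishing cannot be read off a power series. The
    auxiliary polynomial therefore has coefficients in two letters standing for the s_k of the two
    series, and its nonvanishing is a statement about sequences. Liouville's inequality costs a
    factor c in the exponent: the order of vanishing I must exceed c p, while unknowns of degree
    below p alone would only allow I < p. The missing unknowns come from the supposed relation P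
    itself: powers of P (s_k + F) serve as multipliers, and since their values are small too, only
    the lowest one survives. The cone does not move with k. The automorph carries the cone attached
    to p_k / q_k to the next one, so a fixed array of coefficients is evaluated at moving monomials.
    An exponent splits into an expanding part (its weight) and a contracting part; the weight is
    injective because lam is irrational, so distinct monomials of one series never tie. Ties between
    the two series are the real difficulty. *)

Lemma normc_ge0 x : 0 <= normc x.
Proof. by case: x => a b; rewrite /normc sqrtr_ge0. Qed.

Lemma normc_eq0 x : (normc x == 0) = (x == 0).
Proof. by apply/eqP/eqP => [/eq0_normc|->] //; exact: normc0. Qed.

Lemma normc_gt0 x : (0 < normc x) = (x != 0).
Proof. by rewrite lt_def normc_ge0 andbT normc_eq0. Qed.

Lemma normcX x n : normc (x ^+ n) = normc x ^+ n.
Proof. by elim: n => [|n IHn]; rewrite ?expr0 ?normc1 // !exprS normcM IHn. Qed.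

Lemma normc_real (a : R) : normc a%:C%C = `|a|.
Proof. by rewrite /= expr0n addr0 sqrtr_sqr. Qed.

Lemma normc_nat n : normc (n%:R : R[i]%C) = n%:R.
Proof.
by rewrite -(rmorph_nat (real_complex R)) normc_real ger0_norm.
Qed.

Lemma normc_int (n : int) : normc (n%:~R : R[i]%C) = `|n|%:~R.
Proof.
by rewrite -(rmorph_int (real_complex R)) normc_real intr_norm.
Qed.

Lemma normc_rat (a : rat) : normc (ratr a : R[i]%C) = ratr `|a|.
Proof.
by rewrite -(fmorph_eq_rat (real_complex R \o ratr)) /= expr0n addr0 sqrtr_sqr ratr_norm.
Qed.

Lemma ler_normcD x y : normc (x + y) <= normc x + normc y.
Proof. exact: le_normcD. Qed.

Lemma ler_normcB x y : normc (x - y) <= normc x + normc y.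
Proof. by rewrite -(normcN y) ler_normcD. Qed.

Lemma normcBC x y : normc (x - y) = normc (y - x).
Proof. by rewrite -normcN opprB. Qed.

Lemma ler_normc_sum (I : Type) (r : seq I) (P : pred I) (F : I -> R[i]%C) :
  normc (\sum_(t <- r | P t) F t) <= \sum_(t <- r | P t) normc (F t).
Proof.
elim/big_rec2: _ => [|t y z _ h]; first by rewrite normc0.
by apply: le_trans (ler_normcD _ _) _; rewrite lerD2l.
Qed.

Lemma normc_prod (I : Type) (r : seq I) (P : pred I) (F : I -> R[i]%C) :
  normc (\prod_(t <- r | P t) F t) = \prod_(t <- r | P t) normc (F t).
Proof. by elim/big_rec2: _ => [|t y z _ h]; rewrite ?normc1 // normcM h. Qed.

Lemma lerB_normcD x y : normc x - normc y <= normc (x + y).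
Proof.
rewrite lerBlDr -{1}[x](addrK y); exact: ler_normcB.
Qed.

Lemma normc_norm x : `|x| = (normc x)%:C%C.
Proof. by case: x => a b; rewrite normc_def. Qed.

Lemma expr_lt_eventually (q M : R) : 0 <= q < 1 -> 0 < M -> exists N, q ^+ N < M.
Proof.
move=> /andP[q0 q1] M0; have h := @cvg_expr R q.
rewrite ger0_norm // in h; move/cvgr0Pnorm_lt: (h q1) => /(_ _ M0)[N _ /(_ N (leqnn N))] /=.
by rewrite ger0_norm ?exprn_ge0 // => hN; exists N.
Qed.

End Modulus.

(** * Number fields generated by finitely many algebraic numbers *)

Lemma primitive_generator (C : numFieldType) (s : seq C) :
  (forall x, x \in s -> algebraicOver (ratr : rat -> C) x) ->
  exists2 z : C, algebraicOver (ratr : rat -> C) z &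
    forall x, x \in s -> exists p : {poly rat}, x = (map_poly ratr p).[z].
Proof.
elim: s => [_|x s IHs algs].
  by exists 0 => //; exists 'X; rewrite ?polyX_eq0 // map_polyX rootX.
have [|z [q q0 qz] genz] := IHs; first by move=> y ys; apply: algs; rewrite inE ys orbT.
have [r r0 rx] := algs x (mem_head _ _).
have [n [[p Dp] [p' Dp']]] := pchar0_PET q0 qz r0 rx (pchar_num _).
exists (x *+ n - z).
  apply: (@algebraic_sub _ _ (@ratr C)); last by exists q.
  by rewrite -mulr_natr; apply: algebraic_mul; [exists r | rewrite -(rmorph_nat (@ratr C)); apply: algebraic_id].
move=> y; rewrite inE => /predU1P[->|/genz[g ->]]; first by exists p'; rewrite Dp'.
by exists (g \Po p); rewrite map_comp_poly horner_comp Dp.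
Qed.

(** One generator z suffices, and an annihilating polynomial of least size is irreducible, which is
    what the construction of the extension asks for. *)
Lemma number_field_containing (C : numFieldType) (s : seq C) :
  (forall x, x \in s -> algebraicOver (ratr : rat -> C) x) ->
  exists (K : fieldExtType rat) (i : {rmorphism K -> C}),
    forall x, x \in s -> exists y, i y = x.
Proof.
move=> /primitive_generator[z [q0 q00 q0z] genz].
pose P n := exists2 q : {poly rat}, q != 0 & root (map_poly ratr q) z /\ size q = n.
have exP : exists n, `[< P n >] by exists (size q0); apply/asboolP; exists q0.
case: (ex_minnP exP) => n /asboolP[r nz_r [rz0 szr]] minr.
have irr_r: irreducible_poly r.
  apply/(subfx_irreducibleP rz0 nz_r) => q qz0 nzq; rewrite szr.
  by apply: minr; apply/asboolP; exists q.
exists (SubFieldExtType rz0 irr_r), (@subfx_inj _ _ (@ratr C) z r).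
move=> x /genz[p ->].
by exists (subfx_eval (@ratr C) z r p); exact: (subfx_inj_eval rz0 nz_r).
Qed.

(** * Heights in a number field and Liouville's inequality *)

Section Heights.
Variables (R : realType) (K : fieldExtType rat) (i : {rmorphism K -> R[i]%C}).
Local Notation m := (\dim {:K}).
Let e := vbasis {:K}.

Definition regrep (x : K) : 'M[rat]_m := \matrix_(a, b) coord e b (x * e`_a).

Lemma regrepE x (a : 'I_m) : x * e`_a = \sum_(b < m) regrep x a b *: e`_b.
Proof.
rewrite [LHS](coord_vbasis (memvf _)); apply: eq_bigr => b _.
by rewrite mxE.
Qed.

Lemma regrepD x y : regrep (x + y) = regrep x + regrep y.
Proof. by apply/matrixP => a b; rewrite !mxE mulrDl linearD. Qed.

Lemma regrep0 : regrep 0 = 0.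
Proof. by apply/matrixP => a b; rewrite !mxE mul0r linear0. Qed.

Lemma regrepM x y : regrep (x * y) = regrep y *m regrep x.
Proof.
apply/matrixP => a b; rewrite !mxE -mulrA regrepE mulr_sumr linear_sum /=.
by apply: eq_bigr => c _; rewrite -scalerAr linearZ /= [regrep x _ _]mxE.
Qed.

Lemma regrep1 : regrep 1 = 1%:M.
Proof.
apply/matrixP => a b; rewrite !mxE mul1r coord_free; last exact: (basis_free (vbasisP _)).
by rewrite eq_sym.
Qed.

Definition msum p q (A : 'M[rat]_(p, q)) : rat := \sum_a \sum_b `|A a b|.

Lemma msum_ge0 p q (A : 'M[rat]_(p, q)) : 0 <= msum A.
Proof. by apply: sumr_ge0 => a _; apply: sumr_ge0. Qed.

Lemma ler_row_msum p q (A : 'M[rat]_(p, q)) a : \sum_b `|A a b| <= msum A.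
Proof.
rewrite /msum (bigD1 a) //= lerDl.
by apply: sumr_ge0 => ? _; apply: sumr_ge0.
Qed.

Lemma msumM p q r (A : 'M[rat]_(p, q)) (B : 'M[rat]_(q, r)) : msum (A *m B) <= msum A * msum B.
Proof.
rewrite /msum mulr_suml; apply: ler_sum => a _.
apply: (@le_trans _ _ (\sum_b \sum_c `|A a c| * `|B c b|)).
  apply: ler_sum => b _; rewrite mxE; apply: le_trans (ler_norm_sum _ _ _) _.
  by apply: ler_sum => c _; rewrite normrM.
rewrite exchange_big mulr_suml; apply: ler_sum => c _.
by rewrite -mulr_sumr ler_wpM2l // ler_row_msum.
Qed.

Lemma msumD p q (A B : 'M[rat]_(p, q)) : msum (A + B) <= msum A + msum B.
Proof.
rewrite -big_split /=; apply: ler_sum => a _; rewrite -big_split /=.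
by apply: ler_sum => b _; rewrite mxE ler_normD.
Qed.

(** Expanding the product of the row sums gives one term for every map of the indices; the Leibniz
    terms of the determinant are those of the permutations. *)
Lemma ler_det_msum p (A : 'M[rat]_p) : `|\det A| <= msum A ^+ p.
Proof.
apply: (@le_trans _ _ (\prod_(a < p) \sum_(b < p) `|A a b|)).
  rewrite bigA_distr_bigA /=; apply: le_trans (ler_norm_sum _ _ _) _.
  rewrite [leLHS](_ : _ = \sum_(s : 'S_p) \prod_(a < p) `|A a (s a)|); last first.
    apply: eq_bigr => s _; rewrite normrM normrX normrN1 expr1n mul1r.
    by rewrite normr_prod.
  rewrite [leRHS](bigID (fun f : {ffun 'I_p -> 'I_p} => injectiveb f)) /=.
  rewrite -[leLHS]addr0 lerD //; last first.
    by apply: sumr_ge0 => f _; apply: prodr_ge0.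
  rewrite (reindex_onto (fun s : 'S_p => pval s) (fun f => insubd (1%g : 'S_p) f)) /=; last first.
    by move=> f inj_f; rewrite insubdK.
  rewrite [leRHS](_ : _ = \sum_(s : 'S_p) \prod_(a < p) `|A a (s a)|) //.
  apply: eq_big => s; last by move=> _; apply: eq_bigr => a _; rewrite pvalE.
  by rewrite (valP s) /= -[X in insubd _ X]/(val s) valKd eqxx.
apply: (@le_trans _ _ (\prod_(a < p) msum A)); first apply: ler_prod => a _.
  by rewrite sumr_ge0 // ler_row_msum.
by rewrite prodr_const card_ord.
Qed.

(** A substitute for the largest absolute value of a conjugate: subadditive, submultiplicative, and
    an upper bound for the modulus by [normc_le_house]. Its value at 1 is m, whence the factor m in
    [houseX]. *)
Definition house (x : K) : rat := msum (regrep x).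

Lemma house_ge0 x : 0 <= house x. Proof. exact: msum_ge0. Qed.

Lemma houseD x y : house (x + y) <= house x + house y.
Proof. by rewrite /house regrepD msumD. Qed.

Lemma house_sum (T : finType) (F : T -> K) : house (\sum_t F t) <= \sum_t house (F t).
Proof.
elim/big_rec2: _ => [|t y x _ le_xy].
  by rewrite /house regrep0 /msum big1 // => a _; rewrite big1 // => b _; rewrite mxE normr0.
by apply: le_trans (houseD _ _) _; rewrite lerD2l.
Qed.

Lemma houseM x y : house (x * y) <= house x * house y.
Proof. by rewrite /house regrepM mulrC msumM. Qed.

Lemma house1 : house 1 = m%:R.
Proof.
rewrite /house regrep1 /msum (eq_bigr (fun=> 1)); first by rewrite sumr_const card_ord.
move=> a _; rewrite (bigD1 a) //= mxE eqxx normr1 big1 ?addr0 // => b ba.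
by rewrite mxE eq_sym (negPf ba) normr0.
Qed.

Lemma dim_ge1 : (0 < m)%N.
Proof.
have := dimvS (sub1v (fullv : {vspace K})).
by rewrite dim_vline oner_eq0.
Qed.

Lemma houseX x n : house (x ^+ n) <= m%:R * house x ^+ n.
Proof.
elim: n => [|n IHn]; first by rewrite !expr0 mulr1 house1.
rewrite !exprS mulrCA; apply: le_trans (houseM _ _) _.
by rewrite ler_wpM2l // house_ge0.
Qed.

(** The images of the basis form an eigenvector of [regrep x] with eigenvalue [i x]. At the
    coordinate of largest modulus the eigenvalue is bounded by a row sum. *)
Lemma normc_le_house x : normc (i x) <= ratr (house x).
Proof.
have [a0 max_a0] : exists a0 : 'I_m, forall a : 'I_m, normc (i e`_a) <= normc (i e`_a0).
  have [a0 _ h] := @arg_maxP _ R 'I_m (Ordinal dim_ge1) xpredT (fun a => normc (i e`_a)) isT.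
  by exists a0 => a; apply: h.
have nz : 0 < normc (i e`_a0).
  rewrite normc_gt0 fmorph_eq0; apply/eqP => e0.
  have := basis_not0 (vbasisP (fullv : {vspace K})) (mem_nth 0 _ : e`_a0 \in e).
  by rewrite size_tuple ltn_ord e0 eqxx => /(_ isT).
rewrite -(ler_pM2r nz) -normcM -rmorphM regrepE rmorph_sum.
apply: le_trans (ler_normc_sum _ _ _) _.
apply: (@le_trans _ _ (\sum_b ratr `|regrep x a0 b| * normc (i e`_a0))).
  apply: ler_sum => b _; rewrite rmorphZ_num normcM normc_rat.
  by rewrite ler_wpM2l // ler0q.
by rewrite -mulr_suml -rmorph_sum ler_wpM2r ?normc_ge0 // ler_rat ler_row_msum.
Qed.

(* [d] is a common denominator for multiplication by [x] in the chosen basis. *)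
Definition denom (d : nat) (x : K) : Prop :=
  (0 < d)%N /\ forall a b, d%:R * regrep x a b \is a Num.int.

Lemma denom_exists x : exists d, denom d x.
Proof.
exists (\prod_a \prod_b `|denq (regrep x a b)|)%N; split.
  by rewrite prodn_gt0 // => a; rewrite prodn_gt0 // => b; rewrite absz_gt0 denq_neq0.
move=> a b; rewrite (bigD1 a) //= (bigD1 b) //= !natrM.
rewrite mulrC mulrA mulrA rpredM ?natr_int // rpredM ?natr_int //.
rewrite natr_absz ger0_norm ?denq_ge0 //.
rewrite -{1}(divq_num_den (regrep x a b)) mulfVK ?intr_eq0 ?denq_neq0 //.
exact: intr_int.
Qed.

Lemma denomM d d' x y : denom d x -> denom d' y -> denom (d * d') (x * y).
Proof.
move=> [d0 dx] [d'0 dy]; split=> [|a b]; first by rewrite muln_gt0 d0.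
rewrite regrepM mxE mulr_sumr rpred_sum // => c _.
by rewrite natrM [_ * regrep x c b]mulrC mulrACA rpredM.
Qed.

Lemma denom1 : denom 1 1.
Proof. by split=> // a b; rewrite regrep1 mxE mul1r natr_int. Qed.

Lemma denomX d x n : denom d x -> denom (d ^ n) (x ^+ n).
Proof.
move=> dx; elim: n => [|n IHn]; first exact: denom1.
by rewrite expnS exprS; apply: denomM.
Qed.

Lemma denom_dvd d d' x : (0 < d')%N -> (d %| d')%N -> denom d x -> denom d' x.
Proof.
move=> d'0 /dvdnP[c Dc] [d0 dx]; split=> // a b.
by rewrite Dc natrM -mulrA rpredM ?natr_int.
Qed.

Lemma denom_sum d (T : finType) (F : T -> K) :
  (0 < d)%N -> (forall t, denom d (F t)) -> denom d (\sum_t F t).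
Proof.
move=> d0 dF; split=> // a b; elim/big_rec: _ => [|t y _ IH].
  by rewrite regrep0 mxE mulr0.
by rewrite regrepD mxE mulrDr rpredD //; apply: (dF t).2.
Qed.

(** With B the integral matrix [d%:R *: regrep x], the inverse is d times the adjugate of B divided
    by its determinant. The determinant serves as denominator and the cofactors bound the size. *)
Lemma denom_inv d x : denom d x -> x != 0 ->
  exists d', [/\ denom d' x^-1,
    d'%:R <= (d%:R * house x) ^+ m * (d * m ^ 2)%:R &
    house x^-1 <= (d%:R * house x) ^+ m * (d * m ^ 2)%:R].
Proof.
move=> [d0 dx] x0; pose A := d%:R *: regrep x.
have intA a b : A a b \is a Num.int by rewrite mxE dx.
have [B DA] : exists B : 'M[int]_m, A = map_mx intr B.
  exists (\matrix_(a, b) Num.floor (A a b)); apply/matrixP => a b.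
  by rewrite [RHS]mxE [X in _ = X%:~R]mxE floorK.
have dR : (d%:R : rat) != 0 by rewrite pnatr_eq0 -lt0n.
have inv : regrep x *m regrep x^-1 = 1%:M by rewrite -regrepM mulVf // regrep1.
have uA : A \in unitmx.
  by rewrite unitmxZ ?unitfE //; case/mulmx1_unit: inv.
have detB0 : \det B != 0.
  move: uA; rewrite DA unitmxE det_map_mx unitfE; apply: contra => /eqP->.
  by rewrite rmorph0.
have Drx : regrep x^-1 = d%:R *: ((\det B)%:~R^-1 *: map_mx intr (\adj B)).
  have uX : regrep x \in unitmx by case/mulmx1_unit: inv.
  rewrite -[LHS](mulKmx uX) inv mulmx1.
  rewrite -[regrep x in LHS](scalerK dR) -/A.
  rewrite invmxZ; last by rewrite unitmxZ ?unitrV ?unitfE.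
  by rewrite invrK /invmx uA DA det_map_mx map_mx_adj.
have nA : msum A = d%:R * house x.
  rewrite /msum mulr_sumr; apply: eq_bigr => a _; rewrite mulr_sumr.
  by apply: eq_bigr => b _; rewrite mxE normrM normr_nat.
have det_le : `|\det B|%:~R <= (d%:R * house x) ^+ m :> rat.
  have := ler_det_msum A; rewrite nA DA det_map_mx => /(le_trans _); apply.
  by rewrite intr_norm.
(* The determinant of B is a nonzero integer bounded by a power of [msum A], so [msum A] is at least
   1. This allows the exponent m - 1 of the cofactors to be raised to m. *)
have A1 : 1 <= d%:R * house x.
  rewrite -nA leNgt; apply/negP => lt1.
  have : `|\det B|%:~R < 1 :> rat.
    by apply: le_lt_trans det_le _; rewrite -nA exprn_ilt1 ?msum_ge0 // -lt0n dim_ge1.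
  by rewrite -[1]/(1%:~R) ltr_int ltNge -gtz0_ge1 normr_gt0 detB0.
have adj_le a b : `|(\adj B) a b|%:~R <= (d%:R * house x) ^+ m :> rat.
  rewrite mxE /cofactor normrM normrX normrN1 expr1n mul1r.
  rewrite intr_norm -det_map_mx; apply: le_trans (ler_det_msum _) _.
  apply: (@le_trans _ _ ((d%:R * house x) ^+ m.-1)); last first.
    by rewrite ler_weXn2l // leq_pred.
  rewrite lerXn2r ?nnegrE ?msum_ge0 //; first by apply: le_trans A1.
  rewrite -nA DA; apply: (@le_trans _ _ (\sum_(u < m.-1) \sum_v `|map_mx intr B (lift b u) v|)).
    apply: ler_sum => u _; rewrite [leRHS](bigD1_ord a) //= -[leLHS]add0r lerD //.
    by apply: ler_sum => v _; rewrite !mxE.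
  rewrite /msum [leRHS](bigD1_ord b) //= -[leLHS]add0r lerD //.
  by apply: sumr_ge0.
have h0 : 0 <= (d%:R * house x) ^+ m by rewrite exprn_ge0 //; apply: le_trans A1.
have m1 := dim_ge1.
have dm1 : 1 <= (d * m ^ 2)%:R :> rat.
  by rewrite ler1n muln_gt0 d0 expn_gt0 m1.
exists `|\det B|%N; split.
- split=> [|a b]; first by rewrite absz_gt0.
  rewrite Drx !mxE mulrCA rpredM ?natr_int // mulrA rpredM ?intr_int //.
  rewrite natr_absz normrEsg intrM mulfK ?intr_int //.
  by rewrite intr_eq0.
- by rewrite natr_absz; apply: le_trans det_le _; rewrite ler_peMr.
rewrite /house Drx /msum.
apply: (@le_trans _ _ (\sum_(a < m) \sum_(b < m) d%:R * (d%:R * house x) ^+ m)).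
  apply: ler_sum => a _; apply: ler_sum => b _.
  rewrite mxE [X in _ * X]mxE normrM normr_nat ler_wpM2l // normrM [map_mx _ _ a b]mxE -intr_norm.
  apply: le_trans (adj_le a b); rewrite ler_piMl //.
  by rewrite normfV invf_le1 ?normr_gt0 ?intr_eq0 // -intr_norm ler1z -gtz0_ge1 normr_gt0.
rewrite -/(msum (regrep x)) -/(house x) !sumr_const card_ord -mulrnA.
by rewrite natrM -mulnn mulrA -[leLHS]mulr_natr [d%:R * _ ^+ _]mulrC.
Qed.

(** The moduli of [i x] and [i x^-1] have product 1, and the second is at most the house of
    [x^-1]. *)
Lemma liouville d x : denom d x -> x != 0 ->
  1 <= normc (i x) * ratr ((d%:R * house x) ^+ m * (d * m ^ 2)%:R).
Proof.
move=> dx x0; have [d' [_ _ h]] := denom_inv dx x0.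
apply: (@le_trans _ _ (normc (i x) * normc (i x^-1))).
  by rewrite -normcM -rmorphM mulfV // rmorph1 normc1.
rewrite ler_wpM2l ?normc_ge0 //; apply: le_trans (normc_le_house _) _.
by rewrite ler_rat.
Qed.

End Heights.

Section HeightBounds.
Variables (R : realType) (K : fieldExtType rat) (i : {rmorphism K -> R[i]%C}).
Local Notation m := (\dim {:K}).
Implicit Types x y : K.

(** A single number bounds both the denominator and the house, so that bounds multiply along with
    the elements. *)
Definition ht (x : K) (B : R) : Prop :=
  exists d, [/\ denom d x, d%:R <= B & ratr (house x) <= B].

Lemma ht_ge1 x B : ht x B -> 1 <= B.
Proof.
by case=> d [[d0 _] dB _]; apply: le_trans dB; rewrite ler1n.
Qed.

Lemma ht_le x B B' : B <= B' -> ht x B -> ht x B'.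
Proof.
by move=> BB' [d [dx dB hB]]; exists d; split=> //; apply: le_trans BB'.
Qed.

Lemma ht_exists x : exists B, ht x B.
Proof.
have [d dx] := denom_exists x.
exists (Num.max d%:R (ratr (house x))); exists d.
by split=> //; rewrite le_max lexx ?orbT.
Qed.

Lemma ratr_house_ge0 x : 0 <= ratr (house x) :> R.
Proof. by rewrite ler0q house_ge0. Qed.

Lemma ratr_houseD x y : ratr (house (x + y)) <= ratr (house x) + ratr (house y) :> R.
Proof. by rewrite -rmorphD ler_rat houseD. Qed.

Lemma ratr_houseM x y : ratr (house (x * y)) <= ratr (house x) * ratr (house y) :> R.
Proof. by rewrite -rmorphM ler_rat houseM. Qed.

Lemma ratr_houseX x n : ratr (house (x ^+ n)) <= m%:R * ratr (house x) ^+ n :> R.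
Proof.
by rewrite -(ratr_nat R) -rmorphXn -rmorphM ler_rat houseX.
Qed.

Lemma ratr_house_sum (T : finType) (F : T -> K) :
  ratr (house (\sum_t F t)) <= \sum_t ratr (house (F t)) :> R.
Proof. by rewrite -rmorph_sum ler_rat house_sum. Qed.

Lemma htM x y B B' : ht x B -> ht y B' -> ht (x * y) (B * B').
Proof.
move=> [d [dx dB hB]] [d' [dy dB' hB']]; exists (d * d')%N; split.
- exact: denomM.
- by rewrite natrM ler_pM.
by apply: le_trans (ratr_houseM _ _) _; rewrite ler_pM // ratr_house_ge0.
Qed.

Lemma htD x y B B' : ht x B -> ht y B' -> ht (x + y) (2 * (B * B')).
Proof.
move=> hx hy; have := ht_ge1 hx; have := ht_ge1 hy.
case: hx hy => d [dx dB hB] [d' [dy dB' hB']] B'1 B1.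
have BB : 0 <= B * B' by rewrite mulr_ge0 //; lra.
exists (d * d')%N; split.
- have dd : (0 < d * d')%N by rewrite muln_gt0 dx.1 dy.1.
  split=> // a b; rewrite regrepD mxE mulrDr rpredD //.
    by apply: (denom_dvd dd _ dx).2; rewrite dvdn_mulr.
  by apply: (denom_dvd dd _ dy).2; rewrite dvdn_mull.
- rewrite natrM; apply: (@le_trans _ _ (B * B')); first by rewrite ler_pM.
  by rewrite mulrDl mul1r lerDl.
apply: le_trans (ratr_houseD _ _) _; apply: le_trans (lerD hB hB') _.
nra.
Qed.

Lemma ht_inv x B : ht x B -> x != 0 ->
  ht x^-1 ((m ^ 2)%:R * B ^+ (m * 2).+1).
Proof.
move=> hx x0; have B1 := ht_ge1 hx.
case: hx => d [dx dB hB]; have [d' [dx' le1 le2]] := denom_inv dx x0.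
have B0 : 0 <= B by lra.
have key : ratr ((d%:R * house x) ^+ m * (d * m ^ 2)%:R) <= (m ^ 2)%:R * B ^+ (m * 2).+1.
  rewrite rmorphM rmorphXn /= rmorphM /= !ratr_nat natrM.
  have dh : 0 <= d%:R * ratr (house x) :> R by rewrite mulr_ge0 ?ratr_house_ge0.
  rewrite [leRHS]mulrC exprSr -mulrA ler_pM ?exprn_ge0 ?(mulr_ge0 (ler0n _ d)) ?ler0n ?ratr_house_ge0 //.
    rewrite mulnC exprM lerXn2r ?nnegrE ?(exprn_ge0 _ B0) //.
    by rewrite expr2 ler_pM ?ratr_house_ge0.
  by rewrite ler_wpM2r.
exists d'; split=> //; last by apply: le_trans key; rewrite ler_rat.
by apply: le_trans key; rewrite -(ratr_nat R) ler_rat.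
Qed.

(** The bound is exponential in q even though the integer coefficients are allowed to grow linearly
    with q. *)
Lemma ht_horner_int (x : K) (A : nat) : exists2 B : R, 1 <= B &
  forall (q : nat) (c : nat -> int), (0 < q)%N ->
    (forall n, (n < q)%N -> `|c n| <= (A * q)%:Z) ->
    ht (\sum_(n < q) (c n)%:~R * x ^+ n) (B ^+ q).
Proof.
have [b [d [dx db hb]]] := ht_exists x; have b1 : 1 <= b by apply: le_trans db; rewrite ler1n dx.1.
have b0 : 0 <= b by lra.
(* The factor 4 absorbs q^2 <= 4^q (q terms with coefficients up to A q), and m (A + 1) absorbs the
   constant A m. *)
pose B := b * (4 * m * (A + 1))%:R.
have B1 : 1 <= B.
  rewrite /B -[leLHS]mulr1 ler_pM // ler1n.
  by rewrite !muln_gt0 dim_ge1 addn1.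
have bB : b <= B.
  rewrite /B ler_peMr // ler1n.
  by rewrite !muln_gt0 dim_ge1 addn1.
exists B => // q c q0 cA.
exists (d ^ q)%N; split.
- apply: denom_sum => [|n]; first by rewrite expn_gt0 dx.1.
  rewrite -[(c n)%:~R]/(intmul 1 (c n)) mulrzl.
  have [? dn] : denom (d ^ q) (x ^+ n).
    apply: (denom_dvd _ _ (denomX n dx)); rewrite ?expn_gt0 ?dx.1 //.
    by rewrite dvdn_exp2l // ltnW.
  split=> // u v; rewrite mxE mulrzAl raddfMz mulrzAr rpredMz //.
  by have := dn u v; rewrite mxE.
- rewrite natrX lerXn2r ?nnegrE ?ler0n //; first by apply: le_trans B1.
  exact: le_trans bB.
apply: le_trans (ratr_house_sum _) _.
apply: (@le_trans _ _ (\sum_(n < q) (A * q * m)%:R * b ^+ q)).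
  apply: ler_sum => n _; rewrite mulrzl.
  have -> : house (x ^+ n *~ c n) = `|c n|%:~R * house (x ^+ n).
    rewrite /house /msum mulr_sumr; apply: eq_bigr => u _.
    rewrite mulr_sumr; apply: eq_bigr => v _.
    by rewrite !mxE mulrzAl raddfMz normrMz -mulrzl intr_norm.
  rewrite rmorphM /= ratr_int natrM -mulrA ler_pM ?ratr_house_ge0 ?ler0z //.
    by rewrite -[leRHS]/((A * q)%:Z%:~R) ler_int cA.
  apply: le_trans (ratr_houseX _ _) _; rewrite ler_wpM2l ?ler0n //.
  apply: (@le_trans _ _ (b ^+ n)).
    by rewrite lerXn2r ?nnegrE ?ratr_house_ge0.
  by rewrite ler_weXn2l // ltnW.
rewrite sumr_const card_ord -[leLHS]mulr_natl mulrA -natrM.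
rewrite /B exprMn mulrC ler_wpM2l ?exprn_ge0 // -natrX ler_nat.
rewrite mulnCA -mulnA [(q * m)%N]mulnC !mulnA.
have q2 : (q * q <= 4 ^ q)%N.
  have h : (q <= 2 ^ q)%N by rewrite ltnW // ltn_expl.
  by rewrite (_ : 4 = 2 * 2)%N // expnMn leq_mul.
have mA : (A * m <= (m * (A + 1)) ^ q)%N.
  apply: (@leq_trans (m * (A + 1))); first by rewrite mulnC leq_mul2l leq_addr orbT.
  rewrite -{1}[(m * _)%N]expn1 leq_pexp2l // muln_gt0 dim_ge1 addn1 //.
rewrite -[(4 * m * (A + 1))%N]mulnA expnMn.
rewrite (_ : (_ * q)%N = (q * q) * (A * m))%N ?leq_mul //.
by rewrite !mulnA; lia.
Qed.

(** The expression is the closed form of a series of rational slope p / q. Its height is exponential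
    in the denominator q, which has the order of the exponents of the monomials at the same step. *)
Lemma ht_geometric_sum (x : K) (A : nat) : 1 - x != 0 -> exists2 B : R, 1 <= B &
  forall (q : nat) (c : nat -> int) (p : int), (0 < q)%N ->
    (forall n, (n < q)%N -> `|c n| <= (A * q)%:Z) -> `|p| <= (A * q)%:Z ->
    1 - x ^+ q != 0 ->
    ht ((\sum_(n < q) (c n)%:~R * x ^+ n + p%:~R * x ^+ q / (1 - x)) / (1 - x ^+ q))
       (B ^+ q).
Proof.
move=> x1; have [B1 B11 h1] := ht_horner_int x A.
have [B2 B21 h2] := ht_horner_int x 1.
have [B3 h3] := ht_exists (1 - x)^-1; have B31 := ht_ge1 h3.
pose c0 : R := 2 * (m ^ 2)%:R * B3.
have c01 : 1 <= c0.
  rewrite /c0 -[leLHS]mulr1 ler_pM // -natrM ler1n muln_gt0 expn_gt0.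
  by rewrite dim_ge1.
pose B := c0 * B1 ^+ 3 * B2 ^+ (2 * (m * 2).+1).
exists B.
  by rewrite /B -[leLHS]mulr1 ler_pM ?exprn_ege1 // -[leLHS]mulr1 ler_pM // exprn_ege1.
move=> q c p q0 cA pA xq.
have q1 : (q.+1 <= q * 2)%N by lia.
have hy := h1 q c q0 cA.
have hp : ht (p%:~R * x ^+ q) (B1 ^+ (q * 2)).
  have := h1 q.+1 (fun n => if n == q then p else 0) isT.
  rewrite big_ord_recr /= eqxx big1 ?add0r => [h|n _]; last by rewrite ltn_eqF // mul0r.
  apply: ht_le (h _) => [|n _]; first by rewrite ler_weXn2l.
  case: ifP => _; last by rewrite normr0.
  by apply: le_trans pA _; rewrite lez_nat leq_mul2l leqnSn orbT.
have hw : ht (1 - x ^+ q) (B2 ^+ (q * 2)).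
  have := h2 q.+1 (fun n => if n == q then -1 else (n == 0%N)%:Z) isT.
  rewrite big_ord_recr /= eqxx mulN1r.
  rewrite (bigD1 (Ordinal q0)) //= ltn_eqF // mul1r big1 ?addr0 => [h|n n0]; last first.
    by rewrite ltn_eqF // (_ : (n == 0 :> nat) = false) ?mul0r //; apply/negP => /eqP n00; case/eqP: n0; apply: val_inj.
  apply: ht_le (h _) => [|n _]; first by rewrite ler_weXn2l.
  by case: ifP => _; rewrite ?normrN1 //; case: eqP.
have hz := htM hp h3.
have := htM (htD hy hz) (ht_inv hw xq).
apply: ht_le.
rewrite /B exprMn [(c0 * _) ^+ q]exprMn -!exprM.
rewrite [leLHS](_ : _ = c0 * B1 ^+ (3 * q) * B2 ^+ (2 * (m * 2).+1 * q)); last first.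
  rewrite (_ : 3 * q = q + q * 2)%N; last by lia.
  rewrite (_ : 2 * (m * 2).+1 * q = q * 2 * (m * 2).+1)%N; last by lia.
  by rewrite exprD /c0; move: (B1 ^+ q) (B1 ^+ _) (B2 ^+ _) (m ^ 2)%:R => u1 u2 u3 u4; ring.
rewrite ler_wpM2r ?exprn_ge0 //; first by lra.
rewrite ler_wpM2r ?exprn_ge0 //; first by lra.
by rewrite -{1}[c0]expr1 ler_weXn2l.
Qed.

(** C is chosen before the degree p and the coefficients, which enter only M. This uniformity makes
    it possible to fix the order of vanishing as a multiple of p. *)
Lemma liouville_box (N : nat) : exists C : nat,
  forall (T : finType) (a : T -> K) (e : T -> 'I_N -> nat) (p : nat),
    (forall t l, (e t l <= p)%N) ->
    exists2 M : R, 0 < M & forall (v : 'I_N -> K) (X : R),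
      (forall l, ht (v l) X) ->
      let y := \sum_t a t * \prod_l v l ^+ e t l in
      1 <= X -> y != 0 -> M <= normc (i y) * X ^+ (C * p).
Proof.
(* Denominator and house each contribute X^(N p); Liouville's bound raises their product to the
   power m and multiplies by one more denominator. *)
exists ((N * 2) * m + N)%N => T a e p ep.
have /fin_all_exists[da hda] : forall t, exists d, denom d (a t) by move=> t; apply: denom_exists.
pose Da := (\prod_t da t)%N.
have Da0 : (0 < Da)%N by rewrite prodn_gt0 // => t; case: (hda t).
pose Ha : R := \sum_t ratr (house (a t)).
have Ha0 : 0 <= Ha by apply: sumr_ge0 => t _; apply: ratr_house_ge0.
pose Z : R := (Da%:R * (Ha * m%:R ^+ N.+1)) ^+ m * (Da * m ^ 2)%:R.
have Z0 : 0 <= Z by rewrite !mulr_ge0 ?exprn_ge0 ?mulr_ge0 ?exprn_ge0.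
exists (Z + 1)^-1; first by rewrite invr_gt0 ltr_wpDl.
move=> v X hv y X1 y0.
have X0 : 0 <= X by lra.
have /fin_all_exists[d hd] : forall l, exists d, [/\ denom d (v l), d%:R <= X & ratr (house (v l)) <= X].
  by move=> l; apply: hv.
pose D := (Da * \prod_l d l ^ p)%N.
have D0 : (0 < D)%N.
  by rewrite muln_gt0 Da0 prodn_gt0 // => l; rewrite expn_gt0; case: (hd l) => -[->].
have dy : denom D y.
  apply: denom_sum => // t; apply: denomM.
    apply: denom_dvd (hda t) => //; rewrite /Da (bigD1 t) //= dvdn_mulr //.
  elim/big_rec2: _ => [|l u w _ IH]; first exact: denom1.
  apply: denomM => //; case: (hd l) => dl _ _.
  by apply: denom_dvd (denomX (e t l) dl); rewrite ?expn_gt0 ?dl.1 // dvdn_exp2l.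
have DX : D%:R <= Da%:R * X ^+ (N * p).
  rewrite natrM ler_wpM2l ?ler0n // natr_prod.
  rewrite mulnC exprM -[N in leRHS]card_ord -prodr_const.
  by apply: ler_prod => l _; rewrite natrX exprn_ge0 ?lerXn2r ?nnegrE //; case: (hd l).
have hX : ratr (house y) <= Ha * m%:R ^+ N.+1 * X ^+ (N * p).
  apply: le_trans (ratr_house_sum _) _; rewrite -mulrA mulr_suml.
  apply: ler_sum => t _; apply: le_trans (ratr_houseM _ _) _.
  rewrite ler_wpM2l ?ratr_house_ge0 //.
  rewrite exprS -mulrA mulnC exprM -[N in X in _ <= _ * (_ ^+ X * _)]card_ord -[N in X in _ <= _ * (_ * _ ^+ X)]card_ord.
  rewrite -!prodr_const -big_split /=.
  elim/big_rec2: _ => [|l u w _ IH]; first by rewrite house1 ratr_nat mulr1.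
  rewrite mulrCA; apply: le_trans (ratr_houseM _ _) _.
  rewrite ler_pM ?ratr_house_ge0 //.
  apply: le_trans (ratr_houseX _ _) _; rewrite ler_wpM2l ?ler0n //.
  apply: (@le_trans _ _ (X ^+ e t l)).
    by rewrite lerXn2r ?nnegrE ?ratr_house_ge0 //; case: (hd l).
  by rewrite ler_weXn2l.
have := liouville i dy y0; rewrite rmorphM rmorphXn /= rmorphM /= !ratr_nat => key.
move: (ratr_house_ge0 y) hX key; move: (ratr (house y)) => Y Y0 hX key.
have ZX : (D%:R * Y) ^+ m * (D * m ^ 2)%:R <= Z * X ^+ ((N * 2 * m + N) * p) :> R.
  rewrite [leRHS](_ : _ = ((Da%:R * X ^+ (N * p)) * (Ha * m%:R ^+ N.+1 * X ^+ (N * p))) ^+ m * ((Da%:R * X ^+ (N * p)) * (m ^ 2)%:R)).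
    rewrite natrM ler_pM ?exprn_ge0 ?mulr_ge0 ?ler0n //; last by rewrite ler_wpM2r ?ler0n.
    rewrite lerXn2r ?nnegrE ?mulr_ge0 ?exprn_ge0 ?ler0n //.
    by rewrite ler_pM ?ler0n.
  rewrite (_ : (N * 2 * m + N) * p = (N * p) * 2 * m + N * p)%N; last by lia.
  rewrite [X ^+ (_ + N * p)]exprD (exprM X (N * p * 2)%N) (exprM X (N * p)%N) /Z natrM.
  move: (X ^+ (N * p)) (Ha * _) => W H.
  rewrite (_ : Da%:R * W * (H * W) = (Da%:R * H) * W ^+ 2); last by rewrite expr2; ring.
  rewrite [(_ * W ^+ 2) ^+ m]exprMn; move: (_ ^+ m) (_ ^+ m) => u1 u2; ring.
have y1 := normc_ge0 (i y).
rewrite -(ler_pM2l (_ : 0 < Z + 1)) ?ltr_wpDl // mulfV ?gt_eqF ?ltr_wpDl //.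
apply: le_trans key _.
rewrite [leRHS]mulrCA ler_wpM2l //; apply: le_trans ZX _.
by rewrite ler_wpM2r ?exprn_ge0 // lerDl.
Qed.

End HeightBounds.

(** * Auxiliary polynomials with coefficients in two letters *)

Section Auxiliary.
Variables (K : fieldType) (n : nat).
Local Notation S := {poly {poly K}}.
Local Notation cst c := (c%:P%:P : S).

(** The two letters of [S] will be specialised to the values s_k of the two series; degrees are
    bounded in each letter separately. *)
Definition bideg (d : nat) (q : S) : Prop :=
  forall i j, (d < i)%N || (d < j)%N -> q`_i`_j = 0.

Lemma bidegW d d' q : (d <= d')%N -> bideg d q -> bideg d' q.
Proof.
move=> dd' h i j /orP[] l; apply: h; rewrite (leq_ltn_trans dd' l) //.
by rewrite orbT.
Qed.

Lemma bideg0 d : bideg d 0.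
Proof. by move=> i j _; rewrite !coef0. Qed.

Lemma bidegC d c : bideg d (cst c).
Proof.
move=> i j; rewrite coefC; case: eqP => [-> /= dj|_ _]; last by rewrite coef0.
by rewrite coefC; case: eqP dj => // ->.
Qed.

Lemma bidegD d p q : bideg d p -> bideg d q -> bideg d (p + q).
Proof. by move=> hp hq i j l; rewrite !coefD hp // hq // addr0. Qed.

Lemma bideg_sum d (I : Type) (r : seq I) (P : pred I) (F : I -> S) :
  (forall t, P t -> bideg d (F t)) -> bideg d (\sum_(t <- r | P t) F t).
Proof.
move=> h; elim/big_rec: _ => [|t x Pt hx]; first exact: bideg0.
by apply: bidegD => //; apply: h.
Qed.

Lemma bidegM d d' p q : bideg d p -> bideg d' q -> bideg (d + d') (p * q).
Proof.
move=> hp hq i j l; rewrite coefM coef_sum big1 // => a _.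
rewrite coefM big1 // => b _.
case: (boolP ((d < a)%N || (d < b)%N)) => [/hp -> |]; first by rewrite mul0r.
rewrite negb_or -!leqNgt => /andP[ad bd]; rewrite (hq (i - a)%N) ?mulr0 //.
have := ltn_ord a; have := ltn_ord b; move: l; lia.
Qed.

Lemma bideg_monom i j d : (i <= d)%N -> (j <= d)%N -> bideg d ('X^i * ('X^j)%:P).
Proof.
move=> id jd a b; rewrite coefMC coefXn.
case: eqP => [-> |_ _]; last by rewrite mul0r coef0.
rewrite ltnNge id /= => db; rewrite mul1r coefXn.
by case: eqP db => // -> ; rewrite ltnNge jd.
Qed.

Definition mbideg (d : nat) (E : mpoly n S) : Prop := forall m, bideg d (mcoeff m E).

Lemma mbidegM d d' E E' : mbideg d E -> mbideg d' E' -> mbideg (d + d') (E * E').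
Proof.
move=> hE hE' m; rewrite mcoeffM; apply: bideg_sum => k _.
exact: bidegM.
Qed.

Lemma mbidegD d E E' : mbideg d E -> mbideg d E' -> mbideg d (E + E').
Proof. by move=> hE hE' m; rewrite mcoeffD; apply: bidegD. Qed.

Lemma mbidegC d q : bideg d q -> mbideg d (mpolyC n q).
Proof.
move=> hq m; rewrite mcoeffC; case: eqP => _; rewrite ?mulr1 // mulr0.
exact: bideg0.
Qed.

Lemma mbidegX d m : mbideg d (mpolyX S m).
Proof.
move=> k; rewrite mcoeffX; case: eqP => _; last exact: bideg0.
by have := @bidegC d 1; rewrite !polyC1.
Qed.

Lemma mbideg_exp d E h : mbideg d E -> mbideg (h * d) (E ^+ h).
Proof.
move=> hE; elim: h => [|h IH].
  by rewrite expr0 mul0n -mpolyC1; apply: mbidegC; have := @bidegC 0 1; rewrite !polyC1.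
by rewrite exprS mulSn; apply: mbidegM.
Qed.

Definition mnm_of (f : 'I_n -> nat) : multinom n := Multinom [tuple f i | i < n].

Lemma mnm_ofE f i : mnm_of f i = f i.
Proof. by rewrite multinomE tnth_mktuple. Qed.

(** The order of vanishing is measured by a box, not by total degree: outside the box one exponent
    is at least I, which alone makes the monomial small. *)
Definition vanishes (I : nat) (E : mpoly n S) : Prop :=
  forall m : multinom n, (forall l, (m l < I)%N) -> mcoeff m E = 0.

(** By induction on the total degree: in the coefficient of the product at m, all terms but the
    constant term of Q times the coefficient of E involve smaller exponents of the box, where E
    already vanishes. *)
Lemma vanishes_div I Q E : mcoeff (@mnm0 n) Q != 0 -> vanishes I (Q * E) -> vanishes I E.
Proof.
move=> Q0 h m; have [N] := ubnP (mdeg m); elim: N m => // N IH m mN mI.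
have := h m mI; rewrite mcoeffM.
have bm0 : (mdeg (@mnm0 n) < (mdeg m).+1)%N by rewrite mdeg0.
have bm : (mdeg m < (mdeg m).+1)%N by [].
rewrite (bigD1 (BMultinom bm0, BMultinom bm)) /=; last by rewrite add0m.
rewrite big1 ?addr0 => [/eqP|[k1 k2] /= /andP[/eqP Dm kneq]].
  by rewrite mulf_eq0 (negPf Q0) /= => /eqP.
have Dm' l : m l = (k1 l + k2 l)%N.
  by have := congr1 (fun x : multinom n => x l) Dm; rewrite mnmDE.
have Dd : mdeg m = (mdeg k1 + mdeg k2)%N by have := congr1 (@mdeg n) Dm; rewrite mdegD.
rewrite (IH k2) ?mulr0 //; last first.
  by move=> l; apply: leq_ltn_trans (mI l); rewrite Dm' leq_addl.
rewrite ltnS in mN; apply: leq_trans mN.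
rewrite [X in (_ < X)%N]Dd -[X in (X < _)%N]add0n ltn_add2r.
rewrite lt0n mdeg_eq0; apply: contra kneq => /eqP k10.
apply/eqP; congr pair; apply: val_inj => //=.
exact: (esym (etrans Dm (etrans (congr1 (@mnm_add n ^~ k2) k10) (add0m _)))).
Qed.

Lemma vanishes_divX I Q E h : mcoeff (@mnm0 n) Q != 0 ->
  vanishes I (Q ^+ h * E) -> vanishes I E.
Proof.
move=> Q0; elim: h => [|h IH]; first by rewrite expr0 mul1r.
by rewrite exprS -mulrA => /(vanishes_div Q0)/IH.
Qed.

Lemma exists_kernel (U V : finType) (M : U -> V -> K) : (#|V| < #|U|)%N ->
  exists2 a : U -> K, (exists u, a u != 0) & forall v, \sum_u a u * M u v = 0.
Proof.
move=> VU; pose A : 'M[K]_(#|U|, #|V|) := \matrix_(i, j) M (enum_val i) (enum_val j).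
have : kermx A != 0.
  rewrite kermx_eq0 /row_free; apply: contraTneq VU => <-.
  by rewrite -leqNgt rank_leq_col.
case/rowV0Pn => r /sub_kermxP rA r0.
exists (fun u => r 0 (enum_rank u)).
  case/rV0Pn: r0 => j rj; exists (enum_val j); by rewrite enum_valK.
move=> v; have := congr1 (fun B : 'rV_#|V| => B 0 (enum_rank v)) rA.
rewrite !mxE => rAv; rewrite -[RHS]rAv (reindex_onto enum_rank enum_val) /=; last first.
  by move=> u _; rewrite enum_valK.
apply: eq_big => [u|u _]; first by rewrite enum_rankK eqxx.
by rewrite mxE !enum_rankK.
Qed.

Definition box (p : nat) : finType := ({ffun 'I_n -> 'I_p} * ('I_p * 'I_p))%type.

Definition box_monom p (t : box p) : mpoly n S :=
  mpolyC n ('X^(t.2.1) * ('X^(t.2.2))%:P) * mpolyX S (mnm_of (fun l => t.1 l)).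

Definition box_poly p (a : box p -> K) : mpoly n S :=
  \sum_t mpolyC n (cst (a t)) * box_monom t.

Lemma mbideg_box_monom p (t : box p) d : (p <= d.+1)%N -> mbideg d (box_monom t).
Proof.
move=> pd; rewrite -[d]addn0; apply: mbidegM; last exact: mbidegX.
apply/mbidegC/bideg_monom.
  by rewrite -ltnS (leq_trans (ltn_ord t.2.1)).
by rewrite -ltnS (leq_trans (ltn_ord t.2.2)).
Qed.

(** There are I^n exponents, each carrying a coefficient of degree below p + H d in either letter,
    against H + 1 boxes of p^(n + 2) unknowns. The powers of Q are what makes unknowns outnumber
    equations when I exceeds p. *)
Lemma auxiliary_polynomial (Q : mpoly n S) (d p H I : nat) :
  mbideg d Q -> (I ^ n * (p + H * d) ^ 2 < H.+1 * (p ^ n * p ^ 2))%N ->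
  exists2 A : 'I_H.+1 -> box p -> K, (exists h t, A h t != 0) &
    vanishes I (\sum_h box_poly (A h) * Q ^+ h).
Proof.
move=> dQ count; pose D := (p + H * d)%N.
have p0 : (0 < p)%N by case: p count {D} => //; rewrite !muln0.
pose V := ({ffun 'I_n -> 'I_I} * ('I_D * 'I_D))%type.
pose U := ('I_H.+1 * box p)%type.
pose M (u : U) (v : V) : K :=
  (mcoeff (mnm_of (fun l => v.1 l)) (box_monom u.2 * Q ^+ u.1))`_(v.2.1)`_(v.2.2).
have [|a [[h t] aht] ker] := exists_kernel M.
  by rewrite !card_prod !card_ffun !card_ord -!mulnn in count *.
exists (fun h t => a (h, t)); first by exists h, t.
have -> : \sum_h0 box_poly (fun t0 => a (h0, t0)) * Q ^+ h0 =
          \sum_(u : U) mpolyC n (cst (a u)) * (box_monom u.2 * Q ^+ u.1).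
  rewrite [RHS](_ : _ = \sum_h' \sum_t' mpolyC n (cst (a (h', t'))) * (box_monom t' * Q ^+ h')); last first.
    by rewrite pair_bigA /=; apply: eq_bigr => -[h' t'] _.
  by apply: eq_bigr => h' _; rewrite /box_poly mulr_suml; apply: eq_bigr => t' _; rewrite -mulrA.
move=> m mI; rewrite raddf_sum /=.
have big (u : U) : bideg D.-1 (mcoeff m (box_monom u.2 * Q ^+ u.1)).
  apply: (@bidegW (p.-1 + u.1 * d)).
    have uH : (u.1 * d <= H * d)%N by rewrite leq_mul2r -ltnS ltn_ord orbT.
    by rewrite /D; move: uH; lia.
  apply: mbidegM; last exact: mbideg_exp.
  by apply: mbideg_box_monom; rewrite prednK.
apply/polyP => i; rewrite coef0 coef_sum; apply/polyP => j; rewrite coef0 coef_sum.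
have coefE u : (mcoeff m (mpolyC n (cst (a u)) * (box_monom u.2 * Q ^+ u.1)))`_i`_j =
    a u * (mcoeff m (box_monom u.2 * Q ^+ u.1))`_i`_j.
  by rewrite mcoeffCM coefCM coefCM.
rewrite (eq_bigr _ (fun u _ => coefE u)).
have D0 : (0 < D)%N by rewrite addn_gt0 p0.
case: (ltnP i D) => [iD|Di]; last first.
  by rewrite big1 // => u _; rewrite big ?mulr0 // prednK // Di.
case: (ltnP j D) => [jD|Dj]; last first.
  by rewrite big1 // => u _; rewrite big ?mulr0 // prednK // Dj orbT.
have Em : mnm_of (fun l => [ffun l => Ordinal (mI l)] l) = m.
  by apply/mnmP => l; rewrite mnm_ofE ffunE.
by have := ker ([ffun l => Ordinal (mI l)], (Ordinal iD, Ordinal jD)); rewrite /M /= Em.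
Qed.

End Auxiliary.

(** * Algebraic independence from rapid approximation *)

Section Lipschitz.
Variables (R : realType) (B : R).
Hypothesis B0 : 0 <= B.
Local Notation C := R[i]%C.

(** Bound and Lipschitz constant are carried together because the estimate for a product needs
    both. *)
Definition lipschitz2 (f : C -> C -> C) : Prop :=
  exists2 M : R, 0 <= M & forall x y x' y', normc x <= B -> normc y <= B ->
    normc x' <= B -> normc y' <= B ->
    normc (f x y) <= M /\ normc (f x y - f x' y') <= M * (normc (x - x') + normc (y - y')).

Lemma lipschitz2_cst c : lipschitz2 (fun _ _ => c).
Proof.
exists (normc c); first exact: normc_ge0.
move=> x y x' y' _ _ _ _; split=> //.
by rewrite subrr normc0 mulr_ge0 ?addr_ge0 ?normc_ge0.
Qed.

Lemma lipschitz2_x : lipschitz2 (fun x _ => x).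
Proof.
exists (B + 1); first by have := B0; lra.
move=> x y x' y' hx _ _ _; split; first by lra.
by have := B0; have := normc_ge0 (x - x'); have := normc_ge0 (y - y'); nra.
Qed.

Lemma lipschitz2_y : lipschitz2 (fun _ y => y).
Proof.
exists (B + 1); first by have := B0; lra.
move=> x y x' y' _ hy _ _; split; first by lra.
by have := B0; have := normc_ge0 (x - x'); have := normc_ge0 (y - y'); nra.
Qed.

Lemma lipschitz2D f g : lipschitz2 f -> lipschitz2 g -> lipschitz2 (fun x y => f x y + g x y).
Proof.
move=> [M M0 hf] [N N0 hg]; exists (M + N); first exact: addr_ge0.
move=> x y x' y' hx hy hx' hy'.
have [f1 f2] := hf x y x' y' hx hy hx' hy'; have [g1 g2] := hg x y x' y' hx hy hx' hy'.
split; first by apply: le_trans (ler_normcD _ _) _; apply: lerD.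
rewrite opprD addrACA mulrDl; apply: le_trans (ler_normcD _ _) _.
exact: lerD.
Qed.

Lemma lipschitz2M f g : lipschitz2 f -> lipschitz2 g -> lipschitz2 (fun x y => f x y * g x y).
Proof.
move=> [M M0 hf] [N N0 hg]; exists (M * N + 2 * M * N); first by rewrite addr_ge0 ?mulr_ge0.
move=> x y x' y' hx hy hx' hy'.
have [f1 f2] := hf x y x' y' hx hy hx' hy'; have [g1 g2] := hg x y x' y' hx hy hx' hy'.
have [f1' _] := hf x' y' x' y' hx' hy' hx' hy'.
have Mf := normc_ge0 (f x y); have Mg := normc_ge0 (g x y); have Mf' := normc_ge0 (f x' y').
have d0 : 0 <= normc (x - x') + normc (y - y') by rewrite addr_ge0 ?normc_ge0.
split; first by rewrite normcM; apply: le_trans (ler_pM _ _ f1 g1) _ => //; rewrite lerDl !mulr_ge0.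
have -> : f x y * g x y - f x' y' * g x' y' =
  (f x y - f x' y') * g x y + f x' y' * (g x y - g x' y') by ring.
apply: le_trans (ler_normcD _ _) _; rewrite !normcM.
apply: le_trans (lerD (ler_pM (normc_ge0 _) Mg f2 g1) (ler_pM Mf' (normc_ge0 _) f1' g2)) _.
have MN : 0 <= M * N by rewrite mulr_ge0.
by move: d0 MN; set d := _ + _; nra.
Qed.

Lemma lipschitz2_sum n (F : nat -> C -> C -> C) :
  (forall k, lipschitz2 (F k)) -> lipschitz2 (fun x y => \sum_(k < n) F k x y).
Proof.
move=> hF; elim: n => [|n IH].
  have [M M0 h] := lipschitz2_cst 0; exists M => // x y x' y' hx hy hx' hy'.
  by rewrite !big_ord0; apply: h.
have [M M0 h] := lipschitz2D IH (hF n); exists M => // x y x' y' hx hy hx' hy'.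
by rewrite !big_ord_recr; apply: h.
Qed.

Lemma lipschitz2X f n : lipschitz2 f -> lipschitz2 (fun x y => f x y ^+ n).
Proof.
move=> hf; elim: n => [|n IH]; first exact: lipschitz2_cst.
have [M M0 h] := lipschitz2M hf IH; exists M => // x y x' y' hx hy hx' hy'.
by rewrite !exprS; apply: h.
Qed.

Lemma lipschitz2_poly (P : {poly {poly C}}) : lipschitz2 (fun x y => P.[x, y]).
Proof.
have [M M0 h] : lipschitz2 (fun x y => \sum_(i < size P) \sum_(j < size P`_i) P`_i`_j * (y ^+ j * x ^+ i)).
  apply: (@lipschitz2_sum _ ( fun i x y => \sum_(j < size P`_i) P`_i`_j * (y ^+ j * x ^+ i))) => i.
  apply: (@lipschitz2_sum _ ( fun j x y => P`_i`_j * (y ^+ j * x ^+ i))) => j.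
  apply: lipschitz2M; first exact: lipschitz2_cst.
  by apply: lipschitz2M; apply: lipschitz2X; [exact: lipschitz2_y | exact: lipschitz2_x].
have E x y : P.[x, y] = \sum_(i < size P) \sum_(j < size P`_i) P`_i`_j * (y ^+ j * x ^+ i).
  rewrite [P.[_]]horner_coef -[LHS]/(horner_eval y _) rmorph_sum; apply: eq_bigr => i _ /=.
  rewrite /horner_eval hornerM -polyC_exp hornerC horner_coef mulr_suml.
  by apply: eq_bigr => j _; rewrite mulrA.
exists M => // x y x' y' hx hy hx' hy'.
by rewrite !E; apply: h.
Qed.

End Lipschitz.

Section Core.
Variables (R : realType) (K : fieldType) (i : {rmorphism K -> R[i]%C}) (n : nat).
Local Notation C := R[i]%C.
Local Notation S := {poly {poly K}}.
Local Notation cst c := (c%:P%:P : S).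

Variables (z : nat -> 'I_n -> K) (s1 s2 : nat -> K) (x1 x2 : C) (q : R) (L : nat -> nat).

Definition box_value p (a : box n p -> K) (k : nat) : K :=
  \sum_t a t * ((s1 k ^+ t.2.1 * s2 k ^+ t.2.2) * \prod_l z k l ^+ t.1 l).

Hypotheses (q0 : 0 < q) (q1 : q < 1).
Hypothesis L_unbounded : forall M, exists k0, forall k, (k0 <= k)%N -> (M <= L k)%N.
Hypothesis z_small : forall k l, normc (i (z k l)) <= q ^+ L k.
Hypothesis expand1 : forall I, exists2 F : mpoly n K, mcoeff (@mnm0 n) F = 0 &
  exists M, forall k, normc (x1 - i (s1 k + meval (z k) F)) <= M * q ^+ (I * L k).
Hypothesis expand2 : forall I, exists2 F : mpoly n K, mcoeff (@mnm0 n) F = 0 &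
  exists M, forall k, normc (x2 - i (s2 k + meval (z k) F)) <= M * q ^+ (I * L k).
Hypothesis lower_bound : exists c : nat, forall p (a : box n p -> K),
  exists2 M, 0 < M & forall k, box_value a k != 0 ->
    M * q ^+ (c * p * L k) <= normc (i (box_value a k)).
Hypothesis nonvanishing : forall p (a : box n p -> K), (exists t, a t != 0) ->
  forall k0, exists2 k, (k0 <= k)%N & box_value a k != 0.

Let ev (k : nat) : {rmorphism S -> K} := horner_eval (s2 k) \o horner_eval ((s1 k)%:P).
Let EV (k : nat) (E : mpoly n S) : K := mmap (ev k) (z k) E.

Let EVD k E E' : EV k (E + E') = EV k E + EV k E'. Proof. exact: rmorphD. Qed.
Let EVM k E E' : EV k (E * E') = EV k E * EV k E'. Proof. exact: rmorphM. Qed.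
Let EVX k E h : EV k (E ^+ h) = EV k E ^+ h. Proof. exact: rmorphXn. Qed.
Let EV0 k : EV k 0 = 0. Proof. exact: raddf0. Qed.
Let EV_sum k (T : Type) (r : seq T) (P : pred T) (F : T -> mpoly n S) :
  EV k (\sum_(t <- r | P t) F t) = \sum_(t <- r | P t) EV k (F t).
Proof. exact: raddf_sum. Qed.
Let EVC k c : EV k (mpolyC n c) = c.[s1 k, s2 k].
Proof. by rewrite /EV mmapC /= /horner_eval. Qed.

Lemma EV_box p (a : box n p -> K) k : EV k (box_poly a) = box_value a k.
Proof.
rewrite EV_sum; apply: eq_bigr => t _.
rewrite !EVM !EVC /EV mmapX /=.
rewrite !hornerC !hornerM !hornerXn hornerC -polyC_exp hornerC hornerXn.
congr (_ * (_ * _)).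
by apply: eq_bigr => l _; rewrite mnm_ofE.
Qed.

Lemma EV_map k F : EV k (map_mpoly (polyC \o polyC) F) = meval (z k) F.
Proof.
elim/mpolyind: F => [|c m F _ _ IH]; first by rewrite !raddf0 EV0.
rewrite !raddfD /= EVD IH; congr (_ + _).
rewrite mevalZ mevalX map_mpolyZ map_mpolyX -mul_mpolyC EVM EVC /EV mmapX /=.
by rewrite !hornerC.
Qed.

(** The alternative [I = 0] lets the same estimate serve as a plain bound for polynomials that need
    not vanish. *)
Lemma supp_bound I (E : mpoly n S) : (I = 0%N \/ vanishes I E) ->
  (exists2 B, 0 <= B & forall k, normc (i (s1 k)) <= B /\ normc (i (s2 k)) <= B) ->
  exists2 M, 0 <= M & forall k, normc (i (EV k E)) <= M * q ^+ (I * L k).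
Proof.
move=> hI [B B0 sB].
have q01 k : 0 <= q ^+ k <= 1 by rewrite exprn_ge0 ?exprn_ile1 // ltW.
have evb c : exists2 M, 0 <= M & forall k, normc (i (ev k c)) <= M.
  have [M M0 hM] := lipschitz2_poly B0 (map_poly (map_poly i) c).
  exists M => // k; have [h1 h2] := sB k; have [h _] := hM _ _ _ _ h1 h2 h1 h2.
  by rewrite /= /horner_eval -!horner_map /= map_polyC.
have /choice[f hf] : forall m, exists y, 0 <= y /\ forall k, normc (i (ev k (mcoeff m E))) <= y.
  by move=> m; have [M M0 h] := evb (mcoeff m E); exists M.
exists (\sum_(m <- msupp E) f m); first by apply: sumr_ge0 => m _; case: (hf m).
move=> k; rewrite /= /mmap rmorph_sum mulr_suml.
apply: le_trans (ler_normc_sum _ _ _) _.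
rewrite big_seq_cond [leRHS]big_seq_cond; apply: ler_sum => m; rewrite andbT => mE.
rewrite rmorphM normcM ler_pM ?normc_ge0 //; first by case: (hf m).
rewrite /mmap1 rmorph_prod normc_prod.
have le1 l : 0 <= normc (i (z k l ^+ m l)) <= 1.
  rewrite normc_ge0 rmorphXn normcX exprn_ile1 ?normc_ge0 //.
  by apply: le_trans (z_small k l) _; case/andP: (q01 (L k)).
case: hI => [->|vE]; first by rewrite mul0n expr0; apply: prodr_ile1.
have [l Il] : exists l, (I <= m l)%N.
  apply: contrapT => /forallNP h; move: mE; rewrite mcoeff_msupp vE ?eqxx //.
  by move=> l; rewrite ltnNge; apply/negP/h.
rewrite (bigD1 l) //= -[leRHS]mulr1 ler_pM ?normc_ge0 //.
  by apply: prodr_ge0 => j _; apply: normc_ge0.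
  rewrite rmorphXn normcX mulnC exprM.
  apply: (@le_trans _ _ ((q ^+ L k) ^+ m l)).
    by rewrite lerXn2r ?nnegrE ?normc_ge0 //; case/andP: (q01 (L k)).
  by case/andP: (q01 (L k)) => ? ?; rewrite ler_wiXn2l.
by apply: prodr_ile1.
Qed.

Lemma values_bounded :
  exists2 B, 0 <= B & [/\ forall k, normc (i (s1 k)) <= B /\ normc (i (s2 k)) <= B,
     normc x1 <= B & normc x2 <= B].
Proof.
have q01 k : 0 <= q ^+ k <= 1 by rewrite exprn_ge0 ?exprn_ile1 // ltW.
have mb (F : mpoly n K) : exists2 M, 0 <= M & forall k, normc (i (meval (z k) F)) <= M.
  exists (\sum_(m <- msupp F) normc (i (mcoeff m F))); first by apply: sumr_ge0 => m _; apply: normc_ge0.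
  move=> k; rewrite mevalE rmorph_sum; apply: le_trans (ler_normc_sum _ _ _) _.
  apply: ler_sum => m _; rewrite rmorphM normcM ler_piMr ?normc_ge0 //.
  rewrite rmorph_prod normc_prod; apply: prodr_ile1 => l _.
  rewrite normc_ge0 rmorphXn normcX exprn_ile1 ?normc_ge0 //.
  by apply: le_trans (z_small k l) _; case/andP: (q01 (L k)).
have bd (s : nat -> K) x : (forall I, exists2 F : mpoly n K, mcoeff (@mnm0 n) F = 0 &
  exists M, forall k, normc (x - i (s k + meval (z k) F)) <= M * q ^+ (I * L k)) ->
  exists2 B, 0 <= B & (forall k, normc (i (s k)) <= B) /\ normc x <= B.
  move=> /(_ 0%N)[F _ [M hM]]; have [N N0 hN] := mb F.
  exists (normc x + `|M| + N); first by rewrite !addr_ge0 ?normc_ge0.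
  split=> [k|]; last by rewrite -addrA lerDl addr_ge0.
  have -> : i (s k) = x - (x - i (s k + meval (z k) F)) - i (meval (z k) F).
    by rewrite rmorphD /=; ring.
  apply: le_trans (ler_normcB _ _) _; rewrite lerD //.
  apply: le_trans (ler_normcB _ _) _; rewrite lerD //.
  by apply: le_trans (hM k) _; rewrite mul0n expr0 mulr1 ler_norm.
have [B1 B10 [h1 h1']] := bd _ _ expand1; have [B2 B20 [h2 h2']] := bd _ _ expand2.
exists (B1 + B2); first exact: addr_ge0.
have l1 u : u <= B1 -> u <= B1 + B2 by move=> h; apply: le_trans h _; rewrite lerDl.
have l2 u : u <= B2 -> u <= B1 + B2 by move=> h; apply: le_trans h _; rewrite lerDr.
by split; [move=> k; split|..]; auto.
Qed.

Lemma power_decay (M M' : R) : 0 < M -> exists k0, forall k, (k0 <= k)%N -> M' * q ^+ L k < M.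
Proof.
move=> M0; have [N hN] : exists N : nat, `|M'| * q ^+ N < M.
  have M1 : 0 < M / (`|M'| + 1) by rewrite divr_gt0 // ltr_wpDl.
  have [|N hN] := @expr_lt_eventually R q _ _ M1; first by rewrite ltW.
  exists N; have M'1 : 0 < `|M'| + 1 by rewrite ltr_wpDl.
  move: hN; rewrite ltr_pdivlMr // mulrC; apply: le_lt_trans.
  by rewrite ler_wpM2r ?exprn_ge0 ?lerDl // ltW.
have [k0 hk0] := L_unbounded N; exists k0 => k /hk0 NL.
apply: le_lt_trans hN; apply: (@le_trans _ _ (`|M'| * q ^+ L k)).
  by rewrite ler_wpM2r ?exprn_ge0 ?ler_norm // ltW.
by rewrite ler_wpM2l // ler_wiXn2l // ltW.
Qed.

(** A relation P gives Q = P (s1 + F1, s2 + F2), whose constant term is P itself and whose value at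
    step k is of order q^(I L_k), since P (x1, x2) = 0. Let h0 be the least index with A_h0 nonzero.
    The combination may be divided by Q^h0 because P is nonzero, and the terms with h > h0 still
    contain a power of Q. So the value of A_h0 is of order q^(I L_k), against the lower bound of
    order q^(c p L_k). *)
Lemma mahler_independence (P : {poly {poly K}}) : P != 0 ->
  (map_poly (map_poly i) P).[x1, x2] != 0.
Proof.
move=> P0; apply/eqP => Px0.
have [c hc] := lower_bound.
have [B B0 [sB x1B x2B]] := values_bounded.
have sB' : exists2 B, 0 <= B & forall k, normc (i (s1 k)) <= B /\ normc (i (s2 k)) <= B by exists B.
pose mx := \max_(j < size P) size (P`_j)%R.
pose d := (size P + mx).+1.
have d0 : (0 < d)%N by [].
have hPd : bideg d P.
  move=> a b; rewrite /d => /orP[] h.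
    by rewrite (nth_default 0 (_ : size P <= a)%N) ?coef0 //; move: h; lia.
  case: (ltnP a (size P)) => aP; last by rewrite (nth_default 0 aP) coef0.
  rewrite nth_default //.
  have h2 : (size (P`_a)%R <= mx)%N.
    exact: (leq_bigmax (F := fun j : 'I_(size P) => size (P`_j)%R) (Ordinal aP)).
  by apply: leq_trans h2 _; apply: leq_trans (ltnW h); rewrite leqW // leq_addl.
(* H, I and p are chosen so that the system is underdetermined with I >= (c + 1) p *)
pose H := (4 * c.+1 ^ n)%N; pose p := (d * H)%N; pose I := (c.+1 * p)%N.
have p0 : (0 < p)%N by rewrite !muln_gt0 d0 expn_gt0.
have count : (I ^ n * (p + H * d) ^ 2 < H.+1 * (p ^ n * p ^ 2))%N.
  have cnt pp : (0 < pp)%N -> ((c.+1 * pp) ^ n * (pp + pp) ^ 2 < H.+1 * (pp ^ n * pp ^ 2))%N.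
    move=> pp0; rewrite expnMn addnn -mul2n expnMn.
    rewrite (_ : _ ^ n * _ * _ = H * (pp ^ n * pp ^ 2))%N; last first.
      by rewrite /H; move: (c.+1 ^ n)%N (pp ^ n)%N (pp ^ 2)%N => u1 u2 u3; lia.
    by rewrite ltn_pmul2r // muln_gt0 !expn_gt0 pp0.
  by rewrite [(H * d)%N]mulnC; apply: cnt.
have [F1 F10 [M1 hM1]] := expand1 I; have [F2 F20 [M2 hM2]] := expand2 I.
pose f : {rmorphism K -> S} := polyC \o polyC.
pose U1 : mpoly n S := mpolyC n 'X + map_mpoly f F1.
pose U2 : mpoly n S := mpolyC n ('X)%:P + map_mpoly f F2.
pose Q : mpoly n S := \sum_(a < size P) \sum_(b < size P`_a) mpolyC n (f P`_a`_b) * (U1 ^+ a * U2 ^+ b).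
have EQ k : EV k Q = P.[s1 k + meval (z k) F1, s2 k + meval (z k) F2].
  rewrite EV_sum [P.[_]]horner_coef -[RHS]/(horner_eval (s2 k + meval (z k) F2) _) rmorph_sum.
  apply: eq_bigr => a _; rewrite EV_sum /= /horner_eval hornerM -polyC_exp hornerC horner_coef mulr_suml.
  apply: eq_bigr => b _.
  rewrite !EVM !EVX !EVD !EVC /f !EV_map !hornerE.
  exact: mulrAC.
have Q0 : mcoeff (@mnm0 n) Q = P.
  rewrite raddf_sum /= -[RHS]coefK poly_def; apply: eq_bigr => a _.
  rewrite raddf_sum /= -mul_polyC.
  have -> : (P`_a)%:P = \sum_(b < size P`_a) f P`_a`_b * 'X%:P ^+ b :> S.
    rewrite -[in LHS](coefK P`_a) poly_def rmorph_sum; apply: eq_bigr => b _.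
    by rewrite -mul_polyC rmorphM rmorphXn.
  rewrite mulr_suml; apply: eq_bigr => b _.
  rewrite !rmorphM !rmorphXn !rmorphD /= !mpolyCK !mcoeff_map_mpoly F10 F20 /= !polyC0 !addr0.
  by rewrite mulrA mulrAC.
have dF F : mbideg 1 (map_mpoly f F).
  by move=> m; rewrite mcoeff_map_mpoly; apply: bidegC.
have dQ : mbideg d Q.
  move=> m; rewrite raddf_sum; apply: bideg_sum => a _; rewrite raddf_sum; apply: bideg_sum => b _.
  apply: (@bidegW K (0 + (a * 1 + b * 1))).
    have ha : (size (P`_a)%R <= mx)%N := leq_bigmax (F := fun j : 'I_(size P) => size (P`_j)%R) a.
    rewrite add0n !muln1 /d leqW // leq_add //; first exact: ltnW (ltn_ord a).
    exact: leq_trans (ltnW (ltn_ord b)) ha.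
  apply: mbidegM; first by apply/mbidegC/bidegC.
  apply: mbidegM; apply: mbideg_exp; apply: mbidegD; rewrite //; apply: mbidegC.
    by have := @bideg_monom K 1 0 1 isT isT; rewrite expr0 expr1 polyC1 mulr1.
  by have := @bideg_monom K 0 1 1 isT isT; rewrite expr0 expr1 mul1r.
have [A [h1 [t1 A1]] vA] := auxiliary_polynomial dQ count.
have exh : exists h, [exists g : 'I_H.+1, (g == h :> nat) && [exists t, A g t != 0]].
  by exists h1; apply/existsP; exists h1; rewrite eqxx; apply/existsP; exists t1.
case: (ex_minnP exh) => _ /existsP[h0 /andP[/eqP <- /existsP[t0 A0]]] minh.
have Az (h : 'I_H.+1) : (h < h0)%N -> box_poly (A h) = 0.
  move=> hh0; rewrite /box_poly big1 // => t _.
  have -> : A h t = 0; last by rewrite !mul0r.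
  apply/eqP; apply: contraLR hh0 => Aht; rewrite -leqNgt; apply: minh.
  by apply/existsP; exists h; rewrite eqxx; apply/existsP; exists t.
pose E := \sum_(h < H.+1 | (h0 <= h)%N) box_poly (A h) * Q ^+ (h - h0).
have vE : vanishes I E.
  apply: (@vanishes_divX _ _ I Q E h0); first by rewrite Q0.
  move: vA; rewrite (bigID (fun h : 'I_H.+1 => (h0 <= h)%N)) /= [X in _ + X]big1 ?addr0; last first.
    by move=> h; rewrite -ltnNge => /Az ->; rewrite mul0r.
  rewrite /E mulr_sumr (eq_bigr (fun h : 'I_H.+1 => Q ^+ h0 * (box_poly (A h) * Q ^+ (h - h0)))) //.
  by move=> h h0h; rewrite mulrCA -exprD subnKC.
have [ME ME0 hE] := supp_bound (or_intror vE) sB'.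
have q01 k : 0 <= q ^+ k <= 1 by rewrite exprn_ge0 ?exprn_ile1 // ltW.
have [MQ MQ0 hQ] : exists2 M, 0 <= M & forall k, normc (i (EV k Q)) <= M * q ^+ (I * L k).
  pose B' := B + `|M1| + `|M2|.
  have B'0 : 0 <= B' by rewrite !addr_ge0.
  have [M M0 hM] := lipschitz2_poly B'0 (map_poly (map_poly i) P).
  exists (M * (`|M1| + `|M2|)); first by rewrite mulr_ge0 ?addr_ge0.
  move=> k; have e1 := hM1 k; have e2 := hM2 k.
  have b1 : normc (x1 - i (s1 k + meval (z k) F1)) <= `|M1| * q ^+ (I * L k).
    by apply: le_trans e1 _; rewrite ler_wpM2r ?ler_norm //; case/andP: (q01 (I * L k)%N).
  have b2 : normc (x2 - i (s2 k + meval (z k) F2)) <= `|M2| * q ^+ (I * L k).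
    by apply: le_trans e2 _; rewrite ler_wpM2r ?ler_norm //; case/andP: (q01 (I * L k)%N).
  have bB u x N : 0 <= N -> normc x <= B -> normc (x - u) <= N * q ^+ (I * L k) -> normc u <= B + N.
    move=> N0 xB xu; have -> : u = x - (x - u) by ring.
    apply: le_trans (ler_normcB _ _) _; rewrite lerD //; apply: le_trans xu _.
    by rewrite ler_piMr //; case/andP: (q01 (I * L k)%N).
  have [||||_ h] := hM (i (s1 k + meval (z k) F1)) (i (s2 k + meval (z k) F2)) x1 x2.
  - by apply: le_trans (bB _ _ _ _ x1B b1) _; rewrite // /B' lerDl.
  - by apply: le_trans (bB _ _ _ _ x2B b2) _; rewrite // /B' addrAC lerDl.
  - by apply: le_trans x1B _; rewrite /B' -addrA lerDl addr_ge0.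
  - by apply: le_trans x2B _; rewrite /B' -addrA lerDl addr_ge0.
  have -> : i (EV k Q) = (map_poly (map_poly i) P).[i (s1 k + meval (z k) F1), i (s2 k + meval (z k) F2)].
    by rewrite EQ -!horner_map /= map_polyC.
  move: h; rewrite Px0 subr0 => /le_trans; apply.
  by rewrite -mulrA ler_wpM2l // mulrDl lerD // normcBC.
have /choice[f0 hf0] : forall h : 'I_H.+1, exists y, 0 <= y /\ forall k, normc (i (EV k (box_poly (A h)))) <= y.
  move=> h; have [M M0 hM] := supp_bound (I := 0) (E := box_poly (A h)) (or_introl erefl) sB'.
  by exists M; split=> // k; have := hM k; rewrite mul0n expr0 mulr1.
pose Mt := ME + \sum_h f0 h * MQ ^+ (h - h0).
have key k : normc (i (box_value (A h0) k)) <= Mt * q ^+ (I * L k).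
  have -> : box_value (A h0) k = EV k E - \sum_(h < H.+1 | (h0 < h)%N) EV k (box_poly (A h)) * EV k Q ^+ (h - h0).
    rewrite /E (bigD1 h0) //= EVD EV_sum EVM EVX EV_box subnn expr0 mulr1.
    rewrite [X in _ + X - _](_ : _ = \sum_(h < H.+1 | (h0 < h)%N) EV k (box_poly (A h)) * EV k Q ^+ (h - h0)) ?addrK //.
    apply: eq_big => h; first by rewrite ltn_neqAle andbC eq_sym.
    by move=> _; rewrite EVM EVX.
  rewrite rmorphB; apply: le_trans (ler_normcB _ _) _; rewrite mulrDl lerD //.
  rewrite rmorph_sum; apply: le_trans (ler_normc_sum _ _ _) _.
  rewrite mulr_suml [leRHS](bigID (fun h : 'I_H.+1 => (h0 < h)%N)) /= -[leLHS]addr0.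
  have qI := q01 (I * L k)%N; case/andP: qI => qI0 qI1.
  apply: lerD; last first.
    apply: sumr_ge0 => h _; have [f1 _] := hf0 h.
    by apply: mulr_ge0 => //; apply: mulr_ge0 => //; apply: exprn_ge0.
  apply: ler_sum => h hh0; rewrite rmorphM rmorphXn normcM normcX -mulrA.
  rewrite ler_pM ?exprn_ge0 ?normc_ge0 //; first by case: (hf0 h).
  apply: (@le_trans _ _ ((MQ * q ^+ (I * L k)) ^+ (h - h0))).
    by rewrite lerXn2r ?nnegrE ?normc_ge0 // mulr_ge0.
  rewrite exprMn ler_wpM2l ?exprn_ge0 // -[leRHS]expr1 ler_wiXn2l //.
  by rewrite subn_gt0.
have [M0 M00 hM0] := hc _ (A h0).
have [k0 hk0] := power_decay Mt M00.
have [|k kk0 nz] := nonvanishing (a := A h0) _ k0; first by exists t0.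
have := le_trans (hM0 k nz) (key k).
have Mt0 : 0 <= Mt.
  rewrite addr_ge0 // sumr_ge0 // => h _; rewrite mulr_ge0 ?exprn_ge0 //.
  by case: (hf0 h).
(* After cancelling the lower bound a factor q^(p L_k) remains, which tends to 0 because p > 0. *)
have -> : (I * L k = p * L k + c * p * L k)%N by rewrite /I mulSn mulnDl.
rewrite exprD mulrA ler_pM2r ?exprn_gt0 //.
apply/negP; rewrite -ltNge; apply: le_lt_trans (hk0 k kk0).
rewrite ler_wpM2l // ler_wiXn2l ?(ltW q0) ?(ltW q1) //.
by rewrite leq_pmull.
Qed.

End Core.

(** * Expansions along a Pell recurrence *)

Section Exponents.
Variable t : nat.

(** Iterates from (1, 1) of the matrix with rows (1, t - 2) and (1, t - 1), which has determinant 1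
    and trace t, hence eigenvalues [lam] and [lam^-1]. *)
Fixpoint pq (k : nat) : nat * nat :=
  if k is k'.+1 then let: (p, q) := pq k' in (p + (t - 2) * q, p + (t - 1) * q)%N
  else (1, 1)%N.
Definition pexp k := (pq k).1.
Definition qexp k := (pq k).2.

Lemma pexpS k : pexp k.+1 = (pexp k + (t - 2) * qexp k)%N.
Proof. by rewrite /pexp /qexp /=; case: pq. Qed.

Lemma qexpS k : qexp k.+1 = (pexp k + (t - 1) * qexp k)%N.
Proof. by rewrite /pexp /qexp /=; case: pq. Qed.

Lemma pq_ge k : (2 < t)%N -> (k < pexp k)%N /\ (pexp k <= qexp k)%N.
Proof.
move=> t2; elim: k => [//|k [IH1 IH2]]; rewrite pexpS qexpS.
by split; nia.
Qed.

Variables (R : realType) (lam : R).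
Hypotheses (lam1 : 1 < lam) (lamt : lam ^+ 2 + 1 = t%:R * lam) (t2 : (2 < t)%N).

(** [wt] and [ell] are the expanding and the contracting coordinate of the exponent i P_k + j Q_k,
    as [pqE] shows. *)
Definition wt (i j : R) : R := i * (1 - lam^-1) + j.
Definition ell (i j : R) : R := i * (lam - 1) - j.

Let lam0 : 0 < lam. Proof. by apply: lt_trans lam1. Qed.
Let lamn0 : lam != 0. Proof. by rewrite gt_eqF. Qed.

Lemma trace_lam : t%:R = lam + lam^-1.
Proof. by apply: (mulIf lamn0); rewrite -lamt mulrDl mulVf // expr2. Qed.

Lemma pqE k (i j : R) : (lam - lam^-1) * (i * (pexp k)%:R + j * (qexp k)%:R) =
  wt i j * lam ^+ k.+1 + ell i j * lam^-1 ^+ k.+1.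
Proof.
elim: k i j => [|k IH] i j.
  rewrite /wt /ell !expr1 !mulr1; have := mulfV lamn0; move: (lam^-1) => u lu.
  by have -> : i = i * (lam * u) by [rewrite lu mulr1]; ring: lu.
have -> : i * (pexp k.+1)%:R + j * (qexp k.+1)%:R =
    (i + j) * (pexp k)%:R + (i * (t%:R - 2) + j * (t%:R - 1)) * (qexp k)%:R.
  rewrite pexpS qexpS !natrD !natrM !natrB; try by lia.
  by ring.
rewrite IH trace_lam /wt /ell !(exprS _ k.+1).
have := mulfV lamn0; move: (lam^-1) => u lu.
move: (lam ^+ k.+1) (u ^+ k.+1) => A B.
have e1 : (i + j) * (1 - u) + (i * (lam + u - 2) + j * (lam + u - 1)) = lam * (i * (1 - u) + j).
  by ring: lu.
have e2 : (i + j) * (lam - 1) - (i * (lam + u - 2) + j * (lam + u - 1)) = u * (i * (lam - 1) - j).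
  by ring: lu.
by rewrite e1 e2; ring.
Qed.

Lemma lamV_lt1 : 0 < lam^-1 < 1.
Proof. by rewrite invr_gt0 lam0 invf_lt1. Qed.

Lemma lamB_gt0 : 0 < lam - lam^-1.
Proof. by have := lamV_lt1; have := lam1; lra. Qed.

Lemma exponent_gap (i j : R) (m : nat) : 0 < wt i j ->
  exists N, forall k, (N <= k)%N -> m%:R <= i * (pexp k)%:R + j * (qexp k)%:R.
Proof.
move=> w0; pose b := m%:R * (lam - lam^-1) + `|ell i j|.
have [u0 u1] := andP lamV_lt1.
have b0 : 0 < b + 1.
  by rewrite ltr_wpDl // addr_ge0 // mulr_ge0 // ltW // lamB_gt0.
have [|N hN] := @expr_lt_eventually R lam^-1 (wt i j / (b + 1)) _ (divr_gt0 w0 b0).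
  by rewrite (ltW u0).
exists N => k Nk; rewrite -(ler_pM2l lamB_gt0) pqE.
have lk : 0 < lam ^+ k.+1 by rewrite exprn_gt0.
have uk : lam^-1 ^+ k.+1 <= lam^-1 ^+ N.
  by rewrite ler_wiXn2l ?(ltW u0) ?(ltW u1) // leqW.
have uk0 : 0 < lam^-1 ^+ k.+1 by rewrite exprn_gt0.
have ul : lam^-1 ^+ k.+1 * lam ^+ k.+1 = 1 by rewrite -exprMn mulVf // expr1n.
have wb : b + 1 < wt i j * lam ^+ k.+1.
  move: hN; rewrite ltr_pdivlMr // => hN.
  have h : lam^-1 ^+ k.+1 * (b + 1) < wt i j.
    by apply: le_lt_trans hN; rewrite ler_wpM2r // ltW.
  have := h; rewrite -(ltr_pM2r lk) mulrAC ul mul1r //.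
have h1 : lam^-1 ^+ k.+1 <= 1 by rewrite exprn_ile1 // ltW.
have h2 : - `|ell i j| <= ell i j * lam^-1 ^+ k.+1.
  have := normr_ge0 (ell i j); have := ler_normr (ell i j) `|ell i j|.
  have : - `|ell i j| <= ell i j by rewrite lerNnormlW.
  nra.
by move: wb h2; rewrite /b; lra.
Qed.

(** The growth is exponential, but k^2 is all that is kept: it makes q^(k k) smaller than every
    geometric sequence, as error terms require. *)
Lemma exponent_growth (i j : R) : 0 < wt i j ->
  exists N, forall k, (N <= k)%N -> (k * k)%:R <= i * (pexp k)%:R + j * (qexp k)%:R.
Proof.
move=> w0; have [u0 u1] := andP lamV_lt1.
have v0 : 0 < 1 - lam^-1 by lra.
(* Replacing i by i - c halves the weight, which stays positive; the exponent is then eventually at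
   least c P_k. *)
pose c := wt i j / 2 / (1 - lam^-1).
have c0 : 0 < c by rewrite !divr_gt0.
have [|N hN] := @exponent_gap (i - c) j 0.
  have -> : wt (i - c) j = wt i j - c * (1 - lam^-1) by rewrite /wt; ring.
  by rewrite /c divfK ?gt_eqF //; lra.
pose d := (Num.truncn c^-1).+1.
have dc : 1 <= d%:R * c by rewrite -ler_pdivrMr // div1r ltW // truncnS_gt.
have pow2 k : (2 ^ k <= pexp k)%N.
  elim: k => // k IH; rewrite pexpS expnS; have [_] := pq_ge k t2.
  by case: t t2 => [|[|[|t']]] // _; rewrite !subSS subn0; nia.
have pow3 k : (10 <= k -> k * k * k <= 2 ^ k)%N.
  elim: k => // k IH; rewrite leq_eqVlt => /orP[/eqP <- //|]; rewrite ltnS => h; rewrite expnS.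
  by have := IH h; nia.
exists (N + d + 10)%N => k hk; have Nk : (N <= k)%N by clear -hk; lia.
have := hN k Nk; rewrite mulrBl => h.
apply: (@le_trans _ _ (c * (pexp k)%:R)); last by lra.
apply: (@le_trans _ _ (c * (d * (k * k))%N%:R)).
  by rewrite [(d * _)%:R]natrM mulrA [c * _]mulrC ler_peMl.
rewrite ler_pM2l // ler_nat; apply: leq_trans (pow2 k).
have k10 : (10 <= k)%N by clear -hk; lia.
by apply: leq_trans (pow3 k k10); rewrite -[(k * k * k)%N]mulnA leq_mul //; clear -hk; lia.
Qed.

Lemma monomial_decay (i j i' j' : nat) : wt i%:R j%:R < wt i'%:R j'%:R ->
  exists N, forall k, (N <= k)%N ->
    (i * pexp k + j * qexp k + k * k <= i' * pexp k + j' * qexp k)%N.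
Proof.
move=> lt; have [|N hN] := @exponent_growth (i'%:R - i%:R) (j'%:R - j%:R).
  by move: lt; rewrite /wt; lra.
exists N => k /hN; rewrite -(ler_nat R) !natrD !natrM; lra.
Qed.

End Exponents.

Section Expansions.
Variables (R : realType) (t : nat) (lam : R).
Hypotheses (lam1 : 1 < lam) (lamt : lam ^+ 2 + 1 = t%:R * lam) (t2 : (2 < t)%N).
Hypothesis wt_inj : forall i j i' j' : nat,
  wt lam i%:R j%:R = wt lam i'%:R j'%:R -> i = i' /\ j = j'.
Local Notation C := R[i]%C.
Variable g : C.
Hypotheses (g0 : 0 < normc g) (g1 : normc g < 1).
Local Notation P := (pexp t).
Local Notation Q := (qexp t).
Local Notation q := (normc g).

Definition zx k : C := g ^+ P k.
Definition zy k : C := g ^+ Q k.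
Definition zeval (p : {poly {poly C}}) k : C := p.[zx k, zy k].

Lemma zevalE p k : zeval p k = \sum_(i < size p) \sum_(j < size p`_i) p`_i`_j * (zx k ^+ i * zy k ^+ j).
Proof.
rewrite /zeval [p.[_]]horner_coef -[LHS]/(horner_eval (zy k) _) rmorph_sum.
apply: eq_bigr => i _ /=.
rewrite /horner_eval hornerM -polyC_exp hornerC horner_coef mulr_suml.
by apply: eq_bigr => j _; rewrite mulrAC mulrA.
Qed.

Lemma zevalD p p' k : zeval (p + p') k = zeval p k + zeval p' k.
Proof. by rewrite /zeval !hornerD. Qed.

Lemma zevalN p k : zeval (- p) k = - zeval p k.
Proof. by rewrite /zeval !hornerN. Qed.

Lemma zevalM p p' k : zeval (p * p') k = zeval p k * zeval p' k.
Proof. by rewrite /zeval !hornerM. Qed.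

Lemma zevalC c k : zeval c%:P%:P k = c.
Proof. by rewrite /zeval !hornerC. Qed.

Lemma zeval_monom i j k : zeval ('X^i * ('X^j)%:P) k = zx k ^+ i * zy k ^+ j.
Proof. by rewrite /zeval hornerM hornerXn hornerC hornerM hornerXn -polyC_exp hornerC. Qed.

Lemma normc_monom i j k : normc (zx k ^+ i * zy k ^+ j) = q ^+ (i * P k + j * Q k).
Proof. by rewrite normcM !normcX -!exprM -exprD mulnC [(Q k * _)%N]mulnC. Qed.

Lemma q01 n : 0 < q ^+ n <= 1.
Proof. by rewrite exprn_gt0 // exprn_ile1 ?ltW. Qed.

Lemma ler_q m n : (m <= n)%N -> q ^+ n <= q ^+ m.
Proof. by move=> mn; rewrite ler_wiXn2l // ltW. Qed.

Lemma monom_small I i j k : (I <= i)%N || (I <= j)%N -> q ^+ (i * P k + j * Q k) <= q ^+ (I * P k).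
Proof.
move=> h; apply: ler_q; have [_ PQ] := pq_ge k t2.
by case/orP: h => h; nia.
Qed.

Lemma zeval_bounded p : exists2 M, 0 <= M & forall k, normc (zeval p k) <= M.
Proof.
exists (\sum_(i < size p) \sum_(j < size p`_i) normc p`_i`_j).
  by apply: sumr_ge0 => i _; apply: sumr_ge0 => j _; apply: normc_ge0.
move=> k; rewrite zevalE; apply: le_trans (ler_normc_sum _ _ _) _.
apply: ler_sum => i _; apply: le_trans (ler_normc_sum _ _ _) _.
apply: ler_sum => j _; rewrite normcM normc_monom ler_piMr ?normc_ge0 //.
by case/andP: (q01 (i * P k + j * Q k)%N).
Qed.

(* [f] is the array of Taylor coefficients, to all orders, of [c] along the orbit. *)
Definition expands (c : nat -> C) (f : nat -> nat -> C) : Prop :=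
  forall I, exists p : {poly {poly C}}, exists2 M,
    (forall i j, (i < I)%N -> (j < I)%N -> p`_i`_j = f i j) &
    forall k, normc (c k - zeval p k) <= M * q ^+ (I * P k).

(** A sequence with an expansion is flat exactly when all its coefficients vanish: see
    [expands_flat] and [flat_expands0]. *)
Definition flat (c : nat -> C) : Prop :=
  forall I, exists M, forall k, normc (c k) <= M * q ^+ (I * P k).

Lemma expands_bounded c f : expands c f -> exists2 M, 0 <= M & forall k, normc (c k) <= M.
Proof.
move=> /(_ 0%N)[p [M _ hM]]; have [B B0 hB] := zeval_bounded p.
exists (`|M| + B); first by rewrite addr_ge0.
move=> k; rewrite -[c k](subrK (zeval p k)); apply: le_trans (ler_normcD _ _) _.
by rewrite lerD //; apply: le_trans (hM k) _; rewrite mul0n expr0 mulr1 ler_norm.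
Qed.

Lemma expands_poly p : expands (zeval p) (fun i j => p`_i`_j).
Proof.
move=> I; exists p; exists 0 => // k.
by rewrite subrr normc0 mul0r.
Qed.

Lemma expands_eq c c' f : c =1 c' -> expands c f -> expands c' f.
Proof. by move=> e h I; have [p [M h1 h2]] := h I; exists p; exists M => // k; rewrite -e. Qed.

Lemma expandsD c c' f f' : expands c f -> expands c' f' ->
  expands (fun k => c k + c' k) (fun i j => f i j + f' i j).
Proof.
move=> h h' I; have [p [M h1 h2]] := h I; have [p' [M' h1' h2']] := h' I.
exists (p + p'); exists (M + M') => [i j iI jI|k]; first by rewrite !coefD h1 // h1'.
rewrite zevalD opprD addrACA mulrDl; apply: le_trans (ler_normcD _ _) _.
exact: lerD.
Qed.

Lemma expandsM c c' f f' : expands c f -> expands c' f' ->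
  expands (fun k => c k * c' k)
    (fun i j => \sum_(a < i.+1) \sum_(b < j.+1) f a b * f' (i - a)%N (j - b)%N).
Proof.
move=> h h' I; have [p [M h1 h2]] := h I; have [p' [M' h1' h2']] := h' I.
have [B B0 hB] := expands_bounded h; have [B' B'0 hB'] := zeval_bounded p'.
exists (p * p'); exists (`|M| * B' + B * `|M'|) => [i j iI jI|k].
  rewrite coefM coef_sum; apply: eq_bigr => a _; rewrite coefM.
  apply: eq_bigr => b _; rewrite h1 ?h1' //.
  - exact: leq_ltn_trans (leq_subr _ _) iI.
  - exact: leq_ltn_trans (leq_subr _ _) jI.
  - by apply: leq_ltn_trans iI; rewrite -ltnS.
  - by apply: leq_ltn_trans jI; rewrite -ltnS.
have -> : c k * c' k - zeval (p * p') k =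
    (c k - zeval p k) * zeval p' k + c k * (c' k - zeval p' k).
  by rewrite zevalM; ring.
have [q0 _] := andP (q01 (I * P k)).
rewrite [leRHS]mulrDl; apply: le_trans (ler_normcD _ _) _; rewrite !normcM lerD //.
  rewrite mulrAC ler_pM ?normc_ge0 //; apply: le_trans (h2 k) _.
  by rewrite ler_wpM2r ?ler_norm // ltW.
rewrite -mulrA ler_pM ?normc_ge0 //; apply: le_trans (h2' k) _.
by rewrite ler_wpM2r ?ler_norm // ltW.
Qed.

Lemma expands_cst c : expands (fun=> c) (fun i j => if (i == 0%N) && (j == 0%N) then c else 0).
Proof.
move=> I; have [p [M h1 h2]] := expands_poly c%:P%:P I.
exists p; exists M => [i j iI jI|k]; last by rewrite -(zevalC c k).
by rewrite h1 // coefC; case: eqP => _; rewrite ?coef0 // coefC; case: eqP.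
Qed.

Lemma expands_flat c f : expands c f -> (forall i j, f i j = 0) -> flat c.
Proof.
move=> h f0 I; have [p [M h1 h2]] := h I.
exists (`|M| + \sum_(i < size p) \sum_(j < size p`_i) normc p`_i`_j) => k.
have [q0 _] := andP (q01 (I * P k)).
rewrite -[c k](subrK (zeval p k)) mulrDl; apply: le_trans (ler_normcD _ _) _.
rewrite lerD //; first by apply: le_trans (h2 k) _; rewrite ler_wpM2r ?ler_norm // ltW.
rewrite zevalE mulr_suml; apply: le_trans (ler_normc_sum _ _ _) _.
apply: ler_sum => i _; rewrite mulr_suml; apply: le_trans (ler_normc_sum _ _ _) _.
apply: ler_sum => j _; rewrite normcM normc_monom.
case: (ltnP i I) => [iI|Ii]; last by rewrite ler_wpM2l ?normc_ge0 // monom_small // Ii.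
case: (ltnP j I) => [jI|Ij]; last by rewrite ler_wpM2l ?normc_ge0 // monom_small // Ij orbT.
by rewrite h1 // f0 normc0 !mul0r.
Qed.

(* The irrational weight separates the monomials, so the lightest one dominates. *)
Lemma expands_leading_term c f i0 j0 : expands c f -> f i0 j0 != 0 ->
  exists i j S N, [/\ f i j != 0, 0 <= S & forall k, (N <= k)%N ->
    normc (c k - f i j * (zx k ^+ i * zy k ^+ j)) <= S * q ^+ (i * P k + j * Q k + k * k)].
Proof.
move=> hc f0.
have u1 : 0 < 1 - lam^-1 by have := lamV_lt1 lam1; lra.
pose w0 := wt lam i0%:R j0%:R.
(* Every monomial outside the square of side I is heavier than (i0, j0). The lightest monomial of p
   therefore lies inside, where p agrees with f. *)
have [I [I0 J0 Iw]] : exists I, [/\ (i0 < I)%N, (j0 < I)%N & w0 < I%:R * (1 - lam^-1) /\ w0 < I%:R].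
  pose I := (maxn (maxn i0 j0) (Num.truncn (w0 / (1 - lam^-1)) + Num.truncn w0)).+1.
  exists I; split; rewrite ?ltnS ?leq_max ?leqnn ?orbT //.
  split.
    rewrite -ltr_pdivrMr //; apply: lt_le_trans (truncnS_gt _) _.
    by rewrite ler_nat ltnS leq_max leq_addr orbT.
  apply: lt_le_trans (truncnS_gt _) _.
  by rewrite ler_nat ltnS leq_max leq_addl orbT.
have [p [M h1 h2]] := hc I.
pose B := (I + size p + \max_(a < size p) size (p`_a)%R)%N.
pose T : finType := ('I_B * 'I_B)%type.
pose w (v : T) := wt lam (v.1)%:R (v.2)%:R.
have i0B : (i0 < B)%N by rewrite /B -addnA ltn_addr.
have j0B : (j0 < B)%N by rewrite /B -addnA ltn_addr.
have pv0 : p`_(Ordinal i0B, Ordinal j0B).1`_(Ordinal i0B, Ordinal j0B).2 != 0 by rewrite /= h1.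
have [[i j] /= pij minij] := @arg_minP _ R T (Ordinal i0B, Ordinal j0B) (fun v => p`_(v.1)`_(v.2) != 0) w pv0.
have wle : w (i, j) <= w0 by have := minij _ pv0.
have wI a b : (I <= a)%N || (I <= b)%N -> w0 < wt lam a%:R b%:R.
  case: Iw => Iw1 Iw2 /orP[h|h]; rewrite /wt.
    apply: lt_le_trans Iw1 _; apply: (@le_trans _ _ (a%:R * (1 - lam^-1))); last by rewrite lerDl.
    by rewrite ler_pM2r // ler_nat.
  apply: lt_le_trans Iw2 _; apply: (@le_trans _ _ b%:R); first by rewrite ler_nat.
  by rewrite lerDr mulr_ge0 // ltW.
have iI : (i < I)%N.
  by rewrite ltnNge; apply/negP => h; have := wI i j; rewrite h => /(_ isT); rewrite ltNge => /negP; apply.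
have jI : (j < I)%N.
  by rewrite ltnNge; apply/negP => h; have := wI i j; rewrite h orbT => /(_ isT); rewrite ltNge => /negP; apply.
have fij : p`_i`_j = f i j by rewrite h1.
pose S := \sum_(v : T) normc p`_(v.1)`_(v.2) + `|M|.
have S0 : 0 <= S by rewrite addr_ge0 // sumr_ge0 // => v _; apply: normc_ge0.
have n0 : 0 < normc (f i j) by rewrite normc_gt0 -fij.
have gap (v : T) : exists N, forall k, (N <= k)%N -> p`_(v.1)`_(v.2) != 0 -> v != (i, j) ->
    (i * P k + j * Q k + k * k <= v.1 * P k + v.2 * Q k)%N.
  case: (eqVneq p`_(v.1)`_(v.2) 0) => [pv|pv]; first by exists 0%N.
  case: (eqVneq v (i, j)) => [|vij]; first by exists 0%N.
  have ltw : wt lam i%:R j%:R < wt lam v.1%:R v.2%:R.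
    rewrite lt_neqAle; apply/andP; split; last exact: (minij v pv).
    apply: contra vij => /eqP /wt_inj[e1 e2].
    by case: v e1 e2 {pv} => v1 v2 /= e1 e2; apply/eqP; congr (_, _); apply: val_inj.
  by have [N hN] := monomial_decay lam1 lamt t2 ltw; exists N => k /hN.
have [N1 hN1] : exists N, forall (v : T) k, (N <= k)%N -> p`_(v.1)`_(v.2) != 0 -> v != (i, j) ->
    (i * P k + j * Q k + k * k <= v.1 * P k + v.2 * Q k)%N.
  have [N hN] := fin_all_exists gap; exists (\max_v N v) => v k Nk.
  by apply: hN; apply: leq_trans Nk; apply: leq_bigmax.
have [N2 hN2] : exists N, forall k, (N <= k)%N -> (i * P k + j * Q k + k * k <= I * P k)%N.
  have [|N hN] := monomial_decay (i' := I) (j' := 0) lam1 lamt t2 (_ : wt lam i%:R j%:R < _).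
    by apply: le_lt_trans wle _; apply: wI; rewrite leqnn.
  by exists N => k /hN; rewrite mul0n addn0.
exists i, j, S, (maxn N1 N2); split; rewrite -?fij // => k; rewrite fij; rewrite geq_max => /andP[k1 k2].
have pE : zeval p k = \sum_(v : T) p`_(v.1)`_(v.2) * (zx k ^+ v.1 * zy k ^+ v.2).
  rewrite zevalE -(pair_bigA _ (fun a b : 'I_B => p`_a`_b * (zx k ^+ a * zy k ^+ b))) /=.
  have sB : (size p <= B)%N by rewrite /B addnAC leq_addl.
  rewrite (big_ord_widen _ (fun a => \sum_(b < size p`_a) p`_a`_b * (zx k ^+ a * zy k ^+ b)) sB).
  rewrite [RHS](bigID (fun a : 'I_B => (a < size p)%N)) /= [X in _ + X]big1 ?addr0; last first.
    by move=> a; rewrite -leqNgt => h; rewrite big1 // => b _; rewrite (nth_default 0 h) coef0 mul0r.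
  apply: eq_bigr => a ap.
  have saB : (size (p`_a)%R <= B)%N.
    apply: leq_trans (leq_addl _ _); exact: (leq_bigmax (F := fun a : 'I_(size p) => size (p`_a)%R) (Ordinal ap)).
  rewrite (big_ord_widen _ (fun b => p`_a`_b * (zx k ^+ a * zy k ^+ b)) saB).
  rewrite [RHS](bigID (fun b : 'I_B => (b < size (p`_a)%R)%N)) /= [X in _ + X]big1 ?addr0 //.
  by move=> b; rewrite -leqNgt => h; rewrite (nth_default 0 h) mul0r.
pose e := (i * P k + j * Q k)%N.
pose U := \sum_(v : T | v != (i, j)) p`_(v.1)`_(v.2) * (zx k ^+ v.1 * zy k ^+ v.2).
have -> : c k - f i j * (zx k ^+ i * zy k ^+ j) = U + (c k - zeval p k).
  by rewrite pE (bigD1 (i, j)) //= fij -/U; ring.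
apply: le_trans (ler_normcD _ _) _; rewrite /S mulrDl lerD //; last first.
  apply: le_trans (h2 k) _; apply: (@le_trans _ _ (`|M| * q ^+ (I * P k))).
    by rewrite ler_wpM2r ?ler_norm // exprn_ge0 // ltW.
  by rewrite ler_wpM2l // ler_q //; apply: hN2.
apply: le_trans (ler_normc_sum _ _ _) _; rewrite mulr_suml [leRHS](bigD1 (i, j)) //=.
rewrite -[leLHS]add0r lerD ?mulr_ge0 ?normc_ge0 ?exprn_ge0 ?(ltW g0) //.
apply: ler_sum => v vij; rewrite normcM normc_monom.
case: (eqVneq p`_(v.1)`_(v.2) 0) => [->|pv]; first by rewrite normc0 !mul0r.
by rewrite ler_wpM2l ?normc_ge0 // ler_q //; apply: hN1.
Qed.

Lemma expands_leading c f i0 j0 : expands c f -> f i0 j0 != 0 ->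
  exists i j N, f i j != 0 /\
    forall k, (N <= k)%N -> normc (f i j) / 2 * q ^+ (i * P k + j * Q k) <= normc (c k).
Proof.
move=> hc f0; have [i [j [S [N [fij S0 rest]]]]] := expands_leading_term hc f0.
have n0 : 0 < normc (f i j) by rewrite normc_gt0.
have S1 : 0 < normc (f i j) / 2 / (S + 1) by rewrite !divr_gt0 // ltr_wpDl.
have [|m hm] := expr_lt_eventually (q := q) _ S1; first by rewrite ltW.
exists i, j, (maxn N m.+1); split=> // k; rewrite geq_max => /andP[/rest {}rest mk].
pose e := (i * P k + j * Q k)%N.
have rest2 : S * q ^+ (e + k * k) <= normc (f i j) / 2 * q ^+ e.
  apply: (@le_trans _ _ (S * q ^+ (e + m))); first by rewrite ler_wpM2l // ler_q // leq_add2l; nia.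
  rewrite exprD mulrCA mulrC ler_pM2r ?exprn_gt0 //.
  move: hm; rewrite ltr_pdivlMr ?ltr_wpDl // => hm; apply: le_trans (ltW hm).
  by rewrite mulrC ler_wpM2l ?lerDl // exprn_ge0 // ltW.
have := lerB_normcD (f i j * (zx k ^+ i * zy k ^+ j)) (c k - f i j * (zx k ^+ i * zy k ^+ j)).
rewrite [f i j * _ + (_ - _)]addrC subrK normcM normc_monom -/e.
move: rest rest2; rewrite -/e; set u := q ^+ e; set A := normc (c k - _); set V := S * _; move: u A V => u A V; lra.
Qed.

Lemma large_weight (w : R) : exists I : nat, w < wt lam I%:R 0.
Proof.
have u1 : 0 < 1 - lam^-1 by have := lamV_lt1 lam1; lra.
exists (Num.truncn (w / (1 - lam^-1))).+1.
by rewrite /wt addr0 -ltr_pdivrMr // truncnS_gt.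
Qed.

(** A nonzero coefficient would yield a leading monomial, and with it a lower bound by a fixed power
    of the scale. *)
Lemma flat_expands0 c f : flat c -> expands c f -> forall i j, f i j = 0.
Proof.
move=> fc hc i0 j0; apply/eqP/negP => /negP f0.
have [i [j [N [fij hN]]]] := expands_leading hc f0.
have [I ltI] := large_weight (wt lam i%:R j%:R).
have [M hM] := fc I.
have n0 : 0 < normc (f i j) / 2 by rewrite divr_gt0 // normc_gt0.
have M0 : 0 < normc (f i j) / 2 / (`|M| + 1) by rewrite divr_gt0 // ltr_wpDl.
have [|m hm] := expr_lt_eventually (q := q) _ M0; first by rewrite ltW.
have [N' hN'] := monomial_decay (j' := 0) lam1 lamt t2 ltI.
pose k := maxn (maxn N N') m.+1.
have k1 : (N <= k)%N by rewrite /k !leq_max leqnn.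
have k2 : (N' <= k)%N by rewrite /k !leq_max leqnn orbT.
have k3 : (m <= k * k)%N by apply: leq_trans (leq_pmulr _ _); rewrite /k !leq_max ?leqnSn ?orbT.
have {}k1 := hN _ k1; have {}k2 : (i * P k + j * Q k + m <= I * P k)%N.
  by apply: leq_trans (leq_trans _ (hN' _ k2)) _; rewrite ?leq_add2l // mul0n addn0.
have := le_trans k1 (hM k); apply/negP; rewrite -ltNge.
apply: (@le_lt_trans _ _ (`|M| * q ^+ (i * P k + j * Q k + m))).
  apply: (@le_trans _ _ (`|M| * q ^+ (I * P k))).
    by rewrite ler_wpM2r ?ler_norm // exprn_ge0 // ltW.
  by rewrite ler_wpM2l // ler_q.
rewrite exprD mulrCA mulrC ltr_pM2r ?exprn_gt0 //.
move: hm; rewrite ltr_pdivlMr ?ltr_wpDl //; apply: le_lt_trans.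
by rewrite mulrC ler_wpM2l ?lerDl // exprn_ge0 // ltW.
Qed.

Lemma expands_neq0 c f i0 j0 : expands c f -> f i0 j0 != 0 ->
  exists N, forall k, (N <= k)%N -> c k != 0.
Proof.
move=> hc f0; have [i [j [N [fij hN]]]] := expands_leading hc f0.
exists N => k /hN h; rewrite -normc_gt0; apply: lt_le_trans h.
by rewrite mulr_gt0 ?divr_gt0 ?exprn_gt0 // normc_gt0.
Qed.

Lemma poly2_neq0 (p : {poly {poly C}}) : p != 0 -> exists i j, p`_i`_j != 0.
Proof.
move=> p0; exists (size p).-1, (size (lead_coef p)).-1.
by rewrite -[p`_(size p).-1]/(lead_coef p) -lead_coefE lead_coef_eq0 lead_coef_eq0.
Qed.

Lemma zeval_neq0 (p : {poly {poly C}}) : p != 0 ->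
  exists N, forall k, (N <= k)%N -> zeval p k != 0.
Proof. by move=> /poly2_neq0[i [j pij]]; apply: expands_neq0 (expands_poly p) pij. Qed.

Lemma zeval_flat (p : {poly {poly C}}) : flat (zeval p) -> p = 0.
Proof.
move=> fp; apply/eqP/negP => /negP /poly2_neq0[i [j]].
by rewrite (flat_expands0 fp (expands_poly p)) eqxx.
Qed.

Lemma eventually0_flat c N : (forall k, (N <= k)%N -> c k = 0) -> flat c.
Proof.
move=> h I; exists (\sum_(k < N) normc (c k) / q ^+ (I * P k)) => k.
have q0 k' : 0 < q ^+ (I * P k') by rewrite exprn_gt0.
have [Nk|kN] := leqP N k.
  rewrite h // normc0 mulr_ge0 ?(ltW (q0 _)) //; apply: sumr_ge0 => k' _.
  by rewrite divr_ge0 ?normc_ge0 // ltW.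
rewrite -ler_pdivrMr // (bigD1 (Ordinal kN)) //= lerDl.
by apply: sumr_ge0 => k' _; rewrite divr_ge0 ?normc_ge0 // ltW.
Qed.

Lemma flatD c c' : flat c -> flat c' -> flat (fun k => c k + c' k).
Proof.
move=> h h' I; have [M hM] := h I; have [M' hM'] := h' I.
by exists (M + M') => k; rewrite mulrDl; apply: le_trans (ler_normcD _ _) _; rewrite lerD.
Qed.

Lemma flat_eq c c' : c =1 c' -> flat c -> flat c'.
Proof. by move=> e h I; have [M hM] := h I; exists M => k; rewrite -e. Qed.

Lemma flat_ev c c' N : (forall k, (N <= k)%N -> c k = c' k) -> flat c -> flat c'.
Proof.
move=> e h; have d : flat (fun k => c' k - c k).
  by apply: (@eventually0_flat _ N) => k Nk; rewrite e // subrr.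
by apply: flat_eq (flatD d h) => k; rewrite subrK.
Qed.

Lemma flatM_bounded c b B : (forall k, normc (b k) <= B) -> flat c -> flat (fun k => c k * b k).
Proof.
move=> hB h I; have [M hM] := h I; exists (`|M| * B) => k.
have B0 : 0 <= B by apply: le_trans (hB 0%N); apply: normc_ge0.
rewrite normcM mulrAC ler_pM ?normc_ge0 //; apply: le_trans (hM k) _.
by rewrite ler_wpM2r ?ler_norm // exprn_ge0 // ltW.
Qed.

Lemma flat_shift c : flat c -> flat (fun k => c k.+1).
Proof.
move=> h I; have [M hM] := h I; exists `|M| => k; apply: le_trans (hM k.+1) _.
apply: (@le_trans _ _ (`|M| * q ^+ (I * P k.+1))).
  by rewrite ler_wpM2r ?ler_norm // exprn_ge0 // ltW.
by rewrite ler_wpM2l // ler_q // leq_mul2l pexpS leq_addr orbT.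
Qed.

(* Dividing by a nonzero polynomial costs only a fixed power of the scale. *)
Lemma flat_div c (p : {poly {poly C}}) : p != 0 -> flat (fun k => c k * zeval p k) -> flat c.
Proof.
move=> /poly2_neq0[i0 [j0 p0]] h.
have [i [j [N [pij hN]]]] := expands_leading (expands_poly p) p0.
have [J ltJ] := large_weight (wt lam i%:R j%:R).
have [N' hN'] := monomial_decay (j' := 0) lam1 lamt t2 ltJ.
pose N1 := maxn N N'; pose c1 k := if (N1 <= k)%N then c k else 0.
apply: (@flat_ev c1 c N1) => [k hk|]; first by rewrite /c1 hk.
have n0 : 0 < normc p`_i`_j / 2 by rewrite divr_gt0 // normc_gt0.
move=> I; have [M hM] := h (I + J)%N; exists (`|M| / (normc p`_i`_j / 2)) => k.
rewrite /c1; case: ifP => [|_]; last first.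
  by rewrite normc0 mulr_ge0 ?exprn_ge0 ?(ltW g0) // divr_ge0 // ltW.
rewrite geq_max => /andP[k1 k2].
have l1 := hN k k1; have l2 : (i * P k + j * Q k <= J * P k)%N.
  by apply: leq_trans (leq_addr (k * k) _) _; apply: leq_trans (hN' k k2) _; rewrite mul0n addn0.
rewrite mulrAC ler_pdivlMr // -(ler_pM2r (_ : 0 < q ^+ (J * P k))) ?exprn_gt0 //.
rewrite -[leRHS]mulrA -exprD -mulnDl.
apply: (@le_trans _ _ (normc (c k * zeval p k))).
  rewrite normcM -mulrA ler_wpM2l ?normc_ge0 //; apply: le_trans l1.
  by rewrite ler_wpM2l ?ler_q // ltW.
apply: le_trans (hM k) _.
by rewrite ler_wpM2r ?ler_norm // exprn_ge0 // ltW.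
Qed.

(** The monomial substitution x -> x y^(t-2), y -> x y^(t-1), which realises one step along the
    orbit. *)
Definition zshift (p : {poly {poly C}}) : {poly {poly C}} :=
  \sum_(i < size p) \sum_(j < size p`_i)
    ((p`_i`_j)%:P)%:P * ('X^(i + j) * ('X^((t - 2) * i + (t - 1) * j))%:P).

Lemma zshiftE p k : zeval (zshift p) k = zeval p k.+1.
Proof.
have zevS (T : finType) (F : T -> {poly {poly C}}) : zeval (\sum_u F u) k = \sum_u zeval (F u) k.
  by elim/big_rec2: _ => [|u x y _ <-]; [rewrite /zeval !horner0 | rewrite zevalD].
rewrite [RHS]zevalE zevS; apply: eq_bigr => i _; rewrite zevS; apply: eq_bigr => j _.
rewrite zevalM zevalC zeval_monom /zx /zy; congr (_ * _).
rewrite -!exprM -!exprD pexpS qexpS; congr (_ ^+ _).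
by nia.
Qed.

End Expansions.

(** * Algebraic relations reduce to linear ones *)

Section Kubota.
Variable C : numFieldType.
Implicit Types c : nat -> C.

Definition ev0 c : Prop := exists k0, forall k, (k0 <= k)%N -> c k = 0.

Lemma ev0_sum (I : finType) (f : I -> nat -> C) :
  (forall i, ev0 (f i)) -> ev0 (fun k => \sum_i f i k).
Proof.
move=> h; have [N hN] := fin_all_exists h; exists (\max_i N i) => k hk.
rewrite big1 // => i _; apply: hN; apply: leq_trans hk; exact: leq_bigmax.
Qed.

Variable F : (nat -> C) -> Prop.
Hypothesis F_cst : forall x : C, F (fun=> x).
Hypothesis F_D : forall c c', F c -> F c' -> F (fun k => c k + c' k).
Hypothesis F_M : forall c c', F c -> F c' -> F (fun k => c k * c' k).
Hypothesis F_V : forall c, F c -> F (fun k => (c k)^-1).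
Hypothesis F_S : forall c, F c -> F (fun k => c k.+1).
Hypothesis F_ev : forall c c' k0, (forall k, (k0 <= k)%N -> c k = c' k) -> F c -> F c'.
Hypothesis F_dich : forall c, F c -> ev0 c \/ exists k0, forall k, (k0 <= k)%N -> c k != 0.
Variable Z : (nat -> C) -> Prop.
Hypothesis Z_ev : forall c c' k0, (forall k, (k0 <= k)%N -> c k = c' k) -> Z c -> Z c'.
Hypothesis Z_D : forall c c', Z c -> Z c' -> Z (fun k => c k + c' k).
Hypothesis Z_M : forall c b, F b -> Z c -> Z (fun k => c k * b k).
Hypothesis Z_S : forall c, Z c -> Z (fun k => c k.+1).
Hypothesis Z_F : forall c, F c -> Z c -> ev0 c.
Variables (s s' : nat -> C) (m : nat).
Hypothesis Fs : F (fun k => s k.+1 - s k).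
Hypothesis Fs' : F (fun k => s' k.+1 - s' k).

Let r k := s k.+1 - s k.
Let r' k := s' k.+1 - s' k.

Lemma F_N c : F c -> F (fun k => - c k).
Proof. by move=> h; apply: (F_ev (k0 := 0)) (F_M (F_cst (-1)) h) => // k _; rewrite mulN1r. Qed.

Lemma F_B c c' : F c -> F c' -> F (fun k => c k - c' k).
Proof. by move=> h h'; apply: F_D h (F_N h'). Qed.

Lemma F_X c n : F c -> F (fun k => c k ^+ n).
Proof.
move=> h; elim: n => [|n IH]; first exact: F_cst.
by apply: (F_ev (k0 := 0)) (F_M h IH) => // k _; rewrite exprS.
Qed.

Lemma F_sum (I : finType) (f : I -> nat -> C) : (forall i, F (f i)) -> F (fun k => \sum_i f i k).
Proof.
move=> h; have : forall l : seq I, F (fun k => \sum_(i <- l) f i k); last by move=> /(_ (index_enum I)).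
elim=> [|i l IH]; first by apply: (F_ev (k0 := 0)) (F_cst 0) => k _; rewrite big_nil.
by apply: (F_ev (k0 := 0)) (F_D (h i) IH) => k _; rewrite big_cons.
Qed.

Definition relval d (a : nat -> nat -> nat -> C) k :=
  \sum_(u < d.+1) \sum_(v < d.+1) a u v k * (s k ^+ u * s' k ^+ v).

(** Relations hold modulo the negligible sequences Z. The bound m on the degree in [s'] lets the
    case m = 0 treat a single sequence. *)
Definition relation d a : Prop :=
  [/\ forall u v, F (a u v),
      forall u v k, (d < u + v)%N || (m < v)%N -> a u v k = 0 &
      Z (relval d a)].

(** The number of coefficients of degree exactly d that are not eventually zero: the second
    parameter of the induction in [kubota]. *)
Definition tops d (a : nat -> nat -> nat -> C) : nat :=
  #|[set u : 'I_d.+1 | ~~ `[< ev0 (a u (d - u)%N) >]]|.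

(** The coefficients of the relation at k + 1 when it is rewritten in [s k] and [s' k] by the
    binomial theorem. *)
Definition shifted d (a : nat -> nat -> nat -> C) i j k :=
  \sum_(u < d.+1) \sum_(v < d.+1)
    a u v k.+1 * ('C(u, i)%:R * r k ^+ (u - i) * ('C(v, j)%:R * r' k ^+ (v - j))).

Lemma expr_shift (x y : C) (u d : nat) : (u <= d)%N ->
  (x + y) ^+ u = \sum_(i < d.+1) 'C(u, i)%:R * y ^+ (u - i) * x ^+ i.
Proof.
move=> ud; rewrite addrC exprDn.
rewrite (big_ord_widen d.+1 (fun i => (y ^+ (u - i) * x ^+ i) *+ 'C(u, i))) //.
rewrite [RHS](bigID (fun i : 'I_d.+1 => (i < u.+1)%N)) /= [X in _ + X]big1 ?addr0.
  by apply: eq_bigr => i _; rewrite -mulr_natl mulrA.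
by move=> i; rewrite -leqNgt => h; rewrite bin_small // !mul0r.
Qed.

Lemma relval_shifted d a k : relval d (shifted d a) k = relval d a k.+1.
Proof.
rewrite /relval /shifted.
have E x y (p : nat -> nat -> nat -> nat -> C) :
  \sum_(i < d.+1) \sum_(j < d.+1) (\sum_(u < d.+1) \sum_(v < d.+1) p u v i j) * (x i * y j) =
  \sum_(u < d.+1) \sum_(v < d.+1) \sum_(i < d.+1) \sum_(j < d.+1) p u v i j * (x i * y j).
  under eq_bigr => i _ do under eq_bigr => j _ do rewrite mulr_suml.
  under eq_bigr => i _ do under eq_bigr => j _ do under eq_bigr => u _ do rewrite mulr_suml.
  under eq_bigr => i _ do rewrite exchange_big.
  rewrite exchange_big; apply: eq_bigr => u _.
  under eq_bigr => i _ do rewrite exchange_big.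
  by rewrite exchange_big.
rewrite (E (fun i => s k ^+ i) (fun j => s' k ^+ j) (fun u v i j =>
  a u v k.+1 * ('C(u, i)%:R * r k ^+ (u - i) * ('C(v, j)%:R * r' k ^+ (v - j))))).
apply: eq_bigr => u _; apply: eq_bigr => v _.
have -> : s k.+1 = s k + r k by rewrite /r addrC subrK.
have -> : s' k.+1 = s' k + r' k by rewrite /r' addrC subrK.
rewrite (expr_shift _ _ (ltnSE (ltn_ord u))) (expr_shift _ _ (ltnSE (ltn_ord v))).
rewrite mulr_suml mulr_sumr; apply: eq_bigr => i _.
rewrite mulr_sumr mulr_sumr; apply: eq_bigr => j _.
by ring.
Qed.

Lemma shifted_term d (a : nat -> nat -> nat -> C) i j k (S : {set 'I_d.+1 * 'I_d.+1}) :
  (forall u v : 'I_d.+1, (u, v) \notin S -> (i <= u)%N -> (j <= v)%N -> a u v k.+1 = 0) ->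
  shifted d a i j k = \sum_(w in S)
    a w.1 w.2 k.+1 * ('C(w.1, i)%:R * r k ^+ (w.1 - i) * ('C(w.2, j)%:R * r' k ^+ (w.2 - j))).
Proof.
move=> h; rewrite /shifted pair_bigA /= (bigID (fun w => w \in S)) /= [X in _ + X]big1 ?addr0 //.
case=> u v /= uv; case: (leqP i u) => iu; last by rewrite bin_small // !(mul0r, mulr0).
case: (leqP j v) => jv; last by rewrite (bin_small jv) !(mul0r, mulr0).
by rewrite h // mul0r.
Qed.

Lemma shifted_high d a i j k : relation d a -> (d < i + j)%N || (m < j)%N -> shifted d a i j k = 0.
Proof.
case=> _ h _ dm; rewrite (@shifted_term _ _ _ _ _ finset.set0) ?big_set0 // => u v _ iu jv; apply: h.
by case/orP: dm => dm; apply/orP; [left|right]; lia.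
Qed.

Lemma shifted_top d a i j k : relation d a -> (i + j = d)%N -> shifted d a i j k = a i j k.+1.
Proof.
case=> _ h _ ij; have id : (i < d.+1)%N by lia.
have jd : (j < d.+1)%N by lia.
rewrite (@shifted_term _ _ _ _ _ [set (Ordinal id, Ordinal jd)]); last first.
  move=> u v uv iu jv; apply: h; apply/orP; left; rewrite ltnNge; apply: contra uv => uv.
  by rewrite inE; apply/eqP; congr (_, _); apply: val_inj => /=; lia.
by rewrite big_set1 /= !binn !subnn !expr0 !mulr1.
Qed.

Lemma shifted_subtop d a i j k : relation d a -> (i + j).+1 = d ->
  shifted d a i j k = a i j k.+1 + (i.+1%:R * r k) * a i.+1 j k.+1 + (j.+1%:R * r' k) * a i j.+1 k.+1.
Proof.
case=> _ h _ ij.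
have id : (i < d.+1)%N by lia.
have jd : (j < d.+1)%N by lia.
have id' : (i.+1 < d.+1)%N by lia.
have jd' : (j.+1 < d.+1)%N by lia.
rewrite (@shifted_term _ _ _ _ _ [set (Ordinal id, Ordinal jd); (Ordinal id', Ordinal jd); (Ordinal id, Ordinal jd')]); last first.
  move=> u v uv iu jv; apply: h; apply/orP; left; rewrite ltnNge; apply: contra uv => uv.
  rewrite !inE !xpair_eqE -!val_eqE /=.
  by lia.
rewrite finset.setUC big_setU1 /=; last by rewrite !inE !xpair_eqE -!val_eqE /=; lia.
rewrite finset.setUC big_setU1 /=; last by rewrite !inE !xpair_eqE -!val_eqE /=; lia.
rewrite big_set1 /= !binn !subnn !expr0 !mulr1 !subSnn !expr1 !binSn; ring.
Qed.

Lemma F_shifted d a i j : relation d a -> F (shifted d a i j).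
Proof.
case=> Fa _ _; apply: F_sum => u; apply: F_sum => v.
apply: F_M; first exact: F_S.
by apply: F_M; apply: F_M; [exact: F_cst|exact: F_X|exact: F_cst|exact: F_X].
Qed.

(** If shifting does not change the relation, its coefficients of degree d are eventually constant,
    and one of degree d - 1 changes at each step by a constant combination of [r] and [r']. Its sum
    with the corresponding combination of [s] and [s'] is then eventually constant. *)
Lemma linear_of_invariant d a : relation d a ->
  (exists2 u : 'I_d.+1, forall k, a u (d - u)%N k = 1 & True) ->
  (forall i j, ev0 (fun k => shifted d a i j k - a i j k)) ->
  exists C1 C2, [/\ C1 != 0 \/ C2 != 0, m = 0%N -> C2 = 0 & F (fun k => C1 * s k + C2 * s' k)].
Proof.
move=> ra [u au _] inv; have [Fa a0 rel] := ra.
have cst i j : (i + j = d)%N -> exists x : C, exists k0, forall k, (k0 <= k)%N -> a i j k = x.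
  move=> ij; have [k0 hk0] := inv i j; exists (a i j k0), k0 => k.
  elim: k => [|k IH]; first by rewrite leqn0 => /eqP ->.
  rewrite leq_eqVlt => /orP[/eqP -> //|]; rewrite ltnS => k0k.
  have := hk0 k k0k; rewrite (shifted_top _ ra ij) => /eqP; rewrite subr_eq0 => /eqP ->.
  exact: IH.
have cst1 i j (x : C) k0 : (forall k, (k0 <= k)%N -> a i j k = x) -> (d < i + j)%N || (m < j)%N -> x = 0.
  by move=> h hd; rewrite -(h k0 (leqnn _)); apply: a0.
have final i j (c1 c2 : C) k1 k2 : (i + j).+1 = d ->
   (forall k, (k1 <= k)%N -> a i.+1 j k = c1) -> (forall k, (k2 <= k)%N -> a i j.+1 k = c2) ->
   F (fun k => i.+1%:R * c1 * s k + j.+1%:R * c2 * s' k).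
  move=> ij h1 h2; have [k3 h3] := inv i j.
  pose e k := i.+1%:R * c1 * s k + j.+1%:R * c2 * s' k + a i j k.
  have [x hx] : exists x, forall k, (maxn (maxn k1 k2) k3 <= k)%N -> e k = x.
    exists (e (maxn (maxn k1 k2) k3)) => k; elim: k => [|k IH]; first by rewrite leqn0 => /eqP ->.
    rewrite leq_eqVlt => /orP[/eqP -> //|]; rewrite ltnS => k0k; rewrite -IH //.
    move: k0k; rewrite !geq_max => /andP[/andP[l1 l2] l3].
    have := h3 k l3; rewrite (shifted_subtop _ ra ij) h1 ?leqW // h2 ?leqW // /e /r /r' => h.
    apply/eqP; rewrite -subr_eq0 -h; apply/eqP; ring.
  apply: (F_ev (k0 := maxn (maxn k1 k2) k3)) (F_B (F_cst x) (Fa i j)) => k hk.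
  by rewrite -(hx k hk) /e addrK.
have ud : (u <= d)%N by rewrite -ltnS.
(* In degree 0 the relation would make the constant sequence 1 negligible. *)
case: (posnP d) => [d0|d0].
  have u0 : val u = 0%N by apply/eqP; rewrite -leqn0; apply: leq_trans ud _; rewrite d0.
  clear - d0 rel au u0 Z_F Z_ev F_cst; subst d; have [|k0 /(_ k0 (leqnn _))] := Z_F (F_cst 1); last by move/eqP; rewrite oner_eq0.
  apply: (Z_ev (k0 := 0)) rel => k _; rewrite /relval.
  by rewrite !big_ord_recl !big_ord0 /= !expr0 !mulr1 !addr0 -(au k) u0.
have um : (d - u <= m)%N.
  rewrite leqNgt; apply/negP => h; have := au 0%N; rewrite a0 ?h ?orbT //.
  by move/eqP; rewrite eq_sym oner_eq0.
case: (posnP u) => [u0|u0].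
  have e : (0 + d.-1).+1 = d by lia.
  have [c1 [k1 h1]] := cst 1%N d.-1 ltac:(lia).
  have h2 k : (0 <= k)%N -> a 0%N d.-1.+1 k = 1.
    by move=> _; rewrite -(au k) u0 subn0 prednK.
  exists (1%:R * c1), (d.-1.+1%:R * 1); split; last exact: final h1 h2.
    by right; rewrite mulr1 pnatr_eq0.
  by move=> m0; move: um; rewrite m0; lia.
have e : (u.-1 + (d - u)).+1 = d by lia.
have [c2 [k2 h2]] := cst u.-1 (d - u).+1 ltac:(lia).
have h1 k : (0 <= k)%N -> a u.-1.+1 (d - u)%N k = 1.
  by move=> _; rewrite -(au k) prednK.
exists (u.-1.+1%:R * 1), ((d - u).+1%:R * c2); split; last exact: final h1 h2.
  by left; rewrite mulr1 pnatr_eq0.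
by move=> m0; rewrite (cst1 _ _ _ _ h2) ?mulr0 // m0 orbT.
Qed.

(** Induction on the degree, then on [tops]. Once a top coefficient is scaled to 1, it disappears
    from the difference between the relation and its shift: either this difference is a nontrivial
    relation with fewer top coefficients, or it vanishes and the invariant case applies. When every
    top coefficient is eventually zero, the top layer is dropped. *)
Lemma kubota d a : relation d a -> (exists u v, ~ ev0 (a u v)) ->
  exists C1 C2, [/\ C1 != 0 \/ C2 != 0, m = 0%N -> C2 = 0 & F (fun k => C1 * s k + C2 * s' k)].
Proof.
elim/ltn_ind: d a => d IHd a.
have [n] := ubnP (tops d a); elim: n a => // n IHn a tn ra nt.
have [Fa a0 rel] := ra.
case: (pickP [pred u : 'I_d.+1 | ~~ `[< ev0 (a u (d - u)%N) >]]) => [u /= /asboolPn au|none]; last first.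
  case: d {IHn} IHd a tn ra nt Fa a0 rel none => [|d] IHd a tn ra [u [v auv]] Fa a0 rel none.
    case: auv; case: (posnP (u + v)) => [/eqP|uv]; last by exists 0%N => k _; apply: a0; rewrite uv.
    rewrite addn_eq0 => /andP[/eqP -> /eqP ->].
    by have /negbT := none ord0; rewrite /= negbK => /asboolP.
  pose b u v k := if (u + v <= d)%N then a u v k else 0.
  have top0 (w : nat) : (w <= d.+1)%N -> ev0 (a w (d.+1 - w)%N).
    by move=> wd; have /negbT := none (Ordinal (wd : (w < d.+2)%N)); rewrite /= negbK => /asboolP.
  have rb : Z (relval d.+1 b).
    pose e (w : 'I_d.+2 * 'I_d.+2) k := if (w.1 + w.2 <= d)%N then 0 else a w.1 w.2 k * (s k ^+ w.1 * s' k ^+ w.2).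
    have [N1 h1] : ev0 (fun k => \sum_w e w k).
      apply: ev0_sum => -[x y]; rewrite /e /=; case: leqP => xy; first by exists 0%N.
      have : ev0 (a x y).
        case: (ltnP d.+1 (x + y)) => xy'; first by exists 0%N => k _; rewrite a0 // xy'.
        have -> : (y : nat) = (d.+1 - x)%N by lia.
        by apply: top0; rewrite -ltnS.
      by case=> N hN; exists N => k /hN ->; rewrite mul0r.
    apply: (Z_ev (k0 := N1)) rel => k /h1 k1; apply/esym.
    have -> : relval d.+1 b k = relval d.+1 a k - \sum_w e w k; last by rewrite k1 subr0.
    rewrite /relval !pair_bigA /= -sumrB; apply: eq_bigr => -[x y] _ /=.
    by rewrite /e /b /=; case: ifP; rewrite ?subr0 ?subrr ?mul0r.
  have rb' : Z (relval d b).
    apply: (Z_ev (k0 := 0)) rb => k _; rewrite /relval big_ord_recr /= [X in _ + X]big1 ?addr0; last first.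
      by move=> y _; rewrite /b leqNgt leq_addr /= mul0r.
    apply: eq_bigr => x _; rewrite big_ord_recr /=.
    by rewrite (_ : b x d.+1 k = 0) ?mul0r ?addr0 // /b leqNgt leq_addl.
  apply: (IHd d (ltnSn d) b).
    split=> // [x y|x y k].
      apply: (F_ev (k0 := 0) (c := if (x + y <= d)%N then a x y else fun=> 0)); last by case: ifP.
      by move=> k _; rewrite /b; case: ifP.
    rewrite /b; case/orP => h; first by rewrite leqNgt h.
    by case: ifP => // _; apply: a0; rewrite h orbT.
  exists u, v; case=> N hN; case: auv; case: (leqP (u + v)%N d) => uv.
    by exists N => k /hN; rewrite /b uv.
  case: (ltnP d.+1 (u + v)) => uv'; first by exists 0%N => k _; rewrite a0 // uv'.
  have -> : v = (d.+1 - u)%N by lia.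
  by apply: top0; lia.
have [//|[k0 hk0]] := F_dich (Fa u (d - u)%N).
(* The top coefficient is nonzero only from k0 on; before that it is replaced by 1, which changes
   nothing eventually. *)
pose w k := if (k0 <= k)%N then a u (d - u)%N k else 1.
have Fw : F w by apply: (F_ev (k0 := k0)) (Fa u (d - u)%N) => k hk; rewrite /w hk.
have w0 k : w k != 0 by rewrite /w; case: ifP => [/hk0 //|_]; rewrite oner_eq0.
pose a1 x y k := if (x == u :> nat) && (y == d - u)%N then 1 else a x y k / w k.
have ea1 x y k : (k0 <= k)%N -> a1 x y k = a x y k / w k.
  by move=> hk; rewrite /a1 /w hk; case: ifP => // /andP[/eqP -> /eqP ->]; rewrite divff // hk0.
have ra1 : relation d a1.
  split=> [x y|x y k h|].
  - by apply: (F_ev (k0 := k0)) (F_M (Fa x y) (F_V Fw)) => k hk; rewrite ea1.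
  - rewrite /a1; case: ifP => [/andP[/eqP ex /eqP ey]|_]; last by rewrite a0 ?mul0r.
    case: au; exists 0%N => k' _; rewrite -ey -ex; exact: a0.
  - apply: (Z_ev (k0 := k0)) (Z_M (F_V Fw) rel) => k /ea1 e.
    rewrite /relval mulr_suml; apply: eq_bigr => x _.
    by rewrite mulr_suml; apply: eq_bigr => y _; rewrite e; ring.
pose b i j k := shifted d a1 i j k - a1 i j k.
have [Fa1 a10 rel1] := ra1.
case: (pselect (exists x y, ~ ev0 (b x y))) => [nb|nb]; last first.
  apply: (linear_of_invariant ra1); first by exists u => // k; rewrite /a1 !eqxx.
  by move=> i j; apply: contrapT => h; apply: nb; exists i, j.
apply: (IHn b) => //; last first.
  split=> [x y|x y k h|].
  - exact: F_B (F_shifted x y ra1) (Fa1 x y).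
  - by rewrite /b (shifted_high _ ra1) // a10 // subrr.
  - apply: (Z_ev (k0 := 0)) (Z_D (Z_S rel1) (Z_M (F_cst (-1)) rel1)) => k _; apply/esym.
    have -> : relval d b k = relval d (shifted d a1) k - relval d a1 k.
      rewrite /relval -sumrB; apply: eq_bigr => x _; rewrite -sumrB; apply: eq_bigr => y _.
      by rewrite /b; ring.
    by rewrite relval_shifted mulrN1.
rewrite -ltnS; apply: leq_trans tn; rewrite ltnS; apply: proper_card; apply/properP; split.
  apply/fintype.subsetP => x; rewrite !inE; apply: contra => /asboolP[N hN].
  have xd : (x + (d - x) = d)%N by have := ltn_ord x; lia.
  apply/asboolP; exists (maxn N k0) => k; rewrite geq_max => /andP[hk hk'].
  rewrite /b (shifted_top _ ra1 xd) !ea1 ?leqW // !hN ?leqW // !mul0r subrr //.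
exists u; first by rewrite inE; apply/asboolPn.
rewrite inE negbK; apply/asboolP; exists 0%N => k _.
have xd : (u + (d - u) = d)%N by have := ltn_ord u; lia.
by rewrite /b (shifted_top _ ra1 xd) /a1 !eqxx subrr.
Qed.

End Kubota.

(** * Rational functions along the orbit, and jumps across an irrational line *)

Section RationalSequences.
Variables (R : realType) (t : nat) (lam : R).
Hypotheses (lam1 : 1 < lam) (lamt : lam ^+ 2 + 1 = t%:R * lam) (t2 : (2 < t)%N).
Hypothesis lam_irr : forall x y : int, x%:~R * lam = y%:~R -> x = 0.

Let lam0 : 0 < lam. Proof. by apply: lt_trans lam1. Qed.
Let lamn0 : lam != 0. Proof. by rewrite gt_eqF. Qed.

Lemma irr_eq0 (x y : int) : x%:~R * lam = y%:~R -> x = 0 /\ y = 0.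
Proof.
move=> e; have x0 := lam_irr e; split=> //; move: e.
by rewrite x0 mul0r => /esym/eqP; rewrite intr_eq0 => /eqP.
Qed.

Lemma wt_inj (i j i' j' : nat) :
  wt lam i%:R j%:R = wt lam i'%:R j'%:R -> i = i' /\ j = j'.
Proof.
rewrite /wt => e.
have h : (i%:Z + j%:Z - i'%:Z - j'%:Z)%:~R * lam = (i%:Z - i'%:Z)%:~R.
  rewrite !(intrB, intrD) -!pmulrn; move: e; have := mulfV lamn0; move: lam^-1 => u lu e.
  have -> : (i%:R - i'%:R : R) = (i%:R - i'%:R) * (lam * u) by rewrite lu mulr1.
  by move/(congr1 (fun x => lam * x)): e => e; lra.
by have [] := irr_eq0 h; lia.
Qed.

Local Notation C := R[i]%C.
Variable g : C.
Hypotheses (g0 : 0 < normc g) (g1 : normc g < 1).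
Local Notation zev := (zeval t g).
Local Notation zeval_neq0 := (zeval_neq0 lam1 lamt t2 wt_inj g0 g1).

Definition ratseq (c : nat -> C) : Prop := exists N D : {poly {poly C}}, D != 0 /\
  exists k0, forall k, (k0 <= k)%N -> c k * zev D k = zev N k.

Lemma ratseq_zeval p : ratseq (zev p).
Proof.
exists p, 1; split; first exact: oner_neq0.
by exists 0%N => k _; rewrite -polyC1 -polyC1 zevalC mulr1.
Qed.

Lemma ratseq_cst x : ratseq (fun=> x).
Proof.
have [N [D [D0 [k0 h]]]] := ratseq_zeval x%:P%:P.
by exists N, D; split=> //; exists k0 => k /h; rewrite zevalC.
Qed.

Lemma ratseq_ev c c' k0 : (forall k, (k0 <= k)%N -> c k = c' k) -> ratseq c -> ratseq c'.
Proof.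
move=> e [N [D [D0 [k1 h]]]]; exists N, D; split=> //.
by exists (maxn k0 k1) => k; rewrite geq_max => /andP[/e <- /h].
Qed.

Lemma ratseqD c c' : ratseq c -> ratseq c' -> ratseq (fun k => c k + c' k).
Proof.
move=> [N [D [D0 [k0 h]]]] [N' [D' [D'0 [k1 h']]]].
exists (N * D' + N' * D), (D * D'); split; first by rewrite mulf_neq0.
exists (maxn k0 k1) => k; rewrite geq_max => /andP[/h e /h' e'].
by rewrite zevalD !zevalM -e -e'; ring.
Qed.

Lemma ratseqM c c' : ratseq c -> ratseq c' -> ratseq (fun k => c k * c' k).
Proof.
move=> [N [D [D0 [k0 h]]]] [N' [D' [D'0 [k1 h']]]].
exists (N * N'), (D * D'); split; first by rewrite mulf_neq0.
exists (maxn k0 k1) => k; rewrite geq_max => /andP[/h e /h' e'].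
by rewrite !zevalM -e -e'; ring.
Qed.

Lemma zeval0 k : zev 0 k = 0.
Proof. by rewrite /zeval !horner0. Qed.

Lemma ratseq_dich c : ratseq c -> ev0 c \/ exists k0, forall k, (k0 <= k)%N -> c k != 0.
Proof.
move=> [N [D [D0 [k0 h]]]]; case: (eqVneq N 0) => [N0|N0].
  left; have [k1 h1] := zeval_neq0 D0.
  exists (maxn k0 k1) => k; rewrite geq_max => /andP[/h e /h1 e1].
  by move/eqP: e; rewrite N0 zeval0 mulf_eq0 (negPf e1) orbF => /eqP.
right; have [k1 h1] := zeval_neq0 N0.
exists (maxn k0 k1) => k; rewrite geq_max => /andP[/h e /h1].
by apply: contraNneq => c0; rewrite -e c0 mul0r.
Qed.

Lemma ratseqV c : ratseq c -> ratseq (fun k => (c k)^-1).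
Proof.
move=> rc; have [[k0 c0]|[k0 c0]] := ratseq_dich rc.
  by apply: (ratseq_ev (k0 := k0)) (ratseq_cst 0) => k /c0 ->; rewrite invr0.
have [N [D [D0 [k1 h]]]] := rc; have [k2 h2] := zeval_neq0 D0.
exists D, N; split; last first.
  exists (maxn k0 k1) => k; rewrite geq_max => /andP[/c0 ck /h <-].
  by rewrite mulrA mulVf // mul1r.
apply/eqP => N0; pose k := maxn k0 (maxn k1 k2).
have e0 : (k0 <= k)%N by rewrite leq_max leqnn.
have e1 : (k1 <= k)%N by rewrite !leq_max leqnn orbT.
have e2 : (k2 <= k)%N by rewrite !leq_max leqnn !orbT.
have /eqP := h k e1; rewrite N0 zeval0 mulf_eq0.
by rewrite (negPf (c0 k e0)) (negPf (h2 k e2)).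
Qed.

Lemma ratseqS c : ratseq c -> ratseq (fun k => c k.+1).
Proof.
move=> [N [D [D0 [k0 h]]]]; exists (zshift t N), (zshift t D); split; last first.
  by exists k0 => k hk; rewrite !(zshiftE lam1 t2 g0 g1) h // leqW.
have [k2 h2] := zeval_neq0 D0; apply/eqP => S0.
by have := h2 k2.+1 (leqnSn _); rewrite -(zshiftE lam1 t2 g0 g1) S0 zeval0 eqxx.
Qed.

Lemma flat_ratseqM c b : ratseq b -> flat t g c -> flat t g (fun k => c k * b k).
Proof.
move=> [N [D [D0 [k0 h]]]] fc; apply: (flat_div lam1 lamt t2 wt_inj g0 g1 D0).
have [M _ hM] := zeval_bounded t g0 g1 N.
have e k : (k0 <= k)%N -> c k * zev N k = c k * b k * zev D k by move/h => <-; rewrite mulrA.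
exact: (@flat_ev _ _ _ g0 (fun k => c k * zev N k) _ k0 e (flatM_bounded g0 hM fc)).
Qed.

Lemma ratseq_flat c : ratseq c -> flat t g c -> ev0 c.
Proof.
move=> [N [D [D0 [k0 h]]]] fc; have [M _ hM] := zeval_bounded t g0 g1 D.
have N0 : N = 0.
  apply: (zeval_flat lam1 lamt t2 wt_inj g0 g1).
  exact: (@flat_ev _ _ _ g0 (fun k => c k * zev D k) _ k0 h (flatM_bounded g0 hM fc)).
have [k1 h1] := zeval_neq0 D0; exists (maxn k0 k1) => k; rewrite geq_max => /andP[/h hk /h1 hk'].
by move/eqP: hk; rewrite N0 zeval0 mulf_eq0 (negPf hk') orbF => /eqP.
Qed.

Definition kubota_ratseq := kubota ratseq_cst ratseqD ratseqM ratseqV ratseqS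
  (fun c c' k0 => @ratseq_ev c c' k0) ratseq_dich
  (fun c c' k0 => @flat_ev _ _ _ g0 c c' k0) (@flatD _ _ _) flat_ratseqM (@flat_shift _ _ _ g0 g1) ratseq_flat.

(** The action of [zshift] on exponents. Its eigenforms are [wtz], with eigenvalue lam, and [ellz],
    with eigenvalue lam^-1. *)
Definition tz (w : int * int) : int * int :=
  (w.1 + w.2, (t%:Z - 2) * w.1 + (t%:Z - 1) * w.2).

Definition ellz (w : int * int) : R := ell lam w.1%:~R w.2%:~R.
Definition wtz (w : int * int) : R := wt lam w.1%:~R w.2%:~R.

Lemma ellz_tz w : ellz (tz w) = lam^-1 * ellz w.
Proof.
rewrite /ellz /tz /ell /= !(intrD, intrM, intrB) -pmulrn (trace_lam lam1 lamt).
by have := mulfV lamn0; move: (lam^-1) => u lu; ring: lu.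
Qed.

Lemma wtz_tz w : wtz (tz w) = lam * wtz w.
Proof.
rewrite /wtz /tz /wt /= !(intrD, intrM, intrB) -pmulrn (trace_lam lam1 lamt).
by have := mulfV lamn0; move: (lam^-1) => u lu; ring: lu.
Qed.

Lemma ellz_iter k w : ellz (iter k tz w) = lam^-1 ^+ k * ellz w.
Proof. by elim: k => [|k IH]; rewrite ?expr0 ?mul1r // iterS ellz_tz IH exprS mulrA. Qed.

Lemma wtz_iter k w : wtz (iter k tz w) = lam ^+ k * wtz w.
Proof. by elim: k => [|k IH]; rewrite ?expr0 ?mul1r // iterS wtz_tz IH exprS mulrA. Qed.

Lemma ellz_eq0 w : ellz w = 0 -> w = (0, 0).
Proof.
case: w => x y; rewrite /ellz /ell /= => e.
have [] := @irr_eq0 x (x + y); first by rewrite intrD; lra.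
by move=> -> ; rewrite add0r => ->.
Qed.

Lemma coord1E w : w.1%:~R * (lam - lam^-1) = wtz w + ellz w :> R.
Proof. by rewrite /ellz /wtz /ell /wt; ring. Qed.

Lemma coord2E w : w.2%:~R = w.1%:~R * (lam - 1) - ellz w :> R.
Proof. by rewrite /ellz /ell; ring. Qed.

Lemma orbit_escapes (B : nat) (eta : R) w : 0 < wtz w -> 0 < eta ->
  exists k0, forall k, (k0 <= k)%N ->
    [/\ B%:Z <= (iter k tz w).1, B%:Z <= (iter k tz w).2 & `|ellz (iter k tz w)| < eta].
Proof.
move=> w0 eta0; have l01 := lamV_lt1 lam1; have l0 := lamB_gt0 lam1.
have [u0 u1] := andP l01.
pose e := Num.min eta 1; have e0 : 0 < e by rewrite lt_min eta0 ltr01.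
have N0 : 0 < `|ellz w| + 1 by rewrite ltr_wpDl.
(* The second coordinate is lam - 1 times the first minus ell, and |ell| < 1; this explains the
   summand (B + 1) / (lam - 1). *)
pose A : R := (B%:R + 1) / (lam - 1) + B%:R.
have lm : 0 < lam - 1 by rewrite subr_gt0.
have pB : 0 <= (B%:R + 1) / (lam - 1) by rewrite divr_ge0 ?(ltW lm) // addr_ge0.
have A0 : 0 <= A by rewrite addr_ge0.
pose W := A * (lam - lam^-1) + 1.
have W0 : 0 < W by rewrite ltr_wpDl // mulr_ge0 // ltW.
have [|k1 h1] := expr_lt_eventually (q := lam^-1) _ (divr_gt0 e0 N0); first by rewrite u1 ltW.
have [|k2 h2] := expr_lt_eventually (q := lam^-1) _ (divr_gt0 w0 W0); first by rewrite u1 ltW.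
exists (maxn k1 k2) => k; rewrite geq_max => /andP[hk1 hk2].
have pw j : (j <= k)%N -> lam^-1 ^+ k <= lam^-1 ^+ j.
  by move=> jk; rewrite ler_wiXn2l // ltW.
have ek : `|ellz (iter k tz w)| < e.
  rewrite ellz_iter normrM ger0_norm ?exprn_ge0 ?(ltW u0) //.
  move: h1; rewrite ltr_pdivlMr // => h1; apply: le_lt_trans h1.
  by rewrite ler_pM ?exprn_ge0 ?(ltW u0) ?lerDl //; apply: pw.
have wk : W <= wtz (iter k tz w).
  rewrite wtz_iter; move: h2; rewrite ltr_pdivlMr // => h2.
  have h3 : lam^-1 ^+ k * W <= wtz w by apply: le_trans (ltW h2); rewrite ler_pM2r // pw.
  have lk : 0 < lam ^+ k by rewrite exprn_gt0.
  move: h3; rewrite -(ler_pM2l lk) mulrA -exprMn mulfV // expr1n mul1r //.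
have c1 := coord1E (iter k tz w); have c2 := coord2E (iter k tz w).
move: ek wk c1 c2; set y := iter k tz w; move=> ek wk c1 c2.
have ek1 : `|ellz y| < 1 by apply: lt_le_trans ek _; rewrite ge_min lexx orbT.
have [e1 e2] : - 1 < ellz y /\ ellz y < 1 by move: ek1; rewrite ltr_norml => /andP[].
have i1 : A <= y.1%:~R.
  by rewrite -(ler_pM2r l0) c1; rewrite /W in wk; lra.
have i2 : B%:R + 1 <= y.1%:~R * (lam - 1).
  rewrite -ler_pdivrMr //; apply: le_trans i1; rewrite /A lerDl //.
have i3 : (B%:Z%:~R : R) <= y.1%:~R.
  by apply: le_trans i1; rewrite /A lerDr.
have i4 : (B%:Z%:~R : R) <= y.2%:~R by rewrite c2; have -> : (B%:Z%:~R : R) = B%:R by []; lra.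
split; first by rewrite -(ler_int R).
  by rewrite -(ler_int R).
by apply: lt_le_trans ek _; rewrite ge_min lexx.
Qed.

Definition taddn (w v : int * int) (n : nat) : int * int :=
  (w.1 + v.1 * n%:Z, w.2 + v.2 * n%:Z).

Lemma iter_tz_taddn w v n k : iter k tz (taddn w v n) = taddn (iter k tz w) (iter k tz v) n.
Proof.
elim: k => [//|k IH]; rewrite !iterS IH /tz /taddn /=.
by congr (_, _); ring.
Qed.

Lemma wtz_taddn w v n : wtz (taddn w v n) = wtz w + wtz v * n%:R.
Proof. by rewrite /wtz /wt /taddn /= !(intrD, intrM) -!pmulrn; ring. Qed.

Lemma ellz_taddn w v n : ellz (taddn w v n) = ellz w + ellz v * n%:R.
Proof. by rewrite /ellz /ell /taddn /= !(intrD, intrM) -!pmulrn; ring. Qed.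

(* Near the line [ell = 0] the array is [h] on the side prescribed by [b] and zero on the other. *)
Definition edge (chi : nat -> nat -> C) (h : int * int -> C) (b : bool) (P : nat) : Prop :=
  [/\ (0 < P)%N, forall w v n, h (taddn w v (P * n)) = h w, forall w, h (tz w) = h w &
    forall E : R, exists I, forall i j : nat, (I <= i)%N -> (I <= j)%N ->
      ellz (i%:Z, j%:Z) != 0 -> `|ellz (i%:Z, j%:Z)| <= E ->
      chi i j = if (0 < ellz (i%:Z, j%:Z)) == b then h (i%:Z, j%:Z) else 0].

Lemma sum_ord_trunc (f : nat -> C) (m n : nat) : (m <= n)%N ->
  (forall a, (m <= a)%N -> f a = 0) -> \sum_(a < n) f a = \sum_(a < m) f a.
Proof.
move=> mn f0; rewrite [RHS](big_ord_widen n (fun a => f a) mn).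
rewrite [LHS](bigID (fun a : 'I_n => (a < m)%N)) /= [X in _ + X]big1 ?addr0 //.
by move=> a; rewrite -leqNgt => /f0.
Qed.

Lemma iter_tz_inv (h : int * int -> C) k w : (forall w, h (tz w) = h w) -> h (iter k tz w) = h w.
Proof. by move=> inv; elim: k => // k IH; rewrite iterS inv. Qed.

Lemma fin_gap (T : finType) (f : T -> R) (p : pred T) : (forall v, p v -> 0 < f v) ->
  exists2 eta, 0 < eta & forall v, p v -> eta <= f v.
Proof.
move=> f0; pose S := \sum_(v | p v) (f v)^-1.
have S0 : 0 <= S by apply: sumr_ge0 => v /f0 h; rewrite invr_ge0 ltW.
exists (1 + S)^-1 => [|v pv]; first by rewrite invr_gt0 ltr_wpDr.
rewrite -[f v]invrK lef_pV2 ?posrE ?invr_gt0 ?f0 ?ltr_wpDr //.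
rewrite ler_wpDl // /S (bigD1 v) //= lerDl; apply: sumr_ge0 => u /andP[/f0 h _].
by rewrite invr_ge0 ltW.
Qed.

Lemma int_ge_nat (J : nat) (y : int) : J%:Z <= y -> exists2 i0 : nat, y = i0%:Z & (J <= i0)%N.
Proof. by case: y => [n|n] h; [exists n; lia | lia]. Qed.

(* Crossing the irrational edge of the cone far out isolates one coefficient of the
   denominator, since the other translates of the edge stay at positive distance. *)
Lemma jump chi chi' h h' b b' P P' (C1 C2 : C) (D : {poly {poly C}}) I1 :
  edge chi h b P -> edge chi' h' b' P' -> D != 0 ->
  (forall i j, (I1 <= i)%N -> (I1 <= j)%N ->
    \sum_(a < i.+1) \sum_(c < j.+1) D`_a`_c *
      (C1 * chi (i - a)%N (j - c)%N + C2 * chi' (i - a)%N (j - c)%N) = 0) ->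
  forall w, C1 * (if b then 1 else -1) * h w + C2 * (if b' then 1 else -1) * h' w = 0.
Proof.
move=> [P0 hper hinv hedge] [P'0 hper' hinv' hedge'] D0 rel w.
have u01 := lamV_lt1 lam1; have [u0 u1] := andP u01.
have lm : 0 < lam - 1 by rewrite subr_gt0.
pose B := (size D + \max_(a < size D) size (D`_a)%R)%N.
have DB a c : (B <= a)%N || (B <= c)%N -> D`_a`_c = 0.
  case: (ltnP a (size D)) => [aD|Da _]; last by rewrite (nth_default 0 Da) coef0.
  case/orP => h1; first by move: aD h1; rewrite /B; lia.
  apply: nth_default; apply: leq_trans h1; apply: leq_trans (leq_addl _ _).
  exact: (leq_bigmax (F := fun a : 'I_(size D) => size (D`_a)%R) (Ordinal aD)).
have [a0 [c0 Dac]] := poly2_neq0 D0.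
have aB : (a0 < B)%N by rewrite ltnNge; apply: contra Dac => hh; rewrite DB ?hh.
have cB : (c0 < B)%N by rewrite ltnNge; apply: contra Dac => hh; rewrite DB ?hh ?orbT.
pose T : finType := ('I_B * 'I_B)%type.
pose pt (v : T) : int * int := (v.1%:Z, v.2%:Z).
(* Among the monomials of D, v0 has the largest ell. At v0 plus a point y near the line, every other
   term of the convolution is taken at a point with ell > 0, whichever side y is on. *)
have [v0 /= Dv0 maxv0] := @arg_maxP _ R T (Ordinal aB, Ordinal cB)
  (fun v => D`_(v.1)`_(v.2) != 0) (fun v => ellz (pt v)) Dac.
pose q (v : T) (y : int * int) : int * int := (v0.1%:Z - v.1%:Z + y.1, v0.2%:Z - v.2%:Z + y.2).
have ellq v y : ellz (q v y) = ellz (pt v0) - ellz (pt v) + ellz y.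
  by rewrite /ellz /ell /q /= !(intrD, intrB); ring.
have [eta eta0 gap] : exists2 eta : R, 0 < eta & forall v : T,
    (D`_(v.1)`_(v.2) != 0) && (v != v0) -> eta <= ellz (pt v0) - ellz (pt v).
  apply: fin_gap => v /andP[Dv vv0]; rewrite subr_gt0 lt_neqAle maxv0 // andbT.
  apply: contra vv0 => /eqP e.
  have /ellz_eq0[] : ellz (q v (0, 0)) = 0 by rewrite ellq e subrr add0r /ellz /ell /= mul0r subrr.
  case: v v0 {Dv0 maxv0 q ellq Dv e} => [x y] [x' y'] /=; rewrite !addr0 => e1 e2.
  have ex : x = x' by move/eqP: e1; rewrite subr_eq0 eqz_nat => /eqP/val_inj.
  have ey : y = y' by move/eqP: e2; rewrite subr_eq0 eqz_nat => /eqP/val_inj.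
  by rewrite ex ey.
pose E := \sum_(v : T) `|ellz (pt v0) - ellz (pt v)| + eta.
have [I hI] := hedge E; have [I' hI'] := hedge' E.
pose J := (I + I' + I1 + B)%N.
pose n := (P * P')%N.
have n0 : (0 < n)%N by rewrite muln_gt0 P0.
have nh x v : h (taddn x v n) = h x by apply: hper.
have nh' x v : h' (taddn x v n) = h' x by rewrite /n mulnC; apply: hper'.
pose psi (s : bool) (x : int * int) : C :=
  C1 * (if s == b then h x else 0) + C2 * (if s == b' then h' x else 0).
have key (Y : int * int) : 0 < wtz Y -> ellz Y != 0 -> exists k0, forall k, (k0 <= k)%N ->
    D`_(v0.1)`_(v0.2) * psi (0 < ellz Y) Y +
    \sum_(v | v != v0) D`_(v.1)`_(v.2) * psi true (q v (iter k tz Y)) = 0.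
  move=> wY lY; have [k0 hk0] := orbit_escapes J wY eta0; exists k0 => k /hk0.
  have sY : (0 < ellz (iter k tz Y)) = (0 < ellz Y).
    by rewrite ellz_iter pmulr_rgt0 // exprn_gt0.
  have lk : ellz (iter k tz Y) != 0.
    by rewrite ellz_iter mulf_neq0 // expf_neq0 // invr_eq0.
  have hY : h (iter k tz Y) = h Y by apply: iter_tz_inv.
  have hY' : h' (iter k tz Y) = h' Y by apply: iter_tz_inv.
  move: (iter k tz Y) sY lk hY hY' => y sY ly hY hY' [y1 y2 y3].
  have [i0 ei Ji] := int_ge_nat y1; have [j0 ej Jj] := int_ge_nat y2.
  have {}Ji : (I + I' + I1 + B <= i0)%N by [].
  have {}Jj : (I + I' + I1 + B <= j0)%N by [].
  pose i := (v0.1 + i0)%N; pose j := (v0.2 + j0)%N.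
  have Bi : (I + I' + I1 + B <= i)%N by clear -Ji; lia.
  have Bj : (I + I' + I1 + B <= j)%N by clear -Jj; lia.
  have l1 : (I1 <= i)%N by clear -Bi; lia.
  have l2 : (I1 <= j)%N by clear -Bj; lia.
  have {}Bi : (B <= i)%N by clear -Bi; lia.
  have {}Bj : (B <= j)%N by clear -Bj; lia.
  have := rel i j l1 l2.
  rewrite (@sum_ord_trunc (fun a => \sum_(c < j.+1) D`_a`_c * (C1 * chi (i - a)%N (j - c)%N + C2 * chi' (i - a)%N (j - c)%N)) B); first last.
  - by move=> a hB; rewrite big1 // => c _; rewrite DB ?hB // mul0r.
  - by rewrite leqW.
  under eq_bigr => a _.
    rewrite (@sum_ord_trunc (fun c => D`_a`_c * (C1 * chi (i - a)%N (j - c)%N + C2 * chi' (i - a)%N (j - c)%N)) B); first last.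
    - by move=> c hB; rewrite DB ?hB ?orbT // mul0r.
    - by rewrite leqW.
    over.
  rewrite pair_bigA /= => r0.
  have cq (v : T) : ((i - v.1)%N%:Z, (j - v.2)%N%:Z) = q v y.
    by rewrite /q ei ej; congr (_, _); [have := ltn_ord v.1; clear -Ji | have := ltn_ord v.2; clear -Jj]; lia.
  have qE (v : T) : D`_(v.1)`_(v.2) != 0 -> ellz (q v y) != 0 /\ `|ellz (q v y)| <= E.
    move=> Dv; split.
      case: (eqVneq v v0) => [->|vv0]; first by rewrite ellq subrr add0r.
      rewrite ellq; have := gap v; rewrite Dv vv0 => /(_ isT) => gv.
      by move: y3; rewrite ltr_norml => /andP[]; lra.
    rewrite ellq; apply: le_trans (ler_normD _ _) _; rewrite lerD ?(ltW y3) //.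
    by rewrite (bigD1 v) //= lerDl sumr_ge0.
  have term (v : T) : D`_(v.1)`_(v.2) * (C1 * chi (i - v.1)%N (j - v.2)%N + C2 * chi' (i - v.1)%N (j - v.2)%N) =
     D`_(v.1)`_(v.2) * psi (0 < ellz (q v y)) (q v y).
    case: (eqVneq D`_(v.1)`_(v.2) 0) => [->|Dv]; first by rewrite !mul0r.
    have [q1 q2] := qE v Dv.
    have m1 : (I + I' <= i - v.1)%N by have := ltn_ord v.1; clear -Ji; lia.
    have m2 : (I + I' <= j - v.2)%N by have := ltn_ord v.2; clear -Jj; lia.
    rewrite hI ?hI' ?cq //.
    - exact: leq_trans (leq_addl _ _) m1.
    - exact: leq_trans (leq_addl _ _) m2.
    - exact: leq_trans (leq_addr _ _) m1.
    - exact: leq_trans (leq_addr _ _) m2.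
  move: r0; under eq_bigr => v _ do rewrite term.
  rewrite (bigD1 v0) //= => r0; apply: etrans r0; congr (_ * _ + _).
    rewrite ellq subrr add0r sY /psi.
    have -> : q v0 y = y by rewrite /q !subrr !add0r; case: y {y1 y2 y3 sY ly hY hY' ei ej cq qE term ellq}.
    by rewrite hY hY'.
  apply: eq_bigr => v vv0; case: (eqVneq D`_(v.1)`_(v.2) 0) => [->|Dv]; first by rewrite !mul0r.
  congr (_ * psi _ _); apply/esym; rewrite ellq.
  have := gap v; rewrite Dv vv0 => /(_ isT) => gv.
  by move: y3; rewrite ltr_norml => /andP[]; lra.
(* A is chosen so that [Yp] and [Ym], both congruent to w modulo the common period n, have positive
   weight and lie on opposite sides of the line. The difference of the two identities retains only
   the term of v0. *)
have [A [A1 A2 A3]] : exists A : nat, [/\ `|wtz w| + `|ellz w| < A%:R * (1 - lam^-1),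
    `|wtz w| + `|ellz w| < A%:R * (lam - 1) & `|wtz w| + `|ellz w| < A%:R].
  pose x := `|wtz w| + `|ellz w|.
  have x0 : 0 <= x by rewrite addr_ge0.
  have um : 0 < 1 - lam^-1 by rewrite subr_gt0.
  exists (Num.truncn (x / (1 - lam^-1) + x / (lam - 1) + x)).+1.
  have := truncnS_gt (x / (1 - lam^-1) + x / (lam - 1) + x); move: (_.+1%:R) => a ha.
  have p1 : 0 <= x / (1 - lam^-1) by rewrite divr_ge0 // ltW.
  have p2 : 0 <= x / (lam - 1) by rewrite divr_ge0 // ltW.
  split; [rewrite -ltr_pdivrMr //|rewrite -ltr_pdivrMr //|]; rewrite -/x; lra.
pose Yp := taddn w (A%:Z, 0) n; pose Ym := taddn w (0, A%:Z) n.
have nR : 1 <= n%:R :> R by rewrite ler1n.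
have bw : - `|wtz w| <= wtz w by rewrite lerNnormlW.
have bl : - `|ellz w| <= ellz w by rewrite lerNnormlW.
have bl' : ellz w <= `|ellz w| by rewrite ler_norm.
have nw := normr_ge0 (wtz w); have nl := normr_ge0 (ellz w).
have sc (x y : R) : x < y -> 0 <= x -> x < y * n%:R.
  move=> xy x0; have y0 : 0 <= y by apply: ltW; apply: le_lt_trans xy.
  by apply: lt_le_trans xy _; rewrite ler_peMr.
have x0 : 0 <= `|wtz w| + `|ellz w| by rewrite addr_ge0.
have eP : wtz Yp = wtz w + A%:R * (1 - lam^-1) * n%:R /\ ellz Yp = ellz w + A%:R * (lam - 1) * n%:R.
  by rewrite wtz_taddn ellz_taddn /wtz /ellz /wt /ell /= mulr0z addr0 subr0 -pmulrn.
have eM : wtz Ym = wtz w + A%:R * n%:R /\ ellz Ym = ellz w - A%:R * n%:R.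
  by rewrite wtz_taddn ellz_taddn /wtz /ellz /wt /ell /= mulr0z !mul0r add0r sub0r mulNr -pmulrn.
have sA1 := sc _ _ A1 x0; have sA2 := sc _ _ A2 x0; have sA3 := sc _ _ A3 x0.
have wp : 0 < wtz Yp by rewrite eP.1; lra.
have lp : 0 < ellz Yp by rewrite eP.2; lra.
have wm : 0 < wtz Ym by rewrite eM.1; lra.
have lmm : ellz Ym < 0 by rewrite eM.2; lra.
have [kp hp] := key Yp wp (lt0r_neq0 lp); have [km hm] := key Ym wm (ltr0_neq0 lmm).
have := hp (maxn kp km) (leq_maxl _ _); have := hm (maxn kp km) (leq_maxr _ _).
move: (maxn kp km) => k {hp hm key}.
have cong v : psi true (q v (iter k tz Yp)) = psi true (q v (iter k tz Ym)).
  have e Y u : Y = taddn w u n -> q v (iter k tz Y) = taddn (q v (iter k tz w)) (iter k tz u) n.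
    by move=> ->; rewrite iter_tz_taddn /q /taddn /=; congr (_, _); rewrite !addrA.
  by rewrite (e Yp _ erefl) (e Ym _ erefl) /psi !nh !nh'.
under [X in _ = 0 -> _ + X = 0 -> _]eq_bigr => v _ do rewrite cong.
rewrite lp ltNge (ltW lmm) /= /psi /Yp /Ym !nh !nh'.
move: (\sum_(_ | _) _) => S e1 e2.
have e3 : D`_(v0.1)`_(v0.2) * (C1 * (if b then 1 else -1) * h w + C2 * (if b' then 1 else -1) * h' w) = 0.
  move: (congr2 (fun x y => x - y) e2 e1) => /=; rewrite subrr => e3; apply: etrans e3.
  by clear; case: b; case: b'; rewrite /=; ring.
by move/eqP: e3; rewrite mulf_eq0 (negPf Dv0) => /eqP.
Qed.

(** After multiplication by the denominator D the sequence becomes a polynomial in the monomials, so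
    the convolution of D with the combined arrays vanishes past the size of M. *)
Lemma ratseq_linear_jump chi chi' h h' b b' P P' (C1 C2 x x' : C) (s s' : nat -> C) :
  edge chi h b P -> edge chi' h' b' P' ->
  expands t g (fun k => x - s k) chi -> expands t g (fun k => x' - s' k) chi' ->
  ratseq (fun k => C1 * s k + C2 * s' k) ->
  forall w, C1 * (if b then 1 else -1) * h w + C2 * (if b' then 1 else -1) * h' w = 0.
Proof.
move=> ed ed' ex ex' [N [D [D0 [k0 hk0]]]].
pose M := (C1 * x + C2 * x')%:P%:P * D - N.
have ec c : expands t g (fun=> c) (fun i j => (c%:P%:P : {poly {poly C}})`_i`_j).
  by apply: expands_eq (expands_poly t g c%:P%:P) => k; rewrite zevalC.
have e1 := expandsM g0 g1 (ec C1) ex; have e2 := expandsM g0 g1 (ec C2) ex'.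
have e3 := expandsM g0 g1 (expands_poly t g D) (expandsD e1 e2).
have e4 := expandsD e3 (expands_poly t g (- M)).
have f0 : flat t g (fun k => zev D k * (C1 * (x - s k) + C2 * (x' - s' k)) + zev (- M) k).
  apply: (@eventually0_flat _ _ _ g0 _ k0) => k /hk0 e.
  by rewrite /M zevalN zevalD zevalN zevalM zevalC -e; ring.
clearbody M.
have z0 := flat_expands0 lam1 lamt t2 wt_inj g0 g1 f0 e4.
have cc (c : C) (f : nat -> nat -> C) i j :
    \sum_(a < i.+1) \sum_(b0 < j.+1) (c%:P%:P : {poly {poly C}})`_a`_b0 * f (i - a)%N (j - b0)%N = c * f i j.
  rewrite big_ord_recl big_ord_recl /= !coefC /= !subn0 big1 ?addr0; last first.
    by move=> a _; rewrite !coefC /= mul0r.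
  by rewrite big1 ?addr0 // => a _; rewrite big1 // => a' _; rewrite coefC /= coef0 mul0r.
apply: (jump (I1 := size M) ed ed' D0) => i j Mi Mj.
have Mz : (- M)`_i = 0 by rewrite coefN nth_default ?oppr0.
have Mz' : (- M)`_i`_j = 0 by rewrite Mz coef0.
have := z0 i j; rewrite Mz' addr0 => zij; apply: etrans zij.
apply: eq_bigr => a _; apply: eq_bigr => c _; congr (_ * _).
by rewrite !cc.
Qed.

End RationalSequences.

(** * Convergent power series *)

Section Sums.
Import numFieldNormedType.Exports.
Variables (R : realType).
Local Notation C := R[i]%C.

(** With r = rho (1 + x), Bernoulli's inequality 1 + n x <= (1 + x)^n absorbs the linear factor. *)
Lemma linear_geometric (rho : R) : 0 < rho < 1 -> exists B r, [/\ 0 <= B, 0 < r < 1 &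
  forall n : nat, n.+1%:R * rho ^+ n <= B * r ^+ n].
Proof.
move=> /andP[r0 r1]; pose r := (1 + rho) / 2; pose x := r / rho - 1.
have x0 : 0 < x by rewrite subr_gt0 ltr_pdivlMr // mul1r /r; lra.
exists (1 + x^-1), r; split.
- by rewrite addr_ge0 // invr_ge0 ltW.
- by rewrite /r; apply/andP; split; lra.
move=> n; have -> : r = rho * (1 + x) by rewrite /x [1 + _]addrC subrK mulrC divfK // gt_eqF.
rewrite exprMn mulrCA mulrC ler_pM2l ?exprn_gt0 //.
have bern : 1 + n%:R * x <= (1 + x) ^+ n.
  elim: n => [|n IH]; first by rewrite mul0r addr0 expr0.
  rewrite exprS; apply: (@le_trans _ _ ((1 + x) * (1 + n%:R * x))); last first.
    by rewrite ler_pM2l //; lra.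
  rewrite -natr1; have : 0 <= x * (n%:R * x) by rewrite !mulr_ge0 // ltW.
  by lra.
apply: le_trans (ler_wpM2l _ bern); last by rewrite addr_ge0 // invr_ge0 ltW.
have xx : x^-1 * x = 1 by rewrite mulVf // gt_eqF.
have : 0 <= x^-1 by rewrite invr_ge0 ltW.
have : 0 <= n%:R * x by rewrite mulr_ge0 // ltW.
have -> : (1 + x^-1) * (1 + n%:R * x) = 1 + n%:R * x + x^-1 + n%:R * (x^-1 * x) by ring.
by rewrite xx mulr1 -natr1; lra.
Qed.

(** Convergence in epsilon form, so that the topology of the complex numbers enters only in
    [hecke_mahlerE]. *)
Definition sums (c : nat -> C) (al S : C) : Prop :=
  forall e : R, 0 < e -> exists N0, forall N, (N0 <= N)%N ->
    normc (S - \sum_(n < N) c n * al ^+ n) <= e.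

Lemma real_sums (u : nat -> R) (B r : R) : 0 < r < 1 -> (forall n, `|u n| <= B * r ^+ n) ->
  exists S, forall e, 0 < e -> exists N0, forall N, (N0 <= N)%N -> `|S - \sum_(n < N) u n| <= e.
Proof.
move=> /andP[r0 r1] ub.
have cv : cvgn (series u).
  apply: normed_cvg; apply: (@series_le_cvg _ _ (geometric B r)).
  - by move=> n; rewrite /= normr_ge0.
  - by move=> n; apply: le_trans (ub n).
  - by move=> n; apply: ub.
  - by apply: is_cvg_geometric_series; rewrite ger0_norm // ltW.
exists (limn (series u)) => e e0.
have /cvgrPdist_le /(_ e e0)[N0 _ h] := cv.
exists N0 => N hN; have := h N hN.
by rewrite /series /= big_mkord.
Qed.

Lemma normc_le_ReIm (x : C) : normc x <= `|complex.Re x| + `|complex.Im x|.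
Proof.
case: x => a b /=; rewrite -[leRHS]ger0_norm ?addr_ge0 // -sqrtr_sqr ler_wsqrtr //.
rewrite -(real_normK (num_real a)) -(real_normK (num_real b)).
have := normr_ge0 a; have := normr_ge0 b; move: `|a| `|b| => x y; nra.
Qed.

Lemma normc_ge_Re (x : C) : `|complex.Re x| <= normc x.
Proof. by case: x => a b /=; rewrite -sqrtr_sqr ler_wsqrtr // lerDl sqr_ge0. Qed.

Lemma normc_ge_Im (x : C) : `|complex.Im x| <= normc x.
Proof. by case: x => a b /=; rewrite -sqrtr_sqr ler_wsqrtr // lerDr sqr_ge0. Qed.

Lemma sums_exists (c : nat -> C) (al : C) (A : R) : 0 < normc al < 1 ->
  (forall n, normc (c n) <= A * n.+1%:R) -> exists S, sums c al S.
Proof.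
move=> a01 cA; have [B [r [B0 r01 hB]]] := linear_geometric a01.
have [a0 a1] := andP a01.
have A0 : 0 <= A by have := cA 0%N; rewrite mulr1; apply: le_trans; apply: normc_ge0.
have bd n : normc (c n * al ^+ n) <= A * B * r ^+ n.
  rewrite normcM normcX -[leRHS]mulrA; apply: le_trans (ler_wpM2l A0 (hB n)).
  by rewrite mulrA ler_wpM2r ?exprn_ge0 // ltW.
have [x hx] := real_sums r01 (fun n => le_trans (normc_ge_Re (c n * al ^+ n)) (bd n)).
have [y hy] := real_sums r01 (fun n => le_trans (normc_ge_Im (c n * al ^+ n)) (bd n)).
exists (x +i* y)%C => e e0; have e2 : 0 < e / 2 by rewrite divr_gt0.
have [N1 h1] := hx _ e2; have [N2 h2] := hy _ e2.
exists (maxn N1 N2) => N; rewrite geq_max => /andP[/h1 k1 /h2 k2].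
apply: le_trans (normc_le_ReIm _) _.
have -> : complex.Re ((x +i* y)%C - \sum_(n < N) c n * al ^+ n) = x - \sum_(n < N) complex.Re (c n * al ^+ n).
  by rewrite raddfB raddf_sum.
have -> : complex.Im ((x +i* y)%C - \sum_(n < N) c n * al ^+ n) = y - \sum_(n < N) complex.Im (c n * al ^+ n).
  by rewrite raddfB raddf_sum.
by rewrite [e]splitr lerD.
Qed.

Lemma eq_of_approx (x y : C) : (forall e : R, 0 < e -> normc (x - y) <= e) -> x = y.
Proof.
move=> h; apply/eqP; rewrite -subr_eq0 -normc_eq0 eq_le normc_ge0 andbT.
by apply/ler_addgt0Pl => e /h; rewrite addr0.
Qed.

Lemma sums_unique c al S S' : sums c al S -> sums c al S' -> S = S'.
Proof.
move=> h h'; apply: eq_of_approx => e e0; have e2 : 0 < e / 2 by rewrite divr_gt0.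
have [N1 h1] := h _ e2; have [N2 h2] := h' _ e2.
have k1 := h1 _ (leq_maxl N1 N2); have k2 := h2 _ (leq_maxr N1 N2).
move: k1 k2; set X := \sum_(_ < _) _ => k1 k2.
have -> : S - S' = (S - X) - (S' - X) by ring.
by apply: le_trans (ler_normcB _ _) _; rewrite [e]splitr lerD.
Qed.

Lemma sums_eq c c' al S : c =1 c' -> sums c al S -> sums c' al S.
Proof.
move=> e h x /h[N hN]; exists N => n /hN; congr (normc (_ - _) <= _).
by apply: eq_bigr => k _; rewrite e.
Qed.

Lemma sumsD c c' al S S' : sums c al S -> sums c' al S' -> sums (fun n => c n + c' n) al (S + S').
Proof.
move=> h h' e e0; have e2 : 0 < e / 2 by rewrite divr_gt0.
have [N1 h1] := h _ e2; have [N2 h2] := h' _ e2.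
exists (maxn N1 N2) => N; rewrite geq_max => /andP[/h1 k1 /h2 k2].
under eq_bigr => n _ do rewrite mulrDl.
rewrite big_split /= opprD addrACA [e]splitr; apply: le_trans (ler_normcD _ _) _.
exact: lerD.
Qed.

Lemma sumsN c al S : sums c al S -> sums (fun n => - c n) al (- S).
Proof.
move=> h e /h[N hN]; exists N => n /hN; rewrite -normcN.
by rewrite opprD; congr (normc (_ - _) <= _); rewrite -sumrN; apply: eq_bigr => k _; rewrite mulNr.
Qed.

Lemma sumsB c c' al S S' : sums c al S -> sums c' al S' -> sums (fun n => c n - c' n) al (S - S').
Proof. by move=> h h'; apply: sumsD h (sumsN h'). Qed.

Lemma sum_shift_ord (V : zmodType) (F : nat -> V) q N :
  \sum_(n < N) (if (n < q)%N then 0 else F (n - q)%N) = \sum_(n < N - q) F n.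
Proof.
case: (leqP N q) => Nq.
  rewrite (eqP (_ : N - q == 0)%N) ?big_ord0 // big1 // => n _.
  by rewrite (leq_trans (ltn_ord n)).
rewrite -(big_mkord xpredT (fun n => if (n < q)%N then 0 else F (n - q)%N)).
rewrite (big_cat_nat (n := q)) //=; last exact: ltnW.
rewrite big_nat_cond big1 ?add0r; last by move=> n /andP[/andP[_ ->]].
rewrite -{1}(add0n q) big_addn big_mkord; apply: eq_bigr => n _.
by rewrite ltnNge leq_addl /= addnK.
Qed.

Lemma sums_shift c al S q : normc al <= 1 -> sums c al S ->
  sums (fun n => if (n < q)%N then 0 else c (n - q)%N) al (al ^+ q * S).
Proof.
move=> a1 h e /h[N0 hN]; exists (N0 + q)%N => N hq.
have -> : \sum_(n < N) (if (n < q)%N then 0 else c (n - q)%N) * al ^+ n =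
   al ^+ q * \sum_(n < N - q) c n * al ^+ n.
  rewrite mulr_sumr -(sum_shift_ord (fun n => al ^+ q * (c n * al ^+ n))); apply: eq_bigr => n _.
  case: ltnP => nq; first by rewrite mul0r.
  by rewrite mulrCA -exprD subnKC.
rewrite -mulrBr normcM normcX; apply: le_trans (hN (N - q)%N _); last by lia.
by rewrite ler_piMl ?normc_ge0 // exprn_ile1 // normc_ge0.
Qed.

Lemma sums_fin c al N : (forall n, (N <= n)%N -> c n = 0) -> sums c al (\sum_(n < N) c n * al ^+ n).
Proof.
move=> c0 e e0; exists N => M NM.
rewrite (big_ord_widen M (fun n => c n * al ^+ n) NM).
rewrite [X in _ - X](bigID (fun n : 'I_M => (n < N)%N)) /= [X in _ - (_ + X)]big1 ?addr0; last first.
  by move=> n; rewrite -leqNgt => /c0 ->; rewrite mul0r.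
by rewrite subrr normc0 ltW.
Qed.

Lemma sums_geom al : 0 < normc al < 1 -> sums (fun=> 1) al (1 - al)^-1.
Proof.
move=> a01; have [a0 a1] := andP a01.
have al1 : 1 - al != 0.
  rewrite subr_eq0; apply: contraTneq a1 => <-; by rewrite normc1 ltxx.
have n0 : 0 < normc (1 - al) by rewrite normc_gt0.
move=> e e0; have en : 0 < e * normc (1 - al) by rewrite mulr_gt0.
have [|N hN] := expr_lt_eventually (q := normc al) _ en; first by rewrite ltW.
exists N => n Nn.
have -> : (1 - al)^-1 - \sum_(k < n) 1 * al ^+ k = al ^+ n / (1 - al).
  apply: (mulIf al1); rewrite mulrBl mulVf // mulfVK //.
  under eq_bigr => k _ do rewrite mul1r.
  have := subrX1 al n; rewrite -[1 - al]opprB mulrN [_ * (al - 1)]mulrC => <-; ring.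
have iv : normc (1 - al)^-1 = (normc (1 - al))^-1.
  by apply: (mulfI (lt0r_neq0 n0)); rewrite -normcM mulfV // normc1 mulfV // gt_eqF.
rewrite normcM iv normcX ler_pdivrMr //; apply: le_trans (ltW hN).
by rewrite ler_wiXn2l // ltW.
Qed.

Definition sums2 (f : nat -> nat -> C) (x y S : C) : Prop :=
  forall e : R, 0 < e -> exists N0, forall I J, (N0 <= I)%N -> (N0 <= J)%N ->
    normc (S - \sum_(i < I) \sum_(j < J) f i j * (x ^+ i * y ^+ j)) <= e.

Lemma sums2_unique f x y S S' : sums2 f x y S -> sums2 f x y S' -> S = S'.
Proof.
move=> h h'; apply: eq_of_approx => e e0; have e2 : 0 < e / 2 by rewrite divr_gt0.
have [N1 h1] := h _ e2; have [N2 h2] := h' _ e2.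
have k1 := h1 _ _ (leq_maxl N1 N2) (leq_maxl N1 N2); have k2 := h2 _ _ (leq_maxr N1 N2) (leq_maxr N1 N2).
move: k1 k2; set X := \sum_(_ < _) _ => k1 k2.
have -> : S - S' = (S - X) - (S' - X) by ring.
by apply: le_trans (ler_normcB _ _) _; rewrite [e]splitr lerD.
Qed.

Lemma sums2B f f' x y S S' : sums2 f x y S -> sums2 f' x y S' ->
  sums2 (fun i j => f i j - f' i j) x y (S - S').
Proof.
move=> h h' e e0; have e2 : 0 < e / 2 by rewrite divr_gt0.
have [N1 h1] := h _ e2; have [N2 h2] := h' _ e2.
exists (maxn N1 N2) => I J; rewrite !geq_max => /andP[i1 i2] /andP[j1 j2].
have k1 := h1 I J i1 j1; have k2 := h2 I J i2 j2.
have -> : \sum_(i < I) \sum_(j < J) (f i j - f' i j) * (x ^+ i * y ^+ j) =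
  \sum_(i < I) \sum_(j < J) f i j * (x ^+ i * y ^+ j) - \sum_(i < I) \sum_(j < J) f' i j * (x ^+ i * y ^+ j).
  rewrite -sumrB; apply: eq_bigr => i _; rewrite -sumrB; apply: eq_bigr => j _; ring.
move: k1 k2; set X := \sum_(_ < _) _; set Y := \sum_(_ < _) _ => k1 k2.
have -> : S - S' - (X - Y) = (S - X) - (S' - Y) by ring.
by apply: le_trans (ler_normcB _ _) _; rewrite [e]splitr lerD.
Qed.

Definition shift2 (a b : nat) (f : nat -> nat -> C) i j :=
  if (i < a)%N || (j < b)%N then 0 else f (i - a)%N (j - b)%N.

Lemma sums2_shift f x y S a b : normc x <= 1 -> normc y <= 1 -> sums2 f x y S ->
  sums2 (shift2 a b f) x y (x ^+ a * y ^+ b * S).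
Proof.
move=> x1 y1 h e /h[N0 hN]; exists (N0 + a + b)%N => I J hI hJ.
have -> : \sum_(i < I) \sum_(j < J) shift2 a b f i j * (x ^+ i * y ^+ j) =
  x ^+ a * y ^+ b * \sum_(i < I - a) \sum_(j < J - b) f i j * (x ^+ i * y ^+ j).
  rewrite mulr_sumr -(sum_shift_ord (fun i => x ^+ a * y ^+ b * \sum_(j < J - b) f i j * (x ^+ i * y ^+ j))).
  apply: eq_bigr => i _; rewrite /shift2; case: ltnP => ia /=; first by rewrite big1 // => j _; rewrite mul0r.
  rewrite mulr_sumr -(sum_shift_ord (fun j => x ^+ a * y ^+ b * (f (i - a)%N j * (x ^+ (i - a) * y ^+ j)))).
  apply: eq_bigr => j _; case: ltnP => jb; first by rewrite mul0r.
  have -> : x ^+ i = x ^+ a * x ^+ (i - a) by rewrite -exprD subnKC.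
  have -> : y ^+ j = y ^+ b * y ^+ (j - b) by rewrite -exprD subnKC.
  by ring.
rewrite -mulrBr !normcM !normcX; apply: le_trans (hN (I - a)%N (J - b)%N _ _); try lia.
by rewrite ler_piMl ?normc_ge0 // mulr_ile1 ?exprn_ge0 ?normc_ge0 // exprn_ile1 // normc_ge0.
Qed.

Lemma sums2_fin f x y N : (forall i j, (N <= i)%N || (N <= j)%N -> f i j = 0) ->
  sums2 f x y (\sum_(i < N) \sum_(j < N) f i j * (x ^+ i * y ^+ j)).
Proof.
move=> f0 e e0; exists N => I J NI NJ.
have tr (V : zmodType) (F : nat -> V) M : (N <= M)%N -> (forall n, (N <= n)%N -> F n = 0) ->
    \sum_(n < M) F n = \sum_(n < N) F n.
  move=> NM F0; rewrite [RHS](big_ord_widen M F NM).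
  rewrite [LHS](bigID (fun n : 'I_M => (n < N)%N)) /= [X in _ + X]big1 ?addr0 //.
  by move=> n; rewrite -leqNgt => /F0.
rewrite (tr _ (fun i => \sum_(j < J) f i j * (x ^+ i * y ^+ j))) //; last first.
  by move=> i Ni; rewrite big1 // => j _; rewrite f0 ?Ni ?mul0r.
rewrite (_ : \sum_(i < N) \sum_(j < J) _ = \sum_(i < N) \sum_(j < N) f i j * (x ^+ i * y ^+ j)).
  by rewrite subrr normc0 ltW.
apply: eq_bigr => i _; apply: (tr _ (fun j => f i j * (x ^+ i * y ^+ j))) => // j Nj.
by rewrite f0 ?Nj ?orbT // mul0r.
Qed.

Lemma sum_ord_geom_le (rho : R) N : 0 < rho < 1 -> \sum_(i < N) rho ^+ i <= (1 - rho)^-1.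
Proof.
move=> /andP[r0 r1]; have n0 : 0 < 1 - rho by lra.
rewrite -(ler_pM2r n0) mulVf ?gt_eqF //.
have := subrX1 rho N; rewrite -[1 - rho]opprB mulrN [_ * (rho - 1)]mulrC => <-.
by rewrite opprB lerBlDr lerDl exprn_ge0 // ltW.
Qed.

(* All monomials outside the square [0, I)^2 have exponent at least I (P - 1) + i + j. *)
Lemma tail_bound (rho : R) (P Q I N : nat) (b : nat -> nat -> bool) : 0 < rho < 1 -> (0 < P)%N -> (P <= Q)%N ->
  (forall i j, b i j -> (I <= i)%N || (I <= j)%N) ->
  \sum_(i < N) \sum_(j < N) (b i j)%:R * rho ^+ (i * P + j * Q) <=
    rho ^+ (I * P.-1) * (1 - rho)^-1 ^+ 2.
Proof.
move=> r01 P0 PQ hb; have [r0 r1] := andP r01.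
apply: (@le_trans _ _ (\sum_(i < N) \sum_(j < N) rho ^+ (I * P.-1) * (rho ^+ i * rho ^+ j))).
  apply: ler_sum => i _; apply: ler_sum => j _.
  case bij : (b i j); last by rewrite mul0r !mulr_ge0 ?exprn_ge0 // ltW.
  rewrite mul1r -!exprD ler_wiXn2l ?(ltW r0) ?(ltW r1) //.
  case: P P0 PQ => // P _ PQ /=; have := hb i j bij.
  move: (nat_of_ord i) (nat_of_ord j) => x y; case/orP => h; nia.
under eq_bigr => i _ do rewrite -mulr_sumr -mulr_sumr.
rewrite -mulr_sumr ler_wpM2l ?exprn_ge0 ?(ltW r0) //.
rewrite -mulr_suml expr2 ler_pM //; try exact: sum_ord_geom_le.
- by apply: sumr_ge0 => i _; rewrite exprn_ge0 // ltW.
- by apply: sumr_ge0 => i _; rewrite exprn_ge0 // ltW.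
Qed.

End Sums.

(* The value at [x] of the Hecke-Mahler series of the rational number [p / q]. *)
Definition fr (F : fieldType) (p : int) (q : nat) (x : F) : F :=
  (\sum_(n < q) ((n%:Z * p) %/ q%:Z)%Z%:~R * x ^+ n + p%:~R * x ^+ q / (1 - x)) / (1 - x ^+ q).

(** * Irrational cones and their automorphisms *)

Section RationalSlope.
Variable R : realType.
Local Notation C := R[i]%C.

Lemma divz_bound (x : int) (q : nat) : (0 < q)%N -> `|(x %/ q%:Z)%Z| <= `|x|.
Proof.
move=> q0; have q0' : 0 < q%:Z by [].
rewrite ler_norml; apply/andP; split; first by rewrite lez_divRL //; nia.
by rewrite -ltzD1 ltz_divLR //; nia.
Qed.

Lemma one_subX_neq0 (al : C) q : normc al < 1 -> (0 < q)%N -> 1 - al ^+ q != 0.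
Proof.
move=> a1 q0; rewrite subr_eq0; apply/negP => /eqP e.
have : normc (al ^+ q) < 1 by rewrite normcX exprn_ilt1 ?normc_ge0 //; case: q q0 {e}.
by rewrite -e normc1 ltxx.
Qed.

(** The coefficients satisfy c_(n+q) = c_n + p, so S - al^q S consists of the first q terms and p
    times a shifted geometric series. *)
Lemma sums_fr (al : C) p q : 0 < normc al < 1 -> (0 < q)%N ->
  sums (fun n => ((n%:Z * p) %/ q%:Z)%Z%:~R) al (fr p q al).
Proof.
move=> a01 q0; have [a0 a1] := andP a01.
pose c n : C := ((n%:Z * p) %/ q%:Z)%Z%:~R.
have [|S hS] := @sums_exists R c al `|p|%:~R a01.
  move=> n; rewrite normc_int (_ : n.+1%:R = n.+1%:Z%:~R) // -intrM ler_int.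
  by apply: le_trans (divz_bound _ q0) _; rewrite normrM; nia.
suff -> : fr p q al = S by [].
have q1 := one_subX_neq0 a1 q0.
have h1 := sumsB hS (sums_shift q (ltW a1) hS).
have h2 : sums (fun n => (if (n < q)%N then c n else 0) + (if (n < q)%N then 0 else p%:~R)) al (S - al ^+ q * S).
  apply: sums_eq h1 => n; rewrite /c; case: ltnP => nq; first by rewrite subr0 addr0.
  rewrite add0r -intrB; congr (_%:~R); have q0' : q%:Z != 0 by lia.
  have {1}-> : n%:Z * p = p * q%:Z + (n - q)%N%:Z * p by rewrite -(subnK nq) PoszD addnK; ring.
  by rewrite divzMDl // addrK.
have h3 : sums (fun n => if (n < q)%N then 0 else p%:~R) al (p%:~R * (al ^+ q / (1 - al))).
  have := sums_shift q (ltW a1) (sums_geom a01) => h e e0.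
  have e1 : 0 < e / (normc (p%:~R : C) + 1) by rewrite divr_gt0 // ltr_wpDl // normc_ge0.
  have [N hN] := h _ e1; exists N => n /hN.
  rewrite ler_pdivlMr ?ltr_wpDl ?normc_ge0 // => hn.
  have -> : \sum_(k < n) (if (k < q)%N then 0 else p%:~R) * al ^+ k = p%:~R * \sum_(k < n) (if (k < q)%N then 0 else 1) * al ^+ k.
    by rewrite mulr_sumr; apply: eq_bigr => k _; case: ifP => _; rewrite ?mul0r ?mulr0 ?mul1r.
  rewrite -mulrBr normcM mulrC; apply: le_trans hn.
  by rewrite ler_wpM2l ?normc_ge0 // lerDl.
have h4 := sumsD (@sums_fin R (fun n => if (n < q)%N then c n else 0) al q _) h3.
have e := sums_unique (h4 _) h2; rewrite /fr.
have {}e : \sum_(n < q) (if (n < q)%N then c n else 0) * al ^+ n +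
    p%:~R * (al ^+ q / (1 - al)) = S - al ^+ q * S by apply: e => n; rewrite ltnNge => ->.
apply: (mulIf q1); rewrite divfK // mulrBr mulr1 [S * _]mulrC -e mulrA; congr (_ + _).
by apply: eq_bigr => n _; rewrite ltn_ord.
Qed.

End RationalSlope.

(** An automorph of w: an integral matrix of determinant 1 with eigenvector (1, w) and eigenvalue
    [plam]. The vector [u0] = (q, p) has slope below w, and [u0_narrow] keeps it close enough to the
    line for the whole cone in between to have positive coordinates [co]. *)
Record pell (R : realType) (w : R) := Pell {
  a00 : int; a01 : int; a10 : int; a11 : int; plam : R; ptr : nat; u0 : int * int;
  pdet : a00 * a11 - a01 * a10 = 1;
  plam1 : 1 < plam;
  peig1 : a00%:~R + a01%:~R * w = plam;
  peig2 : a10%:~R + a11%:~R * w = plam * w;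
  ptrE : a00 + a11 = ptr%:Z;
  u0_gt0 : 0 < u0.1;
  u0_lin : 0 < u0.1%:~R * w - u0.2%:~R;
  u0_narrow : `|a01|%:~R * (u0.1%:~R * w - u0.2%:~R) < (plam - 1) * u0.1%:~R }.

Section System.
Variables (R : realType) (w : R) (S : pell w).
Hypothesis w_irr : forall x y : int, x%:~R * w = y%:~R -> x = 0.
Local Notation C := R[i]%C.
Local Notation lam := (plam S).
Local Notation t := (ptr S).
Local Notation u0 := (u0 S).
Local Notation P := (pexp t).
Local Notation Q := (qexp t).
Local Notation m00 := (a00 S).
Local Notation m01 := (a01 S).
Local Notation m10 := (a10 S).
Local Notation m11 := (a11 S).

Let lam0 : 0 < lam. Proof. by apply: lt_trans (plam1 S). Qed.
Let lamn0 : lam != 0. Proof. by rewrite gt_eqF. Qed.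

Lemma w_irr0 (x y : int) : x%:~R * w = y%:~R -> x = 0 /\ y = 0.
Proof.
move=> e; have x0 := w_irr e; split=> //; move: e.
by rewrite x0 mul0r => /esym/eqP; rewrite intr_eq0 => /eqP.
Qed.

(** Otherwise the eigenvalue would be the integer a00 > 1, which would divide the determinant 1. *)
Lemma m01_neq0 : m01 != 0.
Proof.
apply/eqP => m0; have := peig1 S; rewrite m0 mul0r addr0 => e1.
have := plam1 S; rewrite -e1 (_ : 1 = 1%:~R) // ltr_int => h.
by have := pdet S; rewrite m0 mul0r subr0; move: (a00 S) (a11 S) h => x y h xy; case: (lerP y 0) => hy; nia.
Qed.

Lemma plamt : lam ^+ 2 + 1 = t%:R * lam.
Proof.
have d : m00%:~R * m11%:~R - m01%:~R * m10%:~R = 1 :> R by rewrite -!intrM -intrB pdet.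
have tr : (t%:R : R) = m00%:~R + m11%:~R by rewrite -intrD ptrE.
rewrite tr; have e1 := peig1 S; have e2 := peig2 S.
have : m01%:~R * (m10%:~R + m11%:~R * w) = lam * (m01%:~R * w) by rewrite e2; ring.
have -> : m01%:~R * w = lam - m00%:~R by rewrite -e1; ring.
move=> h; have : m01%:~R * m10%:~R + m11%:~R * (m01%:~R * w) = lam * (lam - m00%:~R) by rewrite -h; ring.
have -> : m01%:~R * w = lam - m00%:~R by rewrite -e1; ring.
by move: d; move: (m00%:~R) (m01%:~R) (m10%:~R) (m11%:~R) => x y z v; nra.
Qed.

Lemma ptr_gt2 : (2 < t)%N.
Proof.
have e := trace_lam (plam1 S) plamt.
have := plam1 S => l1; have : 0 < lam^-1 by rewrite invr_gt0.
have := mulfV lamn0; move: e; move: (lam^-1) => u e lu u00.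
have : 2 < t%:R :> R by rewrite e; nra.
by rewrite (ltr_nat R).
Qed.

Lemma plam_irr (x y : int) : x%:~R * lam = y%:~R -> x = 0.
Proof.
rewrite -(peig1 S) => e.
have /w_irr/eqP : (x * m01)%:~R * w = (y - x * m00)%:~R by rewrite intrB !intrM -e; ring.
by rewrite mulf_eq0 (negPf m01_neq0) orbF => /eqP.
Qed.

(** The automorph acting on lattice vectors (n, m). [ts] is its inverse, and [lin], which vanishes
    on the line of slope w, is contracted by it. *)
Definition st (u : int * int) : int * int := (m00 * u.1 + m01 * u.2, m10 * u.1 + m11 * u.2).
Definition ts (u : int * int) : int * int := (m11 * u.1 - m01 * u.2, m00 * u.2 - m10 * u.1).
Definition lin (u : int * int) : R := u.1%:~R * w - u.2%:~R.
Definition cross (u v : int * int) : int := u.1 * v.2 - u.2 * v.1.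
(** The second coordinate is (st u).1 - u.1. In these coordinates the first component of the
    iterates of u is a combination of P_k and Q_k ([coordE]). The image is a sublattice of index
    |a01|, hence the membership test in [chi]. *)
Definition co (u : int * int) : int * int := (u.1, (m00 - 1) * u.1 + m01 * u.2).
Definition uc (v : int * int) : int * int := (v.1, ((v.2 - (m00 - 1) * v.1) %/ m01)%Z).

Lemma stK : cancel st ts.
Proof.
move=> [x y]; rewrite /st /ts /=; have := pdet S.
move: m00 m01 m10 m11 => a b c d e; congr (_, _).
  by rewrite -[RHS]mul1r -e; ring.
by rewrite -[RHS]mul1r -e; ring.
Qed.

Lemma tsK : cancel ts st.
Proof.
move=> [x y]; rewrite /st /ts /=; have := pdet S.
move: m00 m01 m10 m11 => a b c d e; congr (_, _).
  by rewrite -[RHS]mul1r -e; ring.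
by rewrite -[RHS]mul1r -e; ring.
Qed.

Lemma iter_stK k : cancel (iter k st) (iter k ts).
Proof. by elim: k => // k IH u; rewrite [iter k.+1 st u]iterS iterSr stK IH. Qed.

Lemma iter_tsK k : cancel (iter k ts) (iter k st).
Proof. by elim: k => // k IH u; rewrite [iter k.+1 ts u]iterS iterSr tsK IH. Qed.

Lemma lin_st u : lam * lin (st u) = lin u.
Proof.
have d : m00%:~R * m11%:~R - m01%:~R * m10%:~R = 1 :> R by rewrite -!intrM -intrB pdet.
have e1 := peig1 S; have e2 := peig2 S.
case: u => x y; rewrite /lin /st /= !intrD !intrM.
have -> : lam * ((m00%:~R * x%:~R + m01%:~R * y%:~R) * w - (m10%:~R * x%:~R + m11%:~R * y%:~R)) =
   (m00%:~R * x%:~R + m01%:~R * y%:~R) * (lam * w) - (m10%:~R * x%:~R + m11%:~R * y%:~R) * lam by ring.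
rewrite -e2 -e1; move: d; move: (m00%:~R) (m01%:~R) (m10%:~R) (m11%:~R) (x%:~R) (y%:~R) => a b c d' x' y' d.
have -> : x' * w - y' = (a * d' - b * c) * (x' * w - y') by rewrite d mul1r.
by ring.
Qed.

Lemma cross_st u v : cross (st u) (st v) = cross u v.
Proof.
have := pdet S; rewrite /cross /st /=; move: m00 m01 m10 m11 => a b c d e.
by rewrite -[RHS]mul1r -e; ring.
Qed.

Lemma cross_iter k u v : cross (iter k st u) (iter k st v) = cross u v.
Proof. by elim: k => // k IH; rewrite !iterS cross_st. Qed.

Lemma lin_iter k u : (0 < lin (iter k st u)) = (0 < lin u).
Proof. by elim: k => // k IH; rewrite iterS -IH -[in RHS]lin_st pmulr_rgt0. Qed.

Lemma crossE u v : (cross u v)%:~R = v.1%:~R * lin u - u.1%:~R * lin v :> R.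
Proof. by rewrite /cross /lin intrB !intrM; ring. Qed.

Lemma co_st u : co (st u) = tz t (co u).
Proof.
have d := pdet S; have e := ptrE S.
rewrite /co /st /tz /= -e; move: d; move: m00 m01 m10 m11 => a b c d' d.
congr (_, _); first by ring.
have -> : b * (c * u.1 + d' * u.2) = (a * d' - 1) * u.1 + b * d' * u.2.
  by rewrite -d; ring.
by ring.
Qed.

Lemma ellz_co u : ellz lam (co u) = m01%:~R * lin u.
Proof. by rewrite /ellz /ell /co /lin /= -(peig1 S) !(intrD, intrB, intrM); ring. Qed.

Lemma co_inj u v : co u = co v -> u = v.
Proof.
case: u v => [x y] [x' y'] [-> /addrI /(mulfI m01_neq0) ->] //.
Qed.

Lemma coK : cancel co uc.
Proof. by move=> [x y]; rewrite /uc /co /= addrC addKr mulKz ?m01_neq0. Qed.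

Lemma coordE k u : (iter k.+1 st u).1 = (co u).1 * (P k)%:Z + (co u).2 * (Q k)%:Z.
Proof.
have t2 := ptr_gt2; elim: k u => [|k IH] u.
  by rewrite /co /= !mulr1; ring.
rewrite iterSr IH co_st /tz /= pexpS qexpS !PoszD !PoszM.
rewrite -!subzn //; try lia; try by apply: ltnW.
Qed.

(** [cone] lies strictly between the ray of u0 and the irrational line; [slice] is the rational cone
    between the rays of u0 and st u0, closed on the latter side. *)
Definition cone u : bool := (0 < lin u) && (0 < cross u0 u).
Definition slice u : bool := (0 < cross u0 u) && (cross (st u0) u <= 0).

Lemma lin_u0 : 0 < lin u0. Proof. exact: u0_lin. Qed.

Lemma narrow_pos u : 0 < u.1 -> `|m01|%:~R * lin u < (lam - 1) * u.1%:~R -> 0 <= lin u -> 0 < (co u).2.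
Proof.
move=> u1 h l0; rewrite -(ltr_int R); have := ellz_co u; rewrite /ellz /ell /= => e.
have : m01%:~R * lin u <= `|m01|%:~R * lin u by rewrite ler_wpM2r // ler_int ler_norm.
rewrite -e; lra.
Qed.

Lemma u0_co2 : 0 < (co u0).2.
Proof. by apply: narrow_pos; [exact: u0_gt0|exact: u0_narrow|exact: ltW lin_u0]. Qed.

Lemma st_u0_1 : u0.1 < (st u0).1.
Proof.
have := coordE 0 u0; rewrite /= !mulr1 => ->.
by rewrite ltrDl u0_co2.
Qed.

Lemma kappa_gt0 : 0 < cross u0 (st u0).
Proof.
rewrite -(ltr_int R) crossE; have l0 := lin_u0; have l1 := lin_st u0.
have := st_u0_1; rewrite -(ltr_int R); have := u0_gt0 S; rewrite -(ltr_int R) /= => q0 q1.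
have ls : 0 < lin (st u0) by have := lin_iter 1 u0; rewrite /= l0.
have := plam1 S; rewrite -l1 in l0 *; move: lin_u0; rewrite -l1; move: (lin (st u0)) ls => l ls _ l11.
rewrite subr_gt0; apply: (@lt_le_trans _ _ (u0.1%:~R * (lam * l))).
  by rewrite ltr_pM2l // ltr_pMl.
by rewrite ler_wpM2r ?ltW // mulr_gt0.
Qed.

(** Relative to its first coordinate, a point of the cone is closer to the line than u0 is, so it
    inherits the narrowness of u0. *)
Lemma cone_pos u : cone u -> 0 < (co u).1 /\ 0 < (co u).2.
Proof.
move=> /andP[l0]; rewrite -(ltr_int R) crossE => c0.
have q0 : 0 < u0.1%:~R :> R by rewrite (ltr_int R 0) u0_gt0.
have lu0 := lin_u0.
have u1 : 0 < u.1%:~R :> R.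
  have h : 0 < u.1%:~R * lin u0 by have := mulr_gt0 q0 l0; lra.
  by rewrite -(pmulr_lgt0 _ lu0).
have u1' : 0 < u.1 by rewrite -(ltr_int R).
split=> //; apply: narrow_pos => //; last exact: ltW.
have nr := u0_narrow S; rewrite -/(lin u0) in nr.
have m0 : 0 <= `|m01|%:~R :> R by rewrite ler0z.
rewrite -(ltr_pM2r q0); apply: (@le_lt_trans _ _ (u.1%:~R * (`|m01|%:~R * lin u0))).
  rewrite [leRHS]mulrCA -mulrA ler_wpM2l //; lra.
by rewrite mulrAC [ltRHS]mulrC ltr_pM2l.
Qed.

Lemma kappa_decomp u : cross u0 (st u0) * (co u).1 = cross u0 u * (co (st u0)).1 - cross (st u0) u * (co u0).1 /\
  cross u0 (st u0) * (co u).2 = cross u0 u * (co (st u0)).2 - cross (st u0) u * (co u0).2.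
Proof. by rewrite /cross /co /=; split; ring. Qed.

Lemma slice_cone u : slice u -> cone u.
Proof.
move=> /andP[c0 c1]; rewrite /cone c0 andbT.
have k0 := kappa_gt0; rewrite -(ltr_int R) in k0.
have e : (cross u0 (st u0))%:~R * lin u = (cross u0 u)%:~R * lin (st u0) - (cross (st u0) u)%:~R * lin u0.
  by rewrite !crossE; ring.
have ls : 0 < lin (st u0) by have := lin_iter 1 u0; rewrite /= lin_u0.
rewrite -(pmulr_rgt0 _ k0) e ltr_wpDr ?mulr_gt0 // ?ltr0z //.
by rewrite -mulNr mulr_ge0 ?(ltW lin_u0) // -intrN ler0z oppr_ge0.
Qed.

Definition chi (cn : pred (int * int)) (i j : int) : bool := (co (uc (i, j)) == (i, j)) && cn (uc (i, j)).

Lemma chi_co cn u : chi cn (co u).1 (co u).2 = cn u.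
Proof. by rewrite /chi -surjective_pairing coK eqxx. Qed.

Lemma chiP cn i j : chi cn i j -> exists2 u, co u = (i, j) & cn u.
Proof. by move=> /andP[/eqP e h]; exists (uc (i, j)). Qed.

(** The integers m in the interval are the points (n, m); pulled back by k + 1 steps of the
    automorph they become the cone points whose exponent is n. The proof compares two lists without
    repetition. *)
Lemma count_chi (cn : pred (int * int)) k (n N : nat) (a b : int) :
  (forall u, cn u -> 0 < (co u).1 /\ 0 < (co u).2) -> a <= b ->
  (forall m : int, (a < m <= b) = cn (iter k.+1 ts (n%:Z, m))) -> (n < N)%N ->
  (\sum_(i < N) \sum_(j < N) (chi cn i j && (i * P k + j * Q k == n)%N))%N%:Z = b - a.
Proof.
move=> pos ab hm nN; have [Pk PQ] := pq_ge k ptr_gt2.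
pose pt (r : nat) := co (iter k.+1 ts (n%:Z, a + 1 + r%:Z)).
pose D := `|b - a|%N.
have eD : b - a = D%:Z by rewrite /D; lia.
pose s1 := [seq (`|(pt r).1|%N, `|(pt r).2|%N) | r <- iota 0 D].
pose s2 := [seq x <- [seq (i, j) | i <- iota 0 N, j <- iota 0 N] |
  chi cn x.1%:Z x.2%:Z && (x.1 * P k + x.2 * Q k == n)%N].
have inr r : (r < D)%N -> cn (iter k.+1 ts (n%:Z, a + 1 + r%:Z)).
  by move=> rD; rewrite -hm; lia.
have ptN r : (r < D)%N -> (`|(pt r).1|%N%:Z, `|(pt r).2|%N%:Z) = pt r.
  by move=> /inr /pos[h1 h2]; rewrite [RHS]surjective_pairing /pt; congr (_, _); lia.
have sz : size s1 = size s2.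
  apply/perm_size/uniq_perm.
  - rewrite map_inj_in_uniq ?iota_uniq // => r r'; rewrite !mem_iota /= !add0n => rD r'D [e1 e2].
    have : pt r = pt r' by rewrite -ptN // -[RHS]ptN // e1 e2.
    by move/co_inj/(can_inj (iter_tsK k.+1)) => -[]; lia.
  - rewrite filter_uniq // allpairs_uniq ?iota_uniq //.
    by move=> [x y] [x' y'] _ _.
  move=> [i j]; rewrite mem_filter /=; apply/idP/idP.
    move=> /mapP[r]; rewrite mem_iota add0n /= => rD [ei ej].
    have e : (i%:Z, j%:Z) = pt r by rewrite ei ej ptN.
    have eij : (i%:Z, j%:Z) = co (iter k.+1 ts (n%:Z, a + 1 + r%:Z)) by [].
    have c : chi cn i j by rewrite -[i%:Z]/(i%:Z, j%:Z).1 -[j%:Z]/(i%:Z, j%:Z).2 eij chi_co inr.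
    rewrite c /=.
    have en : (i * P k + j * Q k = n)%N.
      have := coordE k (iter k.+1 ts (n%:Z, a + 1 + r%:Z)); rewrite iter_tsK -eij /= => en.
      by clear -en; lia.
    rewrite en eqxx /=; apply/allpairsP; exists (i, j); rewrite !mem_iota /= !add0n.
    by split=> //; clear -en nN Pk PQ; nia.
  move=> /andP[/andP[c /eqP en] _]; have [u eu cu] := chiP c.
  have e1 : (iter k.+1 st u).1 = n%:Z by rewrite coordE eu /= -en PoszD !PoszM.
  pose m := (iter k.+1 st u).2.
  have eu' : u = iter k.+1 ts (n%:Z, m) by rewrite -e1 -surjective_pairing iter_stK.
  have : a < m <= b by rewrite hm -eu'.
  move=> /andP[am mb]; pose r0 : int := m - a - 1; apply/mapP; exists `|r0|%N.
    by rewrite mem_iota /= add0n /r0; clear -am mb eD; lia.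
  have em : a + 1 + `|r0|%N%:Z = m by rewrite /r0; clear -am; lia.
  by rewrite /pt em -eu' eu.
rewrite eD; congr Posz; rewrite -[RHS](size_iota 0) -(size_map (fun r => (`|(pt r).1|%N, `|(pt r).2|%N))) -/s1 sz.
rewrite -sum1_size /s2 big_filter [RHS]big_mkcond big_allpairs /=.
have io : iota 0 N = index_iota 0 N by rewrite /index_iota subn0.
rewrite io big_mkord; apply: eq_bigr => i _.
by rewrite big_mkord; apply: eq_bigr => j _; case: (_ && _).
Qed.

Lemma sum2_widen (F : nat -> nat -> C) I J N : (I <= N)%N -> (J <= N)%N ->
  \sum_(i < I) \sum_(j < J) F i j =
  \sum_(i < N) \sum_(j < N) (if (i < I)%N && (j < J)%N then F i j else 0).
Proof.
move=> IN JN; rewrite (big_ord_widen N (fun i => \sum_(j < J) F i j) IN) big_mkcond.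
apply: eq_bigr => i _; case: ifP => iI /=; last by rewrite big1.
by rewrite (big_ord_widen N (fun j => F i j) JN) big_mkcond.
Qed.

Lemma sum_pick (b : bool) (e N : nat) (x : C) :
  \sum_(n < N) (b && (e == n))%:R * x ^+ n = (b && (e < N)%N)%:R * x ^+ e.
Proof.
case: b => /=; last by rewrite mul0r big1 // => n _; rewrite mul0r.
case: ltnP => eN; last first.
  by rewrite mul0r big1 // => n _; rewrite gtn_eqF ?mul0r // (leq_trans (ltn_ord n)).
rewrite (bigD1 (Ordinal eN)) //= eqxx big1 ?addr0 // => n ne.
by rewrite (_ : (e == n) = false) ?mul0r //; apply/negP => /eqP en; case/eqP: ne; apply: val_inj.
Qed.

(** Grouping lattice points by exponent turns the series in one variable into a double sum, and the
    error comes from points outside the square. The bound is uniform in the truncations I' and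
    J'. *)
Lemma cone_expansion (cn : pred (int * int)) k (d : nat -> int) (al r : C) : 0 < normc al < 1 ->
  (forall n N, (n < N)%N ->
    (\sum_(i < N) \sum_(j < N) (chi cn i j && (i * P k + j * Q k == n)%N))%N%:Z = d n) ->
  sums (fun n => (d n)%:~R) al r -> forall I I' J', (I <= I')%N -> (I <= J')%N ->
  normc (r - \sum_(i < I') \sum_(j < J') (chi cn i j)%:R * ((al ^+ P k) ^+ i * (al ^+ Q k) ^+ j)) <=
    normc al ^+ (I * (P k).-1) * (1 - normc al)^-1 ^+ 2.
Proof.
move=> a01 hd hr I I' J' II' IJ'; have [a0 a1] := andP a01.
have [Pk PQ] := pq_ge k ptr_gt2.
apply/ler_addgt0Pl => e e0; have [N0 hN0] := hr e e0.
pose N := (N0 + I' * P k + J' * Q k + I' + J').+1.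
have eN : (N0 <= N)%N by rewrite /N; lia.
have PS : \sum_(n < N) (d n)%:~R * al ^+ n =
    \sum_(i < N) \sum_(j < N) (chi cn i j && (i * P k + j * Q k < N)%N)%:R * al ^+ (i * P k + j * Q k).
  have E (n : 'I_N) : (d n)%:~R * al ^+ n =
      \sum_(i < N) \sum_(j < N) (chi cn i j && (i * P k + j * Q k == n)%N)%:R * al ^+ n.
    rewrite -(hd n N (ltn_ord n)) -pmulrn natr_sum mulr_suml; apply: eq_bigr => i _.
    by rewrite natr_sum mulr_suml.
  under eq_bigr => n _ do rewrite E.
  rewrite exchange_big; apply: eq_bigr => i _; rewrite exchange_big; apply: eq_bigr => j _.
  exact: sum_pick.
have h1 := hN0 N eN; rewrite PS in h1.
have eE i j : (al ^+ P k) ^+ i * (al ^+ Q k) ^+ j = al ^+ (i * P k + j * Q k).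
  by rewrite -!exprM -exprD mulnC [(Q k * _)%N]mulnC.
rewrite (@sum2_widen (fun i j => (chi cn i j)%:R * ((al ^+ P k) ^+ i * (al ^+ Q k) ^+ j)) I' J' N); try by rewrite /N; lia.
pose b i j := chi cn i%:Z j%:Z && (i * P k + j * Q k < N)%N && ~~ ((i < I')%N && (j < J')%N).
have dE : \sum_(i < N) \sum_(j < N) (chi cn i j && (i * P k + j * Q k < N)%N)%:R * al ^+ (i * P k + j * Q k) -
   \sum_(i < N) \sum_(j < N) (if (i < I')%N && (j < J')%N then
      (chi cn i j)%:R * ((al ^+ P k) ^+ i * (al ^+ Q k) ^+ j) else 0) =
   \sum_(i < N) \sum_(j < N) (b i j)%:R * al ^+ (i * P k + j * Q k) :> C.
  rewrite -sumrB; apply: eq_bigr => i _; rewrite -sumrB; apply: eq_bigr => j _.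
  rewrite eE /b; case: ifP => [/andP[iI jJ]|_] /=; last by rewrite subr0 andbT.
  rewrite andbF mul0r; case: (chi cn i j) => /=; last by rewrite !mul0r subrr.
  rewrite (_ : (_ < _)%N) ?subrr // /N ltnS.
  have : (i * P k <= I' * P k)%N by rewrite leq_mul2r (ltnW iI) orbT.
  have : (j * Q k <= J' * Q k)%N by rewrite leq_mul2r (ltnW jJ) orbT.
  by move=> h2 h3; apply: leq_trans (leq_add h3 h2) _; clear; lia.
move: h1 dE; set X := \sum_(i < N) _; set Y := \sum_(i < N) \sum_(j < N) (if _ then _ else _) => h1 dE.
have -> : r - Y = (r - X) + (X - Y) by ring.
apply: le_trans (ler_normcD _ _) _; rewrite lerD // dE.
apply: le_trans (ler_normc_sum _ _ _) _.
apply: le_trans (@tail_bound R (normc al) (P k) (Q k) I N b a01 _ PQ _).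
- apply: ler_sum => i _; apply: le_trans (ler_normc_sum _ _ _) _; apply: ler_sum => j _.
  by rewrite normcM normcX normc_nat.
- by lia.
- move=> i j /andP[_]; rewrite negb_and -!leqNgt => /orP[] h; apply/orP; [left|right]; lia.
Qed.

(** The vector (q_k, p_k) is st^(k+1) u0; the shift by one matches [coordE]. *)
Definition qk k : nat := `|(iter k.+1 st u0).1|%N.
Definition pk k : int := (iter k.+1 st u0).2.

Lemma qkE k : (qk k)%:Z = (iter k.+1 st u0).1.
Proof.
rewrite /qk coordE; have := u0_co2; have : 0 < (co u0).1 := u0_gt0 S.
by move: (co u0) => [x y] /= x0 y0; nia.
Qed.

Lemma qk_nat k : (qk k = `|(co u0).1| * P k + `|(co u0).2| * Q k)%N.
Proof.
have := qkE k; rewrite coordE; have := u0_co2; have : 0 < (co u0).1 := u0_gt0 S.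
by move: (co u0) => [x y] /= x0 y0; nia.
Qed.

Lemma qk_gt0 k : (0 < qk k)%N.
Proof.
have [Pk _] := pq_ge k ptr_gt2; rewrite qk_nat.
have : 0 < (co u0).1 := u0_gt0 S.
by move: (co u0) => [x y] /= x0; nia.
Qed.

Lemma cross_ts k u v : cross u (iter k ts v) = cross (iter k st u) v.
Proof. by rewrite -(cross_iter k) iter_tsK. Qed.

Lemma lin_ts k v : (0 < lin (iter k ts v)) = (0 < lin v).
Proof. by rewrite -(lin_iter k) iter_tsK. Qed.

Lemma floor_lt (n : nat) (k : nat) (m : int) :
  (((n%:Z * pk k) %/ (qk k)%:Z)%Z < m) = (0 < cross u0 (iter k.+1 ts (n%:Z, m))).
Proof.
have q0 : 0 < (qk k)%:Z by rewrite (_ : 0 < _) // ltz_nat qk_gt0.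
rewrite ltz_divLR // cross_ts -subr_gt0; congr (0 < _); rewrite /cross qkE /pk.
by move: (iter k.+1 st u0) => [x y] /=; ring.
Qed.

Lemma lin_pk k : 0 < (qk k)%:R * w - (pk k)%:~R.
Proof.
have := lin_iter k.+1 u0; rewrite lin_u0 => h.
by move: h; rewrite /lin -qkE.
Qed.

Lemma floor_le n k : ((n%:Z * pk k) %/ (qk k)%:Z)%Z <= Num.floor (n%:R * w).
Proof.
have q0 : 0 < (qk k)%:R :> R by rewrite ltr0n qk_gt0.
rewrite real_floor_ge_int ?num_real //.
rewrite -(ler_pM2r q0).
have h : ((n%:Z * pk k) %/ (qk k)%:Z)%Z * (qk k)%:Z <= n%:Z * pk k.
  by rewrite -lez_divRL // ltz_nat qk_gt0.
apply: (@le_trans _ _ (n%:Z * pk k)%:~R).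
  by rewrite -(ler_int R) intrM in h; exact: h.
rewrite intrM -[leRHS]mulrA ler_wpM2l //.
by have := lin_pk k; rewrite mulrC; lra.
Qed.

(** The condition lin > 0 is strict while the bound on m is not. Equality n w = m forces n = m = 0,
    where the cross product vanishes as well. *)
Lemma cone_range n k (m : int) :
  (((n%:Z * pk k) %/ (qk k)%:Z)%Z < m <= Num.floor (n%:R * w)) = cone (iter k.+1 ts (n%:Z, m)).
Proof.
rewrite floor_lt /cone andbC; case c : (0 < cross u0 _); last by rewrite !andbF.
rewrite !andbT lin_ts real_floor_ge_int ?num_real // /lin /= subr_gt0 le_eqVlt.
case: eqP => //= e; have e' : n%:Z%:~R * w = m%:~R by [].
have [n0 m0] := w_irr0 e'.
by move: c; rewrite cross_ts n0 m0 /cross !mulr0 subrr ltxx.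
Qed.

Lemma slice_range n k (m : int) :
  (((n%:Z * pk k) %/ (qk k)%:Z)%Z < m <= ((n%:Z * pk k.+1) %/ (qk k.+1)%:Z)%Z) = slice (iter k.+1 ts (n%:Z, m)).
Proof.
rewrite floor_lt /slice [(m <= _)]leNgt floor_lt -leNgt; congr (_ && (_ <= 0)).
by rewrite !cross_ts -iterSr.
Qed.

Lemma slice_le n k : ((n%:Z * pk k) %/ (qk k)%:Z)%Z <= ((n%:Z * pk k.+1) %/ (qk k.+1)%:Z)%Z.
Proof.
have q0 j : 0 < (qk j)%:Z by rewrite ltz_nat qk_gt0.
rewrite lez_divRL // -(ler_pM2r (q0 k)) mulrAC.
have h : ((n%:Z * pk k) %/ (qk k)%:Z)%Z * (qk k)%:Z <= n%:Z * pk k by rewrite -lez_divRL.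
apply: le_trans (ler_wpM2r (ltW (q0 k.+1)) h) _; rewrite -!mulrA ler_wpM2l //.
have : 0 < cross (iter k.+1 st u0) (iter k.+2 st u0).
  by rewrite [iter k.+2 _ _]iterSr cross_iter kappa_gt0.
rewrite /cross -!qkE -/(pk k) -/(pk k.+1); lia.
Qed.

Section Values.
Variables (al xi : C).
Hypothesis a01 : 0 < normc al < 1.
Hypothesis xi_sums : sums (fun n => (Num.floor (n%:R * w))%:~R) al xi.

Definition sk k : C := fr (pk k) (qk k) al.

Lemma cone_approx k I I' J' : (I <= I')%N -> (I <= J')%N ->
  normc (xi - sk k - \sum_(i < I') \sum_(j < J') (chi cone i j)%:R * ((al ^+ P k) ^+ i * (al ^+ Q k) ^+ j)) <=
    normc al ^+ (I * (P k).-1) * (1 - normc al)^-1 ^+ 2.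
Proof.
apply: (@cone_expansion cone k (fun n => Num.floor (n%:R * w) - ((n%:Z * pk k) %/ (qk k)%:Z)%Z)) => //.
  move=> n N nN; apply: count_chi nN; [exact: cone_pos|exact: floor_le|].
  by move=> m; apply: cone_range.
apply: sums_eq (sumsB xi_sums (sums_fr (pk k) a01 (qk_gt0 k))) => n.
by rewrite intrB.
Qed.

(** The case k = 0 is left out because P 0 = 1, so the exponent N (P k - 1) in the tail bound would
    vanish. *)
Lemma slice_sums2 k : (0 < k)%N ->
  sums2 (fun i j => (chi slice i j)%:R) (al ^+ P k) (al ^+ Q k) (sk k.+1 - sk k).
Proof.
move=> k0; have [a0 a1] := andP a01; have [Pk PQ] := pq_ge k ptr_gt2.
have D0 : 0 < (1 - normc al)^-1 ^+ 2 by rewrite exprn_gt0 // invr_gt0 subr_gt0.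
move=> e e0; have [|N hN] := @expr_lt_eventually R (normc al) (e / (1 - normc al)^-1 ^+ 2) _ (divr_gt0 e0 D0).
  by rewrite ltW.
exists N => I J NI NJ.
apply: le_trans (_ : normc al ^+ (N * (P k).-1) * (1 - normc al)^-1 ^+ 2 <= e); last first.
  move: hN; rewrite ltr_pdivlMr // => /ltW; apply: le_trans.
  rewrite ler_pM2r // ler_wiXn2l ?(ltW a0) ?(ltW a1) //.
  by rewrite leq_pmulr //; clear -k0 Pk; lia.
apply: (@cone_expansion slice k (fun n => ((n%:Z * pk k.+1) %/ (qk k.+1)%:Z)%Z - ((n%:Z * pk k) %/ (qk k)%:Z)%Z)) => //.
  move=> n M nM; apply: count_chi nM; [by move=> u /slice_cone/cone_pos|exact: slice_le|].
  by move=> m; apply: slice_range.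
apply: sums_eq (sumsB (sums_fr (pk k.+1) a01 (qk_gt0 k.+1)) (sums_fr (pk k) a01 (qk_gt0 k))) => n.
by rewrite intrB.
Qed.

End Values.

End System.

Section Multiples.
Variables (V : nmodType) (m : nat).
Hypothesis m0 : (0 < m)%N.

Lemma sum_multiples (F : nat -> V) I :
  \sum_(a < m * I) (if (m %| a)%N then F (a %/ m)%N else 0) = \sum_(i < I) F i.
Proof.
elim: I => [|I IH]; first by rewrite muln0 !big_ord0.
rewrite big_ord_recr -IH /= -!(big_mkord xpredT (fun a => if (m %| a)%N then F (a %/ m)%N else 0)).
rewrite mulnS addnC (@big_cat_nat _ _ _ (m * I)%N) //=; last by rewrite leq_addr.
congr (_ + _); rewrite -[(m * I)%N in X in \sum_(X <= _ < _) _]add0n big_addn addKn big_mkord.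
rewrite (bigD1 (Ordinal m0)) //= add0n dvdn_mulr // mulKn // big1 ?addr0 // => a.
rewrite -val_eqE /= -lt0n => a0; rewrite dvdn_addl ?dvdn_mulr // gtnNdvd //.
Qed.

End Multiples.

(** * Points of the form root of unity times a power of a common base *)

Section Twisted.
Variables (R : realType) (w : R) (S : pell w).
Hypothesis w_irr : forall x y : int, x%:~R * w = y%:~R -> x = 0.
Local Notation C := R[i]%C.
Local Notation lam := (plam S).
Local Notation t := (ptr S).
Local Notation u0 := (u0 S).
Local Notation P := (pexp t).
Local Notation Q := (qexp t).
Local Notation st := (st S).
Local Notation co := (co S).
Local Notation chi := (chi S).
Local Notation slice := (slice S).
Local Notation t2 := (ptr_gt2 S).
Variables (g ze : C) (m e : nat).
Hypotheses (g0 : 0 < normc g) (g1 : normc g < 1) (m0 : (0 < m)%N) (e0 : (0 < e)%N) (zee : ze ^+ e = 1).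
Hypothesis cong : exists x y : int, a00 S = 1 + e%:Z * x /\ a01 S = e%:Z * y.

Let al := ze * g ^+ m.

Lemma normc_root : normc ze = 1.
Proof.
have : normc ze ^+ e = 1 by rewrite -normcX zee normc1.
by move/eqP; rewrite pexpr_eq1 ?normc_ge0 // => /eqP.
Qed.

Lemma normc_twist : normc al = normc g ^+ m.
Proof. by rewrite /al normcM normc_root mul1r normcX. Qed.

Lemma twist01 : 0 < normc al < 1.
Proof. by rewrite normc_twist exprn_gt0 //= exprn_ilt1 ?normc_ge0 // -lt0n. Qed.

(** The congruences on the automorph keep the first coordinate fixed modulo e, so a root of unity of
    order dividing e sees only the starting point of an orbit. *)
Lemma st_mod u : exists x : int, (st u).1 = u.1 + e%:Z * x.
Proof.
have [x [y [ex ey]]] := cong; exists (x * u.1 + y * u.2).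
by rewrite /st /= ex ey; ring.
Qed.

Lemma iter_st_mod k u : exists x : int, (iter k st u).1 = u.1 + e%:Z * x.
Proof.
elim: k => [|k [x IH]]; first by exists 0; rewrite mulr0 addr0.
have [y ey] := st_mod (iter k st u); exists (x + y); rewrite iterS ey IH; ring.
Qed.

Lemma root_exp (a b : nat) (x : int) : a%:Z = b%:Z + e%:Z * x -> ze ^+ a = ze ^+ b.
Proof.
move=> h; case: x h => [x|x] h.
  have -> : a = (b + e * x)%N by lia.
  by rewrite exprD exprM zee expr1n mulr1.
have -> : b = (a + e * x.+1)%N by lia.
by rewrite exprD exprM zee expr1n mulr1.
Qed.

(** The root of unity contributes [ze ^+ i], which does not depend on k: it moves from the point to
    the coefficients. *)
Lemma twist_monom k u (i j : nat) : co u = (i%:Z, j%:Z) ->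
  (al ^+ P k) ^+ i * (al ^+ Q k) ^+ j = ze ^+ i * (zx t g k ^+ (m * i) * zy t g k ^+ (m * j)).
Proof.
move=> cu; rewrite /zx /zy -!exprM -!exprD.
have [x ex] := iter_st_mod k.+1 u.
rewrite coordE cu /= in ex.
have u1 : u.1 = i%:Z by have := congr1 fst cu.
rewrite /al exprMn (_ : ze ^+ _ = ze ^+ i); last by apply: (@root_exp _ _ x); rewrite -u1; lia.
by rewrite -exprM; congr (_ * _ ^+ _); ring.
Qed.

(** The array of the cone in the monomials of g: supported on multiples of m, with the root of unity
    acting as a character. *)
Definition twist (cn : pred (int * int)) (a b : nat) : C :=
  if (m %| a)%N && (m %| b)%N then ze ^+ (a %/ m) * (chi cn (a %/ m)%N (b %/ m)%N)%:R else 0.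

Lemma zeval_poly (B : nat) (f : nat -> nat -> C) k :
  zeval t g (\poly_(a < B) (\poly_(b < B) f a b)) k =
  \sum_(a < B) \sum_(b < B) f a b * (zx t g k ^+ a * zy t g k ^+ b).
Proof.
rewrite /zeval [X in X.[_]]horner_poly -[LHS]/(horner_eval (zy t g k) _) rmorph_sum.
apply: eq_bigr => i _ /=.
rewrite /horner_eval hornerM -polyC_exp hornerC horner_poly mulr_suml.
by apply: eq_bigr => j _; rewrite mulrAC mulrA.
Qed.

Lemma twist_sum cn I k :
  \sum_(a < m * I) \sum_(b < m * I) twist cn a b * (zx t g k ^+ a * zy t g k ^+ b) =
  \sum_(i < I) \sum_(j < I) (chi cn i j)%:R * ((al ^+ P k) ^+ i * (al ^+ Q k) ^+ j).
Proof.
rewrite -(sum_multiples m0 (fun i => \sum_(j < I) (chi cn i j)%:R * ((al ^+ P k) ^+ i * (al ^+ Q k) ^+ j))).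
apply: eq_bigr => a _; case: ifP => ma; last first.
  by rewrite big1 // => b _; rewrite /twist ma mul0r.
rewrite -(sum_multiples m0 (fun j => (chi cn (a %/ m)%N j)%:R * ((al ^+ P k) ^+ (a %/ m) * (al ^+ Q k) ^+ j))).
apply: eq_bigr => b _; rewrite /twist ma /=; case: ifP => mb; last by rewrite mul0r.
case c : (chi cn _ _); last by rewrite !mulr0 !mul0r.
have [u eu _] := chiP c.
rewrite mulr1 mul1r (twist_monom k eu).
by rewrite [(m * (a %/ m))%N]mulnC [(m * (b %/ m))%N]mulnC !divnK.
Qed.

Section Values.
Variable xi : C.
Hypothesis xi_sums : sums (fun n => (Num.floor (n%:R * w))%:~R) al xi.

Lemma sk_expands : expands t g (fun k => xi - sk S al k) (twist (cone S)).
Proof.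
move=> I; exists (\poly_(a < m * I) (\poly_(b < m * I) twist (cone S) a b)).
have [a0 a1] := andP twist01.
(* The factor |al|^-I pays for the exponent P_k - 1 in [cone_approx]. *)
exists ((1 - normc al)^-1 ^+ 2 * (normc al)^-1 ^+ I) => [i j iI jI|k].
  have lm x : (x < I)%N -> (x < m * I)%N by move=> h; apply: leq_trans h _; rewrite leq_pmull.
  by rewrite coef_poly lm // coef_poly lm.
rewrite zeval_poly twist_sum.
apply: le_trans (cone_approx S w_irr twist01 xi_sums k (leqnn I) (leqnn I)) _.
rewrite [leLHS]mulrC -[leRHS]mulrA ler_wpM2l ?exprn_ge0 // ?invr_ge0 ?subr_ge0 ?(ltW a1) //.
have [Pk _] := pq_ge k t2.
have -> : normc al ^+ (I * (P k).-1) = (normc al)^-1 ^+ I * normc al ^+ (I * P k).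
  apply: (mulfI (lt0r_neq0 (exprn_gt0 I a0))); rewrite mulrA -exprMn mulfV ?gt_eqF // expr1n mul1r.
  by rewrite -exprD; congr (_ ^+ _); case: (P k) Pk => // p _ /=; rewrite mulnS.
rewrite ler_wpM2l ?exprn_ge0 ?invr_ge0 ?(ltW a0) // normc_twist -exprM.
by rewrite ler_wiXn2l ?(ltW g0) ?(ltW g1) // leq_pmull.
Qed.

Lemma shift_chi (cn : pred (int * int)) v (a b i j : nat) : co v = (a%:Z, b%:Z) ->
  (forall u, cn u -> 0 < (co u).1 /\ 0 < (co u).2) ->
  shift2 a b (fun i j => (chi cn i j)%:R) i j =
    (chi (fun u => cn (u.1 - v.1, u.2 - v.2)) i j)%:R :> C.
Proof.
move=> ev pos; have [ev1 ev2] : (co v).1 = a%:Z /\ (co v).2 = b%:Z by rewrite ev.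
have coB (u : int * int) : co (u.1 - v.1, u.2 - v.2) = ((co u).1 - a%:Z, (co u).2 - b%:Z).
  by rewrite -ev1 -ev2 /co /=; congr (_, _); ring.
rewrite /shift2; case: ifP => h.
  case c : (chi _ i j) => //; have [u eu cu] := chiP c.
  by have := pos _ cu; rewrite coB eu /= => -[]; clear -h; lia.
have [ai bj] : (a <= i)%N /\ (b <= j)%N by clear -h; lia.
congr ((_ : bool)%:R); apply/idP/idP => c; have [u eu cu] := chiP c.
  have -> : i%:Z = (co (u.1 + v.1, u.2 + v.2)).1.
    by move: (congr1 fst eu) ev1; rewrite /co /=; clear -ai; lia.
  have -> : j%:Z = (co (u.1 + v.1, u.2 + v.2)).2.
    move: (congr1 snd eu) ev2; rewrite /co /= => e1 e2.
    by rewrite -(subnK bj) PoszD -e1 -e2; ring.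
  by rewrite chi_co /= !addrK -surjective_pairing.
have e1 : ((i - a)%N%:Z, (j - b)%N%:Z) = co (u.1 - v.1, u.2 - v.2).
  by rewrite coB eu /=; congr (_, _); clear -ai bj; lia.
have -> : (i - a)%N%:Z = (co (u.1 - v.1, u.2 - v.2)).1 by rewrite -e1.
have -> : (j - b)%N%:Z = (co (u.1 - v.1, u.2 - v.2)).2 by rewrite -e1.
by rewrite chi_co.
Qed.

(** This is the generating series of a rational cone spanned by u0 and u1 = st u0. Multiplying by (1
    - x^u0) (1 - x^u1) leaves only the lattice points of a parallelogram, a polynomial independent
    of k. *)
Lemma ratseq_shift_diff : ratseq t g (fun k => sk S al k.+1 - sk S al k).
Proof.
have [a0 a1] := andP twist01.
have nat_co (u : int * int) : 0 < (co u).1 -> 0 < (co u).2 -> exists i j : nat, co u = (i%:Z, j%:Z).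
  by move=> h1 h2; exists `|(co u).1|%N, `|(co u).2|%N; rewrite [LHS]surjective_pairing; congr (_, _); lia.
have p01 : 0 < (co u0).1 := u0_gt0 S; have p02 := u0_co2 S.
pose u1 := st u0.
have sl (u : int * int) : slice u -> 0 < (co u).1 /\ 0 < (co u).2 by move=> /slice_cone/cone_pos.
have [p11 p12] : 0 < (co u1).1 /\ 0 < (co u1).2.
  split; first by apply: lt_trans (st_u0_1 S); exact: p01.
  rewrite /u1 (co_st) /tz /= ltr_wpDl ?mulr_gt0 //.
    by rewrite mulr_ge0 ?(ltW p01) //; have := t2; lia.
  by have := t2; lia.
have [i0 [j0 e0']] := nat_co u0 p01 p02; have [i1 [j1 e1']] := nat_co u1 p11 p12.
pose K := cross u0 u1; have K0 : 0 < K := kappa_gt0 S.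
pose c1 (u : int * int) := slice (u.1 - u0.1, u.2 - u0.2).
pose c2 (u : int * int) := slice (u.1 - u1.1, u.2 - u1.2).
pose c3 (u : int * int) := c1 (u.1 - u1.1, u.2 - u1.2).
have c1pos (u : int * int) : c1 u -> 0 < (co u).1 /\ 0 < (co u).2.
  move=> /sl; have -> : co (u.1 - u0.1, u.2 - u0.2) = ((co u).1 - (co u0).1, (co u).2 - (co u0).2).
    by rewrite /co /=; congr (_, _); ring.
  rewrite !subr_gt0 => -[h1 h2]; split; [exact: lt_trans p01 h1|exact: lt_trans p02 h2].
(* Inclusion and exclusion of the slice and its translates by u0, u1 and u0 + u1. *)
pose h (i j : nat) : C := (chi slice i j)%:R - (chi c1 i j)%:R - ((chi c2 i j)%:R - (chi c3 i j)%:R).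
have fchi (p : pred (int * int)) u i j : co u = (i, j) -> chi p i j = p u.
  by move=> eu; have := chi_co S p u; rewrite eu.
pose B := (i0 + i1 + j0 + j1).+1.
have h0 (i j : nat) : (B <= i)%N || (B <= j)%N -> h i j = 0.
  move=> Bij; case: (pselect (exists u, co u = (i%:Z, j%:Z))) => [[u eu]|nu]; last first.
    have f0 p : chi p i j = false.
      by apply/negP => /chiP[u eu _]; apply: nu; exists u.
    by rewrite /h !f0 !subrr.
  rewrite /h !(fchi _ _ _ _ eu) /c3 /c2 /c1 /slice -/u1.
  pose x := cross u0 u; pose y := cross u1 u.
  have -> : cross u0 ((u.1 - u1.1, u.2 - u1.2).1 - u0.1, (u.1 - u1.1, u.2 - u1.2).2 - u0.2) = x - K.
    by rewrite /x /K /cross /=; ring.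
  have -> : cross u1 ((u.1 - u1.1, u.2 - u1.2).1 - u0.1, (u.1 - u1.1, u.2 - u1.2).2 - u0.2) = y + K.
    by rewrite /y /K /cross /=; ring.
  have -> : cross u0 (u.1 - u0.1, u.2 - u0.2) = x by rewrite /x /cross /=; ring.
  have -> : cross u1 (u.1 - u0.1, u.2 - u0.2) = y + K by rewrite /y /K /cross /=; ring.
  have -> : cross u0 (u.1 - u1.1, u.2 - u1.2) = x - K by rewrite /x /K /cross /=; ring.
  have -> : cross u1 (u.1 - u1.1, u.2 - u1.2) = y by rewrite /y /cross /=; ring.
  have [k1 k2] := kappa_decomp S u; rewrite -/u1 -/K -/x -/y eu e0' e1' /= in k1 k2.
  rewrite -/x -/y.
  (* Where h is nonzero both cross products lie in this range, and by Cramer's rule the coordinates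
     are then at most i0 + i1 and j0 + j1. *)
  have range : ~ ((0 < x) && (x <= K) && (- K < y) && (y <= 0)).
    move=> hr; have l1 : K * i%:Z <= K * (i1%:Z + i0%:Z) by rewrite k1 mulrDr; clear -hr; nia.
    have l2 : K * j%:Z <= K * (j1%:Z + j0%:Z) by rewrite k2 mulrDr; clear -hr; nia.
    rewrite !ler_pM2l // in l1 l2; move: l1 l2 Bij; rewrite /B; clear; lia.
  have [b1 b2] : (0 < x - K -> 0 < x) /\ (y + K <= 0 -> y <= 0) by clear -K0; lia.
  case: (ltP 0 x) b1 range => h1 b1 range; case: (ltP 0 (x - K)) b1 range => h2 b1 range;
  case: (leP y 0) b2 range => h3 b2 range; case: (leP (y + K) 0) b2 range => h4 b2 range;
  rewrite /= ?subrr ?subr0 //; try by [have := b1 isT | have := b2 isT].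
  by case: range; clear -h1 h2 h3 h4; lia.
have key k : (0 < k)%N -> (1 - (al ^+ P k) ^+ i0 * (al ^+ Q k) ^+ j0) * (1 - (al ^+ P k) ^+ i1 * (al ^+ Q k) ^+ j1) *
    (sk S al k.+1 - sk S al k) = \sum_(i < B) \sum_(j < B) h i j * ((al ^+ P k) ^+ i * (al ^+ Q k) ^+ j).
  move=> k0; have x1 n : normc (al ^+ n) <= 1 by rewrite normcX exprn_ile1 ?normc_ge0 // ltW.
  have s0 := slice_sums2 S twist01 k0; move: (_ - _) s0 => r s0.
  have s1 := sums2_shift i0 j0 (x1 _) (x1 _) s0.
  have s2 := sums2_shift i1 j1 (x1 _) (x1 _) s0.
  have s3 := sums2_shift i1 j1 (x1 _) (x1 _) s1.
  have s4 := sums2B (sums2B s0 s1) (sums2B s2 s3).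
  have <- : r - (al ^+ P k) ^+ i0 * (al ^+ Q k) ^+ j0 * r -
      ((al ^+ P k) ^+ i1 * (al ^+ Q k) ^+ j1 * r -
       (al ^+ P k) ^+ i1 * (al ^+ Q k) ^+ j1 * ((al ^+ P k) ^+ i0 * (al ^+ Q k) ^+ j0 * r)) =
     (1 - (al ^+ P k) ^+ i0 * (al ^+ Q k) ^+ j0) * (1 - (al ^+ P k) ^+ i1 * (al ^+ Q k) ^+ j1) * r by ring.
  apply: sums2_unique s4 _.
  have f1 : (fun i j : nat => (chi slice i j)%:R - shift2 i0 j0 (fun i j => (chi slice i j)%:R) i j -
     (shift2 i1 j1 (fun i j => (chi slice i j)%:R) i j -
      shift2 i1 j1 (shift2 i0 j0 (fun i j => (chi slice i j)%:R)) i j)) = h.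
    apply/funext => i; apply/funext => j; rewrite /h (shift_chi _ _ e0' sl) (shift_chi _ _ e1' sl).
    have -> : shift2 i0 j0 (fun i j : nat => (chi slice i j)%:R) = (fun i j : nat => (chi c1 i j)%:R : C).
      by apply/funext => x; apply/funext => y; rewrite (shift_chi _ _ e0' sl).
    by rewrite (shift_chi _ _ e1' c1pos).
  by rewrite f1; apply: sums2_fin.
pose mono (i j : nat) : {poly {poly C}} := 'X^(m * i) * ('X^(m * j))%:P.
pose D : {poly {poly C}} := (1 - (ze ^+ i0)%:P%:P * mono i0 j0) * (1 - (ze ^+ i1)%:P%:P * mono i1 j1).
pose N : {poly {poly C}} := \poly_(a < m * B) (\poly_(b < m * B)
  (if (m %| a)%N && (m %| b)%N then ze ^+ (a %/ m) * h (a %/ m)%N (b %/ m)%N else 0)).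
have DE k : zeval t g D k = (1 - (al ^+ P k) ^+ i0 * (al ^+ Q k) ^+ j0) * (1 - (al ^+ P k) ^+ i1 * (al ^+ Q k) ^+ j1).
  have z1 : zeval t g 1 k = 1 by rewrite -polyC1 -polyC1 zevalC.
  have zf c i j : zeval t g (1 - c%:P%:P * mono i j) k = 1 - c * (zx t g k ^+ (m * i) * zy t g k ^+ (m * j)).
    by rewrite zevalD z1 zevalN zevalM zevalC zeval_monom.
  by rewrite /D zevalM !zf (twist_monom k e0') (twist_monom k e1').
have NE k : zeval t g N k = \sum_(i < B) \sum_(j < B) h i j * ((al ^+ P k) ^+ i * (al ^+ Q k) ^+ j).
  rewrite zeval_poly -(sum_multiples m0 (fun i => \sum_(j < B) h i j * ((al ^+ P k) ^+ i * (al ^+ Q k) ^+ j))).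
  apply: eq_bigr => a _; case: ifP => ma; last by rewrite big1 // => b _; rewrite mul0r.
  rewrite -(sum_multiples m0 (fun j => h (a %/ m)%N j * ((al ^+ P k) ^+ (a %/ m) * (al ^+ Q k) ^+ j))).
  apply: eq_bigr => b _ /=; case: ifP => mb; last by rewrite mul0r.
  case: (pselect (exists u, co u = ((a %/ m)%N%:Z, (b %/ m)%N%:Z))) => [[u eu]|nu].
    rewrite (twist_monom k eu) [(m * (a %/ m))%N]mulnC [(m * (b %/ m))%N]mulnC !divnK //; ring.
  have f0 p : chi p (a %/ m)%N (b %/ m)%N = false.
    by apply/negP => /chiP[u eu _]; apply: nu; exists u.
  by rewrite /h !f0 !subrr !(mulr0, mul0r).
have qkm k u i j (eu : co u = (i%:Z, j%:Z)) : (0 < i)%N -> 1 - (al ^+ P k) ^+ i * (al ^+ Q k) ^+ j != 0.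
  move=> ip; rewrite -!exprM -exprD; apply: one_subX_neq0 => //.
  by have [Pk _] := pq_ge k t2; rewrite addn_gt0 muln_gt0 ip (leq_ltn_trans _ Pk).
exists N, D; split.
  apply/eqP => D0; have := DE 0%N; rewrite D0 zeval0 => /esym/eqP.
  rewrite mulf_eq0 (negPf (qkm 0%N _ _ _ e0' _)) ?(negPf (qkm 0%N _ _ _ e1' _)) //.
    by move: p11; rewrite e1'.
  by move: p01; rewrite e0'.
by exists 1%N => k k0; rewrite NE DE -key // mulrC.
Qed.

End Values.

End Twisted.

(** * The coefficient array near the irrational edge of the cone *)

Section Edge.
Variables (R : realType) (w : R) (S : pell w).
Local Notation C := R[i]%C.
Local Notation lam := (plam S).
Local Notation t := (ptr S).
Local Notation u0 := (u0 S).
Local Notation st := (st S).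
Local Notation ts := (ts S).
Local Notation co := (co S).
Local Notation m01 := (a01 S).
Local Notation m00 := (a00 S).
Variables (ze : C) (m e : nat).
Hypotheses (m0 : (0 < m)%N) (e0 : (0 < e)%N) (zee : ze ^+ e = 1).
Hypothesis cong : exists x y : int, a00 S = 1 + e%:Z * x /\ a01 S = e%:Z * y.

Definition mco (u : int * int) : int * int := (m%:Z * (co u).1, m%:Z * (co u).2).

(** The array on the whole plane with which [twist] agrees on one side of the edge: a character on
    the lattice [mco], zero elsewhere. Reducing modulo e gives a meaning to negative coordinates. *)
Definition lattice_fun (v : int * int) : C :=
  if pselect (exists u, v = mco u) then ze ^+ `|((v.1 %/ m%:Z)%Z %% e%:Z)%Z|%N else 0.

Let mz : m%:Z != 0. Proof. by rewrite eqz_nat -lt0n. Qed.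

Lemma lattice_fun_co u : lattice_fun (mco u) = ze ^+ `|(u.1 %% e%:Z)%Z|%N.
Proof.
rewrite /lattice_fun; case: pselect => [?|[]]; last by exists u.
by rewrite /mco /= mulKz.
Qed.

Lemma lattice_fun_notin v : ~ (exists u, v = mco u) -> lattice_fun v = 0.
Proof. by rewrite /lattice_fun; case: pselect. Qed.

Lemma lattice_fun_neq0 v : lattice_fun v != 0 -> exists u, v = mco u.
Proof. by move=> h; apply: contrapT => /lattice_fun_notin e1; rewrite e1 eqxx in h. Qed.

Lemma ze_neq0 : ze != 0.
Proof. by apply/eqP => z0; move: zee; rewrite z0 expr0n gtn_eqF // => /esym/eqP; rewrite oner_eq0. Qed.

Lemma lattice_fun_co_neq0 u : lattice_fun (mco u) != 0.
Proof. by rewrite lattice_fun_co expf_neq0 // ze_neq0. Qed.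

Lemma tz_inj : injective (tz t).
Proof.
move=> [x y] [x' y'] [e1 e2].
have ex : x = x'.
  have : (t%:Z - 1) * (x + y) - ((t%:Z - 2) * x + (t%:Z - 1) * y) = (t%:Z - 1) * (x' + y') - ((t%:Z - 2) * x' + (t%:Z - 1) * y').
    by rewrite e1 e2.
  by move=> h; clear -h; lia.
by congr (_, _) => //; clear -e1 ex; lia.
Qed.

Lemma tz_mco u : tz t (mco u) = mco (st u).
Proof. by rewrite /mco co_st /tz /=; congr (_, _); ring. Qed.

Lemma lattice_fun_tz v : lattice_fun (tz t v) = lattice_fun v.
Proof.
case: (pselect (exists u, v = mco u)) => [[u ->]|nv].
  rewrite tz_mco !lattice_fun_co; have [x ->] := st_mod cong u.
  by rewrite addrC mulrC modzMDl.
rewrite !lattice_fun_notin // => -[u eu]; apply: nv; exists (ts u).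
by apply: tz_inj; rewrite tz_mco tsK.
Qed.

(** A translation by a multiple of this number in each coordinate comes from a lattice vector whose
    first coordinate is divisible by e, so the character does not change. *)
Definition period := (m * e * `|m01|)%N.

Lemma lattice_fun_taddn_co u x n : lattice_fun (taddn (mco u) x (period * n)) = lattice_fun (mco u).
Proof.
pose y : int * int := (e%:Z * `|m01|%N%:Z * n%:Z * x.1,
  (if 0 < m01 then 1 else -1) * e%:Z * n%:Z * (x.2 - (m00 - 1) * x.1)).
have -> : taddn (mco u) x (period * n) = mco (u.1 + y.1, u.2 + y.2).
  rewrite /taddn /mco /co /y /period /=; congr (_, _).
    by rewrite !PoszM; ring.
  have e1 : `|m01|%N%:Z = m01 * (if 0 < m01 then 1 else -1) by case: ifP => h; clear -h; lia.
  by rewrite !PoszM e1; ring.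
rewrite !lattice_fun_co /=; congr (ze ^+ `|_|%N).
by rewrite /y /= -!mulrA addrC mulrC modzMDl.
Qed.

Lemma lattice_fun_taddn v x n : lattice_fun (taddn v x (period * n)) = lattice_fun v.
Proof.
case: (pselect (exists u, v = mco u)) => [[u ->]|nv]; first exact: lattice_fun_taddn_co.
rewrite !lattice_fun_notin // => -[u eu]; apply: nv.
have ev : v = taddn (mco u) (- x.1, - x.2) (period * n).
  by rewrite -eu /taddn /= !mulNr !addrK -surjective_pairing.
apply: lattice_fun_neq0; rewrite ev lattice_fun_taddn_co; exact: lattice_fun_co_neq0.
Qed.

Lemma ellz_mco u : ellz lam (mco u) = m%:R * (m01%:~R * lin w u).
Proof. by rewrite -ellz_co /ellz /ell /mco /= !intrM -!pmulrn; ring. Qed.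

(** Far out along the line the ray of u0 is distant, so only the sign of [lin] decides membership in
    the cone. By [ellz_mco] this sign is that of ell times the sign of a01. *)
Lemma twist_edge : edge t lam (twist S ze m (cone S)) lattice_fun (0 < m01) period.
Proof.
have m01n := m01_neq0 S; have l0 := lin_u0 S.
split.
- by rewrite !muln_gt0 m0 e0 absz_gt0.
- exact: lattice_fun_taddn.
- exact: lattice_fun_tz.
move=> E; pose N := (Num.truncn (((u0.1)%:~R * `|E|) / lin w u0)).+1.
exists (m * N)%N => i j hi hj elln elle.
have mR : 1 <= m%:R :> R by rewrite ler1n.
case: (pselect (exists u, (i%:Z, j%:Z) = mco u)) => [[u eu]|nu]; last first.
  rewrite lattice_fun_notin // if_same /twist; case: ifP => // /andP[mi mj].
  case c : (chi _ _ _ _); last by rewrite mulr0.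
  have [u eu _] := chiP c; case: nu; exists u; rewrite /mco eu /=.
  by congr (_, _); rewrite -PoszM mulnC divnK.
have [ei ej] : i%:Z = m%:Z * (co u).1 /\ j%:Z = m%:Z * (co u).2 by case: eu.
have du x n : n%:Z = m%:Z * x -> (m %| n)%N /\ x = (n %/ m)%N%:Z.
  move=> h; have x0 : 0 <= x by rewrite -(pmulr_rge0 _ (_ : 0 < m%:Z)) -?h // ltz_nat.
  have ex : x = `|x|%N%:Z by rewrite abszE ger0_norm.
  rewrite ex -PoszM in h; case: h => h; rewrite h dvdn_mulr //; split=> //.
  by rewrite ex mulKn.
have [mi ei'] := du _ _ ei; have [mj ej'] := du _ _ ej.
have c : chi S (cone S) (i %/ m)%N (j %/ m)%N = cone S u by rewrite -ei' -ej' chi_co.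
rewrite /twist mi mj c eu lattice_fun_co.
have -> : ze ^+ (i %/ m) = ze ^+ `|(u.1 %% e%:Z)%Z|%N.
  rewrite (_ : u.1 = (i %/ m)%N%:Z) //; rewrite modz_nat /=; exact/esym/expr_mod.
have ul : lin w u != 0.
  by apply: contraNneq elln => l; rewrite eu ellz_mco l !mulr0.
have sgn : ((0 < ellz lam (mco u)) == (0 < m01)) = (0 < lin w u).
  rewrite ellz_mco pmulr_rgt0 ?ltr0n //; case: (ltrgtP 0 m01) => h.
  - by rewrite pmulr_rgt0 ?ltr0z // eqb_id.
  - rewrite nmulr_rgt0 ?ltrz0 // eqbF_neg -leNgt le_eqVlt.
    by rewrite eq_sym (negPf ul).
  - by rewrite h eqxx in m01n.
rewrite sgn /cone; case lp : (0 < lin w u) => /=; last by rewrite mulr0.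
suff -> : 0 < cross u0 u by rewrite mulr1.
rewrite -(ltr_int R) (crossE w) subr_gt0.
have uN : N%:R <= u.1%:~R :> R.
  rewrite (_ : u.1 = (i %/ m)%N%:Z) // -pmulrn ler_nat leq_divRL // mulnC //.
have lE : lin w u <= `|E|.
  have h : m%:R * (`|m01%:~R| * lin w u) <= E.
    by move: elle; rewrite eu ellz_mco !normrM normr_nat (ger0_norm (ltW lp)).
  have m1 : 1 <= `|m01%:~R| :> R by rewrite -intr_norm (ler_int R 1) -gtz0_ge1 normr_gt0.
  apply: le_trans (le_trans h (ler_norm _)).
  have l1 : lin w u <= `|m01%:~R| * lin w u by rewrite ler_peMl // ltW.
  by apply: le_trans l1 _; rewrite ler_peMl // mulr_ge0 // ltW.
apply: (@le_lt_trans _ _ (u0.1%:~R * `|E|)).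
  by rewrite ler_wpM2l // ler0z ltW // u0_gt0.
apply: (@lt_le_trans _ _ (N%:R * lin w u0)); last by rewrite ler_pM2r.
by rewrite -ltr_pdivrMr // truncnS_gt.
Qed.

End Edge.

(** * Transcendence of the values s_k over the rational sequences *)

Section Transcendence.
Variables (R : realType) (w : R) (S : pell w).
Hypothesis w_irr : forall x y : int, x%:~R * w = y%:~R -> x = 0.
Local Notation C := R[i]%C.
Variable al : C.
Hypothesis al01 : 0 < normc al < 1.
Variable xi : C.
Hypothesis xi_sums : sums (fun n => (Num.floor (n%:R * w))%:~R) al xi.

Let al0 : 0 < normc al. Proof. by case/andP: al01. Qed.
Let al1 : normc al < 1. Proof. by case/andP: al01. Qed.

Let cong1 : exists x y : int, a00 S = 1 + 1%N%:Z * x /\ a01 S = 1%N%:Z * y.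
Proof. by exists (a00 S - 1), (a01 S); rewrite !mul1r addrC subrK. Qed.

Let alE : 1 * al ^+ 1 = al. Proof. by rewrite mul1r. Qed.

Lemma sk_expands1 : expands (ptr S) al (fun k => xi - sk S al k) (twist S 1 1 (cone S)).
Proof.
have := @sk_expands R w S w_irr al 1 1 1 al0 al1 isT isT (expr1n _ _) cong1 xi.
by rewrite alE; apply.
Qed.

Lemma ratseq_shift_diff1 : ratseq (ptr S) al (fun k => sk S al k.+1 - sk S al k).
Proof.
have := @ratseq_shift_diff R w S al 1 1 1 al0 al1 isT isT (expr1n _ _) cong1.
by rewrite alE.
Qed.

(** Kubota's argument with second sequence zero and m = 0 would make a nonzero multiple of s_k a
    rational sequence. The jump of its array would then vanish, whereas it is 1 up to sign at the
    origin. *)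
Lemma sk_transcendental d (a : nat -> nat -> nat -> C) :
  relation (ratseq (ptr S) al) (flat (ptr S) al) (sk S al) (fun=> 0) 0 d a -> forall u v, ev0 (a u v).
Proof.
move=> ra u v; apply: contrapT => nuv.
have F0 : ratseq (ptr S) al (fun k => (fun=> 0 : C) k.+1 - (fun=> 0 : C) k).
  apply: (@ratseq_ev _ _ _ (fun=> 0) _ 0); last exact: ratseq_cst.
  by move=> k _; rewrite subrr.
have [C1 [C2 [nz C20 rat]]] := kubota_ratseq (plam1 S) (plamt S) (ptr_gt2 S) (@plam_irr _ _ S w_irr) al0 al1
  ratseq_shift_diff1 F0 ra (ex_intro _ u (ex_intro _ v nuv)).
have {}C20 := C20 erefl.
have C1n : C1 != 0 by case: nz => //; rewrite C20 eqxx.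
have ed := @twist_edge R w S 1 1 1 isT isT (expr1n _ _) cong1.
have rat' : ratseq (ptr S) al (fun k => C1 * sk S al k + 0 * sk S al k).
  by apply: (ratseq_ev (k0 := 0)) rat => k _; rewrite C20 !mul0r.
have := ratseq_linear_jump (plam1 S) (plamt S) (ptr_gt2 S) (@plam_irr _ _ S w_irr) al0 al1 ed ed
  sk_expands1 sk_expands1 rat'.
have l1 : lattice_fun S (1 : C) 1 1 (mco S 1 (0, 0)) = 1 by rewrite lattice_fun_co // expr1n.
move=> /(_ (mco S 1 (0, 0))); rewrite l1 mulr1 !mul0r addr0.
by move/eqP; rewrite mulf_eq0 (negPf C1n); case: ifP; rewrite ?oppr_eq0 oner_eq0.
Qed.

End Transcendence.

(** * Two series with a common base and a common eigenvalue *)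

Section Pair.
Variables (R : realType) (w w' : R) (S : pell w) (S' : pell w').
Hypothesis w_irr : forall x y : int, x%:~R * w = y%:~R -> x = 0.
Hypothesis w_irr' : forall x y : int, x%:~R * w' = y%:~R -> x = 0.
Hypothesis same_lam : plam S = plam S'.
Local Notation C := R[i]%C.
Local Notation t := (ptr S).
Variables (g ze ze' : C) (m m' e e' : nat).
Hypotheses (g0 : 0 < normc g) (g1 : normc g < 1).
Hypotheses (m0 : (0 < m)%N) (e0 : (0 < e)%N) (zee : ze ^+ e = 1).
Hypotheses (m0' : (0 < m')%N) (e0' : (0 < e')%N) (zee' : ze' ^+ e' = 1).
Hypothesis cong : exists x y : int, a00 S = 1 + e%:Z * x /\ a01 S = e%:Z * y.
Hypothesis cong' : exists x y : int, a00 S' = 1 + e'%:Z * x /\ a01 S' = e'%:Z * y.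
Let al := ze * g ^+ m.
Let al' := ze' * g ^+ m'.
Variables xi xi' : C.
Hypothesis xi_sums : sums (fun n => (Num.floor (n%:R * w))%:~R) al xi.
Hypothesis xi_sums' : sums (fun n => (Num.floor (n%:R * w'))%:~R) al' xi'.

Lemma same_trace : ptr S' = t.
Proof.
apply/eqP; rewrite -(eqr_nat R); apply/eqP.
by rewrite (trace_lam (plam1 S) (plamt S)) (trace_lam (plam1 S') (plamt S')) same_lam.
Qed.

(** At the origin both arrays equal 1, so the jump identity there fixes the ratio of C1 and C2; at
    other points it then says that the arrays agree. *)
Lemma linear_relation_edge C1 C2 : C1 != 0 \/ C2 != 0 ->
  ratseq t g (fun k => C1 * sk S al k + C2 * sk S' al' k) ->
  forall v, lattice_fun S ze m e v = lattice_fun S' ze' m' e' v.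
Proof.
move=> nz rat.
have ed := @twist_edge R w S ze m e m0 e0 zee cong.
have ed' := @twist_edge R w' S' ze' m' e' m0' e0' zee' cong'.
have ex := sk_expands w_irr g0 g1 m0 e0 zee cong xi_sums.
have ex' := sk_expands w_irr' g0 g1 m0' e0' zee' cong' xi_sums'.
rewrite same_trace -same_lam in ed'; rewrite same_trace in ex'.
have J := ratseq_linear_jump (plam1 S) (plamt S) (ptr_gt2 S) (@plam_irr _ _ S w_irr) g0 g1 ed ed' ex ex' rat.
have sg (b : bool) : (if b then 1 else -1 : C) != 0 by case: b; rewrite ?oppr_eq0 oner_eq0.
have := J (0, 0); have z0 : (0, 0) = mco S m (0, 0) by rewrite /mco /co /= !(mulr0, addr0).
have z0' : (0, 0) = mco S' m' (0, 0) by rewrite /mco /co /= !(mulr0, addr0).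
have l1 : lattice_fun S ze m e (0, 0) = 1 by rewrite z0 lattice_fun_co // mod0z expr0.
have l1' : lattice_fun S' ze' m' e' (0, 0) = 1 by rewrite z0' lattice_fun_co // mod0z expr0.
rewrite l1 l1' !mulr1.
move: (sg (0 < a01 S)) (sg (0 < a01 S')) J; move: (if _ then _ else _) (if 0 < a01 S' then _ else _).
move=> s s' s0 s0' J J0 v; have := J v.
have e2 : C2 * s' = - (C1 * s) by apply/eqP; rewrite -addr_eq0 addrC; apply/eqP.
have c1 : C1 * s != 0.
  rewrite mulf_neq0 //; case: nz => // C2n; apply: contraNneq C2n => C10.
  by move: e2; rewrite C10 mul0r oppr0 => /eqP; rewrite mulf_eq0 (negPf s0') orbF.
rewrite e2 mulNr => /eqP; rewrite subr_eq0 => /eqP h.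
exact: (mulfI c1).
Qed.

(** The array determines its data. Its support is m times the image of [co], which gives m, then a01
    up to sign and a00 modulo a01; its values give the root of unity. Since a00 + a01 w is the
    common eigenvalue, w is determined up to sign and integers. *)
Lemma same_edge_classify : (forall v, lattice_fun S ze m e v = lattice_fun S' ze' m' e' v) ->
  al = al' /\ (w - w' \is a Num.int \/ w + w' \is a Num.int).
Proof.
move=> h.
have in1 u : exists u', mco S m u = mco S' m' u'.
  apply: lattice_fun_neq0 (_ : lattice_fun S' ze' m' e' _ != 0).
  by rewrite -h lattice_fun_co_neq0.
have in2 u : exists u', mco S' m' u = mco S m u'.
  apply: lattice_fun_neq0 (_ : lattice_fun S ze m e _ != 0).
  by rewrite h lattice_fun_co_neq0.
have em : m = m'.
  have [u [e1 _]] := in1 (1, 0); have [u' [e2 _]] := in2 (1, 0).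
  rewrite !mulr1 in e1 e2; apply/eqP; rewrite eqn_dvd; apply/andP; split.
    by apply/dvdnP; exists `|u'.1|%N; move: e2; rewrite /co /=; clear -m0 m0'; nia.
  by apply/dvdnP; exists `|u.1|%N; move: e1; rewrite /co /=; clear -m0 m0'; nia.
have mz : m%:Z != 0 by rewrite eqz_nat -lt0n.
have cin1 u : exists u', co S u = co S' u'.
  have [u' [e1 e2]] := in1 u; exists u'; rewrite -em in e1 e2.
  by rewrite /co; congr (_, _); [exact: mulfI mz _ _ e1|exact: mulfI mz _ _ e2].
have cin2 u : exists u', co S' u = co S u'.
  have [u' [e1 e2]] := in2 u; exists u'; rewrite -em in e1 e2.
  by rewrite /co; congr (_, _); [exact: mulfI mz _ _ e1|exact: mulfI mz _ _ e2].
have zE (z : C) (n : nat) : (0 < n)%N -> z ^+ n = 1 -> z ^+ `|(1 %% n%:Z)%Z|%N = z.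
  move=> n0 zn; have -> : `|(1 %% n%:Z)%Z|%N = (1 %% n)%N by rewrite (modz_nat 1).
  by rewrite (expr_mod 1 zn) expr1.
split.
  have [u eu] := cin1 (1, 0); have u1 : u.1 = 1 by case: eu.
  have em1 : mco S m (1, 0) = mco S' m' u by rewrite /mco eu em.
  have := h (mco S m (1, 0)); rewrite lattice_fun_co // em1 lattice_fun_co // u1 /= !zE // => ez.
  by rewrite /al /al' ez em.
have [y [y1 y2]] := cin1 (0, 1); have [z [z1 z2]] := cin2 (0, 1).
have [x [x1 x2]] := cin1 (1, 0).
rewrite !mulr0 !mulr1 !add0r -y1 in y2; rewrite !mulr0 !mulr1 !add0r -z1 in z2.
rewrite !mulr0 !mulr1 !addr0 -x1 mulr1 in x2; rewrite !mulr0 !add0r in y2 z2.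
have e1 := peig1 S; have e2 := peig1 S'; rewrite -same_lam in e2.
have x2' : (a00 S)%:~R = (a00 S')%:~R + (a01 S')%:~R * x.2%:~R :> R.
  by rewrite -intrM -intrD; congr _%:~R; clear -x2; lia.
have n0' : (a01 S')%:~R != 0 :> R by rewrite intr_eq0 m01_neq0.
have eqw : (a01 S)%:~R * w + (a01 S')%:~R * x.2%:~R = (a01 S')%:~R * w'.
  by apply: (addrI (a00 S')%:~R); rewrite e2 -e1 x2'; ring.
have : a01 S = a01 S' \/ a01 S = - a01 S'.
  have n1 := m01_neq0 S; have n2 := m01_neq0 S'; clear -y2 z2 n1 n2.
  move: (a01 S) (a01 S') y.2 z.2 n1 n2 y2 z2 => a b p q a0 b0 ab ba.
  have : p * q = 1 by apply: (mulfI b0); rewrite mulr1 mulrA -ab -ba.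
  move=> pq; have : (`|p| * `|q|)%N = 1%N by rewrite -abszM pq.
  move/eqP; rewrite muln_eq1 => /andP[/eqP hp _]; have : p = 1 \/ p = -1 by clear -hp; lia.
  by case=> hq; rewrite ab hq ?mulr1 ?mulrN1; [left|right].
case=> ea; rewrite ea in eqw.
  left; have -> : w - w' = (- x.2)%:~R; last exact: intr_int.
  by apply: (mulfI n0'); rewrite mulrBr -eqw intrN; ring.
right; have -> : w + w' = x.2%:~R; last exact: intr_int.
by apply: (mulfI n0'); rewrite mulrDr -eqw intrN; ring.
Qed.

End Pair.

(** * Bounded Pell sequences satisfying a rapidly vanishing relation *)

Section Gauss.
Variable F : closedFieldType.
Local Notation ev rho := (map_poly (horner_eval (rho : F))).

Lemma ev_eq0 (P : {poly {poly F}}) rho : ev rho P = 0 ->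
  exists P', P = ('X - rho%:P)%:P * P'.
Proof.
move=> P0; exists (map_poly (fun c => c %/ ('X - rho%:P)) P); apply/polyP => i.
rewrite coefCM coef_map_id0 ?div0p // mulrC divpK // dvdp_XsubCl.
by have := congr1 (fun p : {poly F} => p`_i) P0; rewrite coef_map coef0 /= /horner_eval => /eqP.
Qed.

(** Trivial content: over an algebraically closed field this means that the coefficients have no
    common root. *)
Definition primitive2 (P : {poly {poly F}}) : Prop := forall rho, ev rho P <> 0.

Lemma primitive_part (P : {poly {poly F}}) : P != 0 ->
  exists c G, [/\ P = c%:P * G, c != 0 & primitive2 G].
Proof.
have [n] := ubnP (size (lead_coef P)); elim: n P => // n IH P sP P0.
case: (pselect (exists rho, ev rho P = 0)) => [[rho /ev_eq0[P' eP]]|nr]; last first.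
  exists 1, P; split; rewrite ?polyC1 ?mul1r ?oner_neq0 // => rho h; apply: nr; by exists rho.
have P'0 : P' != 0 by apply: contraNneq P0 => e; rewrite eP e mulr0.
have [||c [G [e c0 G0]]] := IH P' => //.
  move: sP; rewrite eP lead_coefM lead_coefC mulrC size_Mmonic ?monicXsubC ?lead_coef_eq0 //.
  by rewrite size_XsubC addn2.
exists (('X - rho%:P) * c), G; split=> //; first by rewrite eP e polyCM mulrA.
by rewrite mulf_neq0 // polyXsubC_eq0.
Qed.

(** The roots of a are removed one at a time. At a root rho the product q G vanishes and G does not,
    so X - rho divides every coefficient of q. *)
Lemma gauss (a : {poly F}) (f q G : {poly {poly F}}) : a != 0 -> primitive2 G ->
  a%:P * f = q * G -> exists q', f = q' * G.
Proof.
have [n] := ubnP (size a); elim: n a q => // n IH a q sa a0 pG e.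
case: (boolP (size a == 1%N)) => [/size_poly1P[c c0 ea]|/closed_rootP[rho ra]].
  exists ((c^-1)%:P%:P * q); rewrite -mulrA -e ea mulrA -!polyCM mulVf // !polyC1 mul1r //.
have [a' ea'] := factor_theorem _ _ ra.
have : ev rho q * ev rho G = 0.
  rewrite -rmorphM -e rmorphM /= map_polyC /= /horner_eval (rootP ra) polyC0 mul0r //.
move/eqP; rewrite mulf_eq0 => /orP[/eqP /ev_eq0[q' eq']|/eqP /pG //].
have X0 : ('X - rho%:P)%:P != 0 :> {poly {poly F}} by rewrite polyC_eq0 polyXsubC_eq0.
have a'0 : a' != 0 by apply: contraNneq a0 => h; rewrite ea' h mul0r.
apply: (IH a' q') => //.
  by move: sa; rewrite ea' size_Mmonic ?monicXsubC // size_XsubC addn2.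
by apply: (mulfI X0); rewrite mulrA -polyCM [_ * a']mulrC -ea' e eq' mulrA.
Qed.

End Gauss.

(** * Newton polygons in an irrational direction *)

Section Newton.
Variables (R : realFieldType) (F : idomainType) (lam : R).
Hypothesis lam_irr : forall x y : int, x%:~R * lam = y%:~R -> x = 0.
Implicit Types p q : {poly {poly F}}.

Definition slope (a b : nat) : R := a%:R + lam * b%:R.

Lemma slope_inj a b a' b' : slope a b = slope a' b' -> a = a' /\ b = b'.
Proof.
rewrite /slope => e; have h : (b%:Z - b'%:Z)%:~R * lam = (a'%:Z - a%:Z)%:~R.
  by rewrite !intrB -!pmulrn; lra.
have b0 := lam_irr h; have {b0}eb : b = b' by lia.
by split=> //; move: e; rewrite eb => /addIr/eqP; rewrite eqr_nat => /eqP.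
Qed.

Lemma slope_max (sg : R) p : p != 0 -> exists a b, p`_a`_b != 0 /\
  forall a' b', p`_a'`_b' != 0 -> sg * slope a' b' <= sg * slope a b.
Proof.
move=> p0; pose B := (size p + \max_(i < size p) size (p`_i)%R)%N.
have pB a b : p`_a`_b != 0 -> (a < B)%N && (b < B)%N.
  move=> h; case: (ltnP a (size p)) => [ap|pa]; last by rewrite (nth_default 0 pa) coef0 eqxx in h.
  case: (ltnP b (size (p`_a)%R)) => [bp|pb]; last by rewrite (nth_default 0 pb) eqxx in h.
  have h2 : (size (p`_a)%R <= \max_(i < size p) size (p`_i)%R)%N.
    exact: (leq_bigmax (F := fun i : 'I_(size p) => size (p`_i)%R) (Ordinal ap)).
  rewrite /B ltn_addr // (leq_trans bp) // (leq_trans h2) // leq_addl //.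
have l0 : p`_(size p).-1`_(size (lead_coef p)).-1 != 0.
  by rewrite -[p`_(size p).-1]/(lead_coef p) -lead_coefE lead_coef_eq0 lead_coef_eq0.
have /andP[aB bB] := pB _ _ l0.
have [[a b] /= pab mx] := @arg_maxP _ R ('I_B * 'I_B)%type (Ordinal aB, Ordinal bB)
  (fun v => p`_(v.1)`_(v.2) != 0) (fun v => sg * slope v.1 v.2) l0.
exists a, b; split=> // a' b' h; have /andP[aB' bB'] := pB _ _ h.
exact: (mx (Ordinal aB', Ordinal bB')).
Qed.

(** The slope is injective on exponents, so extremal monomials are unique and their product cannot
    cancel. The sign of [sg] selects the maximum or the minimum. *)
Lemma slope_product (sg : R) p q a b a' b' : sg != 0 ->
  (forall x y, p`_x`_y != 0 -> sg * slope x y <= sg * slope a b) ->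
  (forall x y, q`_x`_y != 0 -> sg * slope x y <= sg * slope a' b') ->
  (p * q)`_(a + a')`_(b + b') = p`_a`_b * q`_a'`_b'.
Proof.
move=> sg0 mp mq; rewrite coefM coef_sum.
have aL : (a < (a + a').+1)%N by lia.
have bL : (b < (b + b').+1)%N by lia.
have zero (i : nat) (j : nat) : (i <= a + a')%N -> (j <= b + b')%N -> (i, j) != (a, b) ->
    p`_i`_j * q`_(a + a' - i)`_(b + b' - j) = 0.
  move=> ia jb ij; apply/eqP; apply: contraT; rewrite mulf_eq0 negb_or => /andP[pn qn].
  have h1 := mp _ _ pn; have h2 := mq _ _ qn.
  have e : sg * slope i j + sg * slope (a + a' - i) (b + b' - j) = sg * slope a b + sg * slope a' b'.
    by rewrite /slope !natrB // !natrD; ring.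
  have : sg * slope i j = sg * slope a b by apply/eqP; rewrite eq_le h1 /=; move: h2 e; lra.
  by move/(mulfI sg0)/slope_inj => -[e1 e2]; rewrite e1 e2 eqxx in ij.
rewrite (bigD1 (Ordinal aL)) //= [X in _ + X]big1 ?addr0; last first.
  move=> i ni; rewrite coefM big1 // => j _; apply: (zero i j (ltnSE (ltn_ord i)) (ltnSE (ltn_ord j))).
  by apply: contra ni => /eqP[ei _]; apply/eqP/val_inj.
rewrite coefM (bigD1 (Ordinal bL)) //= [X in _ + X]big1 ?addr0 ?addKn //.
move=> j nj; have := zero a j (leq_addr _ _) (ltnSE (ltn_ord j)); rewrite addKn; apply.
by apply: contra nj => /eqP[ej]; apply/eqP/val_inj.
Qed.

Lemma width_le (delta : R) p q : p != 0 -> q != 0 ->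
  (forall a b a' b', (p * q)`_a`_b != 0 -> (p * q)`_a'`_b' != 0 -> slope a b - slope a' b' <= delta) ->
  forall a b a' b', q`_a`_b != 0 -> q`_a'`_b' != 0 -> slope a b - slope a' b' <= delta.
Proof.
move=> p0 q0 h a b a' b' qab qab'.
have [x [y [pxy mp]]] := slope_max 1 p0; have [x' [y' [qxy mq]]] := slope_max 1 q0.
have [u [v [puv np]]] := slope_max (-1) p0; have [u' [v' [quv nq]]] := slope_max (-1) q0.
have e1 := slope_product (oner_neq0 _) mp mq.
have n1 : (-1 : R) != 0 by rewrite oppr_eq0 oner_eq0.
have e2 := slope_product n1 np nq.
have := h _ _ _ _ (_ : (p * q)`_(x + x')`_(y + y') != 0) (_ : (p * q)`_(u + u')`_(v + v') != 0).
rewrite e1 e2 !mulf_neq0 // => /(_ isT isT).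
have := mp _ _ puv; have := mq _ _ qab; have := nq _ _ qab'.
rewrite /slope !natrD; lra.
Qed.

End Newton.

(** * The recurrence y_(k+2) y_k = y_(k+1)^t and its torsion solutions *)

Section Torsion.
Variables (R : realType) (t : nat) (lam : R).
Hypotheses (lam1 : 1 < lam) (lamt : lam ^+ 2 + 1 = t%:R * lam) (t2 : (2 < t)%N).
Hypothesis lam_irr : forall x y : int, x%:~R * lam = y%:~R -> x = 0.
Local Notation C := R[i]%C.
Variables (y : nat -> C) (B : R).
Hypotheses (y0 : forall k, y k != 0) (yB : forall k, normc (y k) <= B)
  (yVB : forall k, normc (y k)^-1 <= B).
Hypothesis y_rec : forall k, y k.+2 * y k = y k.+1 ^+ t.

(** Decay faster than every geometric sequence. Unlike [flat] it refers to no scale, so it also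
    applies to bounded sequences and to quotients of monomials of two series. *)
Definition tiny (c : nat -> C) : Prop :=
  forall A : nat, exists M, forall k, normc (c k) * A%:R ^+ k <= M.

Lemma tinyD c c' : tiny c -> tiny c' -> tiny (fun k => c k + c' k).
Proof.
move=> h h' A; have [M hM] := h A; have [M' hM'] := h' A; exists (M + M') => k.
apply: le_trans (_ : (normc (c k) + normc (c' k)) * A%:R ^+ k <= _).
  by rewrite ler_wpM2r ?exprn_ge0 // ler_normcD.
by rewrite mulrDl lerD.
Qed.

Lemma tinyM c b (D : R) : (forall k, normc (b k) <= D) -> tiny c -> tiny (fun k => b k * c k).
Proof.
move=> hD h A; have [M hM] := h A; exists (D * M) => k.
have D0 : 0 <= D by apply: le_trans (hD 0%N); apply: normc_ge0.
rewrite normcM -mulrA ler_pM ?normc_ge0 // mulr_ge0 ?normc_ge0 ?exprn_ge0 //.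
Qed.

Lemma tiny_eq c c' : c =1 c' -> tiny c -> tiny c'.
Proof. by move=> e h A; have [M hM] := h A; exists M => k; rewrite -e. Qed.

Lemma tinyS c : tiny c -> tiny (fun k => c k.+1).
Proof.
move=> h A; have [M hM] := h A; have [-> |A0] := posnP A.
  have [M1 hM1] := h 1%N; exists M1 => k; have := hM1 k.+1; rewrite expr1n mulr1; apply: le_trans.
  by rewrite ler_piMr ?normc_ge0 //; case: k => [|k]; rewrite ?expr0 // exprS mul0r.
exists M => k; apply: le_trans (hM k.+1).
by rewrite ler_wpM2l ?normc_ge0 // ler_weXn2l // ler1n.
Qed.

Lemma tiny_small c e : tiny c -> 0 < e -> exists k0, forall k, (k0 <= k)%N -> normc (c k) < e.
Proof.
move=> h e0; have [M hM] := h 2%N.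
have M0 : 0 <= M by have := hM 0%N; rewrite expr0 mulr1; apply: le_trans; apply: normc_ge0.
have M1 : 0 < e / (M + 1) by rewrite divr_gt0 // ltr_wpDl.
have [|k0 hk0] := @expr_lt_eventually R 2^-1 _ _ M1; first by apply/andP; split; lra.
exists k0 => k hk; have p2 : 0 < 2%:R ^+ k :> R by rewrite exprn_gt0.
rewrite -(ltr_pM2r p2); apply: le_lt_trans (hM k) _.
move: hk0; rewrite ltr_pdivlMr ?ltr_wpDl // => hk0.
have : 2^-1 ^+ k * (M + 1) < e.
  apply: le_lt_trans hk0; rewrite ler_wpM2r ?addr_ge0 // ler_wiXn2l //; lra.
rewrite -(ltr_pM2r p2) mulrAC -exprMn mulVf ?pnatr_eq0 // expr1n mul1r.
by apply: lt_trans; rewrite ltrDl.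
Qed.

Lemma B_ge0 : 0 <= B.
Proof. by apply: le_trans (yB 0); apply: normc_ge0. Qed.

(** An ideal by [J_D] and [J_M], where the boundedness of y is used. *)
Definition J (P : {poly {poly C}}) : Prop := tiny (fun k => P.[y k.+1, y k]).

Lemma bounded_value (P : {poly {poly C}}) : exists D, forall k, normc P.[y k.+1, y k] <= D.
Proof.
have [M M0 hM] := lipschitz2_poly B_ge0 P; exists M => k.
by have [] := hM _ _ _ _ (yB k.+1) (yB k) (yB k.+1) (yB k).
Qed.

Lemma J_D P Q : J P -> J Q -> J (P + Q).
Proof. by move=> h h'; apply: tiny_eq (tinyD h h') => k; rewrite !hornerD. Qed.

Lemma J_M P Q : J P -> J (Q * P).
Proof.
move=> h; have [D hD] := bounded_value Q.
by apply: tiny_eq (tinyM hD h) => k; rewrite !hornerM.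
Qed.

Lemma box_bound (P : {poly {poly C}}) : exists n, forall a b, (n <= a)%N || (n <= b)%N -> P`_a`_b = 0.
Proof.
exists (size P + \max_(i < size P) size (P`_i)%R)%N => a b.
case: (ltnP a (size P)) => [ap|pa _]; last by rewrite (nth_default 0 pa) coef0.
case/orP => h; first by move: ap h; lia.
apply: nth_default; apply: leq_trans h; apply: leq_trans (leq_addl _ _).
exact: (leq_bigmax (F := fun i : 'I_(size P) => size (P`_i)%R) (Ordinal ap)).
Qed.

Lemma horner2_box (P : {poly {poly C}}) n x z : (forall a b, (n <= a)%N || (n <= b)%N -> P`_a`_b = 0) ->
  P.[x, z] = \sum_(v : 'I_n * 'I_n) P`_(v.1)`_(v.2) * (x ^+ v.1 * z ^+ v.2).
Proof.
move=> hn; have {1}-> : P = \poly_(a < n) (\poly_(b < n) P`_a`_b).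
  apply/polyP => a; rewrite coef_poly; case: ltnP => an; last first.
    by apply/polyP => b; rewrite hn ?an // coef0.
  apply/polyP => b; rewrite coef_poly; case: ltnP => bn //.
  by rewrite hn ?bn ?orbT.
rewrite [X in X.[_]]horner_poly -[LHS]/(horner_eval z _) rmorph_sum.
rewrite -(pair_bigA _ (fun a b : 'I_n => P`_a`_b * (x ^+ a * z ^+ b))) /=.
apply: eq_bigr => i _ /=.
rewrite /horner_eval hornerM -polyC_exp hornerC horner_poly mulr_suml.
by apply: eq_bigr => j _; rewrite mulrAC mulrA.
Qed.

(* [y k.+2] is replaced by [y k.+1 ^+ t / y k], and the denominators are cleared. *)
Lemma shift_exists (P : {poly {poly C}}) : exists Q (N : nat), [/\ J P -> J Q, P != 0 -> Q != 0 &
  forall a b, Q`_a`_b != 0 -> exists c d, P`_c`_d != 0 /\ slope lam a b = lam * N%:R + lam^-1 * slope lam c d].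
Proof.
have [n hn] := box_bound P.
pose Q : {poly {poly C}} := \sum_(v : 'I_n * 'I_n) (P`_(v.1)`_(v.2))%:P%:P * ('X^(t * v.1 + v.2) * ('X^(n - v.1))%:P).
have cQ a b : Q`_a`_b = \sum_(v : 'I_n * 'I_n) P`_(v.1)`_(v.2) * ((a == t * v.1 + v.2)%N && (b == n - v.1)%N)%:R.
  rewrite /Q coef_sum coef_sum; apply: eq_bigr => v _.
  rewrite coefCM coefCM coefMC coefXn; case: eqP => _ /=; last by rewrite mul0r coef0 !mulr0.
  by rewrite mul1r coefXn.
exists Q, n; split.
- move=> JP; have e k : y k ^+ n * P.[y k.+2, y k.+1] = Q.[y k.+1, y k].
    have hS (T : finType) (F : T -> {poly {poly C}}) : (\sum_u F u).[y k.+1, y k] = \sum_u (F u).[y k.+1, y k].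
      by elim/big_rec2: _ => [|u x z _ <-]; [rewrite !horner0 | rewrite !hornerD].
    rewrite (horner2_box _ _ hn) mulr_sumr /Q hS; apply: eq_bigr => v _.
    rewrite hornerM hornerC hornerM hornerC hornerM hornerXn hornerC hornerM hornerXn -polyC_exp hornerC.
    have vn : (v.1 <= n)%N by apply: ltnW.
    rewrite -{1}(subnK vn) exprD exprD exprM -y_rec exprMn; ring.
  have hb k : normc (y k ^+ n) <= B ^+ n by rewrite normcX lerXn2r ?nnegrE ?normc_ge0 ?B_ge0.
  by apply: tiny_eq e (tinyM hb (tinyS JP)).
- move=> P0; have [a [b Pab]] := poly2_neq0 P0.
  have an : (a < n)%N by rewrite ltnNge; apply: contra Pab => h; rewrite hn ?h.
  have bn : (b < n)%N by rewrite ltnNge; apply: contra Pab => h; rewrite hn ?h ?orbT.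
  apply: contraNneq Pab => Q0; have := cQ (t * a + b)%N (n - a)%N; rewrite Q0 !coef0.
  rewrite (bigD1 (Ordinal an, Ordinal bn)) //= !eqxx mulr1 big1 ?addr0 => [<- //|[c d] /= ncd].
  case: andP => [[/eqP e1 /eqP e2]|_]; last by rewrite mulr0.
  have ca : (c = a :> nat) by have := ltn_ord c; clear -an e2; lia.
  case/eqP: ncd; congr (_, _); apply: val_inj => //=; clear -ca e1; nia.
move=> a b; rewrite cQ => h.
case: (pselect (exists v : 'I_n * 'I_n, P`_(v.1)`_(v.2) != 0 /\ a = (t * v.1 + v.2)%N /\ b = (n - v.1)%N)); last first.
  move=> nv; case/eqP: h; rewrite big1 // => v _; case: andP => [[/eqP e1 /eqP e2]|_]; last by rewrite mulr0.
  case: (eqVneq P`_(v.1)`_(v.2) 0) => [->|pv]; first by rewrite mul0r.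
  by case: nv; exists v.
case=> [[c d] /= [pcd [-> ->]]]; exists c, d; split=> //.
rewrite /slope natrB ?natrD ?natrM; last exact: ltnW.
rewrite (trace_lam lam1 lamt); have : lam != 0 by rewrite gt_eqF // (lt_trans _ lam1).
move/mulfV; move: (lam^-1) => u lu; ring: lu.
Qed.

(** Let P in the ideal have least degree in y_(k+1). By pseudo-division and Gauss's lemma its
    primitive part G divides the whole ideal. Repeated shifting puts nonzero polynomials of
    arbitrarily small width into the ideal, so G has width 0 in an irrational direction and is a
    single monomial. If it involved y_(k+1), division by this factor, whose inverse is bounded,
    would lower the degree. *)
Lemma univariate_relation (P : {poly {poly C}}) : P != 0 -> J P ->
  exists2 r : {poly C}, r != 0 & tiny (fun k => r.[y k]).
Proof.
move=> P0 JP.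
pose Pr s := `[< exists Q, [/\ Q != 0, J Q & size Q = s] >].
have exPr : exists s, Pr s by exists (size P); apply/asboolP; exists P.
case: (ex_minnP exPr) => s /asboolP[{JP P0}P [P0 JP sP]] mins {exPr}.
case: (eqVneq s 1%N) => [s1|s1].
  have /size_poly1P[r r0 eP] : size P == 1%N by rewrite sP s1.
  by exists r => //; apply: tiny_eq JP => k; rewrite eP hornerC.
exfalso.
have s2 : (1 < s)%N by rewrite ltn_neqAle eq_sym s1 /= -sP size_poly_gt0.
have [c [G [eP c0 pG]]] := primitive_part P0.
have dvd f : J f -> exists q, f = q * G.
  move=> Jf; have e := Pdiv.Idomain.divp_eq f P.
  have J1 : J (f %% P).
    have -> : f %% P = (lead_coef P ^+ scalp f P)%:P * f + (- (f %/ P)) * P.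
      by rewrite mul_polyC e mulNr addrAC subrr add0r.
    by apply: J_D; apply: J_M.
  have r0 : f %% P = 0.
    apply/eqP; apply: contraT => nz.
    have : Pr (size (f %% P)) by apply/asboolP; exists (f %% P).
    by move/mins; rewrite -sP leqNgt Pdiv.Idomain.ltn_modp P0.
  apply: (gauss (a := lead_coef P ^+ scalp f P) (q := f %/ P * c%:P) _ pG).
    by rewrite expf_neq0 // lead_coef_eq0.
  by rewrite mul_polyC e r0 addr0 {2}eP mulrA.
have l0 : 0 < lam by apply: lt_trans lam1.
have [u0 u1] := andP (lamV_lt1 lam1).
have [delta hdelta] : exists delta, forall a b a' b', P`_a`_b != 0 -> P`_a'`_b' != 0 ->
    slope lam a b - slope lam a' b' <= delta.
  have [x [x' [_ mx]]] := slope_max lam 1 P0; have [u [u' [_ mu]]] := slope_max lam (-1) P0.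
  exists (slope lam x x' - slope lam u u') => a b a' b' h h'.
  have := mx _ _ h; have := mu _ _ h'; lra.
have step j : exists f, [/\ f != 0, J f & forall a b a' b', f`_a`_b != 0 -> f`_a'`_b' != 0 ->
    slope lam a b - slope lam a' b' <= lam^-1 ^+ j * delta].
  elim: j => [|j [f [f0 Jf wf]]]; first by exists P; split=> // a b a' b' h h'; rewrite expr0 mul1r hdelta.
  have [Q [N [JQ Q0 wQ]]] := shift_exists f; exists Q; split; [exact: Q0|exact: JQ|].
  move=> a b a' b' /wQ[x [z [h1 ->]]] /wQ[x' [z' [h2 ->]]].
  have := wf _ _ _ _ h1 h2; rewrite -(ler_pM2l u0) exprS -mulrA; lra.
have wG a b a' b' : G`_a`_b != 0 -> G`_a'`_b' != 0 -> slope lam a b <= slope lam a' b'.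
  move=> h h'; rewrite -subr_le0; apply/ler_addgt0Pr => e e0; rewrite add0r.
  have d0 : 0 < e / (`|delta| + 1) by rewrite divr_gt0 // ltr_wpDl.
  have [|j hj] := @expr_lt_eventually R lam^-1 _ _ d0; first by rewrite u1 ltW.
  have [f [f0 Jf wf]] := step j; have [q eq] := dvd f Jf.
  have q0 : q != 0 by apply: contraNneq f0 => z; rewrite eq z mul0r.
  have G0 : G != 0 by apply: contraNneq f0 => z; rewrite eq z mulr0.
  rewrite eq in wf; have := width_le lam_irr q0 G0 wf h h'; move/le_trans; apply.
  move: hj; rewrite ltr_pdivlMr ?ltr_wpDl // => hj; apply: le_trans (ltW hj).
  rewrite ler_wpM2l ?exprn_ge0 ?(ltW u0) //; have := ler_norm delta; lra.
have sG : size G = s by rewrite -sP eP size_Cmul.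
have G0 : G`_0 = 0.
  apply/polyP => b; rewrite coef0; apply/eqP; apply: contraT => Gb.
  have lG : G`_s.-1`_(size (lead_coef G)).-1 != 0.
    rewrite -sG -[G`_(size G).-1]/(lead_coef G) -lead_coefE !lead_coef_eq0.
    by rewrite -size_poly_gt0 sG ltnW.
  have : slope lam 0 b = slope lam s.-1 (size (lead_coef G)).-1.
    by apply/eqP; rewrite eq_le !wG.
  by case/(slope_inj lam_irr); move: s2; case: (s) => [|[]].
have /factor_theorem[G' eG] : root G 0 by rewrite /root horner_coef0 G0.
have eP' : P = (c%:P * G') * 'X by rewrite {1}eP eG polyC0 subr0 mulrA.
have P'0 : c%:P * G' != 0 by apply: contraNneq P0 => z; rewrite eP' z mul0r.
have : Pr (size (c%:P * G')).
  apply/asboolP; exists (c%:P * G'); split=> //.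
  apply: (tiny_eq _ (tinyM (fun k => yVB k.+1) JP)) => k.
  by rewrite {1}eP' hornerM hornerX hornerM hornerC mulrC mulfK.
by move/mins; rewrite -sP {1}eP' size_mulX // ltnn.
Qed.

Lemma normc_inv (x : C) : x != 0 -> normc x^-1 = (normc x)^-1.
Proof.
move=> x0; have n0 : normc x != 0 by rewrite normc_eq0.
by apply: (mulfI n0); rewrite -normcM mulfV // normc1 mulfV.
Qed.

Lemma nearest_root (s : seq C) (x : C) : s != [::] ->
  exists2 z, z \in s & normc (x - z) ^+ size s <= \prod_(z <- s) normc (x - z).
Proof.
elim: s => // z s IH _; case: (eqVneq s [::]) => [->|sn].
  by exists z; rewrite ?mem_head // big_seq1 expr1.
have [z' z's h] := IH sn; rewrite big_cons /=.
have [le|lt] := lerP (normc (x - z)) (normc (x - z')).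
  exists z; rewrite ?mem_head // exprS ler_wpM2l ?normc_ge0 //; apply: le_trans h.
  by rewrite lerXn2r ?nnegrE ?normc_ge0.
exists z'; first by rewrite inE z's orbT.
by rewrite exprS ler_pM ?exprn_ge0 ?normc_ge0 // ltW.
Qed.

Lemma list_gap (L : seq C) : exists2 e : R, 0 < e & forall v, v \in L -> v != 0 -> e <= normc v.
Proof.
elim: L => [|v L [e e0 IH]]; first by exists 1.
case: (eqVneq v 0) => [->|v0].
  by exists e => // u; rewrite inE => /orP[/eqP ->|/IH //]; rewrite eqxx.
exists (Num.min e (normc v)); first by rewrite lt_min e0 normc_gt0.
move=> u; rewrite inE ge_min => /orP[/eqP ->|/IH h u0]; first by rewrite lexx orbT.
by rewrite h.
Qed.

Lemma tiny_root (c b : nat -> C) (D : R) n : (forall k, normc (c k) ^+ n.+1 <= D * normc (b k)) ->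
  tiny b -> tiny c.
Proof.
move=> h tb A; have [M hM] := tb (A ^ n.+1)%N; exists (1 + `|D| * `|M|) => k.
set x := normc (c k) * A%:R ^+ k.
have x0 : 0 <= x by rewrite mulr_ge0 ?normc_ge0 ?exprn_ge0.
have xn : x ^+ n.+1 <= `|D| * `|M|.
  rewrite /x exprMn -exprM mulnC exprM -natrX.
  apply: (@le_trans _ _ (D * normc (b k) * (A ^ n.+1)%:R ^+ k)).
    by rewrite ler_wpM2r ?exprn_ge0.
  rewrite -mulrA; apply: (@le_trans _ _ (`|D| * (normc (b k) * (A ^ n.+1)%:R ^+ k))).
    by rewrite ler_wpM2r ?ler_norm // mulr_ge0 ?normc_ge0 ?exprn_ge0.
  by rewrite ler_wpM2l //; apply: le_trans (hM k) (ler_norm _).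
have [x1|x1] := lerP x 1; first by rewrite (le_trans x1) // lerDl mulr_ge0.
apply: (le_trans (y := x ^+ n.+1)); last by apply: le_trans xn _; rewrite lerDr.
by rewrite ler_eXnr // ltW.
Qed.

Lemma tiny_shiftn c n : tiny c -> tiny (fun k => c (n + k)%N).
Proof.
move=> h; elim: n => [|n IH]; first exact: h.
by apply: tiny_eq (tinyS IH) => k; rewrite addSnnS.
Qed.

(** With A >= 4 D, each use of the inequality halves the uniform bound for |E_k| A^k, which tiny
    decay provides to begin with. *)
Lemma backward_zero (E : nat -> C) (D : R) : 0 <= D ->
  (forall k, normc (E k) <= D * (normc (E k.+1) + normc (E k.+2))) -> tiny E -> forall k, E k = 0.
Proof.
move=> D0 h tE; pose A := (Num.truncn (4 * D)).+1.
have A4 : 4 * D <= A%:R by rewrite ltW // truncnS_gt.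
have A1 : 1 <= A%:R :> R by rewrite ler1n.
have [M hM] := tE A.
have M0 : 0 <= M by have := hM 0%N; rewrite expr0 mulr1; apply: le_trans; apply: normc_ge0.
have half n k : normc (E k) * A%:R ^+ k <= M * 2^-1 ^+ n.
  elim: n k => [|n IH] k; first by rewrite expr0 mulr1.
  have k1 := IH k.+1; have k2 := IH k.+2; rewrite exprS in k1; rewrite !exprS in k2.
  rewrite exprS; have hk := h k.
  have Ak : 0 <= A%:R ^+ k :> R by rewrite exprn_ge0.
  have l0 : normc (E k) * A%:R ^+ k <= D * (normc (E k.+1) * A%:R ^+ k + normc (E k.+2) * A%:R ^+ k).
    by rewrite -mulrDl mulrA ler_wpM2r.
  have e1 : 0 <= normc (E k.+1) * A%:R ^+ k by rewrite mulr_ge0 ?normc_ge0.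
  have e2 : 0 <= normc (E k.+2) * A%:R ^+ k by rewrite mulr_ge0 ?normc_ge0.
  have c1 : A%:R * (normc (E k.+1) * A%:R ^+ k) <= M * 2^-1 ^+ n by rewrite mulrCA.
  have c2 : A%:R * (normc (E k.+2) * A%:R ^+ k) <= M * 2^-1 ^+ n.
    apply: le_trans k2; rewrite mulrCA ler_wpM2l ?normc_ge0 //.
    by rewrite ler_peMl // mulr_ge0 // (le_trans ler01).
  move: c1 c2 l0 e1 e2; move: (normc (E k.+1) * _) (normc (E k.+2) * _) (normc (E k) * _) (2^-1 ^+ n).
  move=> x1 x2 x3 X c1 c2 l0 e1 e2.
  have d1 := le_trans (ler_wpM2r e1 A4) c1; have d2 := le_trans (ler_wpM2r e2 A4) c2.
  lra.
move=> k; apply/eqP; rewrite -normc_eq0 eq_le normc_ge0 andbT; apply/ler_addgt0Pr => e e0; rewrite add0r.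
have e1 : 0 < e / (M + 1) by rewrite divr_gt0 // ltr_wpDl.
have [|n hn] := @expr_lt_eventually R 2^-1 _ _ e1; first by apply/andP; split; lra.
move: hn; rewrite ltr_pdivlMr ?ltr_wpDl // => hn.
have := half n k; have Ak : 1 <= A%:R ^+ k :> R by rewrite exprn_ege1.
have p2 : 0 <= 2^-1 ^+ n :> R by rewrite exprn_ge0 // invr_ge0.
have := normc_ge0 (E k); move: (normc (E k)) (2^-1 ^+ n) (A%:R ^+ k) hn Ak p2 => x p a hn Ak p2 x0 ha.
nra.
Qed.

Lemma qexp_rec k : (qexp t k.+2 + qexp t k = t * qexp t k.+1)%N.
Proof.
rewrite !qexpS !pexpS; move: (pexp t k) (qexp t k) => p q; case: t t2 => [|[|u]] // _.
by rewrite !subSS !subn0; nia.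
Qed.

Lemma qexp_det k : (qexp t k * qexp t k.+2 + 1 = qexp t k.+1 ^ 2)%N.
Proof.
elim: k => [|k IH].
  by rewrite !qexpS !pexpS /=; case: t t2 => [|[|u]] // _; rewrite !subSS !subn0 /pexp /qexp /=; nia.
have r1 := qexp_rec k; have r2 := qexp_rec k.+1.
move: (qexp t k) (qexp t k.+1) (qexp t k.+2) (qexp t k.+3) IH r1 r2 => a b c d IH r1 r2.
by nia.
Qed.

Lemma qexp_pexp k : qexp t k.+1 = (pexp t k.+1 + qexp t k)%N.
Proof.
rewrite qexpS pexpS -addnA -mulSnr; congr (_ + _ * _)%N.
by case: t t2 => [|[|u]] // _; lia.
Qed.

(** Y_(k+j+2) is Y_(k+1)^(q_(j+1)) / Y_k^(q_j). Taking j + 2 equal to twice the period gives two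
    relations between Y_k and Y_(k+1); eliminating Y_(k+1) with [qexp_det] leaves the positive
    exponent q_(j+2) - q_j - 2. *)
Lemma period_torsion (Y : nat -> C) s : (forall k, Y k != 0) -> (forall k, Y k.+2 * Y k = Y k.+1 ^+ t) ->
  (0 < s)%N -> (forall k, Y (k + s)%N = Y k) -> exists2 N, (0 < N)%N & forall k, Y k ^+ N = 1.
Proof.
move=> Y0 Yrec s0 Ys.
have Ys2 k : Y (k + s + s)%N = Y k by rewrite !Ys.
(* Doubling the period makes it at least 2. *)
have [j ej] : exists j, (s + s)%N = j.+2 by exists (s + s - 2)%N; lia.
have h j' : forall k, Y (k + j'.+2)%N * Y k ^+ qexp t j' = Y k.+1 ^+ qexp t j'.+1 /\
    Y (k + j'.+3)%N * Y k ^+ qexp t j'.+1 = Y k.+1 ^+ qexp t j'.+2.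
  elim: j' => [|j' IH] k.
    have q1 : qexp t 1 = t by rewrite qexpS; case: t t2 => [|[|u]] // _; rewrite !subSS !subn0 /pexp /qexp /=; lia.
    have e1 : Y (k + 2)%N * Y k = Y k.+1 ^+ t by rewrite addn2 Yrec.
    rewrite q1 expr1; split=> //.
    have r := qexp_rec 0; rewrite q1 /= in r.
    apply: (mulIf (Y0 k.+1)); rewrite -exprSr.
    have -> : (qexp t 2).+1 = (t * t)%N by rewrite -r /qexp /= addn1.
    rewrite mulrAC addn3 Yrec -exprMn.
    by rewrite -[k.+2](addn2 k) e1 exprM.
  have [h1 h2] := IH k; split=> //.
  have r0 := qexp_rec j'; have r1 := qexp_rec j'.+1.
  have n1 : Y (k + j'.+2)%N * Y k ^+ qexp t j' != 0 by rewrite mulf_neq0 ?expf_neq0.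
  apply: (mulIf n1); rewrite [in RHS]h1 -exprD r1 mulrACA -exprD r0.
  have -> : Y (k + j'.+4)%N * Y (k + j'.+2)%N = Y (k + j'.+3)%N ^+ t.
    by rewrite !addnS Yrec.
  by rewrite mulnC exprM -exprMn h2 mulnC -exprM.
have h1 k : Y k ^+ (qexp t j).+1 = Y k.+1 ^+ qexp t j.+1.
  by have [a _] := h j k; rewrite -a -ej addnA Ys2 exprS.
have h2 k : Y k.+1 * Y k ^+ qexp t j.+1 = Y k.+1 ^+ qexp t j.+2.
  by have [_ b] := h j k; rewrite -b addnS -ej addnA -addSn -addSn Ys2.
have [_ PQ] := pq_ge j.+1 t2; have [Pj PQ2] := pq_ge j.+2 t2; have [_ PQ0] := pq_ge j t2.
have q12 := qexp_pexp j.+1.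
have q01 : (qexp t j <= qexp t j.+1)%N by rewrite qexp_pexp leq_addl.
exists (qexp t j.+2 - qexp t j - 2)%N; first by lia.
move=> k; have u0 := Y0 k; have v0 := Y0 k.+1; have := h1 k; have := h2 k; have := qexp_det j.
have : (qexp t j + 3 <= qexp t j.+2)%N by lia.
move: (Y k) (Y k.+1) u0 v0 (qexp t j) (qexp t j.+1) (qexp t j.+2) => u v u0 v0 a b c ac det e2 e1.
have eb : u ^+ b = v ^+ c.-1.
  by apply: (mulfI v0); rewrite e2 -exprS prednK //; lia.
have e3 : u ^+ (a.+1 * c.-1) = u ^+ (b * b).
  by rewrite exprM e1 -exprM mulnC exprM -eb -exprM.
have e4 : (a.+1 * c.-1 = (c - a - 2) + b * b)%N.
  by case: c ac det {e2 e3 eb} => [|c] ac det; [lia | rewrite /=; nia].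
have n0 : u ^+ (b * b) != 0 by rewrite expf_neq0.
by apply: (mulIf n0); rewrite -exprD -e4 e3 mul1r.
Qed.

(** A univariate relation puts y_k extremely close to a root rho_k. As there are finitely many
    roots, rho satisfies the recurrence exactly from some step on and is eventually periodic. The
    quotients Y_(k+p) / Y_k solve the recurrence and tend to 1 faster than every geometric sequence,
    so they equal 1, and a periodic solution is torsion. *)
Lemma torsion (P : {poly {poly C}}) : P != 0 -> J P ->
  exists N k0, (0 < N)%N /\ forall k, (k0 <= k)%N -> y k ^+ N = 1.
Proof.
move=> P0 JP; have [r r0 tr] := univariate_relation P0 JP.
have [s er] := closed_field_poly_normal r.
have lc0 : lead_coef r != 0 by rewrite lead_coef_eq0.
have rE k : r.[y k] = lead_coef r * \prod_(z <- s) (y k - z).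
  rewrite {1}er hornerZ horner_prod; congr (_ * _); apply: eq_bigr => z _.
  by rewrite hornerXsubC.
have sn : s != [::].
  apply/eqP => s0; have gl : 0 < normc (lead_coef r) by rewrite normc_gt0.
  have [k0 hk0] := tiny_small tr gl.
  by have := hk0 _ (leqnn _); rewrite rE s0 big_nil mulr1 ltxx.
have /choice[rho hrho] : forall k, exists z, z \in s /\ normc (y k - z) ^+ size s <= \prod_(z <- s) normc (y k - z).
  by move=> k; have [z zs hz] := nearest_root (y k) sn; exists z.
have rs k : rho k \in s by case: (hrho k).
pose eta k := y k - rho k.
have te : tiny eta.
  case: s sn er rE hrho rs => // z0 s _ er rE hrho rs.
  apply: (@tiny_root _ _ (normc (lead_coef r))^-1 (size s) _ tr) => k.
  rewrite rE normcM mulKf ?normc_eq0 // normc_prod; by case: (hrho k).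
pose D := \sum_(z <- s) normc z.
have rD k : normc (rho k) <= D.
  rewrite /D (big_rem (rho k)) //= lerDl; apply: sumr_ge0 => z _; exact: normc_ge0.
have D0 : 0 <= D by apply: le_trans (rD 0%N); apply: normc_ge0.
have powB x z n (E : R) : normc x <= E -> normc z <= E -> normc (x ^+ n - z ^+ n) <= normc (x - z) * (n%:R * E ^+ n.-1).
  move=> xE zE; have E0 : 0 <= E by apply: le_trans xE; apply: normc_ge0.
  rewrite subrXX normcM ler_wpM2l ?normc_ge0 //; apply: le_trans (ler_normc_sum _ _ _) _.
  rewrite -[n in n%:R]card_ord -sumr_const mulr_suml; apply: ler_sum => i _.
  rewrite mul1r normcM !normcX.
  have -> : E ^+ n.-1 = E ^+ (n.-1 - i) * E ^+ i by rewrite -exprD subnK //; have := ltn_ord i; lia.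
  by rewrite ler_pM ?exprn_ge0 ?normc_ge0 // lerXn2r ?nnegrE ?normc_ge0.
pose e k := rho k.+2 * rho k - rho k.+1 ^+ t.
have tpow (c c' : nat -> C) n (E : R) : (forall k, normc (c k) <= E) -> (forall k, normc (c' k) <= E) ->
   tiny (fun k => c k - c' k) -> tiny (fun k => c k ^+ n - c' k ^+ n).
  move=> h h' tc A; have [M hM] := tc A; exists (M * (n%:R * E ^+ n.-1)) => k.
  apply: le_trans (ler_wpM2r _ (powB _ _ n _ (h k) (h' k))) _; first by rewrite exprn_ge0.
  rewrite mulrAC ler_wpM2r //; have E0 : 0 <= E by apply: le_trans (h 0%N); apply: normc_ge0.
  by rewrite mulr_ge0 // exprn_ge0.
have ten : tiny (fun k => (-1) * e k).
  have h1 : tiny (fun k => (y k.+2 * eta k) + (rho k * eta k.+2)).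
    apply: tinyD; first exact: tinyM (fun k => yB k.+2) te.
    exact: tinyM rD (tinyS (tinyS te)).
  have BD0 : forall k, normc (y k.+1) <= B + D by move=> k; rewrite (le_trans (yB _)) // lerDl.
  have BD1 : forall k, normc (rho k.+1) <= B + D by move=> k; rewrite (le_trans (rD _)) // lerDr B_ge0.
  have h2 := tpow (fun k => y k.+1) (fun k => rho k.+1) t _ BD0 BD1 (tinyS te).
  have h3 := tinyM (fun k => lexx (normc (-1 : C))) h2.
  apply: tiny_eq (tinyD h1 h3) => k; rewrite /e /eta -y_rec; ring.
have te' : tiny e.
  by apply: tiny_eq (tinyM (fun k => lexx (normc (-1 : C))) ten) => k; rewrite mulN1r mulN1r opprK.
(* The list contains every possible value of the defect e, so a defect smaller than ga is zero. *)
have [ga ga0 hga] := list_gap [seq u.1 * u.2 - v ^+ t | u <- [seq (a, b) | a <- s, b <- s], v <- s].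
have [k1 hk1] := tiny_small te' ga0.
have rrec k : (k1 <= k)%N -> rho k.+2 * rho k = rho k.+1 ^+ t.
  move=> hk; apply/eqP; rewrite -subr_eq0; apply: contraT => nz.
  have := hk1 k hk; rewrite ltNge hga //; apply/allpairsP; exists ((rho k.+2, rho k), rho k.+1).
  split; [|exact: rs|by []].
  by apply/allpairsP; exists (rho k.+2, rho k); rewrite /= !rs.
have BV1 : 0 < (B + 1)^-1 by rewrite invr_gt0 ltr_wpDl // B_ge0.
have [k2 hk2] := tiny_small te BV1.
have r0' k : (k2 <= k)%N -> rho k != 0.
  move=> /hk2; rewrite /eta; apply: contraTneq => ->; rewrite subr0 -leNgt.
  rewrite -[leRHS]invrK lef_pV2 ?posrE ?invr_gt0 ?normc_gt0 //; last by rewrite ltr_wpDl // B_ge0.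
  by rewrite -normc_inv // (le_trans (yVB k)) // lerDl.
(* Two consecutive terms determine all later ones, so a repetition among this many pairs yields a
   period. *)
pose K := (k1 + k2)%N; pose n := (size s * size s).+1.
pose L := [seq (rho (K + i)%N, rho (K + i).+1) | i <- iota 0 n].
have nu : ~~ uniq L.
  apply/negP => uL; have := uniq_leq_size uL (s2 := [seq (a, b) | a <- s, b <- s]).
  rewrite size_allpairs size_map size_iota ltnn => /(_ _)/negP; apply=> // x.
  by move=> /mapP[i _ ->]; apply/allpairsP; exists (rho (K + i)%N, rho (K + i).+1); rewrite /= !rs.
have /(uniqPn (0, 0))[i [j [ij jL eij]]] := nu.
have jn : (j < n)%N by rewrite size_map size_iota in jL.
have inn : (i < n)%N by apply: ltn_trans jn.
rewrite !(nth_map 0%N) ?size_iota // !nth_iota // !add0n in eij; case: eij => e1 e2.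
pose K1 := (K + i)%N; pose p := (j - i)%N.
have Kp : (K + j = K1 + p)%N by rewrite /K1 /p; lia.
have per m : rho (K1 + m + p)%N = rho (K1 + m)%N /\ rho (K1 + m + p).+1 = rho (K1 + m).+1.
  elim: m => [|m [h1 h2]]; first by rewrite addn0 -Kp.
  rewrite !addnS !addSn; split=> //.
  have kk : (k2 <= K1 + m)%N by rewrite /K1 /K; lia.
  have kk1 : (k1 <= K1 + m)%N by rewrite /K1 /K; lia.
  have kk1' : (k1 <= K1 + m + p)%N by lia.
  apply: (mulIf (r0' _ kk)); rewrite rrec // -{1}h1 rrec // h2 //.
pose Y k := y (K1 + k)%N.
pose Z k := Y (k + p)%N / Y k.
have tY : tiny (fun k => Y (k + p)%N - Y k).
  have h1 := tiny_shiftn K1 te; have h2 := tiny_shiftn (p + K1) te.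
  have h3 := tinyM (fun k => lexx (normc (-1 : C))) h1.
  apply: tiny_eq (tinyD h2 h3) => k; rewrite /eta /Y.
  have -> : (p + K1 + k = K1 + k + p)%N by lia.
  have [-> _] := per k; rewrite addnA; ring.
have Yn k : Y k != 0 by apply: y0.
have tZ : tiny (fun k => Z k - 1).
  apply: tiny_eq (tinyM (fun k => yVB (K1 + k)) tY) => k.
  by rewrite mulrBr mulVf ?Yn // mulrC.
have Yrec k : Y k.+2 * Y k = Y k.+1 ^+ t by rewrite /Y !addnS y_rec.
have Zrec k : Z k.+2 * Z k = Z k.+1 ^+ t.
  by rewrite /Z !addSn mulrACA -invfM !Yrec exprMn exprVn.
have Zn k : Z k != 0 by rewrite mulf_neq0 ?invr_eq0.
have ZB k : normc (Z k) <= B * B by rewrite normcM ler_pM ?normc_ge0 //; [apply: yB | apply: yVB].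
have ZVB k : normc (Z k)^-1 <= B * B.
  by rewrite invfM invrK mulrC normcM ler_pM ?normc_ge0 //; [apply: yB | apply: yVB].
have BB0 : 0 <= B * B by rewrite mulr_ge0 ?B_ge0.
pose E1 := B * B + 1.
have E10 : 0 <= E1 by rewrite addr_ge0.
(* Solved backwards, the recurrence expresses Z_k - 1 through Z_(k+1)^t - 1 and Z_(k+2) - 1 with
   bounded factors. *)
have z0 : forall k, Z k - 1 = 0.
  apply: (@backward_zero _ (B * B * (t%:R * E1 ^+ t.-1 + 1))) tZ.
    by rewrite mulr_ge0 // addr_ge0 // mulr_ge0 // exprn_ge0.
  move=> k; have -> : Z k - 1 = (Z k.+2)^-1 * ((Z k.+1 ^+ t - 1 ^+ t) - (Z k.+2 - 1)).
    by rewrite -Zrec expr1n opprB addrA subrK mulrBr mulKf // mulVf.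
  rewrite normcM -mulrA ler_pM ?normc_ge0 //; apply: le_trans (ler_normcB _ _) _.
  have h1 : normc (Z k.+1 ^+ t - 1 ^+ t) <= normc (Z k.+1 - 1) * (t%:R * E1 ^+ t.-1).
    by apply: powB; rewrite ?normc1 /E1 ?lerDr //; apply: le_trans (ZB _) _; rewrite lerDl.
  have n1 := normc_ge0 (Z k.+1 - 1); have n2 := normc_ge0 (Z k.+2 - 1).
  have w0 : 0 <= t%:R * E1 ^+ t.-1 by rewrite mulr_ge0 // exprn_ge0.
  move: (t%:R * E1 ^+ t.-1) w0 h1 n1 n2 => w w0 h1 n1 n2; nra.
have p0 : (0 < p)%N by rewrite /p subn_gt0.
have Yp k : Y (k + p)%N = Y k.
  have := z0 k; rewrite /Z => /eqP; rewrite subr_eq0 => /eqP h.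
  by rewrite -[LHS](divfK (Yn k)) h mul1r.
have [N N0 hN] := period_torsion Yn Yrec p0 Yp.
exists N, K1; split=> // k hk; have := hN (k - K1)%N.
by rewrite /Y subnKC.
Qed.

End Torsion.

(** * Automorphs of quadratic irrationals *)

Section Pell.
Variables (R : realType).

Lemma irrational_int (w : R) : irrational w -> forall x y : int, x%:~R * w = y%:~R -> x = 0.
Proof.
move=> wi x y e; apply/eqP; apply: contraT => x0; exfalso; apply: wi.
exists (y%:Q / x%:Q) => //.
rewrite rmorphM fmorphV /= !ratr_int -e mulrC mulKf // intr_eq0 //.
Qed.

Lemma dirichlet (s : R) (N : nat) : (0 < N)%N ->
  exists x : int, exists y : nat, [/\ (0 < y)%N, (y <= N)%N & `|x%:~R - y%:R * s| < N%:R^-1].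
Proof.
move=> N0; have NR : 0 < N%:R :> R by rewrite ltr0n.
pose fr (k : nat) : R := k%:R * s - (Num.floor (k%:R * s))%:~R.
have fr01 k : 0 <= fr k < 1.
  have /andP[h1 h2] := floor_itv (k%:R * s).
  by rewrite subr_ge0 h1 /= ltrBlDr addrC -intrD1.
pose cell (k : 'I_N.+1) : nat := Num.truncn (N%:R * fr k).
have cellN k : (cell k < N)%N.
  have /andP[f0 f1] := fr01 k.
  have /andP[h _] := truncn_itv (mulr_ge0 (ltW NR) f0).
  by rewrite -(ltr_nat R); apply: le_lt_trans h _; rewrite gtr_pMr.
pose f (k : 'I_N.+1) : 'I_N := Ordinal (cellN k).
have /injectivePn[k1 [k2 nk e]] : ~~ injectiveb f.
  by apply/negP => /injectiveP /leq_card; rewrite !card_ord ltnn.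
have close (i j : 'I_N.+1) : cell i = cell j -> `|fr i - fr j| < N%:R^-1.
  move=> ec; have /andP[i0 _] := fr01 i; have /andP[j0 _] := fr01 j.
  have a1 := truncn_itv (mulr_ge0 (ltW NR) i0); have a2 := truncn_itv (mulr_ge0 (ltW NR) j0).
  rewrite -/(cell i) in a1; rewrite -/(cell j) -ec in a2.
  rewrite -(ltr_pM2l NR) mulfV ?gt_eqF // -{1}(ger0_norm (ltW NR)) -normrM mulrBr.
  by move: a1 a2; rewrite ltr_norml -natr1 => /andP[? ?] /andP[? ?]; apply/andP; split; lra.
have gen (i j : 'I_N.+1) : (i < j)%N -> cell i = cell j ->
   exists x : int, exists y : nat, [/\ (0 < y)%N, (y <= N)%N & `|x%:~R - y%:R * s| < N%:R^-1].
  move=> ij ec; exists (Num.floor (j%:R * s) - Num.floor (i%:R * s)), (j - i)%N; split.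
  - by rewrite subn_gt0.
  - by rewrite leq_subLR; have := ltn_ord j; lia.
  have := close _ _ ec; rewrite /fr intrB natrB ?(ltnW ij) //.
  by congr (`|_| < _); ring.
have ec : cell k1 = cell k2 by have := congr1 val e.
case: (ltngtP k1 k2) => h; [exact: gen h ec|exact: gen h (esym ec)|].
by case/eqP: nk; apply: val_inj.
Qed.

Section Equation.
Variables (D : int) (s : R).
Hypotheses (s0 : 0 < s) (sD : s ^+ 2 = D%:~R) (s_irr : forall x y : int, x%:~R * s = y%:~R -> x = 0).

(** The bound on the norm (x - y s) (x + y s) comes from Dirichlet's |x - y s| < 1 / N with y <= N:
    the second factor is at most 1 + 2 N s. *)
Definition good (v : int * nat) : Prop := (0 < v.2)%N /\ `|(v.1 ^+ 2 - D * v.2%:Z ^+ 2)%:~R| <= 2 * s + 1.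
Definition dist (v : int * nat) : R := `|v.1%:~R - v.2%:R * s|.

Lemma dist_gt0 v : (0 < v.2)%N -> 0 < dist v.
Proof.
move=> v0; rewrite normr_gt0 subr_eq0; apply/eqP => e.
by have := @s_irr v.2%:Z v.1 (esym e); lia.
Qed.

Lemma next_good (d : R) : 0 < d -> exists v, good v /\ dist v < d.
Proof.
move=> d0; pose N := (Num.truncn d^-1).+1.
have Nd : N%:R^-1 < d.
  by rewrite -[d]invrK ltf_pV2 ?posrE ?invr_gt0 ?ltr0n // truncnS_gt.
have [x [y [y0 yN h]]] := dirichlet s (ltn0Sn _ : (0 < N)%N).
exists (x, y); split; last exact: lt_trans h Nd.
split=> //=; rewrite intrB intrM !rmorphXn /= -sD.
have -> : x%:~R ^+ 2 - s ^+ 2 * y%:Z%:~R ^+ 2 = (x%:~R - y%:R * s) * ((x%:~R - y%:R * s) + 2 * (y%:R * s)) :> R.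
  by rewrite -pmulrn; ring.
have NR : 1 <= N%:R :> R by rewrite ler1n.
have yR : y%:R <= N%:R :> R by rewrite ler_nat.
have y0R : 0 <= y%:R :> R by [].
have Ni : N%:R * N%:R^-1 = 1 :> R by rewrite mulfV // pnatr_eq0.
have Ni0 : 0 < N%:R^-1 :> R by rewrite invr_gt0; lra.
rewrite normrM; apply: (@le_trans _ _ (N%:R^-1 * (1 + 2 * (N%:R * s)))).
  rewrite ler_pM ?normr_ge0 //; first exact: ltW.
  apply: le_trans (ler_normD _ _) _; rewrite lerD //.
    by apply: le_trans (ltW h) _; rewrite invf_le1 //; lra.
  rewrite ger0_norm ?mulr_ge0 ?(ltW s0) // ler_wpM2l // ler_wpM2r // ltW //.
have Nl : N%:R^-1 <= 1 :> R by rewrite invf_le1 //; lra.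
have -> : N%:R^-1 * (1 + 2 * (N%:R * s)) = N%:R^-1 + 2 * s * (N%:R * N%:R^-1) by ring.
by rewrite Ni; lra.
Qed.

(** Infinitely many good approximations have strictly decreasing distances, so two of them share
    their norm n and their residues modulo n. Their quotient is integral of norm 1, and it is not 1
    or -1 because the distances differ. *)
Lemma pell_equation : exists T U : int, T ^+ 2 - D * U ^+ 2 = 1 /\ U != 0.
Proof.
have /choice[f hf] : forall v : int * nat, exists v', (0 < v.2)%N -> good v' /\ dist v' < dist v.
  move=> v; case: (posnP v.2) => [v0|v0]; first by exists v.
  by have [v' hv'] := next_good (dist_gt0 v0); exists v'.
have [v0 [g0 _]] := next_good ltr01.
pose v n := iter n f v0.
have gv n : good (v n).
  by elim: n => // n IH; case: (hf (v n)) => //; case: IH.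
have dec n m : (n < m)%N -> dist (v m) < dist (v n).
  elim: m => // m IH; rewrite ltnS leq_eqVlt => /orP[/eqP ->|/IH h].
    by case: (hf (v m)) => //; case: (gv m).
  by apply: lt_trans h; case: (hf (v m)) => //; case: (gv m).
pose nv n : int := (v n).1 ^+ 2 - D * (v n).2%:Z ^+ 2.
have nv0 n : nv n != 0.
  apply/eqP => e; have : (v n).1%:~R ^+ 2 = ((v n).2%:R * s) ^+ 2.
    have := congr1 (fun x : int => x%:~R : R) e; rewrite /nv intrB intrM !expr2 !intrM => /eqP; rewrite subr_eq0 => /eqP ->.
    by rewrite mulrACA -(expr2 s) sD mulrC -pmulrn.
  move=> /eqP; rewrite eqf_sqr => /orP[] /eqP e2.
    by have [p _] := gv n; have := dist_gt0 p; rewrite /dist e2 subrr normr0 ltxx.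
  have := @s_irr (- (v n).2%:Z) (v n).1; rewrite e2 intrN mulNr => /(_ erefl).
  by have [p _] := gv n; lia.
pose K := (Num.truncn (2 * s + 1)).+1.
have nK n : (`|nv n| < K)%N.
  have [_ h] := gv n; rewrite -(ltr_nat R); apply: le_lt_trans (truncnS_gt _).
  by rewrite natr_absz intr_norm.
have modK (x : int) n : (`|(x %% nv n)%Z| < K)%N.
  apply: leq_ltn_trans (nK n); have := ltz_mod x (nv0 n); have := modz_ge0 x (nv0 n); lia.
(* A class records the norm, through its absolute value and sign, and both residues modulo it. *)
pose T : finType := ('I_K * bool * 'I_K * 'I_K)%type.
pose c (i : 'I_#|T|.+1) : T := (Ordinal (nK i), (0 < nv i), Ordinal (modK (v i).1 i), Ordinal (modK (v i).2%:Z i)).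
have /injectivePn[i [j nij e]] : ~~ injectiveb c.
  by apply/negP => /injectiveP /leq_card; rewrite card_ord ltnn.
have [en [ex ey]] : nv i = nv j /\ ((v i).1 %% nv i)%Z = ((v j).1 %% nv i)%Z /\ ((v i).2%:Z %% nv i)%Z = ((v j).2%:Z %% nv i)%Z.
  move: e; rewrite /c => -[e1 e2 e3 e4].
  have en : nv i = nv j.
    have a1 := nv0 i; have a2 := nv0 j; clear -e1 e2 a1 a2.
    move: (nv i) (nv j) e1 e2 a1 a2 => x y; case: (ltrP 0 x) => h1; case: (ltrP 0 y) => h2 //; lia.
  split=> //; rewrite -en in e3 e4.
  have p x := modz_ge0 x (nv0 i).
  by split; [have := p (v i).1; have := p (v j).1; clear -e3; lia|have := p (v i).2%:Z; have := p (v j).2%:Z; clear -e4; lia].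
have dij : dist (v i) != dist (v j).
  case: (ltngtP i j) => h; first by rewrite gt_eqF // dec.
    by rewrite lt_eqF // dec.
  by case/eqP: nij; apply: val_inj.
have ndef : nv i = (v i).1 ^+ 2 - D * (v i).2%:Z ^+ 2 by [].
have ndef' : nv i = (v j).1 ^+ 2 - D * (v j).2%:Z ^+ 2 by rewrite en.
have n0 := nv0 i; move: dij ex ey ndef ndef' n0; move: (nv i) (gv i) (gv j); rewrite /dist.
case: (v i) (v j) => [x1 y1] [x2 y2] /= n [y1p _] [y2p _] dij ex ey ndef ndef' n0 {e en}.
have /dvdzP[a ea] : (n %| x2 - x1)%Z by rewrite -eqz_mod_dvd; apply/eqP.
have /dvdzP[b eb] : (n %| y2%:Z - y1%:Z)%Z by rewrite -eqz_mod_dvd; apply/eqP.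
have {ea}ex2 : x2 = x1 + a * n by rewrite -ea addrC subrK.
have {eb}ey2 : y2%:Z = y1%:Z + b * n by rewrite -eb addrC subrK.
(* T1 + U1 s is (x1 + y1 s) (x2 - y2 s) / n; the congruences modulo n make it integral. *)
pose T1 := 1 + a * x1 - D * b * y1%:Z; pose U1 := y1%:Z * a - x1 * b.
have eT : x1 * x2 - D * y1%:Z * y2%:Z = n * T1.
  transitivity (x1 ^+ 2 - D * y1%:Z ^+ 2 + n * (a * x1 - D * b * y1%:Z)); first by rewrite ex2 ey2; ring.
  by rewrite -ndef /T1; ring.
have eU : y1%:Z * x2 - x1 * y2%:Z = n * U1 by rewrite ex2 ey2 /U1; ring.
have eN : (x1 * x2 - D * y1%:Z * y2%:Z) ^+ 2 - D * (y1%:Z * x2 - x1 * y2%:Z) ^+ 2 = n ^+ 2.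
  by transitivity (n * n); last exact: esym (expr2 n); rewrite [X in _ = X * _]ndef [X in _ = _ * X]ndef'; ring.
have pell1 : T1 ^+ 2 - D * U1 ^+ 2 = 1.
  have n2 : n ^+ 2 != 0 by rewrite expf_neq0.
  by apply: (mulfI n2); rewrite mulr1 -[RHS]eN eT eU; ring.
exists T1, U1; split=> //; apply: contraNneq dij => U0.
have T2 : T1 ^+ 2 = 1 by rewrite -pell1 U0 expr0n mulr0 subr0.
have cr : y1%:Z * x2 = x1 * y2%:Z by apply/eqP; rewrite -subr_eq0 eU U0 mulr0.
have sq : y1%:Z ^+ 2 = y2%:Z ^+ 2.
  apply: (mulfI n0); rewrite {1}ndef' {1}ndef.
  have : (y1%:Z * x2) ^+ 2 = (x1 * y2%:Z) ^+ 2 by rewrite cr.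
  by rewrite !exprMn => h; rewrite !mulrBl [x2 ^+ 2 * _]mulrC h; ring.
have ey12 : y1 = y2.
  by move: sq => /eqP; rewrite eqf_sqr => /orP[] /eqP; clear -y1p y2p; lia.
have ex12 : x1 = x2.
  have yz : y1%:Z != 0 by rewrite eqz_nat -lt0n.
  by apply: (mulfI yz); rewrite cr ey12 mulrC.
by rewrite ex12 ey12.
Qed.

End Equation.

Definition automorph (w lam : R) (M : 'M[int]_2) : Prop :=
  [/\ \det M = 1, 1 < lam, (M 0 0)%:~R + (M 0 1)%:~R * w = lam & (M 1 0)%:~R + (M 1 1)%:~R * w = lam * w].

Lemma det2 (A : 'M[int]_2) : \det A = A 0 0 * A 1 1 - A 0 1 * A 1 0.
Proof.
rewrite (expand_det_row _ 0) !big_ord_recl big_ord0 addr0 /cofactor !det_mx11 !mxE /= expr0 expr1.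
have e1 : lift 0 0 = 1 :> 'I_2 by apply: val_inj.
have e0 : lift 1 0 = 0 :> 'I_2 by apply: val_inj.
by rewrite !e1 !e0 mul1r; ring.
Qed.

(** Let A w^2 + B w + E = 0 have discriminant D, so that 2 A w + B is a square root of D. A solution
    T, U of Pell's equation gives the matrix with rows (T + B U, 2 A U) and (-2 E U, T - B U), of
    eigenvalue T + U (2 A w + B). Signs are chosen to make this |T| + |U| s > 1. *)
Lemma automorph_exists (w : R) : quadratic_irrational w -> exists lam M, automorph w lam M.
Proof.
move=> [wi [p sp rp]]; have w_irr := irrational_int wi.
have [A [B [E [A0 eq]]]] : exists A B E : int, A != 0 /\ A%:~R * w ^+ 2 + B%:~R * w + E%:~R = 0.
  have d0 i : (denq p`_i)%:~R != 0 :> R by rewrite intr_eq0 denq_neq0.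
  have ce i : ratr p`_i = (numq p`_i)%:~R / (denq p`_i)%:~R :> R.
    by rewrite -[in LHS](divq_num_den p`_i) rmorphM fmorphV /= !ratr_int.
  exists (numq p`_2 * denq p`_1 * denq p`_0), (numq p`_1 * denq p`_2 * denq p`_0), (numq p`_0 * denq p`_1 * denq p`_2).
  split.
    rewrite !mulf_neq0 ?denq_neq0 // numq_eq0.
    by have := lead_coef_eq0 p; rewrite /lead_coef sp /= => ->; rewrite -size_poly_eq0 sp.
  move: rp; rewrite /root horner_coef size_map_poly sp !big_ord_recl big_ord0 !coef_map /= !ce addr0 => /eqP h.
  have := d0 0%N; have := d0 1%N; have := d0 2%N => n2 n1 n0.
  rewrite !intrM; move: h; rewrite /bump /= !addn0 expr0 expr1 mulr1.
  move: (numq p`_0)%:~R (numq p`_1)%:~R (numq p`_2)%:~R (denq p`_0)%:~R (denq p`_1)%:~R (denq p`_2)%:~R n0 n1 n2.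
  move=> a0 a1 a2 c0 c1 c2 n0 n1 n2 h.
  have -> : a2 * c1 * c0 * w ^+ 2 + a1 * c2 * c0 * w + a0 * c1 * c2 = c0 * c1 * c2 * (a0 / c0 + (a1 / c1 * w + a2 / c2 * w ^+ 2)) by field; rewrite n0 n1 n2.
  by rewrite h mulr0.
pose D := B ^+ 2 - 4 * A * E; pose s0 : R := 2 * A%:~R * w + B%:~R; pose s := `|s0|.
have s_irr (x y : int) : x%:~R * s = y%:~R -> x = 0.
  have gen (x' y' : int) : x'%:~R * s0 = y'%:~R -> x' = 0.
    move=> e; have /w_irr/eqP : (2 * x' * A)%:~R * w = (y' - x' * B)%:~R.
      by rewrite intrB !intrM -e /s0; ring.
    by rewrite !mulf_eq0 (negPf A0) orbF => /orP[/eqP|/eqP].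
  rewrite /s; case: (ger0P s0) => _; first exact: gen.
  by rewrite mulrN -mulNr -intrN => /gen/eqP; rewrite oppr_eq0 => /eqP.
have s0n : 0 < s.
  rewrite normr_gt0; apply/eqP => z; have := @s_irr 1 0; rewrite /s z normr0 mulr0 => /(_ erefl) /eqP.
  by rewrite oner_eq0.
have sD : s ^+ 2 = D%:~R.
  rewrite /s real_normK ?num_real // /s0 /D intrB (expr2 B) !intrM -(expr2 B%:~R).
  have -> : (2 * A%:~R * w + B%:~R) ^+ 2 = 4 * A%:~R * (A%:~R * w ^+ 2 + B%:~R * w + E%:~R) + B%:~R ^+ 2 - 4 * A%:~R * E%:~R by ring.
  by rewrite eq mulr0 add0r.
have [T [U [pell U0]]] := pell_equation s0n sD s_irr.
pose T' := `|T|; pose U' := if 0 <= s0 then `|U| else - `|U|.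
have pell' : T' ^+ 2 - D * U' ^+ 2 = 1.
  have -> : U' ^+ 2 = U ^+ 2 by rewrite /U'; case: ifP => _; rewrite ?sqrrN real_normK ?num_real.
  by rewrite /T' real_normK ?num_real.
have Us : U'%:~R * s0 = `|U|%:~R * s.
  rewrite /U' /s; case: ifP => h; first by rewrite (ger0_norm h).
  by rewrite intrN mulNr -mulrN [X in _ = _ * X]ler0_norm // ltW // ltNge h.
have T1 : 1 <= T'.
  have D0 : 0 < D by rewrite -(ltr_int R) -sD exprn_gt0.
  by rewrite -gtz0_ge1 normr_gt0; apply/eqP => z; move: pell; rewrite z; have := sqr_ge0 U; clear -D0; nia.
pose M : 'M[int]_2 := \matrix_(i, j) (if i == 0 then (if j == 0 then T' + B * U' else 2 * A * U')
   else (if j == 0 then - 2 * E * U' else T' - B * U')).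
exists (T'%:~R + `|U|%:~R * s), M; split.
- by rewrite det2 !mxE /=; apply: etrans pell'; rewrite /D; ring.
- have : 1 <= T'%:~R :> R by rewrite (ler_int R 1).
  have : 0 < `|U|%:~R * s by rewrite mulr_gt0 // ltr0z normr_gt0.
  lra.
- by rewrite !mxE /= -Us /s0 intrD !intrM; ring.
- rewrite !mxE /= -Us /s0 intrB !intrM.
  have -> : (T'%:~R + U'%:~R * (2 * A%:~R * w + B%:~R)) * w = 2 * U'%:~R * (A%:~R * w ^+ 2 + B%:~R * w + E%:~R) + (- 2 * E%:~R * U'%:~R + (T'%:~R - B%:~R * U'%:~R) * w) by ring.
  by rewrite eq mulr0 add0r intrN.
Qed.

Lemma automorphX w lam M n : automorph w lam M -> (0 < n)%N -> automorph w (lam ^+ n) (M ^+ n).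
Proof.
move=> aM; have [d l e1 e2] := aM; elim: n => // -[|n] IH _; first by rewrite !expr1.
have [d' l' e1' e2'] := IH isT; rewrite [M ^+ _]exprS [lam ^+ _]exprS.
have o1 : ord_max = 1 :> 'I_2 by apply: val_inj.
have o2 : widen_ord (leqnSn 1) 0 = 0 :> 'I_2 by apply: val_inj.
have mE i j : (M * M ^+ n.+1) i j = M i 0 * (M ^+ n.+1) 0 j + M i 1 * (M ^+ n.+1) 1 j.
  by rewrite mxE !big_ord_recl big_ord0 addr0; congr (_ + M _ _ * (M ^+ n.+1) _ _); apply: val_inj.
split.
- by rewrite -[M * _]/(M *m _) det_mulmx d d' mulr1.
- by rewrite mulr_egt1.
- rewrite !mE !intrD !intrM -e1' -{1}e1 mulrDl; move: e2'; rewrite -e1'.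
  move: (M ^+ n.+1) => N e2'.
  transitivity ((M 0 0)%:~R * ((N 0 0)%:~R + (N 0 1)%:~R * w) + (M 0 1)%:~R * ((N 1 0)%:~R + (N 1 1)%:~R * w)); first by ring.
  by rewrite e2'; ring.
- rewrite !mE !intrD !intrM -mulrA [lam * _]mulrCA -e2; move: e2'; rewrite -e1'.
  move: (M ^+ n.+1) => N e2'.
  have -> : ((N 0 0)%:~R + (N 0 1)%:~R * w) * ((M 1 0)%:~R + (M 1 1)%:~R * w) =
     (M 1 0)%:~R * ((N 0 0)%:~R + (N 0 1)%:~R * w) + (M 1 1)%:~R * (((N 0 0)%:~R + (N 0 1)%:~R * w) * w) by ring.
  by rewrite -e2'; ring.
Qed.

(** s is the order of M in the finite group of invertible matrices modulo e. The case e = 1 is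
    separate because the ring of residues used here needs a modulus of at least 2. *)
Lemma pow_congruence (M : 'M[int]_2) (e : nat) : \det M = 1 -> (0 < e)%N ->
  exists2 s, (0 < s)%N & forall n, exists x y : int, (M ^+ (s * n)) 0 0 = 1 + e%:Z * x /\ (M ^+ (s * n)) 0 1 = e%:Z * y.
Proof.
move=> dM; case: e => // -[_|e _].
  by exists 1%N => // n; exists ((M ^+ (1 * n)) 0 0 - 1), ((M ^+ (1 * n)) 0 1); rewrite !mul1r addrC subrK.
pose f : {rmorphism int -> 'Z_e.+2} := intr.
pose A : 'M['Z_e.+2]_2 := map_mx f M.
have uA : A \is a GRing.unit by rewrite unitmxE det_map_mx dM rmorph1 unitr1.
pose u : {unit 'M['Z_e.+2]_2} := FinRing.unit _ uA.
exists #[u]%g; first exact: order_gt0.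
move=> n; have An : A ^+ (#[u]%g * n) = 1.
  have : val (u ^+ (#[u] * n))%g = 1 by rewrite expgM expg_order expg1n.
  by rewrite FinRing.val_unitX.
have key i j : f ((M ^+ (#[u]%g * n)) i j) = (1%:M : 'M['Z_e.+2]_2) i j.
  have -> : f ((M ^+ (#[u]%g * n)) i j) = (map_mx f (M ^+ (#[u]%g * n))) i j by rewrite mxE.
  by rewrite rmorphXn /= -/A An.
have dz (x : int) : f x = 0 -> exists y, x = e.+2%:Z * y.
  move=> fx; suff /dvdzP[y ->] : (e.+2%:Z %| x)%Z by exists y; rewrite mulrC.
  have natz (m : nat) : (m%:R : 'Z_e.+2) = 0 -> (e.+2 %| m)%N.
    move=> /(congr1 (@nat_of_ord _)); rewrite val_Zp_nat // => h; exact/eqP.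
  rewrite dvdzE; apply: natz; case: x fx => m; rewrite /f /= //.
  by move/eqP; rewrite oppr_eq0 => /eqP.
have [x ex] : exists x, (M ^+ (#[u]%g * n)) 0 0 - 1 = e.+2%:Z * x.
  by apply: dz; rewrite rmorphB key mxE rmorph1 subrr.
have [y ey] : exists y, (M ^+ (#[u]%g * n)) 0 1 = e.+2%:Z * y.
  by apply: dz; rewrite key mxE.
by exists x, y; split; rewrite // -ex addrC subrK.
Qed.

(** For u0 = (n0, floor (n0 w)) the value of lin lies strictly between 0 and 1, so narrowness holds
    once n0 > |a01| / (lam - 1). *)
Lemma pell_of_automorph w lam M : (forall x y : int, x%:~R * w = y%:~R -> x = 0) ->
  automorph w lam M -> exists S : pell w, [/\ plam S = lam, a00 S = M 0 0 & a01 S = M 0 1].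
Proof.
move=> w_irr [d l e1 e2].
have l0 : 0 < lam by apply: lt_trans l.
have tr : (M 0 0 + M 1 1)%:~R * lam = lam ^+ 2 + 1.
  have dR : (M 0 0)%:~R * (M 1 1)%:~R - (M 0 1)%:~R * (M 1 0)%:~R = 1 :> R by rewrite -!intrM -intrB -det2 d.
  have h : (M 0 1)%:~R * w = lam - (M 0 0)%:~R by rewrite -e1; ring.
  have h2 : (M 0 1)%:~R * (M 1 0)%:~R + (M 1 1)%:~R * ((M 0 1)%:~R * w) = lam * ((M 0 1)%:~R * w).
    by rewrite mulrCA -mulrDr e2; ring.
  rewrite h in h2; rewrite intrD; move: h2 dR; move: (M 0 0)%:~R (M 0 1)%:~R (M 1 0)%:~R (M 1 1)%:~R => a b c e h2 dR.
  nra.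
have t0 : 0 <= M 0 0 + M 1 1.
  by rewrite -(ler_int R) -(ler_pM2r l0) tr mul0r addr_ge0 // sqr_ge0.
pose n0 := (Num.truncn (`|M 0 1|%:~R / (lam - 1))).+1.
have n0R : `|M 0 1|%:~R < (lam - 1) * n0%:R.
  by rewrite mulrC -ltr_pdivrMr ?subr_gt0 // truncnS_gt.
pose m0 := Num.floor (n0%:R * w).
have /andP[f1 f2] := floor_itv (n0%:R * w); rewrite -/m0 intrD1 in f2; rewrite -/m0 in f1.
have lin0 : 0 < n0%:Z%:~R * w - m0%:~R.
  rewrite subr_gt0 lt_neqAle f1 andbT; apply/eqP => e.
  by have := w_irr n0%:Z m0 (esym e); lia.
have nar : `|M 0 1|%:~R * (n0%:Z%:~R * w - m0%:~R) < (lam - 1) * n0%:Z%:~R.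
  apply: le_lt_trans n0R; rewrite ler_piMr ?ler0z //; lra.
have dd : M 0 0 * M 1 1 - M 0 1 * M 1 0 = 1 by rewrite -det2.
have trE : M 0 0 + M 1 1 = (absz (M 0 0 + M 1 1))%:Z by rewrite gez0_abs.
by exists (@Pell R w (M 0 0) (M 0 1) (M 1 0) (M 1 1) lam (absz (M 0 0 + M 1 1)) (n0%:Z, m0) dd l e1 e2 trE isT lin0 nar).
Qed.

End Pell.

(** * Heights and expansions of the data of one series *)

Section OneSystem.
Variables (R : realType) (K : fieldExtType rat) (i : {rmorphism K -> R[i]%C}) (n : nat).
Variables (w : R) (S : pell w) (g ze : K) (m e : nat) (xi : R[i]%C).
Variables (kap L : nat -> nat) (c : nat) (q : R) (z : nat -> 'I_n -> K) (lx ly : 'I_n).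
Local Notation C := R[i]%C.
Local Notation P := (pexp (ptr S)).
Local Notation Q := (qexp (ptr S)).
Hypothesis w_irr : forall x y : int, x%:~R * w = y%:~R -> x = 0.
Hypotheses (g0 : 0 < normc (i g)) (g1 : normc (i g) < 1) (m0 : (0 < m)%N) (e0 : (0 < e)%N) (zee : ze ^+ e = 1).
Hypothesis cong : exists x y : int, a00 S = 1 + e%:Z * x /\ a01 S = e%:Z * y.
Let al := ze * g ^+ m.
Hypothesis xi_sums : sums (fun n => (Num.floor (n%:R * w))%:~R) (i al) xi.
Hypotheses (q1 : q < 1) (gq : normc (i g) <= q).
Hypotheses (LP : forall k, (L k <= P (kap k))%N) (PL : forall k, (P (kap k) <= c * L k)%N).
Hypotheses (z_lx : forall k, z k lx = g ^+ P (kap k)) (z_ly : forall k, z k ly = g ^+ Q (kap k)).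

(** The value s_k inside the number field. The index passes through [kap], so that two series with
    different growth can share one scale L. *)
Definition slope_value (k : nat) : K := fr (pk S (kap k)) (qk S (kap k)) al.

Lemma rmorph_fr p r (x : K) : i (fr p r x) = fr p r (i x).
Proof.
rewrite /fr rmorphM fmorphV rmorphD rmorph_sum rmorphM fmorphV !rmorphB !rmorphM rmorphXn rmorph1 rmorph_int /=.
congr ((_ + _) / _); apply: eq_bigr => a _; by rewrite rmorphM rmorph_int rmorphXn.
Qed.

Let al01 : 0 < normc (i al) < 1.
Proof.
by rewrite /al rmorphM rmorphXn /=; apply: (@twist01 _ _ _ _ e) => //; rewrite -rmorphXn zee rmorph1.
Qed.

Let q0 : 0 < q. Proof. exact: lt_le_trans gq. Qed.

Lemma normc_al : normc (i al) = normc (i g) ^+ m.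
Proof. by rewrite /al rmorphM rmorphXn /=; apply: (@normc_twist _ _ _ _ e) => //; rewrite -rmorphXn zee rmorph1. Qed.

Definition cone_mpoly (I : nat) : mpoly n K :=
  \sum_(a < I) \sum_(b < I) mpolyC n ((chi S (cone S) a b)%:R * ze ^+ a) *
    mpolyX K (mnm_of (fun l => (l == lx) * (m * a) + (l == ly) * (m * b))%N).

Lemma mcoeff0_cone I : mcoeff (@mnm0 n) (cone_mpoly I) = 0.
Proof.
rewrite /cone_mpoly raddf_sum big1 // => a _; rewrite raddf_sum big1 // => b _ /=.
rewrite mcoeffCM mcoeffX; case: (boolP (chi S (cone S) a b)) => [/chiP[u eu cu]|]; last by rewrite !mul0r.
have [a0 _] := cone_pos cu; rewrite eu /= in a0.
suff /negPf -> : mnm_of (fun l : 'I_n => (l == lx) * (m * a) + (l == ly) * (m * b))%N != mnm0 by rewrite mulr0.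
apply/eqP => /(congr1 (fun f : multinom n => f lx)); rewrite mnm_ofE mnm0E eqxx mul1n.
by move/eqP; rewrite addn_eq0 muln_eq0 => /andP[/orP[] /eqP h _]; move: m0 a0; rewrite h.
Qed.

Lemma prod_two (a b k : nat) :
  \prod_l z k l ^+ ((l == lx) * a + (l == ly) * b) = z k lx ^+ a * z k ly ^+ b.
Proof.
under eq_bigr do rewrite exprD; rewrite big_split /=; congr (_ * _).
  by rewrite (bigD1 lx) //= eqxx mul1n big1 ?mulr1 // => l /negPf ->; rewrite mul0n expr0.
by rewrite (bigD1 ly) //= eqxx mul1n big1 ?mulr1 // => l /negPf ->; rewrite mul0n expr0.
Qed.

Lemma meval_cone I k : i (meval (z k) (cone_mpoly I)) =
  \sum_(a < I) \sum_(b < I) (chi S (cone S) a b)%:R * (((i al) ^+ P (kap k)) ^+ a * ((i al) ^+ Q (kap k)) ^+ b).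
Proof.
rewrite /cone_mpoly [meval _ _]raddf_sum [LHS]raddf_sum; apply: eq_bigr => a _ /=.
rewrite [meval _ _]raddf_sum [LHS]raddf_sum; apply: eq_bigr => b _ /=.
rewrite mevalM mevalC mevalX.
under eq_bigr do rewrite mnm_ofE.
rewrite prod_two z_lx z_ly; case: (boolP (chi S (cone S) a b)) => [/chiP[u eu cu]|]; last by rewrite !mul0r rmorph0.
have zee' : i ze ^+ e = 1 by rewrite -rmorphXn zee rmorph1.
rewrite /al rmorphM rmorphXn (@twist_monom R w S (i g) (i ze) m e g0 g1 m0 e0 zee' cong (kap k) u a b eu) !mul1r /zx /zy.
by rewrite !rmorphM !rmorphXn.
Qed.

Lemma expand_one I : exists2 F : mpoly n K, mcoeff (@mnm0 n) F = 0 &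
  exists M, forall k, normc (xi - i (slope_value k + meval (z k) F)) <= M * q ^+ (I * L k).
Proof.
exists (cone_mpoly I); first exact: mcoeff0_cone.
exists ((1 - normc (i al))^-1 ^+ 2 / q ^+ I) => k.
rewrite rmorphD /= meval_cone /slope_value rmorph_fr opprD addrA.
apply: le_trans (cone_approx S w_irr al01 xi_sums (kap k) (leqnn I) (leqnn I)) _.
rewrite [leRHS]mulrAC -mulrA [leLHS]mulrC ler_wpM2l ?sqr_ge0 //.
have alq : normc (i al) <= q.
  by rewrite normc_al; apply: le_trans gq; rewrite -{2}(expr1 (normc _)) ler_wiXn2l // ltW.
have [a0 a1] := andP al01.
apply: (@le_trans _ _ (q ^+ (I * (P (kap k)).-1))); first by rewrite lerXn2r // nnegrE ltW.
rewrite mulrC [leRHS]mulrC ler_pdivlMr ?exprn_gt0 // -exprD ler_wiXn2l ?(ltW q0) ?(ltW q1) //.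
by rewrite -mulnSr leq_mul //; have := LP k; lia.
Qed.

Lemma qexp_le_pexp t k : (2 < t)%N -> (qexp t k <= 2 * pexp t k)%N.
Proof. by case: k => // k t2; rewrite pexpS qexpS; case: t t2 => [|[|[|t]]] // _; rewrite !subSS !subn0; nia. Qed.

Lemma ht_exp (x : K) (B : R) r : ht x B -> (0 < r)%N -> ht (x ^+ r) (B ^+ r).
Proof.
move=> hx; elim: r => // -[|r] IH _; first by rewrite !expr1.
by rewrite [x ^+ _]exprS [B ^+ _]exprS; apply: htM => //; apply: IH.
Qed.

Lemma lin_iter_le j : lin w (iter j (st S) (u0 S)) <= lin w (u0 S).
Proof.
elim: j => // j IH; apply: le_trans IH; rewrite iterS -[leRHS](lin_st S).
rewrite ler_peMl //; last exact/ltW/plam1.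
by rewrite -iterS ltW // lin_iter lin_u0.
Qed.

(** q_k is a fixed combination of P_k and Q_k <= 2 P_k, and q_k w - p_k never exceeds its initial
    value lin u0. *)
Lemma qk_le : exists A, forall k, (qk S k <= A * P k)%N /\ `|pk S k| <= (A * qk S k)%:Z.
Proof.
have [A1 h1] : exists A : nat, `|w| + lin w (u0 S) <= A%:R.
  by exists (Num.truncn (`|w| + lin w (u0 S))).+1; apply/ltW/truncnS_gt.
exists (`|(co S (u0 S)).1| + 2 * `|(co S (u0 S)).2| + A1)%N => k; split.
  by rewrite qk_nat; have := qexp_le_pexp k (ptr_gt2 S); nia.
have l0 := lin_pk S k; have lu := lin_u0 S.
have le : (qk S k)%:R * w - (pk S k)%:~R <= lin w (u0 S).
  have -> : (qk S k)%:R * w - (pk S k)%:~R = lin w (iter k.+1 (st S) (u0 S)) by rewrite /lin -qkE.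
  exact: lin_iter_le.
have q1' : 1 <= (qk S k)%:R :> R by rewrite ler1n qk_gt0.
rewrite -(ler_int R) intr_norm -pmulrn natrM.
have qA : (A1%:R : R) <= (`|(co S (u0 S)).1| + 2 * `|(co S (u0 S)).2| + A1)%N%:R by rewrite ler_nat leq_addl.
apply: le_trans (ler_wpM2r (ltW (lt_le_trans ltr01 q1')) (le_trans h1 qA)).
have w2 : `|(qk S k)%:R * w| = (qk S k)%:R * `|w| by rewrite normrM ger0_norm.
have -> : (pk S k)%:~R = (qk S k)%:R * w - ((qk S k)%:R * w - (pk S k)%:~R) :> R by ring.
apply: le_trans (ler_normB _ _) _; rewrite w2 mulrDl mulrC lerD2l gtr0_norm //.
by apply: le_trans le _; rewrite ler_peMr // ltW.
Qed.

Lemma divz_small_bound (a p : int) (r : nat) : (0 < r)%N -> 0 <= a < r%:Z -> `|((a * p) %/ r%:Z)%Z| <= `|p|.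
Proof.
move=> r0 /andP[a0 ar].
have rz : 0 < r%:Z by lia.
have h1 : - `|p| <= ((a * p) %/ r%:Z)%Z by rewrite lez_divRL //; nia.
have h2 : ((a * p) %/ r%:Z)%Z < `|p| + 1 by rewrite ltz_divLR //; nia.
by rewrite ler_norml h1 -ltzD1.
Qed.

(** Heights at step k are exponential in L k: the closed form of s_k has length q_k, which is of
    order P (kap k) <= c L k. *)
Lemma ht_one : exists2 B : R, 1 <= B &
  forall k, [/\ ht (slope_value k) (B ^+ L k), ht (z k lx) (B ^+ L k) & ht (z k ly) (B ^+ L k)].
Proof.
have [A hA] := qk_le.
have al1 r : (0 < r)%N -> 1 - al ^+ r != 0.
  have [_ a1] := andP al01.
  by move=> r0; have := one_subX_neq0 a1 r0; rewrite -rmorphXn -(rmorph1 i) -rmorphB fmorph_eq0.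
have al1' : 1 - al != 0 by have := al1 1%N isT; rewrite expr1.
have [B1 B11 hB1] := ht_geometric_sum R A al1'.
have [Bg hg] := ht_exists R g; have Bg1 := ht_ge1 hg.
pose B := B1 ^+ (A * c) * Bg ^+ (2 * c).
have B1' : 1 <= B1 ^+ (A * c) by rewrite exprn_ege1.
have Bg1' : 1 <= Bg ^+ (2 * c) by rewrite exprn_ege1.
have P0 k : (0 < P k)%N by case: (pq_ge k (ptr_gt2 S)) => h _; apply: leq_trans h.
have PQ k : (P k <= Q k)%N by case: (pq_ge k (ptr_gt2 S)).
have BL k : Bg ^+ (2 * c) ^+ L k <= B ^+ L k.
  by rewrite lerXn2r // ?nnegrE ?mulr_ge0 ?(le_trans ler01) // ler_peMl // (le_trans ler01).
exists B; first by rewrite /B mulr_ege1.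
move=> k; split.
- have [h1 h2] := hA (kap k).
  apply: (@ht_le _ _ _ (B1 ^+ qk S (kap k))); last first.
    rewrite /slope_value /fr; apply: (hB1 (qk S (kap k)) (fun n' => ((n'%:Z * pk S (kap k)) %/ (qk S (kap k))%:Z)%Z)); rewrite ?qk_gt0 // ?al1 ?qk_gt0 //.
    move=> n' n'q; apply: le_trans h2; apply: divz_small_bound; rewrite ?qk_gt0 //= ltz_nat n'q.
  apply: (@le_trans _ _ (B1 ^+ (A * c) ^+ L k)).
    by rewrite -exprM ler_weXn2l //; have := PL k; clear -h1; nia.
  by rewrite lerXn2r // ?nnegrE ?mulr_ge0 ?(le_trans ler01) // ler_peMr // (le_trans ler01).
- rewrite z_lx; apply: ht_le (BL k) _; apply: (@ht_le _ _ _ (Bg ^+ P (kap k))); last exact: ht_exp.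
  by rewrite -exprM ler_weXn2l //; have := PL k; clear; nia.
- rewrite z_ly; apply: ht_le (BL k) _; apply: (@ht_le _ _ _ (Bg ^+ Q (kap k))).
    by rewrite -exprM ler_weXn2l //; have := PL k; have := qexp_le_pexp (kap k) (ptr_gt2 S); clear; nia.
  by apply: ht_exp => //; apply: leq_trans (PQ _).
Qed.

End OneSystem.

Section Lower.
Variables (R : realType) (K : fieldExtType rat) (i : {rmorphism K -> R[i]%C}) (n : nat).
Variables (z : nat -> 'I_n -> K) (s1 s2 : nat -> K) (q : R) (L : nat -> nat).
Hypotheses (q0 : 0 < q) (q1 : q < 1).
Hypothesis heights : exists2 B : R, 1 <= B & forall k,
  [/\ ht (s1 k) (B ^+ L k), ht (s2 k) (B ^+ L k) & forall l, ht (z k l) (B ^+ L k)].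

(** c0 converts powers of the height bound B into powers of q. Of the 2 + n variables given to
    [liouville_box], the first two are s1 and s2. *)
Lemma box_lower_bound : exists c : nat, forall p (a : box n p -> K),
  exists2 M, 0 < M & forall k, box_value z s1 s2 a k != 0 ->
    M * q ^+ (c * p * L k) <= normc (i (box_value z s1 s2 a k)).
Proof.
have [C hC] := liouville_box i (2 + n).
have [B B1 hB] := heights.
have [c0 hc0] : exists c0, q ^+ c0 < B^-1.
  by apply: expr_lt_eventually; rewrite ?invr_gt0 ?(lt_le_trans ltr01) // ltW.
exists (c0 * C)%N => p a.
pose ex (t : box n p) (l : 'I_(2 + n)) : nat :=
  match fintype.split l with inl j => if j == 0 then nat_of_ord t.2.1 else nat_of_ord t.2.2 | inr j => t.1 j end.
have exp t l : (ex t l <= p)%N.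
  by rewrite /ex; case: fintype.split => j; [case: ifP => _|]; apply/ltnW/ltn_ord.
have [M M0 hM] := hC _ a ex p exp.
exists M => // k.
pose v (l : 'I_(2 + n)) : K :=
  match fintype.split l with inl j => if j == 0 then s1 k else s2 k | inr j => z k j end.
have -> : box_value z s1 s2 a k = \sum_t a t * \prod_l v l ^+ ex t l.
  apply: eq_bigr => t _; rewrite big_split_ord /=; congr (_ * (_ * _)).
    by rewrite !big_ord_recl big_ord0 mulr1 /v /ex !(unsplitK (inl _)).
  by apply: eq_bigr => l _; rewrite /v /ex (unsplitK (inr l)).
have [h1 h2 h3] := hB k.
have hv l : ht (v l) (B ^+ L k) by rewrite /v; case: fintype.split => j //; case: ifP.
move=> nz; have {}nz := hM v (B ^+ L k) hv (exprn_ege1 _ B1) nz.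
have B0 : 0 < B by apply: lt_le_trans B1.
set Y := normc _ in nz *; have Y0 : 0 <= Y by apply: normc_ge0.
apply: le_trans (ler_wpM2r (exprn_ge0 _ (ltW q0)) nz) _.
rewrite -mulrA ler_piMr //.
have -> : (c0 * C * p * L k = c0 * (L k * (C * p)))%N by ring.
rewrite [q ^+ _]exprM -exprM -exprMn exprn_ile1 //.
  by rewrite mulr_ge0 ?exprn_ge0 ?ltW.
by rewrite mulrC -ler_pdivlMr // mul1r ltW.
Qed.

End Lower.

(** * Values of linear combinations of monomials in both systems *)

Section Elimination.
Variables (F : fieldType) (V W : lmodType F) (pos : eqType) (coef : V -> pos -> F).
Variable lead : V -> pos -> Prop.
Hypothesis coefB : forall a b c v, coef (a - c *: b) v = coef a v - c * coef b v.
Hypothesis lead_exists : forall a, a != 0 -> exists v, lead a v.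
Hypothesis lead_coef_neq0 : forall a v, lead a v -> coef a v != 0.

(* Tensors are lists of pairs; both sides agree under every bilinear map. *)
Lemma distinct_leads (l : seq (V * W)) : exists l' : seq (V * W * pos),
  [/\ forall (U : lmodType F) (B : V -> W -> U),
        (forall x y w c, B (x - c *: y) w = B x w - c *: B y w) ->
        (forall x w w' c, B x (w + c *: w') = B x w + c *: B x w') ->
        \sum_(x <- l) B x.1 x.2 = \sum_(x <- l') B x.1.1 x.1.2,
      forall x, x \in l' -> lead x.1.1 x.2 /\ x.1.2 != 0,
      uniq [seq x.2 | x <- l'] &
      forall v, (forall x, x \in l -> coef x.1 v = 0) -> forall x, x \in l' -> coef x.1.1 v = 0].
Proof.
have [n] := ubnP (size l); elim: n l => // n IH [|[a0 u0] l] sl.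
  by exists [::]; split=> // U B _ _; rewrite !big_nil.
case: (eqVneq a0 0) => [->|a00].
  have [//|l' [h1 h2 h3 h4]] := IH l; exists l'; split=> // [U B B1 B2|v hv].
    rewrite big_cons /= -h1 //; have -> : B 0 u0 = 0 by rewrite -[X in B X _](subrr 0) -[X in B (_ - X) _]scale1r B1 scale1r subrr.
    by rewrite add0r.
  by apply: h4 => x xl; apply: hv; rewrite inE xl orbT.
have [v0 lv0] := lead_exists a00; have c0 := lead_coef_neq0 lv0.
pose r a := coef a v0 / coef a0 v0.
(* Subtracting multiples of a0 clears position v0 in the remaining left factors; what is removed is
   collected in u1, so the tensor does not change. *)
pose l2 := [seq (x.1 - r x.1 *: a0, x.2) | x <- l].
pose u1 := u0 + \sum_(x <- l) r x.1 *: x.2.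
have [|l' [h1 h2 h3 h4]] := IH l2; first by rewrite size_map.
have l'0 x : x \in l' -> coef x.1.1 v0 = 0.
  by apply: h4 => y /mapP[z _ ->] /=; rewrite coefB /r divfK ?subrr.
have h4' v x : (forall y, y \in (a0, u0) :: l -> coef y.1 v = 0) -> x \in l' -> coef x.1.1 v = 0.
  move=> hv; apply: h4 => y /mapP[z zl ->] /=; rewrite coefB.
  by rewrite (hv z) ?inE ?zl ?orbT // (hv (a0, u0)) ?inE ?eqxx // mulr0 subrr.
have main (U : lmodType F) (B : V -> W -> U) :
    (forall x y w c, B (x - c *: y) w = B x w - c *: B y w) ->
    (forall x w w' c, B x (w + c *: w') = B x w + c *: B x w') ->
    \sum_(x <- (a0, u0) :: l) B x.1 x.2 = B a0 u1 + \sum_(x <- l') B x.1.1 x.1.2.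
  move=> B1 B2; rewrite big_cons -h1 // big_map /= /u1.
  have -> : B a0 (u0 + \sum_(x <- l) r x.1 *: x.2) = B a0 u0 + \sum_(x <- l) r x.1 *: B a0 x.2.
    elim: l {sl l2 u1 h1 h4 h4'} u0 => [|x l IHl] u; first by rewrite !big_nil !addr0.
    by rewrite !big_cons addrA IHl B2 addrA.
  rewrite -addrA -big_split /=; congr (_ + _); apply: eq_bigr => x _.
  by rewrite B1 addrC subrK.
case: (eqVneq u1 0) => [u10|u10].
  exists l'; split=> // [U B B1 B2|v hv x]; last exact: h4'.
  rewrite main // u10; have -> : B a0 0 = 0; last by rewrite add0r.
  apply: (addIr (B a0 0)); rewrite add0r -{2}[B a0 0]scale1r -B2 scaler0 addr0 //.
exists ((a0, u1, v0) :: l'); split.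
- by move=> U B B1 B2; rewrite main // big_cons.
- by move=> x; rewrite inE => /predU1P[->//|/h2].
- rewrite /= h3 andbT; apply/negP => /mapP[x xl' e].
  by have [/lead_coef_neq0] := h2 x xl'; rewrite -e l'0 // eqxx.
- move=> v hv x; rewrite inE => /predU1P[->|]; last exact: h4'.
  by apply: (hv (a0, u0)); rewrite inE eqxx.
Qed.

End Elimination.

(** * Leading terms of sequences *)

Section Asymptotics.
Variables (R : realType) (t : nat) (g : R[i]%C).
Hypotheses (g0 : 0 < normc g) (g1 : normc g < 1).
Local Notation C := R[i]%C.

(** The relative error is tiny, stronger than o(1), because sums of tied terms are later handed to
    [torsion]. *)
Definition asymptotic (f : nat -> C) (v : nat * nat) : Prop :=
  exists D eta, [/\ D != 0, tiny eta & exists N, forall k, (N <= k)%N ->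
    f k = zx t g k ^+ v.1 * zy t g k ^+ v.2 * (D + eta k)].

Lemma tiny_ev (c : nat -> C) : (forall A : nat, exists M N, forall k, (N <= k)%N -> normc (c k) * A%:R ^+ k <= M) -> tiny c.
Proof.
move=> h A; have [M [N hM]] := h A.
exists (Num.max M (\sum_(k < N) normc (c k) * A%:R ^+ k)) => k; rewrite le_max.
case: (leqP N k) => [/hM -> //|kN]; apply/orP; right.
rewrite (bigD1 (Ordinal kN)) //= lerDl sumr_ge0 // => j _.
by rewrite mulr_ge0 ?normc_ge0 ?exprn_ge0.
Qed.

Lemma tiny_square (rho S : R) (c : nat -> C) : 0 <= rho < 1 ->
  (exists N, forall k, (N <= k)%N -> normc (c k) <= S * rho ^+ (k * k)) -> tiny c.
Proof.
move=> r01 [N hN]; apply: tiny_ev => A.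
have [r0 r1] := andP r01.
have A0 : 0 < (A%:R + 1)^-1 :> R by rewrite invr_gt0 ltr_wpDl.
have [m hm] := expr_lt_eventually r01 A0.
exists `|S|, (maxn N m) => k; rewrite geq_max => /andP[/hN h mk].
apply: (@le_trans _ _ (`|S| * (rho ^+ (k * k) * A%:R ^+ k))).
  rewrite mulrA ler_wpM2r ?exprn_ge0 //; apply: le_trans h _.
  by rewrite ler_wpM2r ?exprn_ge0 // ler_norm.
rewrite ler_piMr // exprM -exprMn exprn_ile1 ?mulr_ge0 ?exprn_ge0 //.
apply: (@le_trans _ _ ((A%:R + 1)^-1 * A%:R)).
  by rewrite ler_wpM2r //; apply: le_trans (ltW hm); rewrite ler_wiXn2l // ltW.
by rewrite mulrC ler_pdivrMr ?ltr_wpDl // mul1r lerDl.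
Qed.

Lemma expands_asymptotic (lam : R) c f i0 j0 : 1 < lam -> lam ^+ 2 + 1 = t%:R * lam -> (2 < t)%N ->
  (forall i j i' j' : nat, wt lam i%:R j%:R = wt lam i'%:R j'%:R -> i = i' /\ j = j') ->
  expands t g c f -> f i0 j0 != 0 -> exists v, f v.1 v.2 != 0 /\ asymptotic c v.
Proof.
move=> lam1 lamt t2 wt_inj hc f0.
have [i [j [S [N [fij S0 h]]]]] := expands_leading_term lam1 lamt t2 wt_inj g0 g1 hc f0.
pose mo k := zx t g k ^+ i * zy t g k ^+ j.
have nmo k : normc (mo k) = normc g ^+ (i * pexp t k + j * qexp t k).
  by rewrite normc_monom.
have mo0 k : mo k != 0 by rewrite -normc_gt0 nmo exprn_gt0.
exists (i, j); split=> //; exists (f i j), (fun k => c k / mo k - f i j); split=> //.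
  apply: (@tiny_square (normc g) S); first by rewrite ltW.
  exists N => k /h; rewrite exprD -/(mo k) => hk.
  have -> : c k / mo k - f i j = (c k - f i j * mo k) / mo k by rewrite mulrBl mulfK.
  have m0 : 0 < normc (mo k) by rewrite normc_gt0.
  by rewrite normcM normc_inv // ler_pdivrMr // -mulrA [_ * normc (mo k)]mulrC nmo.
by exists N => k _; rewrite /= -/(mo k) addrC subrK mulrC divfK.
Qed.

End Asymptotics.

(** * Combinations of powers of s_k and monomials *)

Section BoxFunctions.
Variables (R : realType) (w : R) (S : pell w).
Hypothesis w_irr : forall x y : int, x%:~R * w = y%:~R -> x = 0.
Local Notation C := R[i]%C.
Local Notation t := (ptr S).
Variable al : C.
Hypothesis al01 : 0 < normc al < 1.
Variable xi : C.
Hypothesis xi_sums : sums (fun n => (Num.floor (n%:R * w))%:~R) al xi.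
Variable p : nat.
Let T : finType := ('I_p * ('I_p * 'I_p))%type.

Let al0 : 0 < normc al. Proof. by case/andP: al01. Qed.
Let al1 : normc al < 1. Proof. by case/andP: al01. Qed.

Definition box_fun (u : T) (k : nat) : C :=
  sk S al k ^+ u.1 * (zx t al k ^+ u.2.1 * zy t al k ^+ u.2.2).

Definition box_comb (a : {ffun T -> C^o}) (k : nat) : C := \sum_u a u * box_fun u k.

Lemma box_fun_expands : exists f : T -> nat -> nat -> C, forall u, expands t al (box_fun u) (f u).
Proof.
suff /fin_all_exists : forall u : T, exists f, expands t al (box_fun u) f by [].
move=> u; have [f0 hf0] : exists f, expands t al (sk S al) f.
  have h := expandsD (expands_cst t al xi) (expandsM al0 al1 (expands_cst t al (-1)) (sk_expands1 S w_irr al01 xi_sums)).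
  by exists (fun i j => (if (i == 0%N) && (j == 0%N) then xi else 0) + \sum_(a < i.+1) \sum_(b < j.+1)
      (if ((a : nat) == 0%N) && ((b : nat) == 0%N) then -1 else 0) * twist S 1 1 (cone S) (i - a)%N (j - b)%N);
    apply: expands_eq h => k; ring.
have [f1 hf1] : exists f, expands t al (fun k => sk S al k ^+ u.1) f.
  elim: (nat_of_ord u.1) => [|e [f hf]]; first by exists (fun i j => if (i == 0%N) && (j == 0%N) then 1 else 0); apply: expands_eq (expands_cst t al 1).
  by eexists; apply: expands_eq (expandsM al0 al1 hf0 hf) => k; rewrite exprS.
have h := expandsM al0 al1 hf1 (expands_poly t al ('X^(u.2.1 : nat) * ('X^(u.2.2 : nat))%:P)).
by eexists; refine (expands_eq _ h) => k; rewrite zeval_monom.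
Qed.

Lemma expands_sum (I : finType) (c : I -> nat -> C) (f : I -> nat -> nat -> C) :
  (forall u, expands t al (c u) (f u)) -> expands t al (fun k => \sum_u c u k) (fun i j => \sum_u f u i j).
Proof.
move=> h; have : forall l : seq I, exists2 f', expands t al (fun k => \sum_(u <- l) c u k) f' &
    forall i j, f' i j = \sum_(u <- l) f u i j.
  elim=> [|u l [f' hf' ef']].
    exists (fun i j => if (i == 0%N) && (j == 0%N) then 0 else 0).
      by apply: expands_eq (expands_cst t al 0) => k; rewrite big_nil.
    by move=> i j; rewrite big_nil; case: ifP.
  exists (fun i j => f u i j + f' i j); last by move=> i j; rewrite big_cons ef'.
  by apply: expands_eq (expandsD (h u) hf') => k; rewrite big_cons.
move=> /(_ (index_enum I))[f' hf' ef'] J; have [q [M h1 h2]] := hf' J.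
by exists q, M => // i j iJ jJ; rewrite h1 // ef'.
Qed.

Lemma box_comb_expands f (a : {ffun T -> C^o}) : (forall u, expands t al (box_fun u) (f u)) ->
  expands t al (box_comb a) (fun i j => \sum_u a u * f u i j).
Proof.
move=> hf; apply: expands_sum => u.
have h := expandsM al0 al1 (expands_cst t al (a u)) (hf u) => J; have [q [M h1 h2]] := h J.
exists q, M => // i j iJ jJ; rewrite h1 // big_ord_recl big_ord_recl /= !subn0 big1 ?addr0 => [|b _].
  by rewrite big1 ?addr0 // => b _; rewrite big1 // => e _; rewrite mul0r.
by rewrite mul0r.
Qed.

(** A combination with zero expansion is flat, hence a polynomial relation for s_k modulo flat
    sequences. By [sk_transcendental] its coefficients vanish eventually, so they are zero
    polynomials. *)
Lemma box_comb_independent f (a : {ffun T -> C^o}) : (forall u, expands t al (box_fun u) (f u)) ->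
  (forall i j, \sum_u a u * f u i j = 0) -> a = 0.
Proof.
move=> hf h0.
have fl := expands_flat (plam1 S) (ptr_gt2 S) al0 al1 (box_comb_expands a hf) h0.
pose po (e : nat) : {poly {poly C}} := \sum_(u : T | (u.1 : nat) == e) (a u)%:P%:P * ('X^(u.2.1) * ('X^(u.2.2))%:P).
pose b e v k := if v == 0%N then zeval t al (po e) k else 0.
have po0 e : (p <= e)%N -> po e = 0.
  by move=> pe; rewrite /po big1 // => u /eqP ue; have := ltn_ord u.1; rewrite ue ltnNge pe.
have z0 k : zeval t al 0 k = 0 by rewrite /zeval !horner0.
have rel : relation (ratseq t al) (flat t al) (sk S al) (fun=> 0) 0 p b.
  split.
  - move=> e v; rewrite /b; case: (v == 0%N); first exact: ratseq_zeval.
    exact: ratseq_cst.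
  - move=> e v k /orP[h|h]; rewrite /b; case: eqP => [v0|//]; last by rewrite v0 in h.
    by rewrite po0 ?z0 //; move: h; rewrite v0 addn0 => /ltnW.
  - apply: (@flat_ev _ _ _ al0 (box_comb a) _ 0) => // k _.
    rewrite /relval.
    under eq_bigr => e _.
      rewrite big_ord_recl big1 ?addr0 => [|v _]; last by rewrite /b mul0r.
      rewrite /b /= expr0 mulr1 /po.
      over.
    rewrite /box_comb big_ord_recr /= -/(po p) po0 // z0 mul0r addr0.
    under [RHS]eq_bigr => e _.
      rewrite /zeval horner_sum horner_sum mulr_suml.
      over.
    rewrite (exchange_big_dep xpredT) //=; apply: eq_bigr => u _.
    rewrite (big_pred1 u.1) => [|e]; last by rewrite /= eq_sym.
    by rewrite -/(zeval t al _ k) zevalM zevalC zeval_monom /box_fun; ring.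
have tr := sk_transcendental w_irr al01 xi_sums rel.
apply/ffunP => u; rewrite ffunE.
have poz : po u.1 = 0.
  apply/eqP; apply: contraT => /(zeval_neq0 (plam1 S) (plamt S) (ptr_gt2 S) (wt_inj (plam1 S) (ptr_gt2 S) (@plam_irr _ _ S w_irr)) al0 al1) [N hN].
  have [M hM] := tr u.1 0%N; have := hN (maxn N M) (leq_maxl _ _).
  by rewrite -[zeval _ _ _ _]/(b u.1 0%N _) hM ?leq_maxr // eqxx.
have := congr1 (fun q : {poly {poly C}} => q`_(u.2.1)`_(u.2.2)) poz.
rewrite /po !coef0 coef_sum coef_sum (bigD1 u) //= big1 ?addr0 => [|u' /andP[/eqP e1 ne]].
  by rewrite coefCM coefMC coefXn eqxx coefCM mul1r coefXn eqxx mulr1.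
rewrite coefCM coefMC coefXn coefCM; case: eqP => [e2|_]; last by rewrite mul0r coef0 mulr0.
rewrite mul1r coefXn; case: eqP => [e3|_]; last by rewrite mulr0.
case/eqP: ne; case: u' e1 e2 e3 => x [y z]; case: u {poz} => x' [y' z'] /= e1 e2 e3.
by congr (_, (_, _)); apply: val_inj.
Qed.

Lemma box_comb_asymptotic f (a : {ffun T -> C^o}) : (forall u, expands t al (box_fun u) (f u)) ->
  a != 0 -> exists v, \sum_u a u * f u v.1 v.2 != 0 /\ asymptotic t al (box_comb a) v.
Proof.
move=> hf a0; have [[i [j ij]]|no] := pselect (exists i j, \sum_u a u * f u i j != 0).
  exact: (expands_asymptotic al0 al1 (plam1 S) (plamt S) (ptr_gt2 S)
    (wt_inj (plam1 S) (ptr_gt2 S) (@plam_irr _ _ S w_irr)) (box_comb_expands a hf) ij).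
case/eqP: a0; apply: (box_comb_independent hf) => i j.
by apply/eqP; apply: contraT => h; case: no; exists i, j.
Qed.

End BoxFunctions.

Section NormalForm.
Variables (R : realType) (w w' : R) (S : pell w) (S' : pell w').
Hypothesis w_irr : forall x y : int, x%:~R * w = y%:~R -> x = 0.
Hypothesis w_irr' : forall x y : int, x%:~R * w' = y%:~R -> x = 0.
Local Notation C := R[i]%C.
Variables al al' : C.
Hypotheses (al01 : 0 < normc al < 1) (al01' : 0 < normc al' < 1).
Variables xi xi' : C.
Hypothesis xi_sums : sums (fun n => (Num.floor (n%:R * w))%:~R) al xi.
Hypothesis xi_sums' : sums (fun n => (Num.floor (n%:R * w'))%:~R) al' xi'.
Variable p : nat.
Local Notation T := ('I_p * ('I_p * 'I_p))%type.

(** Distinct leading monomials on the left are what the nonvanishing arguments require; on the right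
    they may coincide. The indices k and k' are independent because the two orbits may run at
    different speeds. *)
Lemma normal_form (a : T -> T -> C) : (exists u u', a u u' != 0) ->
  exists n (phi psi : 'I_n.+1 -> nat -> C) (v v' : 'I_n.+1 -> nat * nat),
  [/\ injective v, forall b, asymptotic (ptr S) al (phi b) (v b),
      forall b, asymptotic (ptr S') al' (psi b) (v' b) &
      forall k k', \sum_u \sum_u' a u u' * (box_fun S al u k * box_fun S' al' u' k') =
        \sum_b phi b k * psi b k'].
Proof.
move=> [u0 [u0' a0]].
have [f hf] := box_fun_expands S w_irr al01 xi_sums p.
have [f' hf'] := box_fun_expands S' w_irr' al01' xi_sums' p.
pose V := {ffun T -> C^o}.
pose coef (x : V) (v : nat * nat) : C := \sum_u x u * f u v.1 v.2.
pose lead (x : V) v := coef x v != 0 /\ asymptotic (ptr S) al (box_comb S al x) v.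
have coefB x y c v : coef (x - c *: y) v = coef x v - c * coef y v.
  rewrite /coef mulr_sumr -sumrB; apply: eq_bigr => u _; rewrite !ffunE.
  by rewrite mulrBl mulrA.
have lead_ex x : x != 0 -> exists v, lead x v.
  by move=> /(box_comb_asymptotic w_irr al01 xi_sums hf).
have lead0 x v : lead x v -> coef x v != 0 by case.
(* The tensor is written with unit vectors on the left and the rows of [a] on the right. *)
pose l : seq (V * V) := [seq ([ffun u' => (u' == u)%:R], [ffun u' => a u u']) | u <- index_enum T].
have [l' [h1 h2 h3 _]] := distinct_leads coefB lead_ex lead0 l.
have lsum (U : lmodType C) (B : V -> V -> U) : \sum_(x <- l) B x.1 x.2 =
   \sum_u B [ffun u' => (u' == u)%:R] [ffun u' => a u u'] by rewrite big_map.
have psi_ex x : exists v', x \in l' -> asymptotic (ptr S') al' (box_comb S' al' x.1.2) v'.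
  case: (boolP (x \in l')) => [xl|_]; last by exists (0, 0)%N.
  have [_ x0] := h2 x xl.
  by have [v' [_ hv']] := box_comb_asymptotic w_irr' al01' xi_sums' hf' x0; exists v'.
have [g hg] := choice psi_ex.
(* The bilinear map reading off the coefficient at (u0, u0') is nonzero on the tensor. *)
have nz : l' != [::].
  apply/eqP => l'0; case/eqP: a0.
  have B1 (x y z : V) c : (x - c *: y) u0 * z u0' = x u0 * z u0' - c *: (y u0 * z u0') :> C^o.
    by rewrite !ffunE mulrBl -mulrA.
  have B2 (x y z : V) c : x u0 * (y + c *: z) u0' = x u0 * y u0' + c *: (x u0 * z u0') :> C^o.
    by rewrite !ffunE mulrDr; congr (_ + _); rewrite mulrCA.
  pose B (x y : V) : C^o := x u0 * y u0'.
  have := h1 _ B B1 B2; rewrite lsum l'0 big_nil /B => <-.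
  rewrite (bigD1 u0) //= !ffunE eqxx mul1r big1 ?addr0 // => u /negPf ne.
  by rewrite !ffunE eq_sym ne mul0r.
have [n sl'] : exists n, size l' = n.+1 by case: (l') nz => // x s _; exists (size s).
pose x0 : V * V * (nat * nat) := (0, 0, (0, 0)%N).
pose X (b : 'I_n.+1) := nth x0 l' b.
have Xl b : X b \in l' by apply: mem_nth; rewrite sl'.
exists n, (fun b => box_comb S al (X b).1.1), (fun b => box_comb S' al' (X b).1.2),
  (fun b => (X b).2), (fun b => g (X b)); split.
- move=> b b' e; apply: val_inj; apply/eqP; rewrite -(nth_uniq (0, 0)%N _ _ h3) ?size_map ?sl' ?ltn_ord //.
  by rewrite !(nth_map x0) ?sl' ?ltn_ord //; apply/eqP; exact: e.
- by move=> b; have [[_ ?] _] := h2 _ (Xl b).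
- by move=> b; apply: hg.
move=> k k'.
have B1 (x y z : V) c : box_comb S al (x - c *: y) k * box_comb S' al' z k' =
    box_comb S al x k * box_comb S' al' z k' - c * (box_comb S al y k * box_comb S' al' z k').
  rewrite mulrA -mulrBl; congr (_ * _); rewrite /box_comb mulr_sumr -sumrB.
  by apply: eq_bigr => u _; rewrite !ffunE mulrBl -mulrA.
have B2 (x y z : V) c : box_comb S al x k * box_comb S' al' (y + c *: z) k' =
    box_comb S al x k * box_comb S' al' y k' + c * (box_comb S al x k * box_comb S' al' z k').
  rewrite mulrCA -mulrDr; congr (_ * _); rewrite /box_comb mulr_sumr -big_split.
  by apply: eq_bigr => u _; rewrite !ffunE mulrDl -mulrA.
pose B (x y : V) : C^o := box_comb S al x k * box_comb S' al' y k'.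
have := h1 _ B B1 B2; rewrite lsum /B.
rewrite (big_nth x0) big_mkord sl' => <-; apply: eq_bigr => u _.
have -> : box_comb S al [ffun u' => (u' == u)%:R] k = box_fun S al u k.
  rewrite /box_comb (bigD1 u) //= ffunE eqxx mul1r big1 ?addr0 // => u' /negPf ne.
  by rewrite ffunE ne mul0r.
by rewrite /box_comb mulr_sumr; apply: eq_bigr => u' _; rewrite ffunE; ring.
Qed.

End NormalForm.

(** * Domination by a single term *)

Section Sizes.
Variables (R : realType) (t t' : nat) (g g' : R[i]%C).
Hypotheses (g01 : 0 < normc g < 1) (g01' : 0 < normc g' < 1).
Local Notation C := R[i]%C.

Definition size_exp (t : nat) (g : C) (v : nat * nat) (k : nat) : R :=
  - ln (normc g) * (v.1%:R * (pexp t k)%:R + v.2%:R * (qexp t k)%:R).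

Lemma normc_monom_exp s (h : C) v k : 0 < normc h ->
  normc (zx s h k ^+ v.1 * zy s h k ^+ v.2) = expR (- size_exp s h v k).
Proof.
move=> h0; rewrite normc_monom /size_exp mulNr opprK -!natrM -natrD mulrC expRM_natl lnK //.
Qed.

Lemma asymptotic_bounds s (h : C) f v : 0 < normc h -> asymptotic s h f v ->
  exists c d N, [/\ 0 < c, 0 < d & forall k, (N <= k)%N ->
    c * expR (- size_exp s h v k) <= normc (f k) <= d * expR (- size_exp s h v k)].
Proof.
move=> h0 [D [eta [D0 te [N hN]]]].
have D0' : 0 < normc D by rewrite normc_gt0.
have [|N' hN'] := tiny_small te (_ : 0 < normc D / 2); first by lra.
exists (normc D / 2), (2 * normc D), (maxn N N'); split; try lra.
move=> k; rewrite geq_max => /andP[/hN -> /hN' e].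
rewrite normcM normc_monom_exp // mulrC ![_ * expR _]mulrC !ler_pM2l ?expR_gt0 //.
have := lerB_normcD D (eta k); have := ler_normcD D (eta k); lra.
Qed.

Variables (n : nat) (phi psi : 'I_n.+1 -> nat -> C) (v v' : 'I_n.+1 -> nat * nat).
Hypotheses (ha : forall b, asymptotic t g (phi b) (v b)) (ha' : forall b, asymptotic t' g' (psi b) (v' b)).

Definition energy b k k' : R := size_exp t g (v b) k + size_exp t' g' (v' b) k'.

Lemma term_bounds : exists c d N, [/\ 0 < c, 0 < d & forall b k k', (N <= k)%N -> (N <= k')%N ->
    c * expR (- energy b k k') <= normc (phi b k * psi b k') <= d * expR (- energy b k k')].
Proof.
have [g0 _] := andP g01; have [g0' _] := andP g01'.
have h b : exists x : R * R * nat, [/\ 0 < x.1.1, 0 < x.1.2 & forall k k', (x.2 <= k)%N -> (x.2 <= k')%N ->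
    x.1.1 * expR (- energy b k k') <= normc (phi b k * psi b k') <= x.1.2 * expR (- energy b k k')].
  have [c [d [N [c0 d0 hN]]]] := asymptotic_bounds g0 (ha b).
  have [c' [d' [N' [c0' d0' hN']]]] := asymptotic_bounds g0' (ha' b).
  exists (c * c', d * d', maxn N N'); split=> /=; rewrite ?mulr_gt0 // => k k'.
  rewrite !geq_max => /andP[/hN/andP[h1 h2] _] /andP[_ /hN'/andP[h3 h4]].
  rewrite normcM /energy opprD expRD !(mulrACA _ _ (expR _)); apply/andP; split.
    by rewrite ler_pM // ?mulr_ge0 ?expR_ge0 // ltW.
  by rewrite ler_pM ?normc_ge0.
have [x hx] := fin_all_exists h.
have [c c0 hc] := @fin_gap R 'I_n.+1 (fun b => (x b).1.1) xpredT (fun b _ => let: And3 h _ _ := hx b in h).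
exists c, (\sum_b (x b).1.2), (\max_b (x b).2); split=> //.
  rewrite (bigD1 ord0) //= ltr_wpDr ?sumr_ge0 //; first by move=> b _; case: (hx b) => _ /ltW.
  by case: (hx ord0).
move=> b k k' hk hk'; have [_ _ hb] := hx b.
have /andP[h1 h2] := hb k k' (leq_trans (leq_bigmax b) hk) (leq_trans (leq_bigmax b) hk').
apply/andP; split.
  by apply: le_trans h1; rewrite ler_wpM2r ?expR_ge0 // hc.
apply: le_trans h2 _; rewrite ler_wpM2r ?expR_ge0 // (bigD1 b) //= lerDl sumr_ge0 // => b' _.
by case: (hx b') => _ /ltW.
Qed.

(** Each term is comparable to exp (- energy) with uniform constants, so the term of least energy
    outweighs the sum of the others once the gaps exceed a fixed A. *)
Lemma separated_neq0 : exists A N, forall k k', (N <= k)%N -> (N <= k')%N ->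
  (forall b b', b != b' -> A <= `|energy b k k' - energy b' k k'|) -> \sum_b phi b k * psi b k' != 0.
Proof.
have [c [d [N [c0 d0 hN]]]] := term_bounds.
(* With gaps of at least - ln e the other terms add up to at most half the lower bound of the least
   one. *)
pose e := c / (2 * n.+1%:R * d).
have nd : 0 < 2 * n.+1%:R * d by rewrite !mulr_gt0.
have e0 : 0 < e by rewrite divr_gt0.
exists (- ln e), N => k k' Nk Nk' sep.
have [b0 _ hmin] := @arg_minP _ R 'I_n.+1 ord0 xpredT (fun b => energy b k k') isT.
rewrite -normc_gt0 (bigD1 b0) //=.
set X := phi b0 k * _; set Y := \sum_(b | _) _.
suff : normc Y < normc X by have := lerB_normcD X Y; lra.
have /andP[h1 _] := hN b0 k k' Nk Nk'.
apply: lt_le_trans h1.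
pose M := expR (- energy b0 k k'); have M0 : 0 < M by apply: expR_gt0.
rewrite -/M; apply: (@le_lt_trans _ _ (\sum_(b : 'I_n.+1) d * (e * M))).
  apply: le_trans (ler_normc_sum _ _ _) _; rewrite [leRHS](bigD1 b0) //= -[leLHS]add0r lerD //.
    by rewrite mulr_ge0 ?(ltW d0) // mulr_ge0 ?(ltW e0) ?(ltW M0).
  apply: ler_sum => b bb0; have /andP[_ h2] := hN b k k' Nk Nk'; apply: le_trans h2 _.
  rewrite ler_pM2l // /M -{1}(lnK e0) -expRD ler_expR.
  have := sep b b0 bb0; rewrite ger0_norm ?subr_ge0 ?hmin //; lra.
rewrite sumr_const card_ord -[_ *+ _]mulr_natl.
have -> : n.+1%:R * (d * (e * M)) = (2 * n.+1%:R * d * e) * (M / 2) by field.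
have -> : 2 * n.+1%:R * d * e = c by rewrite /e mulrC divfK // gt_eqF.
by rewrite ltr_pM2l //; lra.
Qed.

End Sizes.

(** * Near coincidences between powers of two independent numbers *)

Section Ties.
Variable R : realType.

(** Among n + 1 consecutive bad k two would share an index s, making b_s times the difference of
    their ratios small. But the quotient of two such ratios is one of finitely many numbers l2^y /
    l1^x with x > 0, none of which is 1. *)
Lemma avoid_ties (l1 l2 : R) (lv : nat -> nat) (n : nat) (a b : 'I_n -> R) :
  1 < l1 -> 1 < l2 -> (forall x y, (0 < x)%N -> l1 ^+ x != l2 ^+ y) ->
  (forall k, l1 ^+ k <= l2 ^+ lv k < l2 * l1 ^+ k) -> (forall s, a s != 0) ->
  exists2 e, 0 < e & forall k0, exists2 k, (k0 <= k)%N &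
    forall s, e <= `|a s + b s * (l2 ^+ lv k / l1 ^+ k)|.
Proof.
move=> l11 l21 ind hlv a0.
have l10 : 0 < l1 by apply: lt_trans l11.
have l20 : 0 < l2 by apply: lt_trans l21.
pose rho k := l2 ^+ lv k / l1 ^+ k.
have rho1 k : 1 <= rho k < l2.
  have /andP[h1 h2] := hlv k; rewrite /rho ler_pdivlMr ?exprn_gt0 // mul1r h1.
  by rewrite ltr_pdivrMr ?exprn_gt0.
have lvm k k' : (k <= k')%N -> (lv k <= lv k' <= lv k + (1 + lv (k' - k)))%N.
  move=> kk'; have /andP[h1 h2] := hlv k; have /andP[h3 h4] := hlv k'; have /andP[h5 h6] := hlv (k' - k)%N.
  apply/andP; split.
    rewrite -ltnS -(ltr_eXn2l l21); apply: lt_le_trans h2 _; rewrite exprS ler_pM2l //.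
    by apply: le_trans h3; rewrite ler_weXn2l // ltW.
  rewrite -ltnS -(ltr_eXn2l l21); apply: lt_le_trans h4 _.
  rewrite exprS ler_pM2l // !exprD expr1 -{1}(subnKC kk') exprD.
  apply: ler_pM => //; rewrite ?exprn_ge0 ?(ltW l10) //.
  by apply: le_trans h5 _; rewrite ler_peMl ?exprn_ge0 ?(ltW l20) ?(ltW l21).
have [de de0 hde] : exists2 de : R, 0 < de & forall k k', (k < k' <= k + n.+1)%N -> de <= `|rho k' / rho k - 1|.
  pose J := (2 + \max_(j < n.+2) lv j)%N.
  have [|de de0 h] := @fin_gap R ('I_n.+2 * 'I_J)%type (fun x => `|l2 ^+ x.2 / l1 ^+ x.1 - 1|) (fun x => (0 < x.1)%N).
    move=> [x y] /= x0; rewrite normr_gt0 subr_eq0; apply/eqP => e.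
    by have /eqP[] := ind x y x0; rewrite (divr1_eq e).
  exists de => // k k' /andP[kk' k'n].
  have /andP[m1 m2] := lvm k k' (ltnW kk').
  have xb : (k' - k < n.+2)%N by clear -k'n; lia.
  have yb : (lv k' - lv k < J)%N.
    rewrite /J addSn ltnS leq_subLR; apply: leq_trans m2 _; rewrite !leq_add2l.
    exact: (leq_bigmax (F := fun j : 'I_n.+2 => lv j) (Ordinal xb)).
  have := h (Ordinal xb, Ordinal yb); rewrite /= subn_gt0 => /(_ kk').
  suff -> : l2 ^+ (lv k' - lv k) / l1 ^+ (k' - k) = rho k' / rho k by [].
  rewrite /rho -[in RHS](subnKC m1) -[in l1 ^+ k'](subnKC (ltnW kk')) !exprD.
  by field; rewrite ?expf_neq0 ?gt_eqF.
have [|e1 e10 he1] := @fin_gap R 'I_n (fun s => `|a s|) xpredT; first by move=> s _; rewrite normr_gt0.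
have [|e2 e20 he2] := @fin_gap R 'I_n (fun s => `|b s|) (fun s => b s != 0); first by move=> s h; rewrite normr_gt0.
(* e1 rules out b_s = 0; the other bound contradicts two bad indices with the same s. *)
pose e := Num.min e1 (de * e2 / 2).
have e0 : 0 < e by rewrite lt_min e10 /= !divr_gt0 ?mulr_gt0.
exists e => // k0; apply: contrapT => no.
have bad k : (k0 <= k)%N -> exists s, `|a s + b s * rho k| < e.
  move=> kk; apply: contrapT => h; apply: no; exists k => // s.
  by rewrite leNgt; apply/negP => hs; apply: h; exists s.
have /choice[f hf] : forall x : 'I_n.+1, exists s, `|a s + b s * rho (k0 + x)%N| < e.
  by move=> x; apply: bad; rewrite leq_addr.
have /injectivePn[x [y nxy exy]] : ~~ injectiveb f.
  by apply/negP => /injectiveP /leq_card; rewrite !card_ord ltnn.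
have gen (i j : 'I_n.+1) : (i < j)%N -> f i = f j -> False.
  move=> ij fij; have h1 := hf i; have h2 := hf j; rewrite -fij in h2.
  have kb : (k0 + i < k0 + j <= k0 + i + n.+1)%N by have := ltn_ord j; clear -ij; lia.
  have := hde _ _ kb; set r1 := rho (k0 + i)%N; set r2 := rho (k0 + j)%N; move=> hr.
  rewrite -/r1 in h1; rewrite -/r2 in h2.
  have /andP[r11 _] := rho1 (k0 + i)%N; rewrite -/r1 in r11.
  have b0 : b (f i) != 0.
    apply/eqP => b0; move: h1; rewrite b0 mul0r addr0 ltNge => /negP; apply.
    by rewrite ge_min he1.
  have hb := he2 (f i) b0.
  have r10 : 0 < r1 by lra.
  have : `|b (f i) * (r2 - r1)| < 2 * e.
    have -> : b (f i) * (r2 - r1) = (a (f i) + b (f i) * r2) - (a (f i) + b (f i) * r1) by ring.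
    by apply: le_lt_trans (ler_normB _ _) _; lra.
  rewrite normrM; have -> : r2 - r1 = (r2 / r1 - 1) * r1 by field; rewrite gt_eqF.
  rewrite normrM (gtr0_norm r10); apply/negP; rewrite -leNgt.
  apply: (@le_trans _ _ (e2 * (de * 1))).
    have ee : e <= de * e2 / 2 by rewrite /e ge_min lexx orbT.
    by rewrite mulr1 mulrC mulrC [e2 * de]mulrC; move: ee; move: (de * e2) => z; clear; lra.
  apply: ler_pM => //; [exact: ltW|by rewrite mulr1 ltW|by apply: ler_pM => //; exact: ltW].
case: (ltngtP x y) => h; [exact: gen h exy|exact: gen h (esym exy)|].
by case/eqP: nxy; apply: val_inj.
Qed.

Lemma power_between (l1 l2 : R) : 1 < l1 -> 1 < l2 ->
  exists lv : nat -> nat, forall k, l1 ^+ k <= l2 ^+ lv k < l2 * l1 ^+ k.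
Proof.
move=> l11 l21.
suff /choice[lv hlv] : forall k, exists n, l1 ^+ k <= l2 ^+ n < l2 * l1 ^+ k by exists lv.
move=> k.
have l20 : 0 < l2 by apply: lt_trans l21.
have ex : exists n, l1 ^+ k <= l2 ^+ n.
  have [||n hn] := @expr_lt_eventually R l2^-1 (l1 ^+ k)^-1.
  - by rewrite invr_ge0 (ltW l20) invf_lt1.
  - by rewrite invr_gt0 exprn_gt0 // (lt_trans ltr01).
  - by exists n; rewrite ltW // -ltf_pV2 ?posrE ?exprn_gt0 ?(lt_trans ltr01) // -exprVn.
case: (ex_minnP ex) => n hn hmin; exists n; rewrite hn /=.
case: n hn hmin => [|n] hn hmin.
  by rewrite expr0; apply: lt_le_trans l21 _; rewrite ler_peMr ?(ltW l20) // exprn_ege1 // ltW.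
by rewrite exprS ltr_pM2l // ltNge; apply/negP => /hmin; rewrite ltnn.
Qed.

End Ties.

(** * Nonvanishing for multiplicatively independent eigenvalues *)

Section Independent.
Variables (R : realType) (t t' : nat) (lam lam' : R).
Hypotheses (lam1 : 1 < lam) (lamt : lam ^+ 2 + 1 = t%:R * lam) (t2 : (2 < t)%N).
Hypotheses (lam1' : 1 < lam') (lamt' : lam' ^+ 2 + 1 = t'%:R * lam') (t2' : (2 < t')%N).
Hypothesis lam_irr : forall x y : int, x%:~R * lam = y%:~R -> x = 0.

Lemma pexp_comparable (s : nat) (l : R) : 1 < l -> l ^+ 2 + 1 = s%:R * l -> (2 < s)%N ->
  exists c d, [/\ 0 < c, 0 < d & forall k, c * l ^+ k <= (pexp s k)%:R <= d * l ^+ k].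
Proof.
move=> l1 ls s2; have l0 : 0 < l by lra.
have b0 := lamB_gt0 l1; have [u0 u1] := andP (lamV_lt1 l1).
exists ((1 - l^-1) * l / (l - l^-1)), (((1 - l^-1) * l + (l - 1)) / (l - l^-1)); split.
- by rewrite divr_gt0 // mulr_gt0 //; lra.
- by rewrite divr_gt0 // ltr_wpDl ?mulr_ge0 //; lra.
move=> k; have := pqE l1 ls s2 k 1 0; rewrite mul0r addr0 mul1r /wt /ell !mul1r addr0 subr0 => e.
have e' : (pexp s k)%:R = ((1 - l^-1) * l * l ^+ k + (l - 1) * l^-1 ^+ k.+1) / (l - l^-1).
  by rewrite -mulrA -exprS -e mulrC mulKf // gt_eqF.
have lk : 1 <= l ^+ k by rewrite exprn_ege1 // ltW.
have uk : 0 <= l^-1 ^+ k.+1 by rewrite exprn_ge0 // ltW.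
have uk1 : l^-1 ^+ k.+1 <= 1 by rewrite exprn_ile1 // ltW.
rewrite e' ![_ / _ * _]mulrAC !ler_pM2r ?invr_gt0 //; apply/andP; split.
  by rewrite lerDl mulr_ge0 // subr_ge0 ltW.
rewrite [leRHS]mulrDl lerD2l ler_wpM2l ?subr_ge0 ?(ltW l1) //; lra.
Qed.

(** Only the expanding coordinate matters; the contracting one contributes a bounded amount. *)
Lemma size_exp_growth (s : nat) (l : R) (g : R[i]%C) v : 1 < l -> l ^+ 2 + 1 = s%:R * l -> (2 < s)%N ->
  0 < normc g < 1 -> exists d, 0 <= d /\ forall k,
  `|size_exp s g v k - (- ln (normc g)) * (wt l v.1%:R v.2%:R * l / (l - l^-1)) * l ^+ k| <= d.
Proof.
move=> l1 ls s2 /andP[g0 g1].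
have b0 := lamB_gt0 l1; have [u0 u1] := andP (lamV_lt1 l1).
exists (`|ln (normc g)| * (`|ell l v.1%:R v.2%:R| / (l - l^-1))); split.
  by rewrite mulr_ge0 // divr_ge0 // ltW.
move=> k; have e := pqE l1 ls s2 k v.1%:R v.2%:R.
have -> : size_exp s g v k = - ln (normc g) * ((wt l v.1%:R v.2%:R * l ^+ k.+1 + ell l v.1%:R v.2%:R * l^-1 ^+ k.+1) / (l - l^-1)).
  by rewrite -e [_ * (_ + _)]mulrC mulfK ?gt_eqF.
rewrite exprS -[_ * _ * l ^+ k]mulrA -mulrBr normrM normrN ler_wpM2l //.
have -> : (wt l v.1%:R v.2%:R * (l * l ^+ k) + ell l v.1%:R v.2%:R * l^-1 ^+ k.+1) / (l - l^-1) - wt l v.1%:R v.2%:R * l / (l - l^-1) * l ^+ k =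
   ell l v.1%:R v.2%:R * l^-1 ^+ k.+1 / (l - l^-1) by ring.
rewrite normrM [X in _ * X]ger0_norm ?invr_ge0 ?(ltW b0) // ler_pM2r ?invr_gt0 // normrM ler_piMr //.
by rewrite ger0_norm ?exprn_ge0 ?(ltW u0) // exprn_ile1 // ltW.
Qed.

Variables (g g' : R[i]%C).
Hypotheses (g01 : 0 < normc g < 1) (g01' : 0 < normc g' < 1).
Hypothesis ind : forall x y, (0 < x)%N -> lam ^+ x != lam' ^+ y.
Variable lv : nat -> nat.
Hypothesis hlv : forall k, lam ^+ k <= lam' ^+ lv k < lam' * lam ^+ k.

Lemma lv_unbounded M : exists k0, forall k, (k0 <= k)%N -> (M <= lv k)%N.
Proof.
have l0 : 0 < lam by apply: lt_trans lam1.
have [||n hn] := @expr_lt_eventually R lam^-1 (lam' ^+ M)^-1.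
- by rewrite invr_ge0 (ltW l0) invf_lt1.
- by rewrite invr_gt0 exprn_gt0 // (lt_trans ltr01).
exists n => k nk; rewrite leqNgt; apply/negP => h.
have /andP[h1 _] := hlv k.
move: hn; rewrite exprVn ltf_pV2 ?posrE ?exprn_gt0 ?(lt_trans ltr01) // ltNge => /negP; apply.
apply: (@le_trans _ _ (lam ^+ k)); first by rewrite ler_weXn2l // ltW.
by apply: le_trans h1 _; rewrite ler_weXn2l ?(ltW lam1') ?(ltnW h).
Qed.

(** Up to a bounded error the energies are a_b lam^k + c_b lam'^(lv k), and a is injective because
    the left leading monomials are distinct. [avoid_ties] supplies arbitrarily large k at which all
    differences are of order lam^k, beyond the gap that domination requires. *)
Lemma independent_nonvanishing n (phi psi : 'I_n.+1 -> nat -> R[i]%C) v v' : injective v ->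
  (forall b, asymptotic t g (phi b) (v b)) -> (forall b, asymptotic t' g' (psi b) (v' b)) ->
  forall k0, exists2 k, (k0 <= k)%N & \sum_b phi b k * psi b (lv k) != 0.
Proof.
move=> v_inj ha ha' k0; have [A [N hN]] := separated_neq0 g01 g01' ha ha'.
have [g0 g1] := andP g01.
pose a b := (- ln (normc g)) * (wt lam (v b).1%:R (v b).2%:R * lam / (lam - lam^-1)).
pose c b := (- ln (normc g')) * (wt lam' (v' b).1%:R (v' b).2%:R * lam' / (lam' - lam'^-1)).
have l0 : 0 < lam by apply: lt_trans lam1.
have [d hd] := fin_all_exists (fun b => size_exp_growth (v b) lam1 lamt t2 g01).
have [d' hd'] := fin_all_exists (fun b => size_exp_growth (v' b) lam1' lamt' t2' g01').
pose D := \sum_b (d b + d' b).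
have hD b k k' : `|energy t t' g g' v v' b k k' - (a b * lam ^+ k + c b * lam' ^+ k')| <= D.
  have -> : energy t t' g g' v v' b k k' - (a b * lam ^+ k + c b * lam' ^+ k') =
     (size_exp t g (v b) k - a b * lam ^+ k) + (size_exp t' g' (v' b) k' - c b * lam' ^+ k') by rewrite /energy; ring.
  apply: le_trans (ler_normD _ _) _; apply: (@le_trans _ _ (d b + d' b)).
    by rewrite lerD //; [case: (hd b)|case: (hd' b)].
  rewrite /D (bigD1 b) //= lerDl sumr_ge0 // => j _.
  by rewrite addr_ge0 //; [case: (hd j)|case: (hd' j)].
have D0 : 0 <= D by rewrite sumr_ge0 // => j _; rewrite addr_ge0 //; [case: (hd j)|case: (hd' j)].
pose da (s : 'I_(n.+1 * n.+1)) : 'I_n.+1 * 'I_n.+1 := enum_val (cast_ord (esym (etrans (card_prod _ _) (f_equal2 muln (card_ord n.+1) (card_ord n.+1)))) s).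
(* Diagonal pairs receive the harmless form 1 + 0 rho, so that [avoid_ties] can run over all
   pairs. *)
pose a2 s := if (da s).1 == (da s).2 then 1 else a (da s).1 - a (da s).2.
pose c2 s := if (da s).1 == (da s).2 then 0 else c (da s).1 - c (da s).2.
have a_inj b b' : a b = a b' -> b = b'.
  move=> e; apply: v_inj.
  have lg : - ln (normc g) != 0 by rewrite oppr_eq0 lt_eqF // ln_lt0 // g0 g1.
  have lb := lamB_gt0 lam1.
  have /(wt_inj lam1 t2 lam_irr)[e1 e2] : wt lam (v b).1%:R (v b).2%:R = wt lam (v b').1%:R (v b').2%:R.
    apply: (mulIf (_ : lam != 0)); first by rewrite gt_eqF.
    apply: (mulIf (_ : (lam - lam^-1)^-1 != 0)); first by rewrite invr_eq0 gt_eqF.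
    exact: (mulfI lg).
  by case: (v b) (v b') e1 e2 => x y [x' y'] /= -> ->.
have a20 s : a2 s != 0.
  rewrite /a2; case: ((da s).1 =P (da s).2) => [_|ne]; first by rewrite oner_neq0.
  by rewrite subr_eq0; apply/eqP => /a_inj.
have [e e0 he] := avoid_ties c2 lam1 lam1' ind hlv a20.
have [||n1 hn1] := @expr_lt_eventually R lam^-1 (e / (`|A| + 2 * D + 1)).
- by rewrite invr_ge0 (ltW l0) invf_lt1.
- by rewrite divr_gt0 // ltr_wpDl // addr_ge0 // mulr_ge0.
have [n2 hn2] := lv_unbounded N.
have [k hk ek] := he (maxn k0 (maxn N (maxn n1 n2))).
move: hk; rewrite !geq_max => /and4P[k0k Nk n1k n2k].
exists k => //; apply: hN => //; first exact: hn2.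
move=> b b' bb'.
have [s hs] : exists s, da s = (b, b').
  exists (cast_ord (etrans (card_prod _ _) (f_equal2 muln (card_ord n.+1) (card_ord n.+1))) (enum_rank (b, b'))).
  by rewrite /da cast_ord_comp cast_ord_id enum_rankK.
have := ek s; rewrite /a2 /c2 hs /= (negPf bb') => es.
have h1 := hD b k (lv k); have h2 := hD b' k (lv k).
have lk : 0 < lam ^+ k by rewrite exprn_gt0.
have big : `|A| + 2 * D + 1 <= e * lam ^+ k.
  have l1 : lam^-1 ^+ k <= lam^-1 ^+ n1 by rewrite ler_wiXn2l ?invr_ge0 ?(ltW l0) // invf_le1 // ltW.
  have := le_lt_trans l1 hn1; rewrite exprVn ltr_pdivlMr ?ltr_wpDl ?addr_ge0 ?mulr_ge0 //.
  by rewrite mulrC ltr_pdivrMr // => /ltW.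
have : e * lam ^+ k <= `|(a b - a b') * lam ^+ k + (c b - c b') * lam' ^+ lv k|.
  have -> : (a b - a b') * lam ^+ k + (c b - c b') * lam' ^+ lv k =
     (a b - a b' + (c b - c b') * (lam' ^+ lv k / lam ^+ k)) * lam ^+ k by field; rewrite gt_eqF.
  by rewrite normrM (gtr0_norm lk) ler_pM2r.
set X := energy _ _ _ _ _ _ b _ _ in h1 *; set Y := energy _ _ _ _ _ _ b' _ _ in h2 *.
set x := a b * _ + _ in h1; set y := a b' * _ + _ in h2.
have -> : (a b - a b') * lam ^+ k + (c b - c b') * lam' ^+ lv k = (X - Y) - (X - x) + (Y - y) by rewrite /x /y; ring.
move=> h3; have := ler_normD ((X - Y) - (X - x)) (Y - y); have := ler_normB (X - Y) (X - x).
have := ler_norm A; lra.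
Qed.

End Independent.

(** * Nonvanishing for equal eigenvalues and multiplicatively independent points *)

Section Ties.
Variables (R : realType) (t : nat) (lam : R).
Hypotheses (lam1 : 1 < lam) (lamt : lam ^+ 2 + 1 = t%:R * lam) (t2 : (2 < t)%N).
Hypothesis lam_irr : forall x y : int, x%:~R * lam = y%:~R -> x = 0.
Local Notation C := R[i]%C.
Local Notation P := (pexp t).
Local Notation Q := (qexp t).
Local Notation wtz := (wtz lam).
Local Notation ellz := (ellz lam).
Local Notation tz := (tz t).

Definition dot (d : int * int) (k : nat) : int := d.1 * (P k)%:Z + d.2 * (Q k)%:Z.

Lemma dot_tz d k : dot (tz d) k = dot d k.+1.
Proof.
rewrite /dot /tz /= pexpS qexpS !PoszD !PoszM.
have -> : (t - 2)%N%:Z = t%:Z - 2 by lia.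
have -> : (t - 1)%N%:Z = t%:Z - 1 by lia.
ring.
Qed.

Lemma dotB a b k : dot (a.1 - b.1, a.2 - b.2) k = dot a k - dot b k.
Proof. by rewrite /dot /=; ring. Qed.

Lemma dot_rec d k : dot d k.+2 + dot d k = t%:Z * dot d k.+1.
Proof.
rewrite -!dot_tz /dot /tz /=; ring.
Qed.

Lemma wtz_eq0 d : wtz d = 0 -> d = (0, 0).
Proof.
move=> h; have lw : d.1%:~R * lam * (1 - lam^-1) + d.2%:~R * lam = 0.
  by rewrite -[RHS](mul0r lam) -h /wtz /wt mulrDl; congr (_ + _); rewrite mulrAC.
have l0 : lam != 0 by rewrite gt_eqF // (lt_trans ltr01).
have /(irr_eq0 lam_irr)[e1 e2] : (d.1 + d.2)%:~R * lam = d.1%:~R.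
  rewrite intrD mulrDl; move: lw; rewrite mulrBr mulr1 mulfK // => lw.
  by apply/eqP; rewrite -subr_eq0; apply/eqP; rewrite -lw; ring.
by case: d {h lw} e1 e2 => a b /= e1 e2; move: e1; rewrite e2 add0r => ->.
Qed.

Lemma dot_unbounded d : d != (0, 0) -> exists N, forall k, (N <= k)%N -> dot d k != 0.
Proof.
move=> d0.
have gen e : 0 < wtz e -> exists N, forall k, (N <= k)%N -> dot e k != 0.
  move=> w0; have [N hN] := exponent_growth lam1 lamt t2 w0.
  exists N.+1 => k hk; have := hN k (ltnW hk).
  have -> : e.1%:~R * (P k)%:R + e.2%:~R * (Q k)%:R = (dot e k)%:~R :> R by rewrite /dot intrD !intrM -!pmulrn.
  move=> h; apply/eqP => z; move: h; rewrite z lern0 muln_eq0 orbb => /eqP k0; by move: hk; rewrite k0.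
case: (ltrgtP 0 (wtz d)) => [|h|h]; first exact: gen.
  have [|N hN] := gen (- d.1, - d.2).
    by move: h; rewrite /wtz /wt /= !intrN; lra.
  exists N => k /hN; apply: contraNneq => z.
  suff -> : dot (- d.1, - d.2) k = - dot d k by rewrite z oppr0.
  by rewrite /dot /=; ring.
by case/eqP: d0; apply: wtz_eq0.
Qed.

Lemma normc_exprz (x : C) (z : int) : x != 0 -> normc (x ^ z) = expR (z%:~R * ln (normc x)).
Proof.
move=> x0; have n0 : 0 < normc x by rewrite normc_gt0.
have nat_case (m : nat) : normc (x ^+ m) = expR (m%:R * ln (normc x)).
  by rewrite normcX expRM_natl lnK.
case: z => m; first by rewrite -exprnP nat_case -pmulrn.
have -> : x ^ Negz m = (x ^+ m.+1)^-1 by [].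
by rewrite normc_inv ?expf_neq0 // nat_case -expRN NegzE intrN mulNr -pmulrn.
Qed.

Variables (g g' : C).
Hypotheses (g01 : 0 < normc g < 1) (g01' : 0 < normc g' < 1).
Hypothesis ind : forall x y, (0 < x)%N -> (0 < y)%N -> g ^+ x != g' ^+ y.

Let gn0 : g != 0. Proof. by case/andP: g01 => h _; rewrite -normc_gt0. Qed.
Let gn0' : g' != 0. Proof. by case/andP: g01' => h _; rewrite -normc_gt0. Qed.

(** Both moduli are below 1, so the exponents have opposite signs and the relation becomes an
    equality of positive powers. *)
Lemma no_int_relation (x y : int) : x != 0 -> g ^ x * g' ^ y != 1.
Proof.
have [_ h1] := andP g01; have [_ h1'] := andP g01'.
have [h0 _] := andP g01; have [h0' _] := andP g01'.
have l1 : ln (normc g) < 0 by rewrite ln_lt0 // h0.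
have l1' : ln (normc g') < 0 by rewrite ln_lt0 // h0'.
move=> x0; apply/eqP => e.
have : x%:~R * ln (normc g) + y%:~R * ln (normc g') = 0.
  by apply: expR_inj; rewrite expRD expR0 -!normc_exprz // -normcM e normc1.
have gen (a b : nat) : (0 < a)%N -> g ^+ a = g' ^+ b -> False.
  move=> a0; case: (posnP b) => [->|b0]; last by move/eqP; rewrite (negPf (ind a0 b0)).
  move/(congr1 (@normc R)); rewrite normcX expr0 normc1 => /eqP.
  by rewrite pexpr_eq1 ?(ltW h0) // lt_eqF.
case: x x0 e => [x|x] x0 e.
  have xp : (0 < x)%N by lia.
  case: y e => [y|y] e; last first.
    move=> _; apply: (gen x y.+1) => //.
    apply: (mulIf (_ : (g' ^+ y.+1)^-1 != 0)); first by rewrite invr_eq0 expf_neq0.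
    by rewrite mulfV ?expf_neq0.
  have : 0 < x%:R :> R by rewrite ltr0n.
  have : 0 <= y%:R :> R by [].
  rewrite -!pmulrn; move: (x%:R) (y%:R) => X Y; nra.
case: y e => [y|y] e; last first.
  have : 0 < x.+1%:R :> R by rewrite ltr0n.
  have : 0 < y.+1%:R :> R by rewrite ltr0n.
  by rewrite !NegzE !intrN -!pmulrn; move: (x.+1%:R) (y.+1%:R) => X Y; nra.
move=> _; apply: (gen x.+1 y) => //.
apply: (mulfI (_ : (g ^+ x.+1)^-1 != 0)); first by rewrite invr_eq0 expf_neq0.
by rewrite mulVf ?expf_neq0 //; apply: esym.
Qed.

(** The weight of the exponent governing the modulus of [mono_pair d d']: if positive, the sequence
    is tiny; if zero, it is bounded together with its inverse. *)
Definition slope_pair (d d' : int * int) : R := - ln (normc g) * wtz d - ln (normc g') * wtz d'.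
Definition mono_pair (d d' : int * int) k : C := g ^ dot d k * g' ^ dot d' k.

Lemma mono_pair_neq0 d d' k : mono_pair d d' k != 0.
Proof. by rewrite mulf_neq0 // expfz_neq0. Qed.

Lemma mono_pairB a b a' b' k :
  mono_pair a a' k = mono_pair b b' k * mono_pair (a.1 - b.1, a.2 - b.2) (a'.1 - b'.1, a'.2 - b'.2) k.
Proof.
have e (x : C) (m n : int) : x != 0 -> x ^ m = x ^ n * x ^ (m - n) by move=> x0; rewrite -expfzDr // addrC subrK.
by rewrite /mono_pair !dotB (e g (dot a k) (dot b k)) // (e g' (dot a' k) (dot b' k)) //; ring.
Qed.

Lemma normc_mono_pair d d' k : normc (mono_pair d d' k) =
  expR (- ((- ln (normc g) * d.1%:~R - ln (normc g') * d'.1%:~R) * (P k)%:R +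
          (- ln (normc g) * d.2%:~R - ln (normc g') * d'.2%:~R) * (Q k)%:R)).
Proof.
rewrite /mono_pair normcM !normc_exprz // -expRD; congr expR.
by rewrite /dot !intrD !intrM -!pmulrn; ring.
Qed.

Lemma slope_wt d d' : slope_pair d d' =
  wt lam (- ln (normc g) * d.1%:~R - ln (normc g') * d'.1%:~R) (- ln (normc g) * d.2%:~R - ln (normc g') * d'.2%:~R).
Proof. by rewrite /slope_pair /wtz /wt; ring. Qed.

Lemma mono_pair_tiny d d' : 0 < slope_pair d d' -> tiny (mono_pair d d').
Proof.
rewrite slope_wt => h; have [N hN] := exponent_growth lam1 lamt t2 h.
apply: (@tiny_square R (expR (-1)) 1).
  by rewrite expR_ge0 /= -[ltRHS]expR0 ltr_expR; lra.
exists N => k /hN hk; rewrite mul1r normc_mono_pair -expRM_natl ler_expR mulrN1 lerN2.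
exact: hk.
Qed.

Lemma mono_pair_bounded d d' : slope_pair d d' = 0 ->
  exists2 B, 1 <= B & forall k, normc (mono_pair d d' k) <= B /\ normc (mono_pair d d' k)^-1 <= B.
Proof.
rewrite slope_wt => h; have b0 := lamB_gt0 lam1; have [u0 u1] := andP (lamV_lt1 lam1).
set i1 := - ln (normc g) * d.1%:~R - _ in h *; set j1 := _ - _ * d'.2%:~R in h *.
exists (expR (`|ell lam i1 j1| / (lam - lam^-1))).
  by rewrite -expR0 ler_expR divr_ge0 // ltW.
move=> k; have e : (i1 * (P k)%:R + j1 * (Q k)%:R) = ell lam i1 j1 * lam^-1 ^+ k.+1 / (lam - lam^-1).
  by have := pqE lam1 lamt t2 k i1 j1; rewrite h mul0r add0r => <-; rewrite [_ * (_ + _)]mulrC mulfK // gt_eqF.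
rewrite normc_inv ?mono_pair_neq0 // normc_mono_pair -/i1 -/j1 e -expRN !ler_expR opprK.
have bd : `|ell lam i1 j1 * lam^-1 ^+ k.+1 / (lam - lam^-1)| <= `|ell lam i1 j1| / (lam - lam^-1).
  rewrite normrM [X in _ * X]ger0_norm ?invr_ge0 ?(ltW b0) // ler_pM2r ?invr_gt0 // normrM ler_piMr //.
  by rewrite ger0_norm ?exprn_ge0 ?(ltW u0) // exprn_ile1 // ltW.
by move: bd; rewrite ler_norml => /andP[]; split; lra.
Qed.

Lemma tiny_ev_eq c c' N : (forall k, (N <= k)%N -> c k = c' k) -> tiny c -> @tiny R c'.
Proof.
move=> h tc; apply: tiny_ev => A; have [M hM] := tc A.
by exists M, N => k /h <-.
Qed.

Lemma tiny_sum (I : finType) (c : I -> nat -> C) : (forall b, tiny (c b)) -> tiny (fun k => \sum_b c b k).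
Proof.
move=> h; have : forall l : seq I, tiny (fun k => \sum_(b <- l) c b k); last by move=> /(_ (index_enum I)).
elim=> [|b l IH].
  by move=> A; exists 0 => k; rewrite big_nil normc0 mul0r.
by apply: tiny_eq (tinyD (h b) IH) => k; rewrite big_cons.
Qed.

Lemma tiny_bounded c : @tiny R c -> exists B, forall k, normc (c k) <= B.
Proof. by move=> /(_ 1%N)[B hB]; exists B => k; have := hB k; rewrite expr1n mulr1. Qed.

Lemma int_root (x : C) (h : int) : x != 0 -> h != 0 -> exists2 r, r != 0 & r ^ h = x.
Proof.
move=> x0 h0.
have gen (y : C) n : y != 0 -> (0 < n)%N -> exists2 r, r != 0 & r ^+ n = y.
  move=> y0 n0; exists (n.-root y); last exact: rootCK.
  by rewrite rootC_eq0.
case: h h0 => [n|n] h0; first by apply: gen; rewrite // lt0n.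
have [||r r0 hr] := gen x^-1 n.+1; rewrite ?invr_eq0 //.
by exists r => //; rewrite -[RHS]invrK -hr.
Qed.

Lemma dot_lin (x z : int) a b e k : e.1 = x * a.1 + z * b.1 -> e.2 = x * a.2 + z * b.2 ->
  dot e k = x * dot a k + z * dot b k.
Proof. by move=> e1 e2; rewrite /dot e1 e2; ring. Qed.

Lemma wtz_lin (x z : int) a b e : e.1 = x * a.1 + z * b.1 -> e.2 = x * a.2 + z * b.2 ->
  wtz e = x%:~R * wtz a + z%:~R * wtz b.
Proof. by move=> e1 e2; rewrite /wtz /wt e1 e2 !intrD !intrM; ring. Qed.

Lemma wtz_comb (h x z : int) a b e :
  wtz (h * a.1 - x * b.1 - z * e.1, h * a.2 - x * b.2 - z * e.2) = h%:~R * wtz a - x%:~R * wtz b - z%:~R * wtz e.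
Proof. by rewrite /wtz /wt /= !intrB !intrM; ring. Qed.

(** Neither eigenform of [tz] vanishes on a nonzero integral vector, so d and tz d are linearly
    independent. *)
Lemma cross_tz_neq0 d : d != (0, 0) -> d.1 * (tz d).2 - d.2 * (tz d).1 != 0.
Proof.
move=> d0; apply/eqP => h.
have l0 : lam != 0 by rewrite gt_eqF // (lt_trans ltr01).
have e : wtz d * ellz (tz d) - ellz d * wtz (tz d) = - (lam - lam^-1) * (d.1 * (tz d).2 - d.2 * (tz d).1)%:~R.
  by rewrite /wtz /ellz /wt /ell intrB !intrM; ring.
move: e; rewrite h mulr0 wtz_tz // ellz_tz //.
have -> : wtz d * (lam^-1 * ellz d) - ellz d * (lam * wtz d) = - (lam - lam^-1) * (wtz d * ellz d) by ring.
have b0 := lamB_gt0 lam1.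
move/eqP; rewrite mulf_eq0 oppr_eq0 (gt_eqF b0) /= mulf_eq0 => /orP[] /eqP.
  by move/wtz_eq0 => e; rewrite e eqxx in d0.
by move/(ellz_eq0 lam_irr) => e; rewrite e eqxx in d0.
Qed.

Lemma root_le (x B : R) n : 0 <= x -> (0 < n)%N -> 1 <= B -> x ^+ n <= B -> x <= B.
Proof.
move=> x0 n0 B1 h; rewrite leNgt; apply/negP => Bx.
have x1 : 1 <= x by lra.
have : x <= x ^+ n by rewrite -{1}(expr1 x) ler_weXn2l.
lra.
Qed.

Lemma expfzK_exp (u : C) (m : nat) (x : int) (N : nat) : u != 0 -> m%:Z = x + N%:Z -> u ^ x * u ^+ N = u ^+ m.
Proof. by move=> u0 e; rewrite [in RHS]exprnP e expfzDr. Qed.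

Lemma expz_dot_rec (x : C) d k : x != 0 -> x ^ dot d k.+2 * x ^ dot d k = (x ^ dot d k.+1) ^+ t.
Proof. by move=> x0; rewrite -expfzDr // dot_rec mulrC exprnP exprz_exp. Qed.

Section TiedGroup.
(* All tied monomials are, up to a common root, monomials in two consecutive values of one sequence. *)
Variables (d d' : int * int).
Hypotheses (d0 : d != (0, 0)) (dd : slope_pair d d' = 0).

(** Cramer's rule gives x and z from e alone. For e' the defect has weight zero, because slope zero
    ties the weight of e' to that of e; an integral vector of weight zero is zero. *)
Lemma tied_coordinates e e' : slope_pair e e' = 0 ->
  let h := d.1 * (tz d).2 - d.2 * (tz d).1 in
  exists x z : int, [/\ h * e.1 = x * d.1 + z * (tz d).1, h * e.2 = x * d.2 + z * (tz d).2,
    h * e'.1 = x * d'.1 + z * (tz d').1 & h * e'.2 = x * d'.2 + z * (tz d').2].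
Proof.
move=> ee h; exists (e.1 * (tz d).2 - e.2 * (tz d).1), (d.1 * e.2 - d.2 * e.1).
set x := e.1 * _ - _; set z := d.1 * e.2 - _.
have h1 : h * e.1 = x * d.1 + z * (tz d).1 by rewrite /h /x /z; ring.
have h2 : h * e.2 = x * d.2 + z * (tz d).2 by rewrite /h /x /z; ring.
pose f : int * int := (h * e'.1 - x * d'.1 - z * (tz d').1, h * e'.2 - x * d'.2 - z * (tz d').2).
suff [f1 f2] : f = (0, 0).
  by split=> //; apply/eqP; rewrite -subr_eq0 opprD addrA; apply/eqP.
apply: wtz_eq0.
have [h0 h1'] := andP g01'; have l' : - ln (normc g') != 0 by rewrite oppr_eq0 lt_eqF // ln_lt0 // h0.
apply: (mulfI l'); rewrite mulr0.
have wf : wtz f = h%:~R * wtz e' - x%:~R * wtz d' - z%:~R * (lam * wtz d').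
  by rewrite -(@wtz_tz R t) // -wtz_comb.
have we : h%:~R * wtz e = x%:~R * wtz d + z%:~R * (lam * wtz d).
  rewrite -(@wtz_tz R t) // -(wtz_lin (e := (h * e.1, h * e.2)) h1 h2) /wtz /wt /= !intrM; ring.
move: ee dd; rewrite /slope_pair wf => ee dd'.
have ee' : - ln (normc g') * wtz e' = ln (normc g) * wtz e by lra.
have dd2 : - ln (normc g') * wtz d' = ln (normc g) * wtz d by lra.
have -> : - ln (normc g') * (h%:~R * wtz e' - x%:~R * wtz d' - z%:~R * (lam * wtz d')) =
   h%:~R * (- ln (normc g') * wtz e') - (x%:~R + z%:~R * lam) * (- ln (normc g') * wtz d') by ring.
rewrite ee' dd2.
have -> : h%:~R * (ln (normc g) * wtz e) - (x%:~R + z%:~R * lam) * (ln (normc g) * wtz d) =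
  ln (normc g) * (h%:~R * wtz e - (x%:~R * wtz d + z%:~R * (lam * wtz d))) by ring.
by rewrite we subrr mulr0.
Qed.

(** With r^h = g and r'^h = g', tied monomials become Laurent monomials in y_k and y_(k+1), distinct
    for distinct e. A tiny combination is then a polynomial relation for y; torsion of y would give
    a multiplicative relation between g and g'. *)
Lemma no_tied_relation (I : finType) (e e' : I -> int * int) (c : I -> C) (b0 : I) :
  injective e -> (forall b, slope_pair (e b) (e' b) = 0) -> c b0 != 0 ->
  ~ tiny (fun k => \sum_b c b * mono_pair (e b) (e' b) k).
Proof.
move=> e_inj ee c0 tF.
pose h := d.1 * (tz d).2 - d.2 * (tz d).1; have h0 : h != 0 := cross_tz_neq0 d0.
have [r r0 rh] := int_root gn0 h0; have [r' r0' rh'] := int_root gn0' h0.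
pose y k := r ^ dot d k * r' ^ dot d' k.
have y0 k : y k != 0 by rewrite mulf_neq0 // expfz_neq0.
have yh k : y k ^ h = mono_pair d d' k.
  by rewrite /y expfzMl exprzAC rh exprzAC rh'.
have [B B1 hB] := mono_pair_bounded dd.
have [yB yVB] : (forall k, normc (y k) <= B) /\ (forall k, normc (y k)^-1 <= B).
  have aux k : normc (y k ^ h) <= B /\ normc (y k ^ h)^-1 <= B by rewrite yh.
  move: h h0 {rh rh' yh} aux => [n|n] h0 aux.
    have n0 : (0 < n)%N by rewrite lt0n.
    split=> k; have [a1 a2] := aux k; apply: (root_le (normc_ge0 _) n0 B1).
      by move: a1; rewrite -exprnP normcX.
    by move: a2; rewrite -exprnP -exprVn normcX.
  split=> k; have [a1 a2] := aux k; apply: (root_le (normc_ge0 _) (ltn0Sn n) B1).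
    by move: a2; rewrite (_ : y k ^ Negz n = (y k ^+ n.+1)^-1) // invrK normcX.
  by move: a1; rewrite (_ : y k ^ Negz n = (y k ^+ n.+1)^-1) // -exprVn normcX.
have y_rec k : y k.+2 * y k = y k.+1 ^+ t.
  by rewrite /y mulrACA (expz_dot_rec d k r0) (expz_dot_rec d' k r0') exprMn.
have [x hx] := fin_all_exists (fun b => tied_coordinates (ee b)).
have [z hz] := fin_all_exists hx.
have mE b k : mono_pair (e b) (e' b) k = y k ^ x b * y k.+1 ^ z b.
  have [e1 e2 e3 e4] := hz b.
  rewrite /mono_pair -[in LHS]rh -[in LHS]rh' !exprz_exp.
  have -> : h * dot (e b) k = x b * dot d k + z b * dot (tz d) k.
    by rewrite -(dot_lin (e := (h * (e b).1, h * (e b).2)) k e1 e2) /dot /=; ring.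
  have -> : h * dot (e' b) k = x b * dot d' k + z b * dot (tz d') k.
    by rewrite -(dot_lin (e := (h * (e' b).1, h * (e' b).2)) k e3 e4) /dot /=; ring.
  rewrite !dot_tz !expfzDr // /y !expfzMl !exprz_exp ![_ * x b]mulrC ![_ * z b]mulrC; ring.
(* Multiplying by the N-th power of y_k y_(k+1) clears the negative exponents. *)
pose N := (\sum_b (`|x b| + `|z b|))%N.
have Nb b : (`|x b| + `|z b| <= N)%N by rewrite /N (bigD1 b) //= leq_addr.
pose ex b := absz (x b + N%:Z); pose ez b := absz (z b + N%:Z).
have exE b : (ex b)%:Z = x b + N%:Z by rewrite /ex; have := Nb b; clear; lia.
have ezE b : (ez b)%:Z = z b + N%:Z by rewrite /ez; have := Nb b; clear; lia.
pose p : {poly {poly C}} := \sum_b (c b)%:P%:P * ('X^(ez b) * ('X^(ex b))%:P).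
have pE k : p.[y k.+1, y k] = (y k.+1 * y k) ^+ N * \sum_b c b * mono_pair (e b) (e' b) k.
  rewrite /p !horner_sum mulr_sumr; apply: eq_bigr => b _.
  rewrite !(hornerM, hornerC, hornerXn, horner_exp) mE; move: (y0 k) (y0 k.+1); move: (y k) (y k.+1) => u v u0 v0.
  rewrite exprMn -(expfzK_exp u0 (exE b)) -(expfzK_exp v0 (ezE b)).
  by move: (u ^ x b) (v ^ z b) (u ^+ N) (v ^+ N) => a1 a2 a3 a4; ring.
have p0 : p != 0.
  apply/eqP => /(congr1 (fun q : {poly {poly C}} => q`_(ez b0)`_(ex b0))).
  rewrite !coef0 coef_sum coef_sum (bigD1 b0) //= big1 ?addr0 => [|b bb0].
    rewrite coefCM coefMC coefXn eqxx coefCM mul1r coefXn eqxx mulr1 => /eqP.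
    by rewrite (negPf c0).
  rewrite coefCM coefMC coefXn coefCM; case: eqP => [e2|_]; last by rewrite mul0r coef0 mulr0.
  rewrite mul1r coefXn; case: eqP => [e3|_]; last by rewrite mulr0.
  case/eqP: bb0; apply: e_inj.
  have ex1 : x b = x b0 by have := exE b; have := exE b0; rewrite e3; clear; lia.
  have ez1 : z b = z b0 by have := ezE b; have := ezE b0; rewrite e2; clear; lia.
  have [e11 e12 _ _] := hz b; have [e21 e22 _ _] := hz b0.
  rewrite ex1 ez1 -e21 in e11; rewrite ex1 ez1 -e22 in e12.
  by rewrite (surjective_pairing (e b)) (mulfI h0 e11) (mulfI h0 e12) -surjective_pairing.
have Jp : J y p.
  apply: (@tiny_eq _ (fun k => (y k.+1 * y k) ^+ N * \sum_b c b * mono_pair (e b) (e' b) k)).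
    by move=> k; rewrite pE.
  apply: (@tinyM _ _ _ ((B * B) ^+ N)) => // k.
  by rewrite normcX normcM lerXn2r ?nnegrE ?mulr_ge0 ?normc_ge0 ?(le_trans ler01 B1) // ler_pM ?normc_ge0.
have [M [k0 [M0 tor]]] := torsion lam1 lamt t2 lam_irr y0 yB yVB y_rec p0 Jp.
have [k1 hk1] := dot_unbounded d0.
pose k := maxn k0 k1.
have k0k : (k0 <= k)%N by rewrite leq_maxl.
have k1k : (k1 <= k)%N by rewrite leq_maxr.
have e1 : mono_pair d d' k ^+ M = 1 by rewrite -yh exprnP exprzAC -exprnP tor // exp1rz.
have nz : dot d k * M%:Z != 0 by rewrite mulf_neq0 ?hk1 // eqz_nat -lt0n.
have := no_int_relation (dot d' k * M%:Z) nz.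
by rewrite -!exprz_exp -expfzMl -exprnP -/(mono_pair d d' k) e1 eqxx.
Qed.

End TiedGroup.

(** After division by a term of least slope, tied terms are bounded and all others tiny. A second
    tied term provides the direction needed by [no_tied_relation]; without one, a nonzero constant
    would be tiny. *)
Lemma dependent_nonvanishing n (phi psi : 'I_n.+1 -> nat -> C) v v' : injective v ->
  (forall b, asymptotic t g (phi b) (v b)) -> (forall b, asymptotic t g' (psi b) (v' b)) ->
  forall k0, exists2 k, (k0 <= k)%N & \sum_b phi b k * psi b k != 0.
Proof.
move=> v_inj ha ha' k0; apply: contrapT => no.
have Z k : (k0 <= k)%N -> \sum_b phi b k * psi b k = 0.
  by move=> hk; apply/eqP; apply: contraT => h; case: no; exists k.
pose vz b : int * int := ((v b).1%:Z, (v b).2%:Z); pose vz' b : int * int := ((v' b).1%:Z, (v' b).2%:Z).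
have zm (x : C) u k : x != 0 -> zx t x k ^+ u.1 * zy t x k ^+ u.2 = x ^ dot (u.1%:Z, u.2%:Z) k.
  by move=> x0; rewrite /dot /= -!PoszM -PoszD -exprnP exprD ![(_ * P _)%N]mulnC ![(_ * Q _)%N]mulnC !exprM.
pose W b := slope_pair (vz b) (vz' b).
have [b0 _ Wmin] := @arg_minP _ R 'I_n.+1 ord0 xpredT W isT.
pose e b : int * int := ((vz b).1 - (vz b0).1, (vz b).2 - (vz b0).2).
pose e' b : int * int := ((vz' b).1 - (vz' b0).1, (vz' b).2 - (vz' b0).2).
have We b : slope_pair (e b) (e' b) = W b - W b0.
  by rewrite /W /slope_pair /wtz /wt /e /e' /= !intrB; ring.
have mE b k : mono_pair (vz b) (vz' b) k = mono_pair (vz b0) (vz' b0) k * mono_pair (e b) (e' b) k.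
  exact: mono_pairB.
have term b : exists x : C * (nat -> C), [/\ x.1 != 0, tiny x.2 & exists N, forall k, (N <= k)%N ->
    phi b k * psi b k = mono_pair (vz b) (vz' b) k * (x.1 + x.2 k)].
  have [D [eta [D0 te [N hN]]]] := ha b; have [D' [eta' [D0' te' [N' hN']]]] := ha' b.
  exists (D * D', fun k => D * eta' k + (D' * eta k + eta k * eta' k)); split=> /=.
  - by rewrite mulf_neq0.
  - have [B hB] := tiny_bounded te.
    by apply: tinyD; [|apply: tinyD]; [apply: (@tinyM _ _ _ (normc D))|apply: (@tinyM _ _ _ (normc D'))|apply: tinyM hB _].
  - exists (maxn N N') => k; rewrite geq_max => /andP[/hN -> /hN' ->].
    by rewrite !zm // /mono_pair -/(vz b) -/(vz' b); ring.
have [x hx] := fin_all_exists term.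
have [N hN] : exists N, forall b k, (N <= k)%N -> phi b k * psi b k = mono_pair (vz b) (vz' b) k * ((x b).1 + (x b).2 k).
  have h b : exists N, forall k, (N <= k)%N -> phi b k * psi b k = mono_pair (vz b) (vz' b) k * ((x b).1 + (x b).2 k).
    by case: (hx b).
  have [N hN] := fin_all_exists h; exists (\max_b N b) => b k hk.
  by apply: hN; apply: leq_trans hk; apply: leq_bigmax.
have Z2 k : (maxn k0 N <= k)%N -> \sum_b mono_pair (e b) (e' b) k * ((x b).1 + (x b).2 k) = 0.
  rewrite geq_max => /andP[h1 h2].
  apply: (mulfI (mono_pair_neq0 (vz b0) (vz' b0) k)); rewrite mulr0 -[RHS](Z k h1) mulr_sumr.
  by apply: eq_bigr => b _; rewrite (hN b) // (mE b) mulrA.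
pose G := [pred b | W b == W b0].
have tF : tiny (fun k => \sum_b (if G b then (x b).1 * mono_pair (e b) (e' b) k else 0)).
  pose r b k := if G b then - (mono_pair (e b) (e' b) k * (x b).2 k) else - (((x b).1 + (x b).2 k) * mono_pair (e b) (e' b) k).
  apply: (@tiny_ev_eq (fun k => \sum_b r b k) _ (maxn k0 N)).
    move=> k /Z2 z2; apply/eqP; rewrite -subr_eq0 -oppr_eq0 -[X in _ == X]z2 -sumrB -sumrN; apply/eqP.
    by apply: eq_bigr => b _; rewrite /r; case: ifP => _; ring.
  apply: tiny_sum => b; have [_ tx _] := hx b; rewrite /r.
  case: (boolP (G b)) => [Gb|Gb].
    have [|B _ hB] := @mono_pair_bounded (e b) (e' b); first by rewrite We (eqP Gb) subrr.
    apply: (@tiny_eq _ (fun k => (- mono_pair (e b) (e' b) k) * (x b).2 k)); first by move=> k; rewrite mulNr.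
    by apply: (@tinyM _ _ _ B) => // k; rewrite normcN; case: (hB k).
  have [B hB] := tiny_bounded tx.
  apply: (@tiny_eq _ (fun k => (- ((x b).1 + (x b).2 k)) * mono_pair (e b) (e' b) k)); first by move=> k; rewrite mulNr.
  apply: (@tinyM _ _ _ (normc (x b).1 + B)) => [k|].
    by rewrite normcN; apply: le_trans (ler_normcD _ _) _; rewrite lerD2l.
  apply: mono_pair_tiny; rewrite We subr_gt0 lt_neqAle Wmin // andbT eq_sym; exact: Gb.
have e_inj b b' : e b = e b' -> b = b'.
  rewrite /e /vz /= => -[h1 h2]; apply: v_inj.
  case: (v b) (v b') (v b0) h1 h2 => [a1 a2] [c1 c2] [f1 f2] /= h1 h2.
  by congr (_, _); clear -h1 h2; lia.
case: (pselect (exists b1, G b1 /\ b1 <> b0)) => [[b1 [Gb1 b10]]|single].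
  have d0 : e b1 != (0, 0).
    apply/eqP => h; apply: b10; apply: e_inj; rewrite h /e; congr (_, _); ring.
  have dd : slope_pair (e b1) (e' b1) = 0 by rewrite We (eqP Gb1) subrr.
  pose I : finType := {b | b \in G}.
  have Gb0 : G b0 by apply/eqP.
  apply: (@no_tied_relation _ _ d0 dd I (fun b => e (val b)) (fun b => e' (val b)) (fun b => (x (val b)).1) (exist _ b0 Gb0)).
  - by move=> b b' /e_inj /val_inj.
  - by move=> b; rewrite We (eqP (valP b)) subrr.
  - by case: (hx b0).
  apply: tiny_eq tF => k; rewrite -big_mkcond /=.
  exact: (big_sub G (fun i => (x i).1 * mono_pair (e i) (e' i) k)).
have : tiny (fun=> (x b0).1).
  apply: tiny_eq tF => k; rewrite (bigD1 b0) //= eqxx big1 ?addr0 => [|b bb0].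
    have -> : e b0 = (0, 0) by rewrite /e !subrr.
    have -> : e' b0 = (0, 0) by rewrite /e' !subrr.
    by rewrite /mono_pair /dot /= !mul0r addr0 !expr0z !mulr1.
  case: ifP => // Gb; case: single; exists b; split=> //; exact/eqP.
have [x0 _ _] := hx b0; have n0 : 0 < normc (x b0).1 by rewrite normc_gt0.
by move=> /tiny_small /(_ n0)[k /(_ k (leqnn k))]; rewrite ltxx.
Qed.

End Ties.

(** * Independence of the two values *)

Section TwoSystems.
Variables (R : realType) (K : fieldExtType rat) (i : {rmorphism K -> R[i]%C}) (n : nat).
Variables (w w' : R) (S : pell w) (S' : pell w') (g ze g' ze' : K) (m e m' e' : nat) (xi xi' : R[i]%C).
Variables (kap kap' L : nat -> nat) (c : nat) (z : nat -> 'I_n -> K) (lx ly lx' ly' : 'I_n).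
Hypothesis w_irr : forall x y : int, x%:~R * w = y%:~R -> x = 0.
Hypothesis w_irr' : forall x y : int, x%:~R * w' = y%:~R -> x = 0.
Hypotheses (g0 : 0 < normc (i g)) (g1 : normc (i g) < 1) (m0 : (0 < m)%N) (e0 : (0 < e)%N) (zee : ze ^+ e = 1).
Hypotheses (g0' : 0 < normc (i g')) (g1' : normc (i g') < 1) (m0' : (0 < m')%N) (e0' : (0 < e')%N) (zee' : ze' ^+ e' = 1).
Hypothesis cong : exists x y : int, a00 S = 1 + e%:Z * x /\ a01 S = e%:Z * y.
Hypothesis cong' : exists x y : int, a00 S' = 1 + e'%:Z * x /\ a01 S' = e'%:Z * y.
Hypothesis xi_sums : sums (fun n => (Num.floor (n%:R * w))%:~R) (i (ze * g ^+ m)) xi.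
Hypothesis xi_sums' : sums (fun n => (Num.floor (n%:R * w'))%:~R) (i (ze' * g' ^+ m')) xi'.
Hypotheses (LP : forall k, (L k <= pexp (ptr S) (kap k))%N) (PL : forall k, (pexp (ptr S) (kap k) <= c * L k)%N).
Hypotheses (LP' : forall k, (L k <= pexp (ptr S') (kap' k))%N) (PL' : forall k, (pexp (ptr S') (kap' k) <= c * L k)%N).
Hypothesis L_unbounded : forall M, exists k0, forall k, (k0 <= k)%N -> (M <= L k)%N.
Hypotheses (z_lx : forall k, z k lx = g ^+ pexp (ptr S) (kap k)) (z_ly : forall k, z k ly = g ^+ qexp (ptr S) (kap k)).
Hypotheses (z_lx' : forall k, z k lx' = g' ^+ pexp (ptr S') (kap' k)) (z_ly' : forall k, z k ly' = g' ^+ qexp (ptr S') (kap' k)).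
Hypothesis cover : forall l, l \in [:: lx; ly; lx'; ly'].
Local Notation s1 := (slope_value S g ze m kap).
Local Notation s2 := (slope_value S' g' ze' m' kap').
Hypothesis nonvanishing : forall p (a : box n p -> K), (exists t, a t != 0) ->
  forall k0, exists2 k, (k0 <= k)%N & box_value z s1 s2 a k != 0.

Let q := Num.max (normc (i g)) (normc (i g')).
Let q0 : 0 < q. Proof. by rewrite lt_max g0. Qed.
Let q1 : q < 1. Proof. by rewrite gt_max g1. Qed.
Let gq : normc (i g) <= q. Proof. by rewrite le_max lexx. Qed.
Let gq' : normc (i g') <= q. Proof. by rewrite le_max lexx orbT. Qed.

(** Both series enter with q the larger of the two moduli and L a common scale for their
    exponents. *)
Lemma core_independence (P : {poly {poly K}}) : P != 0 -> (map_poly (map_poly i) P).[xi, xi'] != 0.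
Proof.
have small (h : K) (x : nat) k : normc (i h) <= q -> normc (i h) < 1 -> (L k <= x)%N -> normc (i (h ^+ x)) <= q ^+ L k.
  move=> hq h1 hx; rewrite rmorphXn normcX.
  apply: (@le_trans _ _ (normc (i h) ^+ L k)); first by rewrite ler_wiXn2l ?normc_ge0 // ltW.
  by rewrite lerXn2r ?nnegrE ?normc_ge0 ?(ltW q0).
have PQ s k : (2 < s)%N -> (pexp s k <= qexp s k)%N by move=> s2'; case: (pq_ge k s2').
apply: (mahler_independence (z := z) (s1 := s1) (s2 := s2) (L := L) q0 q1 L_unbounded).
- move=> k l; have := cover l; rewrite !inE => /or4P[] /eqP ->.
  + by rewrite z_lx small.
  + by rewrite z_ly small //; apply: leq_trans (LP k) (PQ _ _ (ptr_gt2 S)).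
  + by rewrite z_lx' small.
  + by rewrite z_ly' small //; apply: leq_trans (LP' k) (PQ _ _ (ptr_gt2 S')).
- exact: (expand_one w_irr g0 g1 m0 e0 zee cong xi_sums q1 gq LP z_lx z_ly).
- exact: (expand_one w_irr' g0' g1' m0' e0' zee' cong' xi_sums' q1 gq' LP' z_lx' z_ly').
- apply: (box_lower_bound i q0 q1).
  have [B B1 hB] := ht_one g0 g1 m0 e0 zee q1 gq PL z_lx z_ly.
  have [B' B1' hB'] := ht_one g0' g1' m0' e0' zee' q1 gq' PL' z_lx' z_ly'.
  have B0 : 0 < B by apply: lt_le_trans B1.
  have B0' : 0 < B' by apply: lt_le_trans B1'.
  exists (Num.max B B'); first by rewrite le_max B1.
  move=> k; have [h1 h2 h3] := hB k; have [h1' h2' h3'] := hB' k.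
  have M1 : B ^+ L k <= Num.max B B' ^+ L k by rewrite lerXn2r ?nnegrE ?(ltW B0) // le_max ?lexx ?(ltW B0) ?orbT.
  have M2 : B' ^+ L k <= Num.max B B' ^+ L k by rewrite lerXn2r ?nnegrE ?(ltW B0') // le_max ?lexx ?(ltW B0') ?orbT.
  split; [exact: ht_le M1 h1|exact: ht_le M2 h1'|].
  move=> l; have := cover l; rewrite !inE => /or4P[] /eqP ->.
  + exact: ht_le M1 h2.
  + exact: ht_le M1 h3.
  + exact: ht_le M2 h2'.
  + exact: ht_le M2 h3'.
- exact: nonvanishing.
Qed.

End TwoSystems.

Section FourVariables.
Variables (R : realType) (K : fieldExtType rat) (i : {rmorphism K -> R[i]%C}).
Variables (w w' : R) (S : pell w) (S' : pell w') (al al' : K) (xi xi' : R[i]%C).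
Variables (kap kap' L : nat -> nat) (c : nat).
Hypothesis w_irr : forall x y : int, x%:~R * w = y%:~R -> x = 0.
Hypothesis w_irr' : forall x y : int, x%:~R * w' = y%:~R -> x = 0.
Hypotheses (al01 : 0 < normc (i al) < 1) (al01' : 0 < normc (i al') < 1).
Hypothesis xi_sums : sums (fun n => (Num.floor (n%:R * w))%:~R) (i al) xi.
Hypothesis xi_sums' : sums (fun n => (Num.floor (n%:R * w'))%:~R) (i al') xi'.
Hypotheses (LP : forall k, (L k <= pexp (ptr S) (kap k))%N) (PL : forall k, (pexp (ptr S) (kap k) <= c * L k)%N).
Hypotheses (LP' : forall k, (L k <= pexp (ptr S') (kap' k))%N) (PL' : forall k, (pexp (ptr S') (kap' k) <= c * L k)%N).
Hypothesis L_unbounded : forall M, exists k0, forall k, (k0 <= k)%N -> (M <= L k)%N.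
Hypothesis nonv : forall n (phi psi : 'I_n.+1 -> nat -> R[i]%C) v v', injective v ->
  (forall b, asymptotic (ptr S) (i al) (phi b) (v b)) -> (forall b, asymptotic (ptr S') (i al') (psi b) (v' b)) ->
  forall k0, exists2 k, (k0 <= k)%N & \sum_b phi b (kap k) * psi b (kap' k) != 0.

Let z k (l : 'I_4) : K := nth 0 [:: al ^+ pexp (ptr S) (kap k); al ^+ qexp (ptr S) (kap k);
  al' ^+ pexp (ptr S') (kap' k); al' ^+ qexp (ptr S') (kap' k)] l.
Let o0 : 'I_4 := @Ordinal 4 0 isT.
Let o1 : 'I_4 := @Ordinal 4 1 isT.
Let o2 : 'I_4 := @Ordinal 4 2 isT.
Let o3 : 'I_4 := @Ordinal 4 3 isT.

(** Four variables keep the monomials of the two points apart. The exponents of a box split into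
    those of either series, and [normal_form] reduces nonvanishing to the hypothesis [nonv]. *)
Lemma four_independence (P : {poly {poly K}}) : P != 0 -> (map_poly (map_poly i) P).[xi, xi'] != 0.
Proof.
have [a0 a1] := andP al01; have [a0' a1'] := andP al01'.
have alE (x : K) : 1 * x ^+ 1 = x by rewrite mul1r.
have cong1 (w0 : R) (S0 : pell w0) : exists x y : int, a00 S0 = 1 + 1%N%:Z * x /\ a01 S0 = 1%N%:Z * y.
  by exists (a00 S0 - 1), (a01 S0); split; ring.
apply: (@core_independence R K i 4 w w' S S' al 1 al' 1 1 1 1 1 xi xi' kap kap' L c z
  o0 o1 o2 o3) => //; rewrite ?alE ?expr1n //.
  by move=> l; rewrite !inE; case: l => [[|[|[|[|]]]]].
move=> p a [t0 at0] k0.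
pose T := ('I_p * ('I_p * 'I_p))%type.
pose mk (u : T * T) : box 4 p :=
  ([ffun l : 'I_4 => nth u.1.2.1 [:: u.1.2.1; u.1.2.2; u.2.2.1; u.2.2.2] l], (u.1.1, u.2.1)).
pose km (t : box 4 p) : T * T := ((t.2.1, (t.1 o0, t.1 o1)),
  (t.2.2, (t.1 o2, t.1 o3))).
have mkK : cancel mk km by case=> [[x [x1 x2]] [y [y1 y2]]]; rewrite /km /mk /= !ffunE.
have kmK : cancel km mk.
  case=> [f [x y]]; rewrite /km /mk /=; congr (_, _); apply/ffunP => l; rewrite ffunE /=.
  by case: l => [[|[|[|[|//]]]] h] /=; congr (f _); apply: val_inj.
pose b (u u' : T) : R[i]%C := i (a (mk (u, u'))).
have nzb : exists u u', b u u' != 0.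
  by exists (km t0).1, (km t0).2; rewrite /b -surjective_pairing kmK fmorph_eq0.
have [n [phi [psi [v [v' [v_inj ha ha' eq]]]]]] := normal_form S S' w_irr w_irr' al01 al01' xi_sums xi_sums' nzb.
have [k hk nz] := nonv v_inj ha ha' k0; exists k => //.
rewrite -(fmorph_eq0 i); move: nz; rewrite -eq; apply: contraNneq => e0; apply/eqP.
rewrite -[RHS]e0 /box_value rmorph_sum (reindex mk) /=; last by exists km => x _; [apply: mkK|apply: kmK].
rewrite pair_bigA /=; apply: eq_bigr => -[[x [x1 x2]] [y [y1 y2]]] _.
rewrite rmorphM /= -/(b _ _) /box_fun /sk /slope_value /zx /zy !alE /=; congr (_ * _).
rewrite !big_ord_recl big_ord0 /mk /= !ffunE /= /z /= !rmorphM ?rmorphXn !rmorph_fr ?rmorph1 /=; ring.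
Qed.

End FourVariables.

Section TwoVariables.
Variables (R : realType) (K : fieldExtType rat) (i : {rmorphism K -> R[i]%C}).
Variables (w w' : R) (S : pell w) (S' : pell w') (g ze ze' : K) (m e m' e' : nat) (xi xi' : R[i]%C).
Hypothesis w_irr : forall x y : int, x%:~R * w = y%:~R -> x = 0.
Hypothesis w_irr' : forall x y : int, x%:~R * w' = y%:~R -> x = 0.
Hypothesis same_lam : plam S = plam S'.
Hypotheses (g0 : 0 < normc (i g)) (g1 : normc (i g) < 1).
Hypotheses (m0 : (0 < m)%N) (e0 : (0 < e)%N) (zee : ze ^+ e = 1).
Hypotheses (m0' : (0 < m')%N) (e0' : (0 < e')%N) (zee' : ze' ^+ e' = 1).
Hypothesis cong : exists x y : int, a00 S = 1 + e%:Z * x /\ a01 S = e%:Z * y.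
Hypothesis cong' : exists x y : int, a00 S' = 1 + e'%:Z * x /\ a01 S' = e'%:Z * y.
Hypothesis xi_sums : sums (fun n => (Num.floor (n%:R * w))%:~R) (i (ze * g ^+ m)) xi.
Hypothesis xi_sums' : sums (fun n => (Num.floor (n%:R * w'))%:~R) (i (ze' * g ^+ m')) xi'.
Hypothesis distinct : ~ (ze * g ^+ m = ze' * g ^+ m' /\ (w - w' \is a Num.int \/ w + w' \is a Num.int)).
Local Notation C := R[i]%C.
Local Notation t := (ptr S).

Let o0 : 'I_2 := @Ordinal 2 0 isT.
Let o1 : 'I_2 := @Ordinal 2 1 isT.
Let z k (l : 'I_2) : K := nth 0 [:: g ^+ pexp t k; g ^+ qexp t k] l.

(** With a common base the two series share their monomials. A box polynomial vanishing for all
    large k is a relation between s and s' over the rational sequences; [kubota] makes it linear,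
    and the edges then identify the data. *)
Lemma two_independence (P : {poly {poly K}}) : P != 0 -> (map_poly (map_poly i) P).[xi, xi'] != 0.
Proof.
have tt : ptr S' = t := same_trace same_lam.
have PU M : exists k0, forall k, (k0 <= k)%N -> (M <= pexp t k)%N.
  by exists M => k Mk; case: (pq_ge k (ptr_gt2 S)) => h _; apply: leq_trans Mk (ltnW h).
apply: (@core_independence R K i 2 w w' S S' g ze g ze' m e m' e' xi xi' id id (pexp t) 1 z o0 o1 o0 o1) => //.
- by move=> k; rewrite mul1n.
- by move=> k; rewrite tt.
- by move=> k; rewrite tt mul1n.
- by move=> k; rewrite tt.
- by move=> k; rewrite tt.
- by move=> l; rewrite !inE; case: l => [[|[|]]].
move=> p a [t0 at0] k0; apply: contrapT => no.
have Z k : (k0 <= k)%N -> box_value z (slope_value S g ze m id) (slope_value S' g ze' m' id) a k = 0.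
  by move=> hk; apply/eqP; apply: contraT => h; case: no; exists k.
pose G := i g; pose Ze := i ze; pose Ze' := i ze'.
have zee1 : Ze ^+ e = 1 by rewrite -rmorphXn zee rmorph1.
have zee1' : Ze' ^+ e' = 1 by rewrite -rmorphXn zee' rmorph1.
have alE : i (ze * g ^+ m) = Ze * G ^+ m by rewrite rmorphM rmorphXn.
have alE' : i (ze' * g ^+ m') = Ze' * G ^+ m' by rewrite rmorphM rmorphXn.
pose s := sk S (Ze * G ^+ m); pose s' := sk S' (Ze' * G ^+ m').
have Fs : ratseq t G (fun k => s k.+1 - s k) := ratseq_shift_diff g0 g1 m0 e0 zee1 cong.
have Fs' : ratseq t G (fun k => s' k.+1 - s' k).
  by rewrite -tt; apply: (ratseq_shift_diff g0 g1 m0' e0' zee1' cong').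
pose po (u v : nat) : {poly {poly C}} :=
  \sum_(x : box 2 p | (x.2.1 == u :> nat) && (x.2.2 == v :> nat)) (i (a x))%:P%:P * ('X^(x.1 o0) * ('X^(x.1 o1))%:P).
have po0 u v : (p <= u)%N || (p <= v)%N -> po u v = 0.
  move=> h; rewrite /po big1 // => x /andP[/eqP eu /eqP ev].
  by case/orP: h; rewrite -?eu -?ev leqNgt ltn_ord.
have z0 k : zeval t G 0 k = 0 by rewrite /zeval !horner0.
pose b u v k := zeval t G (po u v) k.
(* Both exponents are below p, so the total degree is below p + p and taking m equal to p + p
   imposes no restriction. *)
have rel : relation (ratseq t G) (flat t G) s s' (p + p) (p + p) b.
  split.
  - move=> u v; exact: ratseq_zeval.
  - move=> u v k h; rewrite /b po0 ?z0 //.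
    case/orP: h => h; last by apply/orP; right; apply: leq_trans (ltnW h); rewrite leq_addr.
    by case: (leqP p u) => //= hu; rewrite leqNgt; apply/negP => hv; move: h; rewrite ltnNge leq_add // ltnW.
  - apply: (eventually0_flat t g0 (N := k0)) => k hk.
    rewrite -[RHS](rmorph0 i) -(Z k hk) /relval.
    transitivity (\sum_(u < (p + p).+1) \sum_(v < (p + p).+1) \sum_(x : box 2 p | (x.2.1 == u :> nat) && (x.2.2 == v :> nat))
       i (a x) * (zx t G k ^+ x.1 o0 * zy t G k ^+ x.1 o1) * (s k ^+ x.2.1 * s' k ^+ x.2.2)).
      apply: eq_bigr => u _; apply: eq_bigr => v _; rewrite /b /po {1}/zeval !horner_sum mulr_suml.
      by apply: eq_bigr => x /andP[/eqP -> /eqP ->]; rewrite -/(zeval t G _ k) zevalM zevalC zeval_monom.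
    rewrite pair_bigA /= (exchange_big_dep xpredT) //= /box_value rmorph_sum; apply: eq_bigr => x _.
    have h1 : (x.2.1 < (p + p).+1)%N by rewrite ltnS (leq_trans (ltnW (ltn_ord _))) ?leq_addr.
    have h2 : (x.2.2 < (p + p).+1)%N by rewrite ltnS (leq_trans (ltnW (ltn_ord _))) ?leq_addr.
    rewrite (big_pred1 (Ordinal h1, Ordinal h2)) => [|[u v]]; last first.
      by rewrite /= xpair_eqE -!val_eqE /= [u == _ :> nat]eq_sym [v == _ :> nat]eq_sym.
    rewrite !big_ord_recl big_ord0 mulr1 /z /=.
    have -> : lift ord0 ord0 = o1 :> 'I_2 by apply: val_inj.
    have -> : ord0 = o0 :> 'I_2 by apply: val_inj.
    rewrite /= !rmorphM !rmorphXn /s /s' /sk /slope_value !rmorph_fr alE alE' /zx /zy; ring.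
have nev : exists u v, ~ ev0 (b u v).
  exists t0.2.1, t0.2.2 => -[N hN].
  have pn : po t0.2.1 t0.2.2 != 0.
    apply/eqP => /(congr1 (fun q : {poly {poly C}} => q`_(t0.1 o0)`_(t0.1 o1))).
    rewrite /po !coef0 coef_sum coef_sum (bigD1 t0) ?eqxx //= big1 ?addr0 => [|x /andP[/andP[/eqP e1 /eqP e2] ne]].
      rewrite coefCM coefMC coefXn eqxx coefCM mul1r coefXn eqxx mulr1 => /eqP.
      by rewrite fmorph_eq0 (negPf at0).
    rewrite coefCM coefMC coefXn coefCM; case: eqP => [e3|_]; last by rewrite mul0r coef0 mulr0.
    rewrite mul1r coefXn; case: eqP => [e4|_]; last by rewrite mulr0.
    case/eqP: ne; case: x e1 e2 e3 e4 => f [x y]; case: t0 {at0 hN} => f' [x' y'] /= e1 e2 e3 e4.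
    congr (_, (_, _)); try exact: val_inj.
    apply/ffunP => -[[|[|//]] h]; apply: val_inj => /=.
      by have -> : Ordinal h = o0 by apply: val_inj.
    by have -> : Ordinal h = o1 by apply: val_inj.
  have [N' hN'] := zeval_neq0 (plam1 S) (plamt S) (ptr_gt2 S) (wt_inj (plam1 S) (ptr_gt2 S) (@plam_irr _ _ S w_irr)) g0 g1 pn.
  by have := hN' (maxn N N') (leq_maxr _ _); rewrite -/(b _ _ _) hN ?leq_maxl // eqxx.
have [C1 [C2 [nz _ rat]]] := kubota_ratseq (plam1 S) (plamt S) (ptr_gt2 S) (@plam_irr _ _ S w_irr) g0 g1 Fs Fs' rel nev.
have xs : sums (fun n => (Num.floor (n%:R * w))%:~R) (Ze * G ^+ m) xi by rewrite -alE.
have xs' : sums (fun n => (Num.floor (n%:R * w'))%:~R) (Ze' * G ^+ m') xi' by rewrite -alE'.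
have le := linear_relation_edge w_irr w_irr' same_lam g0 g1 m0 e0 zee1 m0' e0' zee1' cong cong' xs xs' nz rat.
have [h1 h2] := same_edge_classify same_lam G m0 e0 zee1 m0' e0' zee1' le.
by apply: distinct; split=> //; apply: (fmorph_inj i); rewrite alE alE'.
Qed.

End TwoVariables.

(** * Descent to a number field *)

Section Algebraic.
Variable R : realType.
Local Notation C := R[i]%C.
Local Notation alg := (algebraicOver (ratr : rat -> C)).

Lemma algebraic_root_of (g a : C) n : (0 < n)%N -> g ^+ n = a -> alg a -> alg g.
Proof.
move=> n0 ga aa; apply/integral_algebraic.
apply: (@integral_root _ _ _ ('X^n - a%:P)).
- by rewrite -size_poly_eq0 size_XnsubC.
- by rewrite /root !hornerE ga subrr.
move=> c /(nthP 0)[j _ <-]; apply/integral_algebraic.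
rewrite coefB coefXn coefC.
apply: algebraic_sub; last by case: ifP => _ //; apply: algebraic0.
by case: (j == n); [apply: algebraic1|apply: algebraic0].
Qed.

Lemma algebraicX (a : C) n : alg a -> alg (a ^+ n).
Proof. by move=> aa; elim: n => [|n IH]; rewrite ?expr0 ?exprS; [apply: algebraic1|apply: algebraic_mul]. Qed.

Lemma algebraic_int (n : int) : alg n%:~R.
Proof. by rewrite -(ratr_int _ n); apply: (algebraic_id (ratr : {rmorphism rat -> C})). Qed.

Definition alg_poly (P : {poly {poly C}}) : Prop := forall a b : nat, alg P`_a`_b.

Lemma common_field (P : {poly {poly C}}) (x y : C) : alg_poly P -> alg x -> alg y ->
  exists (K : fieldExtType rat) (i : {rmorphism K -> C}) (P' : {poly {poly K}}) (x' y' : K),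
    [/\ map_poly (map_poly i) P' = P, i x' = x & i y' = y].
Proof.
move=> aP ax ay.
pose s := [:: x; y] ++ flatten [seq polyseq q | q <- polyseq P].
have hs c : c \in s -> alg c.
  rewrite mem_cat !inE => /orP[/orP[] /eqP -> //|].
  move=> /flattenP[q /mapP[r /(nthP 0)[a _ <-] ->]] /(nthP 0)[b _ <-]; exact: aP.
have [K [i hi]] := number_field_containing hs.
have [x' ex] : exists x', i x' = x by apply: hi; rewrite !inE eqxx.
have [y' ey] : exists y', i y' = y by apply: hi; rewrite !inE eqxx orbT.
have coefK a b : exists c, i c = P`_a`_b.
  case: (ltnP a (size P)) => ha; last by exists 0; rewrite rmorph0 (nth_default 0 ha) coef0.
  case: (ltnP b (size (P`_a)%R)) => hb; last by exists 0; rewrite rmorph0 nth_default.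
  apply: hi; rewrite mem_cat; apply/orP; right; apply/flattenP; exists (polyseq P`_a).
    by apply/mapP; exists P`_a => //; apply: mem_nth.
  exact: mem_nth.
have [f hf] := choice (fun ab : nat * nat => coefK ab.1 ab.2).
exists K, i, (\poly_(a < size P) \poly_(b < size (P`_a)%R) f (a, b)), x', y'; split=> //.
apply/polyP => a; apply/polyP => b; rewrite !coef_map coef_poly.
case: (ltnP a (size P)) => ha; last by rewrite (nth_default 0 ha) !coef0; apply: rmorph0.
rewrite coef_poly; case: (ltnP b (size (P`_a)%R)) => hb; first exact: (hf (a, b)).
by rewrite nth_default //; apply: rmorph0.
Qed.

End Algebraic.

(** * Algebraic independence outside the exceptional pairs *)

Section Independence.
Variables (R : realType) (w1 w2 : R) (a1 a2 xi1 xi2 : R[i]%C).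
Local Notation C := R[i]%C.
Local Notation alg := (algebraicOver (ratr : rat -> C)).
Hypotheses (hw1 : quadratic_irrational w1) (hw2 : quadratic_irrational w2) (ha1 : alg a1) (ha2 : alg a2).
Hypotheses (a101 : 0 < normc a1 < 1) (a201 : 0 < normc a2 < 1).
Hypothesis sums1 : sums (fun n => (Num.floor (n%:R * w1))%:~R) a1 xi1.
Hypothesis sums2 : sums (fun n => (Num.floor (n%:R * w2))%:~R) a2 xi2.

Variable P : {poly {poly C}}.
Hypotheses (P0 : P != 0) (aP : alg_poly P).

Let irr1 : forall x y : int, x%:~R * w1 = y%:~R -> x = 0.
Proof. exact: irrational_int (proj1 hw1). Qed.

Let irr2 : forall x y : int, x%:~R * w2 = y%:~R -> x = 0.
Proof. exact: irrational_int (proj1 hw2). Qed.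

Lemma preimage_neq0 (K : fieldExtType rat) (i : {rmorphism K -> C}) (Q : {poly {poly K}}) :
  map_poly (map_poly i) Q = P -> Q != 0.
Proof. by move=> e; apply: contraNneq P0 => Q0; rewrite -e Q0 map_poly0. Qed.

(** With g an e2-th root of a1, a2 is g^e1 times a root of unity of order dividing e2. A power of
    the automorph of w2 satisfies the congruences modulo e2; the automorph of w1 is raised to the
    same power to keep the eigenvalues equal. *)
Lemma independent_related (lam : R) (M1 M2 : 'M[int]_2) (e1 e2 : nat) :
  automorph w1 lam M1 -> automorph w2 lam M2 -> (0 < e1)%N -> (0 < e2)%N -> a1 ^+ e1 = a2 ^+ e2 ->
  ~ (a1 = a2 /\ (w1 - w2 \is a Num.int \/ w1 + w2 \is a Num.int)) -> P.[xi1, xi2] != 0.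
Proof.
move=> b1 b2 e10 e20 ea distinct.
have [s s0 hs] := pow_congruence (let: And4 d _ _ _ := b2 in d) e20.
have s1 : (0 < s * 1)%N by rewrite muln1.
have [S1 [l1 _ _]] := pell_of_automorph irr1 (automorphX b1 s1).
have [S2 [l2 c00 c01]] := pell_of_automorph irr2 (automorphX b2 s1).
have [n1 n1'] := andP a101; have [n2 n2'] := andP a201.
pose g := e2.-root a1; have ge : g ^+ e2 = a1 by apply: rootCK.
have gn0 : g != 0 by rewrite rootC_eq0 // -normc_gt0.
have g0 : 0 < normc g by rewrite normc_gt0.
have g1 : normc g < 1.
  by rewrite ltNge; apply/negP => h; move: n1'; rewrite -ge normcX ltNge exprn_ege1.
pose ze := a2 / g ^+ e1.
have ag : alg g := algebraic_root_of e20 ge ha1.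
have az : alg ze by apply: algebraic_mul ha2 (algebraic_inv (algebraicX _ ag)).
have [K [i [P' [g' [ze' [eP eg eze]]]]]] := common_field aP ag az.
have zee : ze' ^+ e2 = 1.
  apply: (fmorph_inj i); rewrite rmorphXn rmorph1 /= eze /ze expr_div_n -ea exprAC ge divff //.
  by rewrite expf_neq0 // -normc_gt0.
have E1 : i (1 * g' ^+ e2) = a1 by rewrite mul1r rmorphXn /= eg ge.
have E2 : i (ze' * g' ^+ e1) = a2 by rewrite rmorphM rmorphXn /= eg eze divfK // expf_neq0.
rewrite -eP; apply: (@two_independence R K i w1 w2 S1 S2 g' 1 ze' e2 1 e1 e2) => //.
- by rewrite l1 l2.
- by rewrite eg.
- by rewrite eg.
- by exists (a00 S1 - 1), (a01 S1); split; ring.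
- by have [x [y [h1 h2]]] := hs 1%N; exists x, y; rewrite c00 c01.
- by rewrite E1.
- by rewrite E2.
- by case=> h1 h2; apply: distinct; split=> //; rewrite -E1 -E2 h1.
- exact: preimage_neq0 eP.
Qed.

Lemma independent_bases (lam : R) (M1 M2 : 'M[int]_2) :
  automorph w1 lam M1 -> automorph w2 lam M2 ->
  (forall x y, (0 < x)%N -> (0 < y)%N -> a1 ^+ x != a2 ^+ y) -> P.[xi1, xi2] != 0.
Proof.
move=> b1 b2 ind.
have [S1 [l1 _ _]] := pell_of_automorph irr1 b1.
have [S2 [l2 _ _]] := pell_of_automorph irr2 b2.
have tt : ptr S2 = ptr S1 by apply: same_trace; rewrite l1 l2.
have [K [i [P' [x [y [eP ex ey]]]]]] := common_field aP ha1 ha2.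
rewrite -eP; apply: (@four_independence R K i w1 w2 S1 S2 x y xi1 xi2 id id (pexp (ptr S1)) 1) => //.
- by rewrite ex.
- by rewrite ey.
- by rewrite ex.
- by rewrite ey.
- by move=> k; rewrite mul1n.
- by move=> k; rewrite tt.
- by move=> k; rewrite tt mul1n.
- by move=> M; exists M => k Mk; case: (pq_ge k (ptr_gt2 S1)) => h _; apply: leq_trans Mk (ltnW h).
- move=> n phi psi v v' v_inj h1 h2; rewrite ex in h1; rewrite ey tt in h2.
  exact: (dependent_nonvanishing (plam1 S1) (plamt S1) (ptr_gt2 S1) (@plam_irr _ _ S1 irr1) a101 a201 ind v_inj h1 h2).
- exact: preimage_neq0 eP.
Qed.

(** The second orbit is read at index [lv k], where its eigenvalue power is comparable to that of
    the first. The scale L is the smaller exponent, and N bounds the ratio of the exponents both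
    ways. *)
Lemma independent_units (lam1 lam2 : R) (M1 M2 : 'M[int]_2) :
  automorph w1 lam1 M1 -> automorph w2 lam2 M2 ->
  (forall x y, (0 < x)%N -> (0 < y)%N -> lam1 ^+ x != lam2 ^+ y) -> P.[xi1, xi2] != 0.
Proof.
move=> b1 b2 ind.
have [S1 [l1 _ _]] := pell_of_automorph irr1 b1.
have [S2 [l2 _ _]] := pell_of_automorph irr2 b2.
have p1 := plam1 S1; have p2 := plam1 S2.
have ind' x y : (0 < x)%N -> plam S1 ^+ x != plam S2 ^+ y.
  rewrite l1 l2; case: y => [|y] x0; last exact: ind.
  by rewrite expr0 gt_eqF // exprn_egt1 -?lt0n // -l1.
have [lv hlv] := power_between p1 p2.
have [c [d [c0 d0 h1]]] := pexp_comparable p1 (plamt S1) (ptr_gt2 S1).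
have [c' [d' [c0' d0' h2]]] := pexp_comparable p2 (plamt S2) (ptr_gt2 S2).
have [K [i [P' [x [y [eP ex ey]]]]]] := common_field aP ha1 ha2.
pose N := (Num.truncn (d / c' + d' * plam S2 / c)).+2.
have p20 : 0 < plam S2 by lra.
have q1 : 0 <= d / c' by rewrite divr_ge0 // ltW.
have q2 : 0 <= d' * plam S2 / c by rewrite divr_ge0 ?mulr_ge0 // ltW.
have hN : d / c' + d' * plam S2 / c + 1 <= N%:R.
  by rewrite /N -[_.+2%:R]natr1 lerD2r; apply/ltW/truncnS_gt.
have r1 k : (pexp (ptr S1) k <= N * pexp (ptr S2) (lv k))%N.
  rewrite -(ler_nat R) natrM; have /andP[_ u1] := h1 k; have /andP[u2 _] := h2 (lv k).
  have /andP[u3 _] := hlv k; apply: le_trans u1 _.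
  apply: (@le_trans _ _ (d / c' * (pexp (ptr S2) (lv k))%:R)); last first.
    by rewrite ler_wpM2r //; lra.
  rewrite -mulrA ler_pM2l // mulrC ler_pdivlMr // mulrC; apply: le_trans u2.
  by rewrite ler_pM2l.
have r2 k : (pexp (ptr S2) (lv k) <= N * pexp (ptr S1) k)%N.
  rewrite -(ler_nat R) natrM; have /andP[u1 _] := h1 k; have /andP[_ u2] := h2 (lv k).
  have /andP[_ u3] := hlv k; apply: le_trans u2 _.
  apply: (@le_trans _ _ (d' * plam S2 / c * (pexp (ptr S1) k)%:R)); last first.
    by rewrite ler_wpM2r //; lra.
  rewrite -!mulrA ler_pM2l //; apply: le_trans (ltW u3) _.
  by rewrite ler_pM2l // mulrC ler_pdivlMr // mulrC.
have n1 : (1 <= N)%N by [].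
rewrite -eP; apply: (@four_independence R K i w1 w2 S1 S2 x y xi1 xi2 id lv
  (fun k => minn (pexp (ptr S1) k) (pexp (ptr S2) (lv k))) N) => //.
- by rewrite ex.
- by rewrite ey.
- by rewrite ex.
- by rewrite ey.
- by move=> k; rewrite geq_minl.
- by move=> k; rewrite minnMr leq_min r1 andbT leq_pmull.
- by move=> k; rewrite geq_minr.
- by move=> k; rewrite minnMr leq_min r2 leq_pmull.
- move=> M; have [k1 hk1] := lv_unbounded p1 p2 hlv M.
  exists (maxn M k1) => k; rewrite geq_max leq_min => /andP[hM /hk1 hk].
  have [u1 _] := pq_ge k (ptr_gt2 S1); have [u2 _] := pq_ge (lv k) (ptr_gt2 S2).
  by rewrite (leq_trans hM (ltnW u1)) (leq_trans hk (ltnW u2)).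
- move=> n phi psi v v' v_inj e1 e2; rewrite ex in e1; rewrite ey in e2.
  exact: (independent_nonvanishing p1 (plamt S1) (ptr_gt2 S1) p2 (plamt S2) (ptr_gt2 S2)
    (@plam_irr _ _ S1 irr1) a101 a201 ind' hlv v_inj e1 e2).
- exact: preimage_neq0 eP.
Qed.

(** Passing to powers of the automorphs turns a multiplicative relation between the eigenvalues into
    equality. *)
Lemma independent_values :
  ~ (a1 = a2 /\ (w1 - w2 \is a Num.int \/ w1 + w2 \is a Num.int)) -> P.[xi1, xi2] != 0.
Proof.
move=> distinct.
have [lam1 [M1 au1]] := automorph_exists hw1; have [lam2 [M2 au2]] := automorph_exists hw2.
case: (pselect (exists x y, [/\ (0 < x)%N, (0 < y)%N & lam1 ^+ x = lam2 ^+ y])) => [[x [y [x0 y0 exy]]]|nxy].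
  have b1 := automorphX au1 x0; have := automorphX au2 y0; rewrite -exy => b2.
  case: (pselect (exists e1 e2, [/\ (0 < e1)%N, (0 < e2)%N & a1 ^+ e1 = a2 ^+ e2])) => [[e1 [e2 [e10 e20 ea]]]|nea].
    exact: independent_related b1 b2 e10 e20 ea distinct.
  apply: independent_bases b1 b2 _ => e1 e2 e10 e20.
  by apply/eqP => e; apply: nea; exists e1, e2.
apply: independent_units au1 au2 _ => x y x0 y0.
by apply/eqP => e; apply: nxy; exists x, y.
Qed.

End Independence.

(** * Linear relations for the exceptional pairs *)

Section Dependence.
Variables (R : realType) (w1 w2 : R) (a xi1 xi2 : R[i]%C).
Local Notation C := R[i]%C.
Local Notation alg := (algebraicOver (ratr : rat -> C)).
Hypotheses (w_irr : forall x y : int, x%:~R * w2 = y%:~R -> x = 0) (aa : alg a) (a01 : 0 < normc a < 1).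
Hypothesis sums1 : sums (fun n => (Num.floor (n%:R * w1))%:~R) a xi1.
Hypothesis sums2 : sums (fun n => (Num.floor (n%:R * w2))%:~R) a xi2.

Let an1 : 1 - a != 0.
Proof. by rewrite subr_eq0; apply/eqP => e; case/andP: a01; rewrite -e normc1 ltxx. Qed.

Lemma sums_nat : sums (fun n => n%:R) a (a / (1 - a) ^+ 2).
Proof.
have [|T hT] := @sums_exists R (fun n => n%:R) a 1 a01.
  by move=> n; rewrite normc_nat mul1r ler_nat.
suff <- : T = a / (1 - a) ^+ 2 by [].
have [_ a1] := andP a01.
have h1 := sums_shift 1 (ltW a1) hT.
have h2 := sums_shift 1 (ltW a1) (sums_geom a01).
have e : T - a ^+ 1 * T = a ^+ 1 * (1 - a)^-1.
  apply: sums_unique (sums_eq _ (sumsB hT h1)) h2 => -[|n] /=; first by rewrite subr0.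
  by rewrite subn1 -natrB ?leqnSn // subSnn.
rewrite expr1 in e; apply: (mulIf an1); rewrite expr2 invfM mulrA divfK //.
by rewrite -e; ring.
Qed.

Lemma sumsZ (b : C) c T : sums c a T -> sums (fun n => b * c n) a (b * T).
Proof.
move=> h e e0; have b0 : 0 < normc b + 1 by rewrite ltr_wpDl ?normc_ge0.
have [N0 hN] := h (e / (normc b + 1)) (divr_gt0 e0 b0); exists N0 => N /hN h1.
have -> : b * T - \sum_(n < N) b * c n * a ^+ n = b * (T - \sum_(n < N) c n * a ^+ n).
  by rewrite mulrBr mulr_sumr; congr (_ - _); apply: eq_bigr => n _; rewrite mulrA.
rewrite normcM; apply: le_trans (ler_wpM2l (normc_ge0 _) h1) _.
by rewrite mulrCA ler_piMr ?(ltW e0) // ler_pdivrMr // mul1r lerDl.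
Qed.

Lemma algebraically_dependent_of (b c : C) : alg b -> alg c ->
  xi1 + c * xi2 = b -> algebraically_dependent (Qbar R) xi1 xi2.
Proof.
move=> ab ac e; exists ('X + (c%:P * 'X - b%:P)%:P); split.
- apply/eqP => /(congr1 (fun q : {poly {poly C}} => q`_1)).
  by rewrite coefD coefX coefC addr0 coef0 => /eqP; rewrite oner_eq0.
- move=> i j; rewrite /Qbar /= coefD coefX coefC coefD.
  apply: algebraic_add.
    by case: (i == 1%N); rewrite /= ?coef1 ?coef0; [case: (j == 0%N)|]; [exact: algebraic1|exact: algebraic0|exact: algebraic0].
  case: (i == 0%N); last by rewrite coef0; exact: algebraic0.
  rewrite coefB coefCM coefX coefC; apply: algebraic_sub; last by case: (j == 0%N) => //; exact: algebraic0.
  by apply: algebraic_mul ac _; case: (j == 1%N); [exact: algebraic1|exact: algebraic0].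
- by rewrite !(hornerD, hornerN, hornerM, hornerC, hornerX) addrA e subrr.
Qed.

(** If w1 = w2 + N, the floors differ by N n and the series by N a / (1 - a)^2. If w1 = N - w2, the
    floors add up to N n - 1 for n > 0 by irrationality but to 0 for n = 0, hence the geometric
    series shifted by one. *)
Lemma dependent_values : w1 - w2 \is a Num.int \/ w1 + w2 \is a Num.int ->
  algebraically_dependent (Qbar R) xi1 xi2.
Proof.
have aT : alg (a / (1 - a) ^+ 2).
  apply: algebraic_mul aa (algebraic_inv (algebraicX _ _)).
  by apply: algebraic_sub aa; exact: algebraic1.
case=> /intrP[N eN].
  apply: (@algebraically_dependent_of (N%:~R * (a / (1 - a) ^+ 2)) (- 1)).
  - by apply: algebraic_mul aT; exact: algebraic_int.
  - by apply: algebraic_opp; exact: algebraic1.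
  rewrite mulN1r; apply: sums_unique (sumsB sums1 sums2) _.
  apply: sums_eq (sumsZ N%:~R sums_nat) => n; rewrite -intrB pmulrn -intrM; congr _%:~R.
  suff -> : Num.floor (n%:R * w1) = N * n%:Z + Num.floor (n%:R * w2) by rewrite addrK.
  have /andP[f1 f2] := floor_itv (n%:R * w2).
  apply: floor_def; rewrite !intrD intrM -eN -pmulrn; rewrite intrD in f2; apply/andP; split; lra.
apply: (@algebraically_dependent_of (N%:~R * (a / (1 - a) ^+ 2) - a ^+ 1 * (1 - a)^-1) 1).
- apply: algebraic_sub; first by apply: algebraic_mul aT; exact: algebraic_int.
  by apply: algebraic_mul (algebraicX 1 aa) (algebraic_inv _); apply: algebraic_sub aa; exact: algebraic1.
- exact: algebraic1.
have [_ a1] := andP a01; rewrite mul1r; apply: sums_unique (sumsD sums1 sums2) _.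
apply: sums_eq (sumsB (sumsZ N%:~R sums_nat) (sums_shift 1 (ltW a1) (sums_geom a01))) => -[|n] /=.
  by rewrite mulr0 subr0 !mul0r floor0 addr0.
rewrite -intrD pmulrn -intrM -[X in _ - X]/(1%:~R : C) -intrB; congr _%:~R.
have /andP[f1 f2] := floor_itv (n.+1%:R * w2).
have nz : (Num.floor (n.+1%:R * w2))%:~R != n.+1%:R * w2.
  by apply/eqP => e; have := w_irr (x := n.+1%:Z) (esym e).
suff -> : Num.floor (n.+1%:R * w1) = N * n.+1%:Z - 1 - Num.floor (n.+1%:R * w2) by ring.
have f3 : (Num.floor (n.+1%:R * w2))%:~R < n.+1%:R * w2 by rewrite lt_neqAle nz.
rewrite intrD in f2.
have ew : n.+1%:R * w1 + n.+1%:R * w2 = N%:~R * n.+1%:R by rewrite -mulrDr eN mulrC.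
by apply: floor_def; rewrite !(intrD, intrB, intrM) -pmulrn; apply/andP; split; lra.
Qed.

End Dependence.

(** * From epsilon sums to the limit defining the series *)

Section Limits.
Import numFieldNormedType.Exports.
Variable R : realType.
Local Notation C := R[i]%C.

Lemma hecke_mahlerE (w : R) (a xi : C) :
  sums (fun n => (Num.floor (n%:R * w))%:~R) a xi -> hecke_mahler w a = xi.
Proof.
move=> h; have hs : hausdorff_space R[i]^o by exact: norm_hausdorff.
rewrite /hecke_mahler; apply: (cvg_lim hs); apply/cvgrPdist_le => e e0.
have ee : e = (normc e)%:C%C by rewrite -normc_norm gtr0_norm.
have e1 : 0 < normc e by rewrite normc_gt0 gt_eqF.
have [N hN] := h _ e1.
near=> n; have Nn : (N <= n)%N by near: n; exact: nbhs_infty_ge.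
by rewrite normc_norm ee lecR /series /= big_mkord; apply: hN.
Unshelve. all: by end_near.
Qed.

Lemma hecke_mahler_sums (w : R) (a : C) : 0 < normc a < 1 ->
  sums (fun n => (Num.floor (n%:R * w))%:~R) a (hecke_mahler w a).
Proof.
move=> a01; have [|xi h] := @sums_exists R (fun n => (Num.floor (n%:R * w))%:~R) a (`|w| + 1) a01.
  move=> n; rewrite normc_int intr_norm.
  have /andP[f1 f2] := floor_itv (n%:R * w).
  have h : `|n%:R * w| = n%:R * `|w| by rewrite normrM ger0_norm.
  have : `|(Num.floor (n%:R * w))%:~R| <= `|n%:R * w| + 1 :> R.
    rewrite intrD in f2; have := ler_norm (n%:R * w); have := lerNnormlW (lexx `|n%:R * w|).
    rewrite ler_norml => ? ?; apply/andP; split; lra.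
  move=> h2; apply: le_trans h2 _; rewrite h -natr1 mulrDr mulr1 mulrDl mul1r mulrC.
  by have := ler0n R n; have := normr_ge0 w; lra.
by rewrite (hecke_mahlerE h).
Qed.

End Limits.

Lemma normc_unit_interval (R : realType) (a : R[i]%C) : 0 < `|a| < 1 -> 0 < normc a < 1.
Proof. by rewrite normc_norm -[0]/(0%:C%C) -[1]/(1%:C%C) !ltcR. Qed.

Local Open Scope classical_set_scope.
Local Open Scope complex_scope.

Theorem theorem7p5 (R : realType) (w1 w2 : R) (a1 a2 : R[i])
    (hw1 : quadratic_irrational w1) (hw2 : quadratic_irrational w2)
    (ha1 : Qbar R a1) (ha2 : Qbar R a2)
    (ha1lt1 : 0 < `|a1| < 1) (ha2lt1 : 0 < `|a2| < 1) :
  algebraically_dependent (Qbar R) (hecke_mahler w1 a1) (hecke_mahler w2 a2)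
  <-> a1 = a2 /\ (w1 - w2 \is a Num.int \/ w1 + w2 \is a Num.int).
Proof.
have n1 := normc_unit_interval ha1lt1; have n2 := normc_unit_interval ha2lt1.
have s1 := hecke_mahler_sums w1 n1; have s2 := hecke_mahler_sums w2 n2.
split=> [[P [P0 aP Px]]|[ea h]].
  apply: contrapT => no.
  by have := independent_values hw1 hw2 ha1 ha2 n1 n2 s1 s2 P0 aP no; rewrite Px eqxx.
rewrite -ea in s2 *.
exact: (dependent_values (irrational_int (proj1 hw2)) ha1 n1 s1 s2 h).
Qed.
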